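(* Let $\mathcal S=(\beta_1,\dots,\beta_m)$ be an admissible set of positive real Schur roots. Send a maximal $\mathcal S$-green sequence $\mathcal U_{\epsilon(0)},\dots,\mathcal U_{\epsilon(s)}$, crossing successively the walls $D(\beta_{k_1}),\dots,D(\beta_{k_s})$ (where $D(\beta_{k_i})$ is the wall separating $\mathcal U_{\epsilon(i-1)}$ and $\mathcal U_{\epsilon(i)}$), to the word $x(\beta_{k_1})x(\beta_{k_2})\cdots x(\beta_{k_s})$ in the generators of the picture group $G(\mathcal S)$. This operation gives a bijection $$\{\text{maximal }\mathcal S\text{-green sequences}\}\xrightarrow{\ \cong\ }\{\text{positive expressions for the Coxeter element } c_{\mathcal S}\text{ in }G(\mathcal S)\}.$$
   Context: Setting: $K$ is a field; $Q$ is a valued quiver with vertices $1,\dots,n$ without loops, oriented cycles or multiple edges, i.e. there are positive integers $f_i$ at the vertices and pairs of positive integers $(d_{ij},d_{ji})$ on arrows $i\to j$ with $f_id_{ij}=f_jd_{ji}$. A $K$-modulation is fixed: division algebras $F_i$ with $\dim_K F_i=f_i$ and $F_i$-$F_j$-bimodules $M_{ij}$ with $\dim_K M_{ij}=f_id_{ij}$ for each arrow $i\to j$. A representation consists of right $F_i$-vector spaces $V_i$ and $F_j$-linear maps $V_i\otimes M_{ij}\to V_j$; $\Lambda$ is the corresponding finite dimensional hereditary algebra. The dimension vector has $i$th coordinate $\dim_{F_i}V_i$. A module is exceptional if its endomorphism ring is a division algebra and it has no self-extensions. Positive real Schur roots are the dimension vectors of exceptional modules; $M_\beta$ is the unique exceptional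 module of dimension vector $\beta$. Write $hom(\alpha,\beta)=\dim_K\mathrm{Hom}_\Lambda(M_\alpha,M_\beta)$, $ext(\alpha,\beta)=\dim_K\mathrm{Ext}_\Lambda(M_\alpha,M_\beta)$; $\alpha\ne\beta$ are hom-orthogonal if $hom(\alpha,\beta)=0=hom(\beta,\alpha)$. A root $\beta'$ is a subroot of $\beta$ ($\beta'\subset\beta$), resp. quotient root ($\beta\twoheadrightarrow\beta'$), if $M_{\beta'}$ is isomorphic to a submodule, resp. quotient, of $M_\beta$. Admissible sets: A lateral ordering on a set $\mathcal S$ of such roots is a total order such that for $\alpha,\beta\in\mathcal S$: $hom(\alpha,\beta)\ne0$ implies $\alpha\le\beta$, and $ext(\alpha,\beta)\neq0$ implies $\alpha>\beta$. A sequence $(\beta_1,\dots,\beta_m)$ is vertically ordered if for every $k$ all (real Schur) subroots and all (real Schur) quotient roots of $\beta_k$ are of the form $\beta_j$ with $j\le k$. A finite set of roots is admissible if it has a lateral and a vertical ordering; it is listed in its vertical ordering. Walls and compartments: $\langle x,y\rangle=\sum_i x_iy_if_i$ on $\mathbb R^n$, $H(\beta)=\{x:\langle x,\beta\rangle=0\}$, $D(\beta)=\{x\in\mathbb R^n:\langle x,\beta\rangle=0,\ \langle x,\beta'\rangle\le0\ \forall\beta'\subset\beta\}$; the positive side of $D(\beta)$ is where $\langle x,\beta\rangle>0$. For $\epsilon\in\{0,+,-\}^m$ put $\mathcal U_\epsilon=\{x\in\mathbb R^n:\langle x,\beta_i\rangle>0\text{ if }\epsilon_i=+,\ \langle x,\beta_j\rangle<0\text{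 if }\epsilon_j=-\}$. $\epsilon$ is admissible if for all $1\le k\le m$: $\epsilon_k=0\iff D(\beta_k)\cap\mathcal U_{\epsilon_1,\dots,\epsilon_{k-1}}=\emptyset$ (the empty sequence giving $\mathbb R^n$). An $\mathcal S$-compartment is a $\mathcal U_\epsilon$ with $\epsilon$ admissible. Two compartments are separated by the wall $D(\beta)$ if they lie on opposite sides of it and are adjacent along it (the intersection of their closures contains a nonempty relatively open subset of $H(\beta)$ contained in $D(\beta)$). A maximal $\mathcal S$-green sequence of length $s$ is a sequence of $\mathcal S$-compartments $\mathcal U_{\epsilon(0)},\dots,\mathcal U_{\epsilon(s)}$ such that (1) each consecutive pair $\mathcal U_{\epsilon(i-1)},\mathcal U_{\epsilon(i)}$ is separated by a wall $D(\beta_{k_i})$, $\beta_{k_i}\in\mathcal S$, with $\epsilon(i-1)_{k_i}=-$, $\epsilon(i)_{k_i}=+$ and $\epsilon(i-1)_j=\epsilon(i)_j$ for $j<k_i$; (2) $\mathcal U_{\epsilon(0)}$ contains the vectors all of whose coordinates are negative; (3) $\mathcal U_{\epsilon(s)}$ contains the vectors all of whose coordinates are positive. Picture group: $G(\mathcal S)$ has one generator $x(\beta)$ for each $\beta\in\mathcal S$ and, for each pair $\beta_i,\beta_j\in\mathcal S$ of hom-orthogonal roots with $ext(\beta_i,\beta_j)=0$, the relation $x(\beta_i)x(\beta_j)=\prod x(\gamma_k)$, where $\gamma_k$ runs over all roots in $\mathcal S$ of the form $a_k\beta_i+b_k\beta_j$, $a_k,b_k\in\mathbb Z_{\ge0}$,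 in increasing order of $a_k/b_k$ (from $0/1$, i.e. $\beta_j$, to $1/0$, i.e. $\beta_i$). A positive expression for $g\in G(\mathcal S)$ is a word in the generators $x(\beta)$ (no inverses) whose product is $g$. The Coxeter element $c_{\mathcal S}$ is the product of the $x(\alpha_i)$ over all simple roots $\alpha_i\in\mathcal S$ (dimension vectors of simple modules) in lateral order, i.e. with $\alpha_i$ before $\alpha_j$ whenever there is an arrow $j\to i$; it does not depend on the choice of such an order. *)

(* Defs.v *)
From HB Require Import structures.
From mathcomp Require Import all_boot all_order all_algebra all_field.
From mathcomp Require Import all_classical all_reals all_analysis.

Set Implicit Arguments.
Unset Strict Implicit.
Unset Printing Implicit Defensive.

Import GRing.Theory numFieldNormedType.Exports.
Local Open Scope classical_set_scope.
Local Open Scope quotient_scope.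
Local Open Scope ring_scope.

Record valued_quiver (n : nat) := ValuedQuiver {
  arr : rel 'I_n;
  vf : 'I_n -> nat;
  (* [vd i j], [vd j i] are the two valuations of an arrow i -> j; values of
     [vd] at pairs not joined by an arrow are irrelevant. *)
  vd : 'I_n -> 'I_n -> nat;
  (* Excludes loops and pairs of opposite arrows as well. *)
  arr_acyclic : forall c : seq 'I_n, cycle arr c -> c = [::];
  vf_gt0 : forall i, (0 < vf i)%N;
  vd_gt0 : forall i j, arr i j -> (0 < vd i j)%N /\ (0 < vd j i)%N;
  vd_sym : forall i j, arr i j -> (vf i * vd i j = vf j * vd j i)%N
}.

(* Finite dimensional A-B-bimodules on which K acts centrally: K-bilinearity
   and unitality give (c%:A) m = c *: m = m (c%:A). *)
Record bimodule (K : fieldType) (A B : falgType K) := Bimodule {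
  bsort :> vectType K;
  bl : A -> bsort -> bsort;
  br : bsort -> B -> bsort;
  bl_linl : forall m, linear (bl^~ m);
  bl_linr : forall a, linear (bl a);
  br_linl : forall b, linear (br^~ b);
  br_linr : forall m, linear (br m);
  bl1 : forall m, bl 1 m = m;
  blM : forall a a' m, bl (a * a') m = bl a (bl a' m);
  br1 : forall m, br m 1 = m;
  brM : forall m b b', br m (b * b') = br (br m b) b';
  blr : forall a m b, br (bl a m) b = bl a (br m b)
}.

Record modulation (K : fieldType) (n : nat) (Q : valued_quiver n) :=
  Modulation {
  mF : 'I_n -> falgType K;
  mF_div : forall i (x : mF i), x != 0 -> x \is a GRing.unit;
  mF_dim : forall i, \dim {: mF i} = vf Q i;
  mM : forall i j, arr Q i j -> bimodule (mF i) (mF j);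
  mM_dim : forall i j (a : arr Q i j), \dim {: mM a} = (vf Q i * vd Q i j)%N
}.

(* A finite dimensional right A-vector space is a vectType over the converse
   ring A^c. *)
Definition ract (K : fieldType) (A : falgType K) (V : vectType A^c)
  (v : V) (x : A) : V := (x : A^c) *: v.

(* The F_j-linear map V_i \otimes_{F_i} M_ij -> V_j attached to an arrow is
   given by the corresponding F_i-balanced, F_j-linear biadditive map. *)
Record rep (K : fieldType) (n : nat) (Q : valued_quiver n)
  (X : modulation K Q) := Rep {
  rV : forall i : 'I_n, vectType (mF X i)^c;
  phi : forall i j (a : arr Q i j), rV i -> mM X a -> rV j;
  phiDl : forall i j (a : arr Q i j) v v' m,
    @phi i j a (v + v') m = @phi i j a v m + @phi i j a v' m;
  phiDr : forall i j (a : arr Q i j) v m m',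
    @phi i j a v (m + m') = @phi i j a v m + @phi i j a v m';
  phi_bal : forall i j (a : arr Q i j) v (x : mF X i) m,
    @phi i j a (ract v x) m = @phi i j a v (bl x m);
  phi_lin : forall i j (a : arr Q i j) v m (y : mF X j),
    @phi i j a v (br m y) = ract (@phi i j a v m) y
}.
Arguments phi {K n Q X} r {i j} a v m.

Section Representations.
Context (K : fieldType) (n : nat) (Q : valued_quiver n) (X : modulation K Q).
Implicit Types (M N E : rep X) (a b : 'rV[nat]_n).

Record rhom M N := RHom {
  hmap :> forall i, {linear rV M i -> rV N i};
  hmap_phi : forall i j (e : arr Q i j) v m,
    hmap j (phi M e v m) = phi N e (hmap i v) m
}.

Definition rinj M N (h : rhom M N) : Prop := forall i, injective (h i).
Definition rsurj M N (h : rhom M N) : Prop :=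
  forall i (w : rV N i), exists v, h i v = w.

Definition rzero M : Prop := forall i (v : rV M i), v = 0.

Definition Hom_zero M N : Prop := forall (h : rhom M N) i v, h i v = 0.

Definition short_exact N E M (f : rhom N E) (g : rhom E M) : Prop :=
  [/\ rinj f, rsurj g &
      forall i (x : rV E i), g i x = 0 <-> exists y, f i y = x].

(* Vanishing of Yoneda's Ext^1(M, N). *)
Definition Ext_zero M N : Prop :=
  forall E (f : rhom N E) (g : rhom E M), short_exact f g ->
    exists s : rhom M E, forall i v, g i (s i v) = v.

Definition End_division M : Prop :=
  ~ rzero M /\
  forall h : rhom M M, (exists i v, h i v != 0) ->
    exists h' : rhom M M,
      forall i v, h' i (h i v) = v /\ h i (h' i v) = v.

Definition exceptional M : Prop := End_division M /\ Ext_zero M M.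

Definition dimvec M : 'rV[nat]_n := \row_i dim (rV M i).

Definition real_schur_root b : Prop :=
  exists M, exceptional M /\ dimvec M = b.

(* "M is (isomorphic to) M_b".  As M_b is unique up to isomorphism, properties
   of M_b are expressed below through arbitrary modules M with [Mroot b M]. *)
Definition Mroot b M : Prop := exceptional M /\ dimvec M = b.

(* [hom_zero a b] is dim_K Hom(M_a, M_b) = 0, [ext_zero a b] is
   dim_K Ext^1(M_a, M_b) = 0. *)
Definition hom_zero a b : Prop :=
  forall M N, Mroot a M -> Mroot b N -> Hom_zero M N.

Definition ext_zero a b : Prop :=
  forall M N, Mroot a M -> Mroot b N -> Ext_zero M N.

Definition hom_orthogonal a b : Prop :=
  [/\ a <> b, hom_zero a b & hom_zero b a].

Definition subroot b' b : Prop :=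
  exists M' M (h : rhom M' M), [/\ Mroot b' M', Mroot b M & rinj h].

Definition quotroot b' b : Prop :=
  exists M M' (h : rhom M M'), [/\ Mroot b M, Mroot b' M' & rsurj h].

Definition simple_rep M : Prop :=
  ~ rzero M /\ forall N (h : rhom N M), rinj h -> rzero N \/ rsurj h.

(* b is the dimension vector of the simple module at the vertex i. *)
Definition simple_root (i : 'I_n) b : Prop :=
  exists M, [/\ simple_rep M, (0 < dim (rV M i))%N & dimvec M = b].

Section Family.
Context (m : nat) (beta : 'I_m -> 'rV[nat]_n).

Definition lateral_ordering (r : rel 'I_m) : Prop :=
  [/\ [/\ reflexive r, antisymmetric r, transitive r & total r],
      forall k l, ~ hom_zero (beta k) (beta l) -> r k l &
      forall k l, ~ ext_zero (beta k) (beta l) -> r l k /\ k <> l].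

Definition vertically_ordered : Prop :=
  forall (k : 'I_m) b, subroot b (beta k) \/ quotroot b (beta k) ->
    exists2 j : 'I_m, (j <= k)%N & b = beta j.

Definition admissible_roots : Prop :=
  [/\ injective beta,
      forall k, real_schur_root (beta k),
      exists r, lateral_ordering r &
      vertically_ordered].

(* The word w lists, in increasing order of a/b in [0, +oo], the indices of the
   roots a beta_i + b beta_j of the family; a/b < a'/b' is a b' < a' b. *)
Definition slope_word (i j : 'I_m) (w : seq 'I_m) : Prop :=
  [/\ uniq w,
      forall l, l \in w <->
        exists a b : nat, beta l = beta i *+ a + beta j *+ b &
      forall l l' (a b a' b' : nat), l \in w -> l' \in w ->
        (index l w < index l' w)%N ->
        beta l = beta i *+ a + beta j *+ b ->
        beta l' = beta i *+ a' + beta j *+ b' ->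
        (a * b' < a' * b)%N].

Definition picture_rel (u v : seq 'I_m) : Prop :=
  exists i j, [/\ u = [:: i; j], hom_orthogonal (beta i) (beta j),
                  ext_zero (beta i) (beta j) & slope_word i j v].

Definition coxeter_word (w : seq 'I_m) : Prop :=
  [/\ uniq w,
      forall l, l \in w <-> exists i, simple_root i (beta l) &
      forall l l' i j, l \in w -> l' \in w ->
        simple_root i (beta l) -> simple_root j (beta l') ->
        arr Q j i -> (index l w < index l' w)%N].

End Family.
End Representations.

(* Group presented by generators T and positive relations u = v.  The letter
   (t, true) stands for t and (t, false) for its inverse. *)
Inductive word_eq (T : Type) (rels : seq T -> seq T -> Prop) :
  seq (T * bool) -> seq (T * bool) -> Prop :=
| WeRefl u : word_eq rels u u
| WeSym u v : word_eq rels u v -> word_eq rels v u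
| WeTrans u v w : word_eq rels u v -> word_eq rels v w -> word_eq rels u w
| WeCat u u' v v' : word_eq rels u u' -> word_eq rels v v' ->
    word_eq rels (u ++ v) (u' ++ v')
| WeCancel t s : word_eq rels [:: (t, s); (t, ~~ s)] [::]
| WeRel u v : rels u v ->
    word_eq rels [seq (t, true) | t <- u] [seq (t, true) | t <- v].

Definition winv (T : Type) (u : seq (T * bool)) : seq (T * bool) :=
  rev [seq (x.1, ~~ x.2) | x <- u].

Section Presentation.
Context (T : choiceType) (rels : seq T -> seq T -> Prop).
Implicit Types u v : seq (T * bool).

Lemma word_eq_mulV u : word_eq rels (u ++ winv u) [::].
Proof.
elim: u => [|[t s] u IH]; first exact: WeRefl.
rewrite /winv /= rev_cons -cats1 -/(winv u).
apply: WeTrans (WeCancel rels t s).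
rewrite -cat1s -[X in word_eq _ _ X](cat1s (t, s)) !catA.
apply: WeCat; last exact: WeRefl.
rewrite -catA -[X in word_eq _ _ X]cats0.
by apply: WeCat => //; apply: WeRefl.
Qed.

Lemma winvK u : winv (winv u) = u.
Proof.
rewrite /winv map_rev revK -map_comp -[RHS]map_id.
by apply: eq_map => -[t s] /=; rewrite negbK.
Qed.

Lemma word_eq_Vmul u : word_eq rels (winv u ++ u) [::].
Proof. by have := word_eq_mulV (winv u); rewrite winvK. Qed.

Lemma word_eq_inv u v : word_eq rels u v -> word_eq rels (winv u) (winv v).
Proof.
move=> uv; apply: (@WeTrans _ _ _ (winv u ++ (v ++ winv v))).
  rewrite -[X in word_eq _ X]cats0; apply: WeCat; first exact: WeRefl.
  exact/WeSym/word_eq_mulV.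
rewrite catA -[X in word_eq _ _ X]cat0s; apply: WeCat; last exact: WeRefl.
apply: WeTrans (word_eq_Vmul u); apply: WeCat; first exact: WeRefl.
exact: WeSym.
Qed.

Definition word_eqb u v : bool := `[< word_eq rels u v >].

Lemma word_eqb_refl : reflexive word_eqb.
Proof. by move=> u; apply/asboolP/WeRefl. Qed.

Lemma word_eqb_sym : symmetric word_eqb.
Proof. by move=> u v; apply/asboolP/asboolP; apply: WeSym. Qed.

Lemma word_eqb_trans : transitive word_eqb.
Proof.
by move=> v u w /asboolP uv /asboolP vw; apply/asboolP/(WeTrans uv vw).
Qed.

Canonical word_equiv :=
  EquivRel word_eqb word_eqb_refl word_eqb_sym word_eqb_trans.

Definition presented_group := {eq_quot word_equiv}.
HB.instance Definition _ := Choice.on presented_group.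
HB.instance Definition _ := Quotient.on presented_group.

Definition pg_pi u : presented_group := \pi_presented_group u.
Definition pg_one : presented_group := pg_pi [::].
Definition pg_mul (x y : presented_group) := pg_pi (repr x ++ repr y).
Definition pg_inv (x : presented_group) := pg_pi (winv (repr x)).

Lemma pg_piE u v : word_eq rels u v -> pg_pi u = pg_pi v.
Proof. by move=> uv; apply/eqmodP/asboolP. Qed.

Lemma repr_pg_pi u : word_eq rels (repr (pg_pi u)) u.
Proof. by apply/asboolP/(@eqmodP _ word_equiv); rewrite reprK. Qed.

Lemma pg_reprK x : pg_pi (repr x) = x.
Proof. exact: reprK. Qed.

Lemma pg_mulA : associative pg_mul.
Proof.
move=> x y z; apply: (@pg_piE (repr x ++ repr (pg_mul y z))
                              (repr (pg_mul x y) ++ repr z)).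
apply: (@WeTrans _ _ _ (repr x ++ (repr y ++ repr z))).
  by apply: WeCat; [exact: WeRefl | exact: repr_pg_pi].
rewrite catA; apply: WeCat; last exact: WeRefl.
exact/WeSym/repr_pg_pi.
Qed.

Lemma pg_mul1g : left_id pg_one pg_mul.
Proof.
move=> x; rewrite -[RHS]pg_reprK; apply: pg_piE.
rewrite -[X in word_eq _ _ X]cat0s.
by apply: WeCat; [exact: repr_pg_pi | exact: WeRefl].
Qed.

Lemma pg_mulg1 : right_id pg_one pg_mul.
Proof.
move=> x; rewrite -[RHS]pg_reprK; apply: pg_piE.
rewrite -[X in word_eq _ _ X]cats0.
by apply: WeCat; [exact: WeRefl | exact: repr_pg_pi].
Qed.

Lemma pg_mulVg : left_inverse pg_one pg_inv pg_mul.
Proof.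
move=> x; apply: pg_piE; apply: WeTrans (word_eq_Vmul (repr x)).
by apply: WeCat; [exact: repr_pg_pi | exact: WeRefl].
Qed.

Lemma pg_mulgV : right_inverse pg_one pg_inv pg_mul.
Proof.
move=> x; apply: pg_piE; apply: WeTrans (word_eq_mulV (repr x)).
by apply: WeCat; [exact: WeRefl | exact: repr_pg_pi].
Qed.

HB.instance Definition _ := isGroup.Build presented_group
  pg_mulA pg_mul1g pg_mulg1 pg_mulVg pg_mulgV.

Definition pg_gen (t : T) : presented_group := pg_pi [:: (t, true)].

Definition pg_word (w : seq T) : presented_group :=
  \big[*%g/1%g]_(t <- w) pg_gen t.

End Presentation.

Section PictureGroup.
Context (K : fieldType) (n : nat) (Q : valued_quiver n) (X : modulation K Q).
Context (m : nat) (beta : 'I_m -> 'rV[nat]_n).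

Definition picture_group : Type := presented_group (picture_rel X beta).
HB.instance Definition _ := Group.on picture_group.

Definition word_val (w : seq 'I_m) : picture_group := pg_word _ w.

Definition positive_expressions (g : picture_group) : set (seq 'I_m) :=
  [set w | word_val w = g].

Definition coxeter_element (c : picture_group) : Prop :=
  exists2 w, coxeter_word X beta w & word_val w = c.

End PictureGroup.

Section GreenSequences.
Context (R : realType).
Context (K : fieldType) (n : nat) (Q : valued_quiver n) (X : modulation K Q).
Implicit Types (x y : 'rV[R]_n) (b : 'rV[nat]_n).

Definition pairing x y : R := \sum_i x 0 i * y 0 i * (vf Q i)%:R.

Definition pairr x b : R := pairing x (map_mx (fun k : nat => k%:R) b).

Definition hyperplane b : set 'rV[R]_n := [set x | pairr x b = 0].

Definition wall b : set 'rV[R]_n :=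
  [set x | pairr x b = 0 /\ forall b', subroot X b' b -> pairr x b' <= 0].

Context (m : nat) (beta : 'I_m -> 'rV[nat]_n).

(* Elements of {0,+,-}^m: None is 0, Some true is +, Some false is -. *)
Definition signs := {ffun 'I_m -> option bool}.

(* U of the prefix formed by the first k entries of e. *)
Definition Uprefix (e : signs) (k : nat) : set 'rV[R]_n :=
  [set x | forall j : 'I_m, (j < k)%N ->
     (e j = Some true -> 0 < pairr x (beta j)) /\
     (e j = Some false -> pairr x (beta j) < 0)].

Definition Ureg (e : signs) : set 'rV[R]_n := Uprefix e m.

Definition admissible_signs (e : signs) : Prop :=
  forall k : 'I_m, e k = None <-> wall (beta k) `&` Uprefix e k = set0.

Definition opposite_sides b (U V : set 'rV[R]_n) : Prop :=
  (U `<=` [set x | pairr x b < 0] /\ V `<=` [set x | 0 < pairr x b]) \/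
  (U `<=` [set x | 0 < pairr x b] /\ V `<=` [set x | pairr x b < 0]).

Definition adjacent_along b (U V : set 'rV[R]_n) : Prop :=
  exists W : set 'rV[R]_n,
    [/\ open W, W `&` hyperplane b !=set0, W `&` hyperplane b `<=` wall b &
        W `&` hyperplane b `<=` closure U `&` closure V].

Definition separated_by b (U V : set 'rV[R]_n) : Prop :=
  opposite_sides b U V /\ adjacent_along b U V.

Definition green_step (e e' : signs) (k : 'I_m) : Prop :=
  [/\ separated_by (beta k) (Ureg e) (Ureg e'),
      e k = Some false, e' k = Some true &
      forall j : 'I_m, (j < k)%N -> e j = e' j].

(* e :: es are the consecutive sign vectors, ks the indices of the walls
   crossed. *)
Fixpoint green_path (e : signs) (es : seq signs) (ks : seq 'I_m) : Prop :=
  match es, ks with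
  | [::], [::] => True
  | e' :: es', k :: ks' => green_step e e' k /\ green_path e' es' ks'
  | _, _ => False
  end.

(* Us is a maximal green sequence, crossing successively the walls
   D(beta_k) for k in ks. *)
Definition green_crossing (Us : seq (set 'rV[R]_n)) (ks : seq 'I_m) : Prop :=
  exists (e : signs) (es : seq signs),
    [/\ Us = [seq Ureg e' | e' <- e :: es],
        forall e', e' \in e :: es -> admissible_signs e',
        green_path e es ks,
        forall x, (forall i, x 0 i < 0) -> Ureg e x &
        forall x, (forall i, 0 < x 0 i) -> Ureg (last e es) x].

Definition maximal_green_sequences : set (seq (set 'rV[R]_n)) :=
  [set Us | exists ks, green_crossing Us ks].

End GreenSequences.

Arguments maximal_green_sequences R {K n Q} X {m} beta _.

(* Main.v *)
(* An Euler characteristic computation, King semistability and the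
   Harder-Narasimhan filtration translate the representation theory of an
   admissible set into combinatorial data on its roots: their Euler form, lateral
   rank, subroots and quotient roots.  In these terms, the product of the walls
   met by a half line in the direction of (-1,...,-1) is an element of the
   picture group that does not change while its starting point moves inside a
   compartment, by the rank two relations, and is multiplied by x(beta) when the
   point crosses D(beta) in the positive direction.  It is trivial at negative
   points and equal to c at positive points, so a maximal green sequence spells c.
   A green sequence is determined by its letters, since a compartment has at most
   one successor through a given wall.

   Surjectivity is by induction on the number of roots.  Let omega be the
   vertically last root.  Deleting omega from a word for c gives a word for the
   Coxeter element of the smaller set, hence a green sequence of the latter.  It
   lifts as soon as the letters omega sit where that sequence runs through
   compartments cut by D(omega).  Along the lateral order, the picture group acts
   on the subgroup of the earlier letters, as in an HNN extension; these actions
   show that two words for the same element with the same deletion contain omega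
   equally often, and that omega commutes only with words of letters
   hom-orthogonal to it.  This fixes the number of letters omega to at most one,
   and its position up to commutations that stay inside the run of cut
   compartments. *)

Require Import Defs.
From HB Require Import structures.
From mathcomp Require Import all_boot all_order all_algebra all_field.
From mathcomp Require Import all_classical all_reals all_analysis.
From mathcomp Require Import ring lra zify.

Set Implicit Arguments.
Unset Strict Implicit.
Unset Printing Implicit Defensive.

Import Order.TTheory GRing.Theory Num.Theory VectorInternalTheory.
Local Open Scope ring_scope.

(** * Linear algebra over division algebras *)

(** The obstacle is surjectivity: an identity between positive words has to be turned into geometry,
    and no normal form for the picture group is at hand. The substitute rests on reading a relation
    with laterally last letter t as A t = t [phi A t], where [phi A t] only uses earlier letters: t
    is a stable letter that conjugates the subgroup of the letters orthogonal to it. That this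
    conjugation respects the earlier relations is the identity [rank3]. It comes from the same
    deformation argument as the invariance of the word of a half line, run near a point where three
    roots are stable and along lines parallel to the wall of t; this is why that argument is stated
    for an arbitrary base point, direction, threshold and target group. The record [root_data] is
    closed under exchanging subroots with quotient roots ([dual]) and under dropping the vertically
    last root ([trunc]): the first halves the arguments about compartments, the second carries the
    induction. Genericity is never quantified: every choice is an infinitesimal displacement,
    controlled by the signs of finitely many linear functionals ([perturb_fun], [avoid]). *)

Definition mk_linear (S : nzRingType) (U V : lmodType S) (f : U -> V)
    (fL : linear f) : {linear U -> V} :=
  HB.pack f (GRing.isLinear.Build S U V _ f fL).

Section DivisionLinearAlgebra.
Variables (S : nzRingType) (Sdiv : forall x : S, x != 0 -> exists y, y * x = 1).

(** Row reduction over a skew field, by induction on n. If all vectors of [P] have first coordinate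
    0, that coordinate joins [Z]; otherwise a vector of [P] normalised to first coordinate 1 is a
    pivot, and the shear that clears it frees the first coordinate from any equation. *)
Lemma echelon n (P : 'rV[S]_n -> Prop) :
    P 0 -> (forall a u v, P u -> P v -> P (a *: u + v)) ->
  exists (Z : {set 'I_n}) (E E' : 'M[S]_n),
    [/\ E *m E' = 1%:M, E' *m E = 1%:M &
        forall v, P v <-> forall i, i \in Z -> (v *m E) 0 i = 0].
Proof.
elim: n P => [|n IHn] P P0 PL.
  exists finset.set0, 1%:M, 1%:M; rewrite mulmx1; split=> // v.
  by split=> [_ i|_]; [rewrite inE | rewrite (thinmx0 v)].
have PS u v : P u -> P v -> P (u + v) by move=> Pu Pv; rewrite -[u]scale1r; apply: PL.
have PZ a u : P u -> P (a *: u) by move=> Pu; rewrite -[_ *: _]addr0; apply: PL.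
pose P' w := P (row_mx (0 : 'rV_1) w : 'rV_(1 + n)).
have [||Z1 [E1 [E1' [EE EE' hZ]]]] := IHn P'; first by rewrite /P' row_mx0.
  move=> a u v Pu Pv; rewrite /P'.
  have -> : row_mx 0 (a *: u + v) = a *: row_mx (0 : 'rV_1) u + row_mx 0 v.
    by rewrite scale_row_mx add_row_mx scaler0 addr0.
  exact: PL.
have Pu0 (y : 'rV_(1 + n)) : lsubmx y = 0 -> P y <-> P' (rsubmx y).
  by move=> y0; rewrite /P' -{1}[y]hsubmxK y0.
have [Pz|] := pselect (forall v : 'rV_(1 + n), P v -> v 0 0 = 0).
  exists [set i : 'I_(1 + n) | if @fintype.split 1 n i is inr j then j \in Z1 else true].
  exists (block_mx (1%:M : 'M[S]_1) 0 0 E1), (block_mx (1%:M : 'M[S]_1) 0 0 E1').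
  rewrite (@mulmx_block _ 1 n 1 n 1 n) (@mulmx_block _ 1 n 1 n 1 n).
  rewrite !(mulmx0, mul0mx, addr0, add0r, mulmx1) EE EE' -!(@scalar_mx_block _ 1 n).
  split=> // v; have vE : v *m (block_mx (1%:M : 'M[S]_1) 0 0 E1 : 'M[S]_(1 + n)) =
      row_mx (lsubmx (v : 'rV_(1 + n))) (rsubmx (v : 'rV_(1 + n)) *m E1).
    by rewrite -{1}[v](@hsubmxK _ 1 1 n) (@mul_row_block _ 1 1 n 1 n)
       !mulmx0 addr0 add0r mulmx1.
  split=> [Pv i|Pv].
    have v0 : lsubmx (v : 'rV_(1 + n)) = 0.
      apply/rowP => k; rewrite !mxE ord1 /=.
      by rewrite (_ : lshift n 0 = 0) ?Pz //; apply: val_inj.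
    rewrite inE vE mxE; case: (@fintype.split 1 n i) => [j _|j jZ]; first by rewrite v0 mxE.
    by move/Pu0: Pv => /(_ v0)/hZ; apply.
  have v0 : lsubmx (v : 'rV_(1 + n)) = 0.
    apply/rowP => k; have := Pv (lshift n k : 'I_(1 + n)); rewrite inE vE mxE.
    by rewrite (unsplitK (inl k)) => ->; rewrite ?mxE.
  apply/Pu0 => //; apply/hZ => j jZ; have := Pv (rshift 1 j); rewrite inE vE mxE.
  by rewrite (unsplitK (inr j)) => ->.
move=> /existsNP[v0 /not_implyP[Pv0 /eqP/Sdiv[y yv0]]].
pose u := rsubmx (y *: v0 : 'rV_(1 + n)).
have Pu : P (row_mx (1%:M : 'M[S]_1) u : 'rV_(1 + n)).
  have -> : (1%:M : 'M[S]_1) = lsubmx (y *: v0 : 'rV_(1 + n)).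
    apply/rowP => k; rewrite !mxE !ord1 eqxx -yv0; congr (_ * v0 _ _).
    exact: val_inj.
  by rewrite hsubmxK; apply: PZ.
exists [set i : 'I_(1 + n) | if @fintype.split 1 n i is inr j then j \in Z1 else false].
exists (block_mx (1%:M : 'M[S]_1) (- u *m E1) 0 E1), (block_mx (1%:M : 'M[S]_1) u 0 E1').
rewrite (@mulmx_block _ 1 n 1 n 1 n) (@mulmx_block _ 1 n 1 n 1 n).
rewrite !(mulmx0, mul0mx, addr0, add0r, mulmx1, mul1mx) EE EE'.
rewrite -mulmxA EE mulmx1 subrr mulNmx addNr -!(@scalar_mx_block _ 1 n).
split=> // v; pose a := lsubmx (v : 'rV_(1 + n)); pose w := rsubmx (v : 'rV_(1 + n)).
have vaw : v = row_mx a w by rewrite hsubmxK.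
have aE : a = a 0 0 *: 1%:M.
  by apply/rowP => k; rewrite !mxE !ord1 eqxx mulr1.
have vE : v *m (block_mx (1%:M : 'M[S]_1) (- u *m E1) 0 E1 : 'M[S]_(1 + n)) =
    row_mx a ((w - a *m u) *m E1).
  by rewrite vaw (@mul_row_block _ 1 1 n 1 n) !mulmx0 addr0 mulmx1 mulmxBl
     mulNmx mulmxN mulmxA [_ + w *m _]addrC.
have Pvw : P v <-> P' (w - a *m u).
  have vd : row_mx 0 (w - a *m u) =
      (v : 'rV[S]_(1 + n)) - a 0 0 *: row_mx 1%:M u :> 'rV[S]_(1 + n).
    rewrite vaw scale_row_mx opp_row_mx add_row_mx -aE subrr.
    by congr (row_mx _ (w - _)); rewrite {1}aE -scalemxAl mul1mx.
  rewrite /P' vd; split=> [Pv|Pv]; first by rewrite addrC -scaleNr; apply: PL.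
  by rewrite -(subrK (a 0 0 *: row_mx 1%:M u) v); apply: PS => //; apply: PZ.
rewrite Pvw hZ; split=> [h i|h j jZ].
  by rewrite inE -mulNmx vE mxE; case: (@fintype.split 1 n i) => // j /h.
by have := h (rshift 1 j); rewrite inE -mulNmx vE mxE (unsplitK (inr j)) => ->.
Qed.

Section Pick.
Variables (n : nat) (A : {set 'I_n}).

Definition pick_mx (u : 'rV[S]_n) : 'rV[S]_#|A| := \row_j u 0 (enum_val j).
Definition put_mx (w : 'rV[S]_#|A|) : 'rV[S]_n :=
  \row_i \sum_(j < #|A| | enum_val j == i) w 0 j.

Lemma pick_mx_linear : linear pick_mx.
Proof. by move=> a u v; apply/rowP => j; rewrite !mxE. Qed.

Lemma put_mx_linear : linear put_mx.
Proof.
move=> a u v; apply/rowP => j; rewrite !mxE mulr_sumr -big_split /=.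
by apply: eq_bigr => i _; rewrite !mxE.
Qed.

Lemma put_mxK : cancel put_mx pick_mx.
Proof.
move=> w; apply/rowP => j; rewrite !mxE (big_pred1 j) // => k.
by rewrite (inj_eq enum_val_inj).
Qed.

Lemma put_pick_mx u i : (put_mx (pick_mx u)) 0 i = if i \in A then u 0 i else 0.
Proof.
rewrite mxE; case: ifPn => iA; last first.
  rewrite big_pred0 // => j; apply/eqP => ji; case/negP: iA.
  by rewrite -ji enum_valP.
rewrite (big_pred1 (enum_rank_in iA i)) => [|j].
  by rewrite mxE enum_rankK_in.
apply/eqP/eqP => [ji|->]; last by rewrite enum_rankK_in.
by apply: enum_val_inj; rewrite enum_rankK_in.
Qed.

Lemma pick_mx_eq0 u : pick_mx u = 0 <-> forall i, i \in A -> u 0 i = 0.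
Proof.
split=> [h i iA|h]; last by apply/rowP => j; rewrite !mxE h ?enum_valP.
have := congr1 (fun w : 'rV_#|A| => w 0 (enum_rank_in iA i)) h.
by rewrite !mxE enum_rankK_in.
Qed.

End Pick.

Lemma splitting_exists (V : vectType S) (P : V -> Prop) :
    P 0 -> (forall a u v, P u -> P v -> P (a *: u + v)) ->
  exists k q (i : {linear 'rV[S]_k -> V}) (r : {linear V -> 'rV[S]_k})
    (p : {linear V -> 'rV[S]_q}) (s : {linear 'rV[S]_q -> V}),
   [/\ cancel i r, cancel s p, forall v, i (r v) + s (p v) = v,
       forall v, P v <-> p v = 0 & (k + q = dim V)%N].
Proof.
move=> P0 PL; have [||Z [E [E' [EE EE' hZ]]]] := @echelon (dim V) (fun u => P (r2v u)).
- by rewrite linear0.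
- by move=> a u v Pu Pv; rewrite linearP; apply: PL.
pose i (w : 'rV_#|~: Z|) : V := r2v (put_mx w *m E').
pose s (w : 'rV_#|Z|) : V := r2v (put_mx w *m E').
pose r (v : V) := pick_mx (~: Z) (v2r v *m E).
pose p (v : V) := pick_mx Z (v2r v *m E).
have iLin : linear i by move=> a u v; rewrite /i put_mx_linear mulmxDl -scalemxAl linearP.
have sLin : linear s by move=> a u v; rewrite /s put_mx_linear mulmxDl -scalemxAl linearP.
have rLin : linear r by move=> a u v; rewrite /r linearP mulmxDl -scalemxAl pick_mx_linear.
have pLin : linear p by move=> a u v; rewrite /p linearP mulmxDl -scalemxAl pick_mx_linear.
exists #|~: Z|, #|Z|, (mk_linear iLin), (mk_linear rLin), (mk_linear pLin), (mk_linear sLin).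
split.
- by move=> w; rewrite /= /r /i r2vK -mulmxA EE' mulmx1 put_mxK.
- by move=> w; rewrite /= /p /s r2vK -mulmxA EE' mulmx1 put_mxK.
- move=> v; rewrite /= /i /s /r /p -linearD -mulmxDl.
  suff -> : put_mx (pick_mx (~: Z) (v2r v *m E)) + put_mx (pick_mx Z (v2r v *m E)) =
            v2r v *m E by rewrite -mulmxA EE mulmx1; apply: v2rK.
  apply/rowP => j; rewrite mxE !put_pick_mx inE; case: (j \in Z) => /=.
    by rewrite add0r.
  by rewrite addr0.
- by move=> v; rewrite -{1}[v]v2rK hZ /= /p pick_mx_eq0.
- by rewrite addnC cardsC card_ord.
Qed.

(** The decomposition of V along P is kept as data because the vertex spaces of sub- and quotient
    representations are defined from it. *)
Record splitting (V : vectType S) (P : V -> Prop) := Splitting {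
  sp_k : nat; sp_q : nat;
  sp_i : {linear 'rV[S]_sp_k -> V}; sp_r : {linear V -> 'rV[S]_sp_k};
  sp_p : {linear V -> 'rV[S]_sp_q}; sp_s : {linear 'rV[S]_sp_q -> V};
  sp_ri : cancel sp_i sp_r;
  sp_ps : cancel sp_s sp_p;
  sp_id : forall v, sp_i (sp_r v) + sp_s (sp_p v) = v;
  sp_P : forall v, P v <-> sp_p v = 0
}.

Lemma splitting_of (V : vectType S) (P : V -> Prop) :
    P 0 -> (forall a u v, P u -> P v -> P (a *: u + v)) -> splitting P.
Proof.
move=> P0 PL; have [k /cid[q /cid[i /cid[r /cid[p /cid[s [ri ps idE PE _]]]]]]] :=
  cid (splitting_exists P0 PL).
exact: Splitting ri ps idE PE.
Qed.

(** Induction on m: the image u of the first basis vector is nonzero, so the equations of the line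
    through u involve fewer than n coordinates; these coordinates kill u and remain injective on the
    span of the other basis vectors. *)
Lemma linear_inj_leq m n (g : {linear 'rV[S]_m -> 'rV[S]_n}) :
  injective g -> (m <= n)%N.
Proof.
elim: m n g => // m IHm n g ginj.
pose u := g (row_mx (1%:M : 'M[S]_1) (0 : 'rV_m) : 'rV_(1 + m)).
have u0 : u != 0.
  apply/eqP; rewrite -(linear0 g) => /ginj.
  move=> /(congr1 (fun w : 'rV_(1 + m) => lsubmx w 0 0)).
  by rewrite row_mxKl !mxE /= => /eqP; rewrite oner_eq0.
have [||Z [E [E' [EE EE' hZ]]]] := @echelon n (fun v => exists a, v = a *: u).
- by exists 0; rewrite scale0r.
- by move=> a _ _ [b ->] [c ->]; exists (a * b + c); rewrite scalerDl scalerA.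
have : (#|Z| < n)%N.
  rewrite -[X in (_ < X)%N]card_ord -cardsT proper_card // properT.
  apply: contraNneq u0 => ZT; have /hZ uz : exists a, u = a *: u by exists 1; rewrite scale1r.
  rewrite -[u]mulmx1 -EE mulmxA; apply/eqP.
  by rewrite (_ : u *m E = 0) ?mul0mx //; apply/rowP => j; rewrite uz ?ZT ?inE // mxE.
apply: leq_ltn_trans.
pose h (w : 'rV[S]_m) := pick_mx Z (g (row_mx 0 w : 'rV_(1 + m)) *m E).
have hLin : linear h.
  move=> a v w; rewrite /h.
  have -> : row_mx 0 (a *: v + w) = a *: row_mx (0 : 'rV_1) v + row_mx 0 w.
    by rewrite scale_row_mx add_row_mx scaler0 addr0.
  by rewrite linearP mulmxDl -scalemxAl pick_mx_linear.
apply: (IHm _ (mk_linear hLin)); apply: raddf_inj => w /pick_mx_eq0/hZ[a].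
rewrite -linearZ => /ginj /(congr1 (@rsubmx _ _ 1 m)).
by rewrite linearZ /= !row_mxKr scaler0.
Qed.

End DivisionLinearAlgebra.

(** * Representations and their extensions *)

Section LinearMaps.
Variables (S : nzRingType) (Sdiv : forall x : S, x != 0 -> exists y, y * x = 1).
Variables U V W : vectType S.

Lemma linear_retract (f : {linear U -> V}) : injective f ->
  exists r : {linear V -> U}, forall u, r (f u) = u.
Proof.
move=> finj; have [||k [q [i [r [p [s [ri ps idE PE dE]]]]]]] :=
  @splitting_exists S Sdiv V (fun v => exists u, f u = v).
- by exists 0; rewrite linear0.
- by move=> a _ _ [u <-] [v <-]; exists (a *: u + v); rewrite linearP.
have /choice[h hE] v : exists u, f u = i (r v).
  by apply/PE; rewrite -(addrK (s (p v)) (i (r v))) idE linearB ps subrr.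
have hL : linear h by move=> a u v; apply: finj; rewrite linearP !hE !linearP.
exists (mk_linear hL) => u; apply: finj; rewrite hE -[RHS]idE.
by rewrite (proj1 (PE (f u))) ?linear0 ?addr0 //; exists u.
Qed.

Lemma linear_section (g : {linear V -> W}) : (forall w, exists v, g v = w) ->
  exists s : {linear W -> V}, forall w, g (s w) = w.
Proof.
move=> gsur; have [||k [q [i [r [p [s [ri ps idE PE dE]]]]]]] :=
  @splitting_exists S Sdiv V (fun v => g v = 0).
- by rewrite linear0.
- by move=> a u v gu gv; rewrite linearP gu gv scaler0 addr0.
have gsp v : g (s (p v)) = g v.
  rewrite -[in RHS](idE v) linearD (_ : g (i _) = 0) ?add0r //.
  by apply/PE; rewrite -(addrK (s (p v)) (i (r v))) idE linearB ps subrr.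
have gsinj x : g (s x) = 0 -> x = 0 by move=> /PE; rewrite ps.
have /choice[h hE] w : exists x, g (s x) = w.
  by have [v <-] := gsur w; exists (p v).
have hL : linear h.
  move=> a u v; apply/subr0_eq/gsinj.
  by rewrite (linearB s) (linearB g) hE (linearP s) (linearP g) !hE subrr.
have shL : linear (fun w => s (h w)) by move=> a u v; rewrite hL linearP.
by exists (mk_linear shL) => w; apply: hE.
Qed.

Lemma linear_dim_leq (f : {linear U -> V}) : injective f -> (dim U <= dim V)%N.
Proof.
move=> finj; have hL : linear (fun x : 'rV[S]_(dim U) => v2r (f (r2v x)) : 'rV[S]_(dim V)).
  by move=> a u v; rewrite !linearP.
apply: (@linear_inj_leq S Sdiv _ _ (mk_linear hL)) => u v /= /(can_inj v2rK)/finj.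
exact: (can_inj r2vK).
Qed.

End LinearMaps.

Lemma linear_dim_exact (S : nzRingType)
    (Sdiv : forall x : S, x != 0 -> exists y, y * x = 1) (U V W : vectType S)
    (f : {linear U -> V}) (g : {linear V -> W}) :
    injective f -> (forall w, exists v, g v = w) ->
    (forall v, g v = 0 <-> exists u, f u = v) ->
  (dim U + dim W)%N = dim V.
Proof.
move=> finj gsur fg; have [||k [q [i [r [p [s [ri ps idE PE dE]]]]]]] :=
  @splitting_exists S Sdiv V (fun v => g v = 0).
- by rewrite linear0.
- by move=> a u v gu gv; rewrite linearP gu gv scaler0 addr0.
have giv x : g (i x) = 0.
  by apply/PE; rewrite -[x]ri -(addrK (s (p (i x))) (i (r _))) idE linearB ps subrr.
have dS m : dim 'rV[S]_m = m by apply: etrans (mul1n m); apply: dim_matrix.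
have eU : dim U = dim 'rV[S]_k.
  apply/eqP; rewrite eqn_leq; apply/andP; split.
    have rfL : linear (r \o f) by move=> a u v /=; rewrite !linearP.
    apply: (@linear_dim_leq S Sdiv _ _ (mk_linear rfL)); apply: raddf_inj => u /= ru.
    apply: finj; rewrite linear0 -(idE (f u)) ru (proj1 (PE (f u))) ?linear0 ?addr0 //.
    by apply/fg; exists u.
  have /choice[h hE] x : exists u, f u = i x by apply/fg/giv.
  have hL : linear h by move=> a u v; apply: finj; rewrite linearP !hE linearP.
  apply: (@linear_dim_leq S Sdiv _ _ (mk_linear hL)) => x y /= /(congr1 f).
  by rewrite !hE; apply: (can_inj ri).
have eW : dim W = dim 'rV[S]_q.
  apply/eqP; rewrite eqn_leq; apply/andP; split.
    have /choice[h hE] w := gsur w.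
    have phL : linear (p \o h).
      move=> a u v /=; rewrite -linearP; apply/subr0_eq; rewrite -linearB; apply/PE.
      by rewrite linearB linearP !hE subrr.
    apply: (@linear_dim_leq S Sdiv _ _ (mk_linear phL)); apply: raddf_inj => w /=.
    by move=> /PE; rewrite hE.
  have gsL : linear (g \o s) by move=> a u v /=; rewrite !linearP.
  apply: (@linear_dim_leq S Sdiv _ _ (mk_linear gsL)); apply: raddf_inj => w /= /PE.
  by rewrite ps.
by rewrite eU eW !dS.
Qed.

Section RepTheory.
Context (K : fieldType) (n : nat) (Q : valued_quiver n) (X : modulation K Q).
Implicit Types M N L E I : rep X.

Lemma mFc_div i (x : (mF X i)^c) : x != 0 -> exists y, y * x = 1.
Proof.
move=> x0; exists ((x : mF X i)^-1 : mF X i).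
exact: (@divrr (mF X i) x (mF_div x0)).
Qed.

Lemma phi0l M i j (a : arr Q i j) m : phi M a 0 m = 0.
Proof. by apply: (addrI (phi M a 0 m)); rewrite -phiDl !addr0. Qed.

Lemma phiNl M i j (a : arr Q i j) v m : phi M a (- v) m = - phi M a v m.
Proof. by apply: (addrI (phi M a v m)); rewrite -phiDl !subrr phi0l. Qed.

Lemma phiBl M i j (a : arr Q i j) u v m :
  phi M a (u - v) m = phi M a u m - phi M a v m.
Proof. by rewrite phiDl phiNl. Qed.

Definition rid M : rhom M M :=
  @RHom _ _ _ X M M (fun i => idfun) (fun i j e v m => erefl).

Definition rcomp M N L (g : rhom N L) (f : rhom M N) : rhom M L.
Proof.
refine (@RHom _ _ _ X M L (fun i => g i \o f i) _) => i j e v m /=.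
by rewrite !hmap_phi.
Defined.

Definition is_sub M (P : forall i, rV M i -> Prop) : Prop :=
  [/\ forall i, P i 0, forall i a u v, P i u -> P i v -> P i (a *: u + v) &
      forall i j (e : arr Q i j) v m, P i v -> P j (phi M e v m)].

Record exact_pair M := ExactPair {
  ex_sub : rep X; ex_quo : rep X;
  ex_i : rhom ex_sub M; ex_p : rhom M ex_quo;
  ex_se : short_exact ex_i ex_p
}.

(** Splitting each vertex space along [P] gives coordinates on the subspaces and on the quotients;
    closure of [P] under [phi] is what turns the induced maps on these coordinates into
    representations. *)
Lemma sub_exact M (P : forall i, rV M i -> Prop) : is_sub P ->
  exists e : exact_pair M, forall i v, P i v <-> ex_p e i v = 0.
Proof.
move=> [P0 PL Pphi].
pose sp i := @splitting_of _ (@mFc_div i) (rV M i) (P i) (P0 i) (PL i).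
pose k i := sp_k (sp i); pose q i := sp_q (sp i).
pose ii i := sp_i (sp i); pose rr i := sp_r (sp i).
pose pp i := sp_p (sp i); pose ss i := sp_s (sp i).
have riE i : cancel (ii i) (rr i) := @sp_ri _ _ _ (sp i).
have psE i : cancel (ss i) (pp i) := @sp_ps _ _ _ (sp i).
have idE i v : ii i (rr i v) + ss i (pp i v) = v := @sp_id _ _ _ (sp i) v.
have PE i v : P i v <-> pp i v = 0 := @sp_P _ _ _ (sp i) v.
have Pii i x : P i (ii i x).
  by apply/PE; rewrite -(addrK (ss i (pp i (ii i x))) (ii i x)) -{1}[x]riE idE linearB psE subrr.
have iiE i v : P i v -> ii i (rr i v) = v.
  by move=> /PE pv; rewrite -[RHS]idE pv linear0 addr0.
pose phiN i j (a : arr Q i j) (v : 'rV[(mF X i)^c]_(k i)) m := rr j (phi M a (ii i v) m).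
have NDl i j (a : arr Q i j) v v' m : phiN i j a (v + v') m = phiN i j a v m + phiN i j a v' m.
  by rewrite /phiN linearD phiDl linearD.
have NDr i j (a : arr Q i j) v m m' : phiN i j a v (m + m') = phiN i j a v m + phiN i j a v m'.
  by rewrite /phiN phiDr linearD.
have Nbal i j (a : arr Q i j) (v : 'rV[(mF X i)^c]_(k i)) (x : mF X i) m :
    phiN i j a (ract v x) m = phiN i j a v (bl x m).
  by rewrite /phiN /ract linearZ (phi_bal (ii i v)).
have Nlin i j (a : arr Q i j) v m (y : mF X j) : phiN i j a v (br m y) = ract (phiN i j a v m) y.
  by rewrite /phiN phi_lin /ract linearZ.
pose N := @Rep _ _ _ X (fun i => 'rV[(mF X i)^c]_(k i)) phiN NDl NDr Nbal Nlin.
pose phiL i j (a : arr Q i j) (v : 'rV[(mF X i)^c]_(q i)) m := pp j (phi M a (ss i v) m).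
have LDl i j (a : arr Q i j) v v' m : phiL i j a (v + v') m = phiL i j a v m + phiL i j a v' m.
  by rewrite /phiL linearD phiDl linearD.
have LDr i j (a : arr Q i j) v m m' : phiL i j a v (m + m') = phiL i j a v m + phiL i j a v m'.
  by rewrite /phiL phiDr linearD.
have Lbal i j (a : arr Q i j) (v : 'rV[(mF X i)^c]_(q i)) (x : mF X i) m :
    phiL i j a (ract v x) m = phiL i j a v (bl x m).
  by rewrite /phiL /ract linearZ (phi_bal (ss i v)).
have Llin i j (a : arr Q i j) v m (y : mF X j) : phiL i j a v (br m y) = ract (phiL i j a v m) y.
  by rewrite /phiL phi_lin /ract linearZ.
pose L := @Rep _ _ _ X (fun i => 'rV[(mF X i)^c]_(q i)) phiL LDl LDr Lbal Llin.
have fphi i j (a : arr Q i j) (v : rV N i) m : ii j (phi N a v m) = phi M a (ii i v) m.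
  by rewrite /= /phiN iiE //; apply: Pphi.
have gphi i j (a : arr Q i j) (v : rV M i) m : pp j (phi M a v m) = phi L a (pp i v) m.
  rewrite /= /phiL; apply/subr0_eq; rewrite -linearB -phiBl; apply/PE/Pphi/PE.
  by rewrite linearB psE subrr.
pose f : rhom N M := @RHom _ _ _ X N M (fun i => ii i) fphi.
pose g : rhom M L := @RHom _ _ _ X M L (fun i => pp i) gphi.
have se : short_exact f g.
  split=> [i|i w|i v].
  - exact: can_inj (riE i).
  - by exists (ss i w); apply: psE.
  - by split=> [/PE Pv|[w <-]]; [exists (rr i v); apply: iiE | apply/PE/Pii].
by exists (ExactPair se) => i v; apply: PE.
Qed.

Lemma short_exact_dim N M L (f : rhom N M) (g : rhom M L) i : short_exact f g ->
  (dim (rV N i) + dim (rV L i))%N = dim (rV M i).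
Proof.
move=> [finj gsur fg]; apply: (linear_dim_exact (@mFc_div i) (finj i)).
  exact: gsur.
exact: fg.
Qed.

Lemma rinj_dim N M (f : rhom N M) i : rinj f -> (dim (rV N i) <= dim (rV M i))%N.
Proof. by move=> /(_ i); apply: linear_dim_leq; apply: mFc_div. Qed.

Lemma rcoker N M (f : rhom N M) : rinj f ->
  exists L (g : rhom M L), short_exact f g.
Proof.
move=> finj; have [|e eP] := @sub_exact M (fun i v => exists w, f i w = v).
  split=> [i|i a _ _ [u <-] [v <-]|i j e _ m [v <-]].
  - by exists 0; rewrite linear0.
  - by exists (a *: u + v); rewrite linearP.
  - by exists (phi N e v m); rewrite hmap_phi.
exists (ex_quo e), (ex_p e); case: (ex_se e) => _ gsur _; split=> // i v.
exact: iff_sym (eP i v).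
Qed.

Lemma rker M L (g : rhom M L) :
  exists N (f : rhom N M), rinj f /\ forall i v, g i v = 0 <-> exists w, f i w = v.
Proof.
have [|e eP] := @sub_exact M (fun i v => g i v = 0).
  split=> [i|i a u v gu gv|i j e v m gv].
  - exact: linear0.
  - by rewrite linearP gu gv scaler0 addr0.
  - by rewrite hmap_phi gv phi0l.
exists (ex_sub e), (ex_i e); case: (ex_se e) => finj _ fg; split=> // i v.
by rewrite eP fg.
Qed.

Lemma rimage M N (h : rhom M N) :
  exists I (p : rhom M I) (q : rhom I N),
    [/\ rsurj p, rinj q & forall i v, q i (p i v) = h i v].
Proof.
have [|e eP] := @sub_exact N (fun i v => exists w, h i w = v).
  split=> [i|i a _ _ [u <-] [v <-]|i j e _ m [v <-]].
  - by exists 0; rewrite linear0.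
  - by exists (a *: u + v); rewrite linearP.
  - by exists (phi M e v m); rewrite hmap_phi.
have [finj gsur fg] := ex_se e; pose f := ex_i e.
have exw i v : exists w, f i w = h i v by apply/fg/eP; exists v.
pose p i := projT1 (choice (exw i)).
have pE i v : f i (p i v) = h i v := projT2 (choice (exw i)) v.
have pL i : linear (p i) by move=> a u v; apply: (finj i); rewrite linearP !pE linearP.
have pphi i j (a : arr Q i j) v m : mk_linear (pL j) (phi M a v m) = phi _ a (mk_linear (pL i) v) m.
  by apply: (finj j); rewrite /= pE hmap_phi hmap_phi pE.
exists (ex_sub e), (RHom pphi), f; split=> // i w.
have /eP[v hv] : ex_p e i (f i w) = 0 by apply/fg; exists w.
by exists v; apply: (finj i); rewrite /= pE.
Qed.

Lemma rsurj_section M L (g : rhom M L) : rsurj g ->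
  exists s : forall i, {linear rV L i -> rV M i}, forall i w, g i (s i w) = w.
Proof.
move=> gsur.
have h i := linear_section (@mFc_div i) (gsur i).
by exists (fun i => sval (cid (h i))) => i; apply: (svalP (cid (h i))).
Qed.

Lemma rinj_retract N M (f : rhom N M) : rinj f ->
  exists r : forall i, {linear rV M i -> rV N i}, forall i w, r i (f i w) = w.
Proof.
move=> finj.
have h i := linear_retract (@mFc_div i) (finj i).
by exists (fun i => sval (cid (h i))) => i; apply: (svalP (cid (h i))).
Qed.

(** Degree one of the two-term complex that computes Ext over the hereditary algebra: vertexwise
    linear maps in degree 0, with differential [cobound], and balanced right linear arrow maps in
    degree 1. There is no degree two, so [cocycle] only expresses this linearity. *)
Definition cochain1 M N := forall i j (a : arr Q i j), rV M i -> mM X a -> rV N j.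

Definition cocycle M N (c : cochain1 M N) : Prop :=
  [/\ forall i j (a : arr Q i j) v v' m, c i j a (v + v') m = c i j a v m + c i j a v' m,
      forall i j (a : arr Q i j) v m m', c i j a v (m + m') = c i j a v m + c i j a v m',
      forall i j (a : arr Q i j) v x m, c i j a (ract v x) m = c i j a v (bl x m) &
      forall i j (a : arr Q i j) v m y, c i j a v (br m y) = ract (c i j a v m) y].

Definition cobound M N (h : forall i, {linear rV M i -> rV N i}) : cochain1 M N :=
  fun i j a v m => h j (phi M a v m) - phi N a (h i v) m.
Arguments cobound {M N} h {i j} a v m.

Definition Ext0 M N : Prop := forall c : cochain1 M N, cocycle c ->
  exists h : forall i, {linear rV M i -> rV N i},
    forall i j (a : arr Q i j) v m, c i j a v m = cobound h a v m.

Lemma cocycle_cobound M N (h : forall i, {linear rV M i -> rV N i}) :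
  cocycle (@cobound M N h).
Proof.
split=> i j a v *; rewrite /cobound.
- by rewrite phiDl !linearD phiDl opprD addrACA.
- by rewrite !phiDr linearD opprD addrACA.
- by rewrite /ract linearZ (phi_bal v) (phi_bal (h i v)).
- by rewrite !phi_lin /ract linearZ -scalerBr.
Qed.

(** A cocycle twists the direct sum of N and M into an extension, whose sections are the solutions
    h. Conversely, a vertexwise section and retraction measure the failure of an extension to split
    by a cocycle, and a solution h corrects the section to a morphism. *)
Lemma Ext_zeroP M N : Ext_zero M N <-> Ext0 M N.
Proof.
split=> [ext c [cDl cDr cbal clin]|ext E f g se].
  pose phiE i j (a : arr Q i j) (w : (rV N i * rV M i)%type) m :=
    (phi N a w.1 m + c i j a w.2 m, phi M a w.2 m).
  have EDl i j (a : arr Q i j) (w w' : (rV N i * rV M i)%type) m :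
      phiE i j a (w + w') m = phiE i j a w m + phiE i j a w' m.
    by rewrite /phiE /= cDl !phiDl; congr pair; rewrite addrACA.
  have EDr i j (a : arr Q i j) (w : (rV N i * rV M i)%type) m m' :
      phiE i j a w (m + m') = phiE i j a w m + phiE i j a w m'.
    by rewrite /phiE /= cDr !phiDr; congr pair; rewrite addrACA.
  have Ebal i j (a : arr Q i j) (w : (rV N i * rV M i)%type) (x : mF X i) m :
      phiE i j a (ract w x) m = phiE i j a w (bl x m).
    by rewrite /phiE -(phi_bal w.1) -(phi_bal w.2) -(cbal _ _ a w.2).
  have Elin i j (a : arr Q i j) (w : (rV N i * rV M i)%type) m (y : mF X j) :
      phiE i j a w (br m y) = ract (phiE i j a w m) y.
    by rewrite /phiE !phi_lin clin /ract -scalerDr.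
  pose E := @Rep _ _ _ X (fun i => (rV N i * rV M i)%type : vectType _) phiE EDl EDr Ebal Elin.
  have fL i : linear (fun w : rV N i => (w, 0) : rV E i).
    by move=> a u v; congr pair; rewrite /= scaler0 addr0.
  have gL i : linear (fun w : rV E i => w.2) by [].
  have c0 i j (a : arr Q i j) m : c i j a 0 m = 0.
    by apply: (addrI (c i j a 0 m)); rewrite -cDl !addr0.
  have fphi i j (a : arr Q i j) v m :
      mk_linear (fL j) (phi N a v m) = phi E a (mk_linear (fL i) v) m.
    by rewrite /= /phiE /= c0 phi0l addr0.
  have gphi i j (a : arr Q i j) v m :
      mk_linear (gL j) (phi E a v m) = phi M a (mk_linear (gL i) v) m by [].
  have [|s sE] := ext E (RHom fphi) (RHom gphi).
    split=> [i u v [] //|i w|i [u v] /=]; first by exists (0, w).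
    by split=> [->|[y [_ <-]] //]; exists u.
  have hL i : linear (fun v => (s i v).1) by move=> a u v; rewrite linearP.
  exists (fun i => mk_linear (hL i)) => i j a v m; rewrite /cobound /=.
  have := hmap_phi s v m; rewrite [in RHS](surjective_pairing (s i v)).
  have /= -> := sE i v; rewrite /= /phiE /= => ->.
  by rewrite /= addrAC subrr add0r.
have [finj gsur fg] := se.
have [s sE] := rsurj_section gsur; have [r rE] := rinj_retract finj.
have fr i x : g i x = 0 -> f i (r i x) = x by move=> /fg[y <-]; rewrite rE.
pose c i j (a : arr Q i j) v m := r j (phi E a (s i v) m - s j (phi M a v m)).
have gc i j (a : arr Q i j) v m : g j (phi E a (s i v) m - s j (phi M a v m)) = 0.
  by rewrite linearB hmap_phi !sE subrr.
have [|h hE] := ext c.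
  split=> i j a v *; rewrite /c.
  - rewrite -linearD; congr (r _ _).
    by rewrite (linearD (s i)) !phiDl (linearD (s j)) opprD addrACA.
  - rewrite -linearD; congr (r _ _).
    by rewrite !phiDr (linearD (s j)) opprD addrACA.
  - by rewrite /ract linearZ (phi_bal (s i v)) (phi_bal v).
  - rewrite /ract -linearZ; congr (r _ _).
    by rewrite scalerBr !phi_lin /ract linearZ.
have tL i : linear (fun v => s i v + f i (h i v)).
  by move=> a u v; rewrite !linearP scalerDr addrACA.
have tphi i j (a : arr Q i j) v m :
    mk_linear (tL j) (phi M a v m) = phi E a (mk_linear (tL i) v) m.
  rewrite /= phiDl -hmap_phi; apply/eqP; rewrite -subr_eq -addrA -linearB -/(cobound h a v m).
  by rewrite -hE fr // addrC subrK.
exists (RHom tphi) => i v /=; rewrite linearD sE (_ : g i (f i _) = 0) ?addr0 //.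
by apply/fg; exists (h i v).
Qed.

(** Heredity: a vertexwise retraction is enough to extend a cocycle from N to M, without any
    obstruction. *)
Lemma Ext0_sub N M L (f : rhom N M) : rinj f -> Ext0 M L -> Ext0 N L.
Proof.
move=> /rinj_retract[r rE] ext c [cDl cDr cbal clin].
have [|h hE] := ext (fun i j a v m => c i j a (r i v) m).
  split=> i j a v *; rewrite ?linearD ?cDl ?cDr ?clin //.
  by rewrite /ract linearZ -(cbal _ _ a).
have kL i : linear (fun v => h i (f i v)) by move=> a u v; rewrite !linearP.
exists (fun i => mk_linear (kL i)) => i j a v m; rewrite /cobound /= hmap_phi.
by rewrite -/(cobound h a (f i v) m) -hE rE.
Qed.

Lemma Ext0_quo M N L (g : rhom N L) : rsurj g -> Ext0 M N -> Ext0 M L.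
Proof.
move=> /rsurj_section[s sE] ext c [cDl cDr cbal clin].
have [|h hE] := ext (fun i j a v m => s j (c i j a v m)).
  split=> i j a v *; rewrite ?cDl ?cDr ?clin ?linearD ?cbal //.
  by rewrite /ract linearZ.
have kL i : linear (fun v => g i (h i v)) by move=> a u v; rewrite !linearP.
exists (fun i => mk_linear (kL i)) => i j a v m.
by rewrite /cobound /= -hmap_phi -linearB -/(cobound h a v m) -hE sE.
Qed.

(** Exactness of Hom(N, L) -> Ext(N, N) -> Ext(N, M): a solution with values in M projects to a
    morphism from N to L, hence to 0, so it takes values in N. *)
Lemma rigid_sub N M L (f : rhom N M) (g : rhom M L) : short_exact f g ->
  Ext0 N M -> Hom_zero N L -> Ext0 N N.
Proof.
move=> [finj gsur fg] ext hom c [cDl cDr cbal clin].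
have [|h hE] := ext (fun i j a v m => f j (c i j a v m)).
  split=> i j a v *; rewrite ?cDl ?cDr ?clin ?linearD ?cbal //.
  by rewrite /ract linearZ.
have kL i : linear (fun v => g i (h i v)) by move=> a u v; rewrite !linearP.
have kphi i j (a : arr Q i j) v m :
    mk_linear (kL j) (phi N a v m) = phi L a (mk_linear (kL i) v) m.
  rewrite /= -hmap_phi; apply/subr0_eq; rewrite -linearB -/(cobound h a v m) -hE.
  by apply/fg; eexists.
have gh i v : g i (h i v) = 0 := hom (RHom kphi) i v.
have [r rE] := rinj_retract finj.
have fr i x : g i x = 0 -> f i (r i x) = x by move=> /fg[y <-]; rewrite rE.
have tL i : linear (fun v => r i (h i v)) by move=> a u v; rewrite !linearP.
exists (fun i => mk_linear (tL i)) => i j a v m; apply: (finj j).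
by rewrite hE /cobound /= linearB hmap_phi !fr.
Qed.

(** Exactness of Hom(N, L) -> Ext(L, L) -> Ext(M, L): a solution on M restricts to a morphism from N
    to L, hence to 0, so it descends to L. *)
Lemma rigid_quo N M L (f : rhom N M) (g : rhom M L) : short_exact f g ->
  Ext0 M L -> Hom_zero N L -> Ext0 L L.
Proof.
move=> [finj gsur fg] ext hom c [cDl cDr cbal clin].
have c0 i j (a : arr Q i j) m : c i j a 0 m = 0.
  by apply: (addrI (c i j a 0 m)); rewrite -cDl !addr0.
have [|h hE] := ext (fun i j a v m => c i j a (g i v) m).
  split=> i j a v *; rewrite ?linearD ?cDl ?cDr ?clin //.
  by rewrite /ract linearZ -(cbal _ _ a).
have gf i v : g i (f i v) = 0 by apply/fg; exists v.
have kL i : linear (fun v => h i (f i v)) by move=> a u v; rewrite !linearP.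
have kphi i j (a : arr Q i j) v m :
    mk_linear (kL j) (phi N a v m) = phi L a (mk_linear (kL i) v) m.
  by apply/subr0_eq; rewrite /= hmap_phi -/(cobound h a (f i v) m) -hE gf c0.
have hf i v : h i (f i v) = 0 := hom (RHom kphi) i v.
have [s sE] := rsurj_section gsur.
have hg i x : h i (s i (g i x)) = h i x.
  apply/subr0_eq; rewrite -linearB.
  have /fg[y <-] : g i (s i (g i x) - x) = 0 by rewrite linearB sE subrr.
  exact: hf.
have tL i : linear (fun v => h i (s i v)) by move=> a u v; rewrite !linearP.
exists (fun i => mk_linear (tL i)) => i j a v m.
rewrite /cobound /= -{1}[v]sE hE /cobound; congr (_ - _).
by rewrite -hg hmap_phi sE.
Qed.

End RepTheory.

(** * The Euler form *)

Section FreeAction.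
Variables (K : fieldType) (V D : vectType K) (V0 : {vspace V}) (D0 : {vspace D}).
Variable act : V -> D -> V.
Hypotheses (act_lin : forall h, linear (act h)) (actDl : forall e, linear (act^~ e)).
Hypothesis act_mem : forall h e, h \in V0 -> e \in D0 -> act h e \in V0.
Hypothesis act_comp : forall e e', e \in D0 -> e' \in D0 ->
  exists2 e'', e'' \in D0 & forall h, h \in V0 -> act (act h e) e' = act h e''.
Hypothesis act_inv : forall e, e \in D0 -> e != 0 ->
  exists2 e', e' \in D0 & forall h, h \in V0 -> act (act h e) e' = h.
Hypothesis act_one : exists2 e, e \in D0 & forall h, h \in V0 -> act h e = h.

(** [V0] is a vector space over the division algebra [D0]: the orbit of a vector outside an
    invariant subspace W meets W in 0 and has the dimension of [D0], so W grows by such orbits until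
    it is [V0]. Composition is only asked to stay within [D0], which covers left and right
    composition of morphisms alike. *)
Lemma free_action_dvdn : (\dim D0 %| \dim V0)%N.
Proof.
have actn h e : act h e = linfun (mk_linear (act_lin h)) e by rewrite lfunE.
suff main k (W : {vspace V}) : (\dim V0 - \dim W <= k)%N -> (W <= V0)%VS ->
    (forall w e, w \in W -> e \in D0 -> act w e \in W) -> (\dim D0 %| \dim W)%N ->
    (\dim D0 %| \dim V0)%N.
  apply: (main (\dim V0) 0%VS); rewrite ?dimv0 ?sub0v ?subn0 //.
  move=> w e; rewrite !memv0 => /eqP -> _.
  by have /= := linear0 (mk_linear (actDl e)) => ->.
elim: k W => [|k IHk] W leW sWV clW dvW.
  suff -> : V0 = W by [].
  by apply/eqP; rewrite eq_sym eqEdim sWV -subn_eq0 -leqn0.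
have [sVW|/subvPn[h hV hW]] := boolP (V0 <= W)%VS.
  by suff -> : V0 = W by []; apply: subv_anti; rewrite sVW sWV.
pose L := (linfun (mk_linear (act_lin h)) @: D0)%VS.
have LW : (W :&: L = 0)%VS.
  apply/eqP; rewrite -subv0; apply/subvP => v; rewrite memv_cap memv0 => /andP[vW].
  move=> /memv_imgP[e eD vE]; have [//|v0] := eqVneq v 0.
  have e0 : e != 0 by apply: contraNneq v0 => e0; rewrite vE e0 linear0.
  have [e' eD' eE] := act_inv eD e0; case/negP: hW.
  rewrite -(eE _ hV); apply: clW => //.
  by rewrite actn -vE.
have dL : \dim L = \dim D0.
  apply: limg_dim_eq; apply/eqP; rewrite -subv0; apply/subvP => e.
  rewrite memv_cap memv_ker memv0 => /andP[eD]; rewrite -actn => /eqP he0.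
  apply/negPn/negP => e0; have [e' eD' eE] := act_inv eD e0; case/negP: hW.
  by rewrite -(eE _ hV) he0; have /= -> := linear0 (mk_linear (actDl e')); rewrite mem0v.
have dWL : \dim (W + L) = (\dim W + \dim L)%N by apply: dimv_disjoint_sum.
have dD : (0 < \dim D0)%N.
  rewrite lt0n dimv_eq0; apply: contraNneq hW => D00.
  have [e eD eE] := act_one; rewrite -(eE _ hV) actn.
  by move: eD; rewrite D00 memv0 => /eqP ->; rewrite linear0 mem0v.
apply: (IHk (W + L)%VS).
- by rewrite dWL dL subnDA; apply: leq_trans (leq_sub2l _ dD) _; rewrite leq_subLR add1n.
- rewrite subv_add sWV; apply/subvP => v /memv_imgP[e eD ->].
  by rewrite -actn act_mem.
- move=> w e /memv_addP[w1 w1W [w2 /memv_imgP[e2 e2D ->] ->]] eD.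
  have /= -> := linearD (mk_linear (actDl e)) w1 (linfun (mk_linear (act_lin h)) e2).
  rewrite memv_add //; first exact: clW.
  have [e3 e3D e3E] := act_comp e2D eD.
  by rewrite -actn e3E // actn memv_img.
- by rewrite dWL dL dvdn_add.
Qed.

End FreeAction.

Section EulerForm.
Context (K : fieldType) (n : nat) (Q : valued_quiver n) (X : modulation K Q).
Implicit Types M N L E I : rep X.

Lemma field_div (x : K) : x != 0 -> exists y, y * x = 1.
Proof. by move=> x0; exists x^-1; rewrite mulVf. Qed.

Definition right_linear i j (a : arr Q i j) (l : 'Hom(mM X a, mF X j)) : Prop :=
  forall m y, l (br m y) = l m * y.

Definition rlin_split i j (a : arr Q i j) : splitting (@right_linear i j a).
Proof.
apply: (splitting_of field_div) => [m y|k u v Pu Pv m y].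
  by rewrite !lfunE /= mul0r.
by rewrite !lfunE /= !lfunE /= Pu Pv mulrDl -scalerAl.
Defined.

(* K-dimension of the space of F_j-linear forms on M_ij *)
Definition arrow_dim i j (a : arr Q i j) : nat := sp_k (rlin_split a).

Definition arrow := {p : 'I_n * 'I_n | arr Q p.1 p.2}.

Section Cochains.
Variables (a b : 'I_n -> nat).

(** Cochains are stored by their K-coordinates, an entry of an arrow component being a right linear
    form on the bimodule. Their dimensions then depend on the two dimension vectors only, and so
    does the Euler form. *)
Definition idx0 := {i : 'I_n & 'I_(a i) * 'I_(b i) * 'I_(dim (mF X i))}%type.
Definition idx1 := {e : arrow &
  'I_(a (sval e).1) * 'I_(b (sval e).2) * 'I_(arrow_dim (proj2_sig e))}%type.
Definition coch0 : vectType K := {ffun idx0 -> K^o}.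
Definition coch1 : vectType K := {ffun idx1 -> K^o}.

Definition dec0 (u : coch0) i : 'M[(mF X i)^c]_(a i, b i) :=
  \matrix_(r, c) (r2v (\row_t u (Tagged (fun i => 'I_(a i) * 'I_(b i) * 'I_(dim (mF X i)))%type (r, c, t))) : mF X i).

Definition enc0 (A : forall i, 'M[(mF X i)^c]_(a i, b i)) : coch0 :=
  [ffun x : idx0 => v2r (A (tag x) (tagged x).1.1 (tagged x).1.2 : mF X (tag x)) 0 (tagged x).2].

Lemma dec0K u : enc0 (dec0 u) = u.
Proof.
by apply/ffunP => -[i [[r c] t]]; rewrite ffunE /= mxE r2vK mxE.
Qed.

Lemma enc0K A i : dec0 (enc0 A) i = A i.
Proof.
apply/matrixP => r c; rewrite mxE -[RHS](v2rK (A i r c : mF X i)); congr r2v.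
by apply/rowP => t; rewrite mxE ffunE.
Qed.

Lemma dec0_linear k u w i r c : dec0 (k *: u + w) i r c =
  k *: (dec0 u i r c : mF X i) + (dec0 w i r c : mF X i).
Proof.
rewrite !mxE -linearP; congr r2v.
by apply/rowP => t; rewrite !mxE !ffunE.
Qed.

Definition dec1 (u : coch1) (e : arrow) (r : 'I_(a (sval e).1)) (c : 'I_(b (sval e).2)) :
    'Hom(mM X (proj2_sig e), mF X (sval e).2) :=
  sp_i (rlin_split (proj2_sig e)) (\row_t u (Tagged (fun e : arrow =>
    'I_(a (sval e).1) * 'I_(b (sval e).2) * 'I_(arrow_dim (proj2_sig e)))%type (r, c, t))).

Definition enc1 (A : forall e : arrow, 'I_(a (sval e).1) -> 'I_(b (sval e).2) ->
    'Hom(mM X (proj2_sig e), mF X (sval e).2)) : coch1 :=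
  [ffun x : idx1 => sp_r (rlin_split (proj2_sig (tag x)))
     (A (tag x) (tagged x).1.1 (tagged x).1.2) 0 (tagged x).2].

Lemma dec1K u : enc1 (dec1 u) = u.
Proof.
by apply/ffunP => -[e [[r c] t]]; rewrite ffunE /= sp_ri mxE.
Qed.

Lemma enc1K A e r c : right_linear (A e r c) ->
  dec1 (enc1 A) (e := e) r c = A e r c.
Proof.
move=> rA; rewrite /dec1 -[RHS](sp_id (rlin_split (proj2_sig e))).
rewrite (proj1 (sp_P (rlin_split (proj2_sig e)) _)) // linear0 addr0; congr (sp_i _ _).
by apply/rowP => t; rewrite mxE ffunE.
Qed.

Lemma dec1_right_linear u e r c : right_linear (dec1 u (e := e) r c).
Proof.
rewrite /dec1; set y := (X in sp_i _ X); pose s := rlin_split (proj2_sig e); apply/(sp_P s).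
have : sp_p s (sp_s s (sp_p s (sp_i s y))) = sp_p s (sp_i s y - sp_i s y).
  congr (sp_p s _); have := sp_id s (sp_i s y); rewrite sp_ri.
  by move=> /(canRL (addKr _)) ->; rewrite addNr subrr.
by rewrite sp_ps subrr linear0.
Qed.

End Cochains.

Definition dv M (i : 'I_n) := dim (rV M i).

Section Differential.
Variables M N : rep X.
Let a := dv M.
Let b := dv N.

Definition bas (V : rep X) i (r : 'I_(dim (rV V i))) : rV V i := r2v (delta_mx 0 r).

Lemma hom0_linear (u : coch0 a b) i :
  linear (fun v : rV M i => @r2v _ (rV N i) (v2r v *m dec0 u i)).
Proof. by move=> x v w; rewrite linearP mulmxDl -scalemxAl linearP. Qed.

Definition hom0 u i : {linear rV M i -> rV N i} := mk_linear (@hom0_linear u i).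

Definition mat_of (h : forall i, {linear rV M i -> rV N i}) i :
    'M[(mF X i)^c]_(a i, b i) := \matrix_(r, c) v2r (h i (bas r)) 0 c.

Lemma mat_ofK h i v : hom0 (enc0 (mat_of h)) i v = h i v.
Proof.
rewrite /= enc0K -[RHS]v2rK; congr r2v.
rewrite -{2}[v]v2rK {2}[v2r v]row_sum_delta !linear_sum /=.
apply/rowP => c; rewrite mxE summxE; apply: eq_bigr => r _.
by rewrite !mxE !linearZ /= mxE.
Qed.

Lemma hom0K u i : mat_of (hom0 u) i = dec0 u i.
Proof.
apply/matrixP => r c; rewrite mxE /= r2vK /bas r2vK.
by rewrite -rowE mxE.
Qed.

Definition cochain_form (c : cochain1 M N) (e : arrow)
    (r : 'I_(a (sval e).1)) (s : 'I_(b (sval e).2)) (m : mM X (proj2_sig e)) : mF X (sval e).2 :=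
  v2r (c _ _ (proj2_sig e) (bas r) m) 0 s.

Lemma v2r_ract (V : rep X) i (v : rV V i) (y : mF X i) s :
  v2r (ract v y) 0 s = (v2r v 0 s : mF X i) * y :> mF X i.
Proof. by rewrite /ract linearZ mxE. Qed.

Lemma bl0 i j (ar : arr Q i j) (m : mM X ar) : bl 0 m = 0.
Proof. exact: (linear0 (mk_linear (@bl_linl _ _ _ (mM X ar) m))). Qed.

Lemma mulr_scalar (A : falgType K) (x : A) k : x * k%:A = k *: x.
Proof. by rewrite -scalerAr mulr1. Qed.

Lemma br_scalar i j (ar : arr Q i j) (k : K) (m : mM X ar) : br m k%:A = k *: m.
Proof. by have /= -> := linearZ_LR (mk_linear (@br_linr _ _ _ (mM X ar) m)) k 1; rewrite br1. Qed.

Lemma cochain_form_linear c e r s : cocycle c -> linear (@cochain_form c e r s).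
Proof.
move=> [cDl cDr cbal clin] k m m'; rewrite /cochain_form cDr linearD mxE.
by rewrite -br_scalar clin v2r_ract -scalerAr mulr1.
Qed.

Definition form_of (c : cochain1 M N) (e : arrow) r s :
    'Hom(mM X (proj2_sig e), mF X (sval e).2) :=
  if pselect (linear (@cochain_form c e r s)) is left cL then linfun (mk_linear cL) else 0.

Lemma form_ofE c e r s m : cocycle c -> form_of c r s m = @cochain_form c e r s m.
Proof.
move=> cc; rewrite /form_of; case: pselect => [cL|[]]; first by rewrite lfunE.
exact: cochain_form_linear.
Qed.

Lemma form_of_right_linear c e r s : cocycle c -> right_linear (@form_of c e r s).
Proof.
move=> cc m y; rewrite !form_ofE // /cochain_form.
by case: cc => _ _ _ ->; rewrite v2r_ract.
Qed.

Definition coc_enc c : coch1 a b := enc1 (@form_of c).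

Lemma coc_enc_eq0 c : cocycle c -> coc_enc c = 0 ->
  forall i j (ar : arr Q i j) v m, c i j ar v m = 0.
Proof.
move=> cc c0 i j ar v m; have [cDl cDr cbal clin] := cc.
have cb r : c i j ar (bas r) m = 0.
  apply: (can_inj v2rK); rewrite linear0; apply/rowP => s; rewrite [RHS]mxE.
  pose e : arrow := exist _ (i, j) ar.
  rewrite -[LHS]/(@cochain_form c e r s m) -form_ofE //.
  rewrite -(enc1K (form_of_right_linear (e := e) r s cc)) -/(coc_enc c) c0 /dec1.
  rewrite (_ : \row_t _ = 0) ?linear0 ?lfunE //.
  by apply/rowP => t; rewrite !mxE ffunE.
have c0l m' : c i j ar 0 m' = 0.
  by apply: (addrI (c i j ar 0 m')); rewrite -cDl !addr0.
have cz r x : c i j ar (x *: bas r) m = c i j ar (bas r) (bl (x : mF X i) m) := cbal _ _ ar (bas r) x m.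
have cb' r m' : c i j ar (bas r) m' = 0.
  apply: (can_inj v2rK); rewrite linear0; apply/rowP => s; rewrite [RHS]mxE.
  pose e : arrow := exist _ (i, j) ar.
  rewrite -[LHS]/(@cochain_form c e r s m') -form_ofE //.
  rewrite -(enc1K (form_of_right_linear (e := e) r s cc)) -/(coc_enc c) c0 /dec1.
  rewrite (_ : \row_t _ = 0) ?linear0 ?lfunE //.
  by apply/rowP => t; rewrite !mxE ffunE.
rewrite -[v]v2rK [v2r v]row_sum_delta linear_sum /=.
elim/big_rec: _ => [|r w _ IH]; first exact: c0l.
by rewrite cDl IH addr0 linearZ /= cz cb'.
Qed.

Definition coc_dec (u : coch1 a b) : cochain1 M N := fun i j ar v m =>
  let e : arrow := exist _ (i, j) ar in
  @r2v _ (rV N j) (\row_s \sum_r (dec1 u (e := e) r s (bl (v2r v 0 r : mF X i) m) : (mF X j)^c)).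

Lemma coc_dec_cocycle u : cocycle (coc_dec u).
Proof.
split=> i j ar v; rewrite /coc_dec /=.
- move=> v' m; rewrite -linearD; congr r2v; apply/rowP => s; rewrite !mxE -big_split /=.
  apply: eq_bigr => r _; rewrite linearD mxE.
  by have /= -> := linearD (mk_linear (@bl_linl _ _ _ (mM X ar) m)) (v2r v 0 r : mF X i) (v2r v' 0 r); rewrite linearD.
- move=> m m'; rewrite -linearD; congr r2v; apply/rowP => s; rewrite !mxE -big_split /=.
  apply: eq_bigr => r _.
  by have /= -> := linearD (mk_linear (@bl_linr _ _ _ (mM X ar) (v2r v 0 r : mF X i))) m m'; rewrite linearD.
- move=> x m; congr r2v; apply/rowP => s; rewrite !mxE.
  by apply: eq_bigr => r _; rewrite v2r_ract blM.
- move=> m y; rewrite /ract -linearZ; congr r2v; apply/rowP => s; rewrite !mxE mulr_sumr.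
  apply: eq_bigr => r _; rewrite -blr.
  exact: (dec1_right_linear u (e := exist _ (i, j) ar) r s).
Qed.

Lemma coc_decK u : coc_enc (coc_dec u) = u.
Proof.
rewrite -[RHS]dec1K /coc_enc; congr enc1.
apply: functional_extensionality_dep => -[[i j] ar].
apply: funext => r; apply: funext => s; apply/lfunP => m.
rewrite form_ofE; last exact: coc_dec_cocycle.
rewrite /cochain_form /coc_dec /= r2vK mxE (bigD1 r) //= big1 ?addr0 => [|r' r'r].
  by rewrite /bas r2vK mxE !eqxx bl1.
by rewrite /bas r2vK mxE eqxx (negPf r'r) bl0 linear0.
Qed.

Lemma coc_enc_linear c c' c'' k : cocycle c -> cocycle c' -> cocycle c'' ->
  (forall i j (ar : arr Q i j) v m,
     c'' i j ar v m = (k%:A : (mF X j)^c) *: c i j ar v m + c' i j ar v m) ->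
  coc_enc c'' = k *: coc_enc c + coc_enc c'.
Proof.
move=> cc cc' cc'' cE; apply/ffunP => -[e [[r s] t]]; rewrite !ffunE /=.
suff -> : form_of c'' r s = k *: form_of c r s + form_of c' (e := e) r s.
  by rewrite linearP !mxE.
apply/lfunP => m; rewrite !lfunE /= lfunE /= !form_ofE // /cochain_form cE.
rewrite linearD mxE linearZ mxE; congr (_ + _).
exact: mulr_scalar.
Qed.

Lemma hom0_scale k u w i v : hom0 (k *: u + w) i v =
  (k%:A : (mF X i)^c) *: hom0 u i v + hom0 w i v.
Proof.
rewrite /= -linearP; congr r2v; apply/rowP => c; rewrite !mxE mulr_sumr -big_split /=.
apply: eq_bigr => r _; rewrite dec0_linear.
rewrite -[LHS]/(((k *: (dec0 u i r c : mF X i) + (dec0 w i r c : mF X i)) * (v2r v 0 r : mF X i)) : mF X i).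
rewrite mulrDl; congr (_ + _); rewrite -scalerAl.
by rewrite -[RHS]/(((dec0 u i r c : mF X i) * (v2r v 0 r : mF X i)) * k%:A : mF X i) -scalerAr mulr1.
Qed.

Definition diff0 (u : coch0 a b) : coch1 a b := coc_enc (cobound (hom0 u)).

Lemma diff0_linear : linear diff0.
Proof.
move=> k u w; apply: coc_enc_linear; try exact: cocycle_cobound.
move=> i j ar v m; rewrite /cobound !hom0_scale phiDl opprD addrACA scalerBr.
congr (_ - _ + _); rewrite (phi_bal (hom0 u i v) (k%:A : mF X i) m).
have -> : bl (k%:A : mF X i) m = k *: m.
  by have /= -> := linearZ_LR (mk_linear (@bl_linl _ _ _ (mM X ar) m)) k 1; rewrite bl1.
by rewrite -br_scalar phi_lin.
Qed.

Definition diff : 'Hom(coch0 a b, coch1 a b) := linfun (mk_linear diff0_linear).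

Definition homS : {vspace coch0 a b} := lker diff.
Definition homdim : nat := \dim homS.

Lemma homSP u : u \in homS ->
  exists h : rhom M N, forall i v, h i v = hom0 u i v.
Proof.
rewrite memv_ker lfunE /= => /eqP d0.
have hphi i j (ar : arr Q i j) v m : hom0 u j (phi M ar v m) = phi N ar (hom0 u i v) m.
  exact/subr0_eq/(coc_enc_eq0 (cocycle_cobound _) d0).
by exists (RHom hphi).
Qed.

Lemma mem_homS (h : rhom M N) : enc0 (mat_of h) \in homS.
Proof.
rewrite memv_ker lfunE /= /diff0; apply/eqP/ffunP => -[e [[r s] t]]; rewrite !ffunE /=.
suff -> : form_of (cobound (hom0 (enc0 (mat_of h)))) r s = 0 :> 'Hom(_, mF X (sval e).2).
  by rewrite linear0 mxE.
apply/lfunP => m; rewrite form_ofE; last exact: cocycle_cobound.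
by rewrite /cochain_form /cobound !mat_ofK hmap_phi subrr linear0 mxE lfunE.
Qed.

Lemma homdim_eq0 : homdim = 0%N <-> Hom_zero M N.
Proof.
split=> [/eqP|hz]; rewrite ?dimv_eq0.
  move=> /eqP h0 h i v; have := mem_homS h; rewrite h0 memv0 => /eqP e0.
  rewrite -mat_ofK e0 /= (_ : dec0 0 i = 0) ?mulmx0 ?linear0 //.
  apply/matrixP => r c; rewrite !mxE (_ : \row_t _ = 0) ?linear0 //.
  by apply/rowP => t; rewrite !mxE ffunE.
apply/eqP; rewrite dimv_eq0 -subv0; apply/subvP => u uS.
have [h hE] := homSP uS; rewrite memv0 -[u]dec0K; apply/eqP/ffunP => -[i [[r c] t]].
by rewrite !ffunE /= -hom0K mxE -hE hz linear0 mxE linear0 mxE.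
Qed.

Definition dim0 : nat := \dim {: coch0 a b}.
Definition dim1 : nat := \dim {: coch1 a b}.

(** Rank-nullity for [diff], whose kernel is Hom; the defect of the inequality is the dimension of
    Ext, so it becomes an equality in [Ext0_dim]. *)
Lemma dim0_leq : (dim0 <= dim1 + homdim)%N.
Proof.
rewrite /dim0 -(limg_ker_dim diff fullv) addnC; apply: leq_add; first exact: dimvS (subvf _).
by rewrite capfv.
Qed.

Lemma Ext0_dim : Ext0 M N -> dim0 = (dim1 + homdim)%N.
Proof.
move=> ext; rewrite /dim0 -(limg_ker_dim diff fullv) capfv addnC; congr (_ + _)%N.
congr (\dim _); apply: subv_anti; rewrite subvf; apply/subvP => u _ /=.
have [h hE] := ext _ (coc_dec_cocycle u).
apply/memv_imgP; exists (enc0 (mat_of h)); rewrite ?memvf // lfunE /= /diff0.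
rewrite -[LHS]coc_decK; apply: (addrI 0); rewrite !add0r; congr coc_enc.
do 5![apply: functional_extensionality_dep => ?].
by rewrite hE /cobound !mat_ofK.
Qed.

End Differential.
End EulerForm.

Section EulerNumbers.
Context (K : fieldType) (n : nat) (Q : valued_quiver n) (X : modulation K Q).
Implicit Types M N L : rep X.

Definition euler0 (a b : 'I_n -> nat) : nat := \sum_i a i * b i * vf Q i.
Definition euler1 (a b : 'I_n -> nat) : nat :=
  \sum_(e : arrow Q) a (sval e).1 * b (sval e).2 * arrow_dim X (proj2_sig e).

Lemma dim_ffun_regular (I : finType) : \dim {: {ffun I -> K^o}} = #|I|.
Proof. by rewrite dimvf /dim /= muln1. Qed.

Lemma dim0E M N : dim0 M N = euler0 (dv M) (dv N).
Proof.
rewrite /dim0 dim_ffun_regular card_tagged sumnE big_map big_enum /=.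
apply: eq_bigr => i _; rewrite !card_prod !card_ord; congr (_ * _)%N.
by rewrite -(mF_dim X) dimvf.
Qed.

Lemma dim1E M N : dim1 M N = euler1 (dv M) (dv N).
Proof.
rewrite /dim1 dim_ffun_regular card_tagged sumnE big_map big_enum /=.
by apply: eq_bigr => e _; rewrite !card_prod !card_ord.
Qed.

Definition euler (a b : 'rV[nat]_n) : int :=
  (euler0 (a 0) (b 0))%:Z - (euler1 (a 0) (b 0))%:Z.

Lemma dimvecE M : dimvec M 0 = dv M.
Proof. by apply: funext => i; rewrite mxE. Qed.

Lemma euler_hom M N : Ext_zero M N -> euler (dimvec M) (dimvec N) = (homdim M N)%:Z.
Proof.
move/Ext_zeroP/Ext0_dim; rewrite dim0E dim1E /euler !dimvecE => ->.
by rewrite PoszD addrC addKr.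
Qed.

Lemma euler_le M N : euler (dimvec M) (dimvec N) <= (homdim M N)%:Z.
Proof.
have := dim0_leq M N; rewrite dim0E dim1E /euler !dimvecE lerBlDl -PoszD lez_nat.
by [].
Qed.

Lemma homdim_gt0 M N : ~ Hom_zero M N -> (0 < homdim M N)%N.
Proof. by move=> h; rewrite lt0n; apply/eqP => /homdim_eq0. Qed.

Lemma Hom_zeroPn M N : ~ Hom_zero M N -> exists (h : rhom M N) i v, h i v != 0.
Proof.
move=> nz; apply: contrapT => no; apply: nz => h i v.
by apply/eqP/negPn/negP => hv; apply: no; exists h, i, v.
Qed.

Lemma End_division_homdim M : End_division M -> (0 < homdim M M)%N.
Proof.
move=> [nz _]; apply: homdim_gt0 => hz; apply: nz => i v.
exact: (hz (rid M)).
Qed.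

Section Composition.
Variables a b c : 'I_n -> nat.

Definition comp0 (u : coch0 X a b) (w : coch0 X b c) : coch0 X a c :=
  enc0 (fun i => dec0 u i *m dec0 w i).

Lemma comp0_linl w : linear (comp0^~ w).
Proof.
move=> k u u'; apply/ffunP => -[i [[r s] t]]; rewrite !ffunE /=.
suff -> : ((dec0 (k *: u + u') i *m dec0 w i) r s : mF X i) =
    k *: ((dec0 u i *m dec0 w i) r s : mF X i) + ((dec0 u' i *m dec0 w i) r s : mF X i).
  by rewrite linearP !mxE.
rewrite !mxE scaler_sumr -big_split /=; apply: eq_bigr => j _; rewrite dec0_linear.
rewrite -[LHS]/((dec0 w i j s : mF X i) * (k *: (dec0 u i r j : mF X i) + (dec0 u' i r j : mF X i))).
by rewrite mulrDr -scalerAr.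
Qed.

Lemma comp0_linr u : linear (comp0 u).
Proof.
move=> k w w'; apply/ffunP => -[i [[r s] t]]; rewrite !ffunE /=.
suff -> : ((dec0 u i *m dec0 (k *: w + w') i) r s : mF X i) =
    k *: ((dec0 u i *m dec0 w i) r s : mF X i) + ((dec0 u i *m dec0 w' i) r s : mF X i).
  by rewrite linearP !mxE.
rewrite !mxE scaler_sumr -big_split /=; apply: eq_bigr => j _; rewrite dec0_linear.
rewrite -[LHS]/((k *: (dec0 w i j s : mF X i) + (dec0 w' i j s : mF X i)) * (dec0 u i r j : mF X i)).
by rewrite mulrDl -scalerAl.
Qed.

End Composition.

Lemma comp0A a b c d (u : coch0 X a b) (w : coch0 X b c) (z : coch0 X c d) :
  comp0 (comp0 u w) z = comp0 u (comp0 w z).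
Proof.
by rewrite {1 3}/comp0; congr enc0; apply: functional_extensionality_dep => i;
  rewrite !enc0K mulmxA.
Qed.

Lemma homS_comp M N L u w : u \in homS M N -> w \in homS N L ->
  comp0 u w \in homS M L.
Proof.
move=> /homSP[h hE] /homSP[g gE].
suff -> : comp0 u w = enc0 (mat_of (rcomp g h)) by exact: mem_homS.
congr enc0; apply: functional_extensionality_dep => i; apply/matrixP => r s.
by rewrite [RHS]mxE /= gE hE /= !r2vK -[in RHS]mulmxA -[in RHS]rowE [in RHS]mxE.
Qed.

Lemma enc_mat_of M N (u : coch0 X (dv M) (dv N)) (h : rhom M N) :
  (forall i v, h i v = hom0 u i v) -> enc0 (mat_of h) = u.
Proof.
move=> hE; rewrite -[RHS]dec0K; congr enc0.
apply: functional_extensionality_dep => i; rewrite -hom0K.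
by apply/matrixP => r s; rewrite !mxE hE.
Qed.

Definition one0 M : coch0 X (dv M) (dv M) := enc0 (fun i => 1%:M).

Lemma one0_hom M : one0 M \in homS M M.
Proof.
rewrite (_ : one0 M = enc0 (mat_of (rid M))) ?mem_homS //.
congr enc0; apply: functional_extensionality_dep => i; apply/matrixP => r s.
by rewrite !mxE /bas r2vK mxE eqxx eq_sym.
Qed.

Lemma comp01 M N (u : coch0 X (dv M) (dv N)) : comp0 u (one0 N) = u.
Proof.
rewrite -[RHS]dec0K; congr enc0; apply: functional_extensionality_dep => i.
by rewrite enc0K mulmx1.
Qed.

Lemma comp10 M N (u : coch0 X (dv M) (dv N)) : comp0 (one0 M) u = u.
Proof.
rewrite -[RHS]dec0K; congr enc0; apply: functional_extensionality_dep => i.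
by rewrite enc0K mul1mx.
Qed.

Lemma homS_inv M u : End_division M -> u \in homS M M -> u != 0 ->
  exists2 u', u' \in homS M M & comp0 u u' = one0 M /\ comp0 u' u = one0 M.
Proof.
move=> [_ Mdiv] uS u0; have [h hE] := homSP uS.
have [|h' h'E] := Mdiv h.
  apply: contrapT => no; case/negP: u0; rewrite -(enc_mat_of hE).
  apply/eqP/ffunP => -[i [[r s] t]]; rewrite !ffunE /= mxE.
  suff -> : h i (bas r) = 0 by rewrite !linear0 mxE linear0 mxE.
  by apply/eqP/negPn/negP => hr; apply: no; exists i, (bas r).
exists (enc0 (mat_of h')); first exact: mem_homS.
have e1 (g g' : rhom M M) (w w' : coch0 X (dv M) (dv M)) :
    (forall i v, g i v = hom0 w i v) -> (forall i v, g' i v = hom0 w' i v) ->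
    (forall i v, g' i (g i v) = v) -> comp0 w w' = one0 M.
  move=> gE gE' gg; rewrite -[LHS]dec0K; congr enc0.
  apply: functional_extensionality_dep => i; rewrite enc0K.
  apply/row_matrixP => r; rewrite !rowE.
  apply: (can_inj (@r2vK _ (rV M i))); rewrite mulmx1 -[RHS]gg gE gE' /= !r2vK.
  by rewrite mulmxA.
have h'E' i v : h' i v = hom0 (enc0 (mat_of h')) i v by rewrite mat_ofK.
by split; [apply: (e1 h h') => // i v; case: (h'E i v) | apply: (e1 h' h) => // i v; case: (h'E i v)].
Qed.

(** Hom(A, N) is a vector space over the division algebra End(A). *)
Lemma homdim_dvdr A N : End_division A -> (homdim A A %| homdim A N)%N.
Proof.
move=> Adiv; apply: (@free_action_dvdn K _ _ _ _ (fun h e => comp0 e h)).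
- by move=> h; apply: comp0_linl.
- by move=> e; apply: comp0_linr.
- by move=> h e hS eS; apply: homS_comp eS hS.
- move=> e e' eS e'S; exists (comp0 e' e); first exact: homS_comp.
  by move=> h _; rewrite comp0A.
- move=> e eS e0; have [e' e'S [_ e1]] := homS_inv Adiv eS e0; exists e' => // h _.
  by rewrite -comp0A e1 comp10.
- by exists (one0 A); [exact: one0_hom | move=> h _; rewrite comp10].
Qed.

Lemma homdim_dvdl B N : End_division B -> (homdim B B %| homdim N B)%N.
Proof.
move=> Bdiv; apply: (@free_action_dvdn K _ _ _ _ (fun h e => comp0 h e)).
- by move=> h; apply: comp0_linr.
- by move=> e; apply: comp0_linl.
- by move=> h e hS eS; apply: homS_comp hS eS.
- move=> e e' eS e'S; exists (comp0 e e'); first exact: homS_comp.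
  by move=> h _; rewrite comp0A.
- move=> e eS e0; have [e' e'S [e1 _]] := homS_inv Bdiv eS e0; exists e' => // h _.
  by rewrite comp0A e1 comp01.
- by exists (one0 B); [exact: one0_hom | move=> h _; rewrite comp01].
Qed.

End EulerNumbers.

(** * Exceptional modules *)

Section ExceptionalModules.
Context (R : realType).
Context (K : fieldType) (n : nat) (Q : valued_quiver n) (X : modulation K Q).
Implicit Types (M N L I : rep X) (x : 'rV[R]_n).

Definition wt x M : R := pairr Q x (dimvec M).
Definition sz M : nat := (\sum_i dim (rV M i))%N.

Lemma wtE x M : wt x M = \sum_i x 0 i * (dim (rV M i))%:R * (vf Q i)%:R.
Proof. by apply: eq_bigr => i _; rewrite !mxE. Qed.

Lemma wt_exact x N M L (f : rhom N M) (g : rhom M L) : short_exact f g ->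
  wt x M = wt x N + wt x L.
Proof.
move=> se; rewrite !wtE -big_split /=; apply: eq_bigr => i _.
by rewrite -(short_exact_dim i se) natrD mulrDr mulrDl.
Qed.

Lemma sz_exact N M L (f : rhom N M) (g : rhom M L) : short_exact f g ->
  sz M = (sz N + sz L)%N.
Proof.
move=> se; rewrite /sz -big_split /=; apply: eq_bigr => i _.
by rewrite (short_exact_dim i se).
Qed.

Lemma rzeroP M : rzero M <-> sz M = 0%N.
Proof.
split=> [z|/eqP]; last first.
  rewrite sum_nat_eq0 => /forallP/= d0 i v; apply: (can_inj v2rK).
  by apply/rowP => j; have := ltn_ord j; rewrite {2}(eqP (d0 i)).
apply/eqP; rewrite sum_nat_eq0; apply/forallP => i /=; rewrite -leqn0 leqNgt.
apply/negP => d0; have /(congr1 v2r) := z i (r2v (delta_mx 0 (Ordinal d0))).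
rewrite r2vK linear0 => /rowP/(_ (Ordinal d0)); rewrite !mxE !eqxx => /eqP.
by rewrite oner_eq0.
Qed.

Lemma rinj_surj N M (f : rhom N M) : rinj f -> sz N = sz M -> rsurj f.
Proof.
move=> finj szE; have [L [g se]] := rcoker finj.
have /rzeroP L0 : sz L = 0%N by apply/eqP; rewrite -(eqn_add2l (sz N)) -(sz_exact se) szE addn0.
by move=> i w; case: se => _ _ h; apply/h; apply: L0.
Qed.

Lemma rsurj_ker M L (g : rhom M L) : rsurj g ->
  exists N (f : rhom N M), short_exact f g.
Proof. by move=> gs; have [N [f [fi fg]]] := rker g; exists N, f. Qed.

Lemma rsurj_inj M L (g : rhom M L) : rsurj g -> sz M = sz L -> rinj g.
Proof.
move=> gs szE; have [N [f se]] := rsurj_ker gs.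
have /rzeroP N0 : sz N = 0%N by apply/eqP; rewrite -(eqn_add2r (sz L)) -(sz_exact se) szE.
move=> i u v /eqP; rewrite -subr_eq0 -linearB => /eqP; case: se => _ _ h /h[y].
by rewrite (N0 _ y) linear0 => /esym/subr0_eq.
Qed.

Lemma sz_rinj N M (f : rhom N M) : rinj f -> (sz N <= sz M)%N.
Proof. by move=> /rcoker[L [g se]]; rewrite (sz_exact se) leq_addr. Qed.

Lemma rbij_inv M N (h : rhom M N) : rinj h -> rsurj h ->
  exists h' : rhom N M, forall i, (forall v, h' i (h i v) = v) /\ (forall w, h i (h' i w) = w).
Proof.
move=> hi hs; have [s sE] := rsurj_section hs.
have sphi i j (e : arr Q i j) v m : s j (phi N e v m) = phi M e (s i v) m.
  by apply: hi; rewrite sE hmap_phi sE.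
exists (RHom sphi) => i; split=> [v|w] /=; last exact: sE.
by apply: hi; rewrite sE.
Qed.

Lemma rinj_comp N M L (f : rhom N M) (g : rhom M L) : rinj f -> rinj g -> rinj (rcomp g f).
Proof. by move=> fi gi i u v /gi/fi. Qed.

Lemma rsurj_comp N M L (f : rhom N M) (g : rhom M L) :
  rsurj f -> rsurj g -> rsurj (rcomp g f).
Proof.
by move=> fs gs i w; have [v <-] := gs i w; have [u <-] := fs i v; exists u.
Qed.

Lemma lex_max (T : finType) (P : pred T) (f : T -> R) (g : T -> int) t0 : P t0 ->
  exists t, P t /\ forall t', P t' -> f t' <= f t /\ (f t' = f t -> g t' <= g t).
Proof.
move=> Pt0; case: (@arg_maxP _ R T t0 P f) => // t1 Pt1 t1max.
case: (@arg_maxP _ int T t1 (fun t => P t && (f t == f t1)) g); first by rewrite Pt1 eqxx.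
move=> t /andP[Pt /eqP ft] tmax; exists t; split=> // t' Pt'; rewrite ft; split.
  exact: t1max.
by move=> ft'; apply: tmax; rewrite Pt' ft' eqxx.
Qed.

(** First step of a Harder-Narasimhan filtration: lexicographic maximum of the weight and then of
    the size, large or small according to s. Submodules have dimension vectors bounded by [sz M], so
    the maximum is taken over a finite type. *)
Lemma max_sub M x (s : bool) :
  exists N L (f : rhom N M) (g : rhom M L), short_exact f g /\
    forall N' (f' : rhom N' M), rinj f' -> wt x N' <= wt x N /\
      (wt x N' = wt x N -> if s then (sz N' <= sz N)%N else (sz N <= sz N')%N).
Proof.
pose T := {ffun 'I_n -> 'I_(sz M).+1}.
pose P (t : T) := `[< exists N (f : rhom N M), rinj f /\ forall i, dim (rV N i) = t i >].
have dle N (f : rhom N M) i : rinj f -> (dim (rV N i) <= sz M)%N.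
  move=> fi; apply: leq_trans (rinj_dim i fi) _.
  by rewrite /sz (bigD1 i) //= leq_addr.
pose tof N : T := [ffun i => inord (dim (rV N i))].
have tofE N (f : rhom N M) i : rinj f -> (tof N i : nat) = dim (rV N i).
  by move=> fi; rewrite ffunE inordK // ltnS (dle _ f).
have Ptof N (f : rhom N M) : rinj f -> P (tof N).
  by move=> fi; apply/asboolP; exists N, f; split=> // i; rewrite (tofE N f).
pose W (t : T) : R := \sum_i x 0 i * (t i : nat)%:R * (vf Q i)%:R.
pose S (t : T) : nat := (\sum_i (t i : nat))%N.
have idinj : rinj (rid M) by move=> i u v.
have [t [/asboolP[N [f [fi tE]]] tmax]] :=
  lex_max W (fun t => if s then Posz (S t) else - Posz (S t)) (Ptof M (rid M) idinj).
have [L [g se]] := rcoker fi; exists N, L, f, g; split=> // N' f' fi'.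
have [le1 le2] := tmax _ (Ptof _ _ fi').
have WE : wt x N = W t by rewrite wtE; apply: eq_bigr => i _; rewrite tE.
have SE : sz N = S t by apply: eq_bigr => i _; rewrite tE.
have WE' : wt x N' = W (tof N') by rewrite wtE; apply: eq_bigr => i _; rewrite (tofE _ f').
have SE' : sz N' = S (tof N') by apply: eq_bigr => i _; rewrite (tofE _ f').
rewrite WE WE' SE SE'; split=> // /le2; case: s {tmax le1 le2} => //.
by rewrite lerN2.
Qed.

(** A nonzero map from N to L with image J would allow enlarging N by J, so wt J <= 0, and shrinking
    N to the kernel, so wt J >= 0; at weight 0 the tie-break on sizes forces J = 0. Hence Hom(N, L)
    = 0, and both ends inherit rigidity from M. *)
Lemma max_sub_rigid M x s : Ext0 M M ->
  exists N L (f : rhom N M) (g : rhom M L), [/\ short_exact f g, Ext0 N N, Ext0 L L &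
    forall N' (f' : rhom N' M), rinj f' -> wt x N' <= wt x N /\
      (wt x N' = wt x N -> if s then (sz N' <= sz N)%N else (sz N <= sz N')%N)].
Proof.
move=> ext; have [N [L [f [g [se mx]]]]] := max_sub M x s.
suff hz : Hom_zero N L.
  exists N, L, f, g; split=> //; case: (se) => fi gs _.
    by apply: rigid_sub se _ hz; apply: Ext0_sub fi ext.
  by apply: rigid_quo se _ hz; apply: Ext0_quo gs ext.
apply: contrapT => /Hom_zeroPn[h [i0 [v0 hv0]]].
have [J [p [q [ps qi qp]]]] := rimage h.
have [Z [k sek]] := rsurj_ker ps.
have [L' [c sec]] := rcoker qi.
have [fi gs _] := se; have [_ cs _] := sec.
have [N' [f' se']] := rsurj_ker (rsurj_comp gs cs).
have [ki _ _] := sek; have [fi' _ _] := se'.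
have [w1 e1] := mx _ _ (rinj_comp ki fi).
have [w2 e2] := mx _ _ fi'.
have wN := wt_exact x sek; have wN' := wt_exact x se'; have wL := wt_exact x sec.
have wM := wt_exact x se.
have sN := sz_exact sek; have sN' := sz_exact se'; have sL := sz_exact sec.
have sM := sz_exact se.
have wJ : wt x J = 0.
  apply/eqP; rewrite eq_le; apply/andP; split.
    by move: w2; rewrite -(lerD2r (wt x L')) -wN' wM wL addrA lerD2r gerDl.
  by rewrite -(lerD2l (wt x Z)) -wN addr0.
have sJ : (sz J <= 0)%N.
  case: (s) e1 e2 => e1 e2.
    rewrite -(leq_add2r (sz L')) -(leq_add2l (sz N)) -sL -sM sN' add0n leq_add2r.
    apply: e2; apply: (addIr (wt x L')).
    by rewrite -wN' wM wL wJ add0r.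
  rewrite -(leq_add2l (sz Z)) -sN addn0; apply: e1.
  by rewrite wN wJ addr0.
move: sJ; rewrite leqn0 => /eqP/rzeroP zJ; case/negP: hv0.
by rewrite -qp (zJ _ (p i0 v0)) linear0.
Qed.

(** Take a smallest nonzero module I that is both a submodule and a quotient of N. The image of a
    nonzero endomorphism of I is again such a module, so the endomorphism is invertible. *)
Lemma exceptional_factor N : Ext0 N N -> ~ rzero N ->
  exists I (f : rhom I N) (g : rhom N I), [/\ rinj f, rsurj g & exceptional I].
Proof.
move=> ext nz.
pose P k := `[< exists I (f : rhom I N) (g : rhom N I),
  [/\ rinj f, rsurj g, ~ rzero I & sz I = k] >].
have exP : exists k, P k.
  exists (sz N); apply/asboolP; exists N, (rid N), (rid N); split=> //.
  by move=> i w; exists w.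
have [k /asboolP[I [f [g [fi gs nzI szI]]]] kmin] := ex_minnP exP.
exists I, f, g; split=> //; split; last first.
  by apply/Ext_zeroP; apply: Ext0_quo gs _; apply: Ext0_sub fi ext.
split=> // h [i0 [v0 hv0]]; have [J [p [q [ps qi qp]]]] := rimage h.
have nzJ : ~ rzero J by move=> zJ; case/negP: hv0; rewrite -qp (zJ _ (p i0 v0)) linear0.
have szJ : sz I = sz J.
  apply/eqP; rewrite eqn_leq (sz_rinj qi) andbT szI; apply: kmin; apply/asboolP.
  exists J, (rcomp f q), (rcomp p g); split=> //.
    exact: rinj_comp.
  exact: rsurj_comp.
have pi := rsurj_inj ps szJ; have qs := rinj_surj qi (esym szJ).
have hi : rinj h by move=> i u v; rewrite -!qp => /qi/pi.
have hs : rsurj h.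
  by move=> i w; have [v <-] := qs i w; have [u <-] := ps i v; exists u; rewrite qp.
have [h' h'E] := rbij_inv hi hs; exists h' => i v; have [a b] := h'E i; split; [exact: a|exact: b].
Qed.

(** I is an exceptional factor of the smallest submodule N of maximal weight. A nonzero quotient of
    I is a quotient of N; its kernel in N is a smaller submodule of M, hence of strictly smaller
    weight. *)
Lemma pos_sub_exceptional M x N0 (f0 : rhom N0 M) : Ext0 M M -> rinj f0 -> 0 < wt x N0 ->
  exists I (f : rhom I M), [/\ rinj f, exceptional I &
    forall L (g : rhom I L), rsurj g -> ~ rzero L -> 0 < wt x L].
Proof.
move=> ext fi0 w0; have [N [L [f [g [se eN eL mx]]]]] := max_sub_rigid x false ext.
have [fi gs _] := se; have [wN _] := mx _ _ fi0.
have nzN : ~ rzero N.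
  move=> zN; have : wt x N = 0; last by move=> wN0; move: wN; rewrite wN0 leNgt w0.
  rewrite wtE big1 // => i _; have /rzeroP/eqP := zN.
  by rewrite sum_nat_eq0 => /forallP/(_ i)/= /eqP ->; rewrite mulr0 mul0r.
have [I [fI [gI [fIi gIs eI]]]] := exceptional_factor eN nzN.
exists I, (rcomp f fI); split=> //; first exact: rinj_comp.
move=> L' g' gs' nzL'; have [Z [k sek]] := rsurj_ker (rsurj_comp gIs gs').
have [ki _ _] := sek; have [le1 e1] := mx _ _ (rinj_comp ki fi).
have wN1 := wt_exact x sek; have sN := sz_exact sek.
rewrite -(ltrD2l (wt x Z)) -wN1 addr0 lt_neqAle le1 andbT; apply/negP => /eqP/e1.
by rewrite sN -{2}[sz Z]addn0 leq_add2l leqn0 => /eqP/rzeroP.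
Qed.

(** Dual argument, on the quotient of M by the largest submodule of maximal weight. *)
Lemma neg_quo_exceptional M x L0 (g0 : rhom M L0) : Ext0 M M -> rsurj g0 -> wt x L0 < 0 ->
  exists I (g : rhom M I), [/\ rsurj g, exceptional I &
    forall N (f : rhom N I), rinj f -> ~ rzero N -> wt x N < 0].
Proof.
move=> ext gs0 w0; have [N [L [f [g [se eN eL mx]]]]] := max_sub_rigid x true ext.
have [fi gs _] := se; have [N0 [f0 se0]] := rsurj_ker gs0.
have [fi0 _ _] := se0; have [wN _] := mx _ _ fi0.
have wM := wt_exact x se; have wM0 := wt_exact x se0.
have wL : wt x L < 0.
  rewrite -(ltrD2l (wt x N)) -wM wM0 addr0; apply: lt_le_trans wN.
  by rewrite gtrDl.
have nzL : ~ rzero L.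
  move=> /rzeroP/eqP; rewrite sum_nat_eq0 => /forallP/= d0.
  by move: wL; rewrite wtE big1 ?ltxx // => i _; rewrite (eqP (d0 i)) mulr0 mul0r.
have [I [fI [gI [fIi gIs eI]]]] := exceptional_factor eL nzL.
exists I, (rcomp gI g); split=> //; first exact: rsurj_comp.
move=> N1 f1 fi1 nzN1; have [L1 [c sec]] := rcoker (rinj_comp fi1 fIi).
have [_ cs _] := sec; have [N' [f' se']] := rsurj_ker (rsurj_comp gs cs).
have [fi' _ _] := se'; have [le1 e1] := mx _ _ fi'.
have wL1 := wt_exact x sec; have wM1 := wt_exact x se'.
have wN' : wt x N' = wt x N + wt x N1.
  by apply: (addIr (wt x L1)); rewrite -wM1 wM wL1 addrA.
have sN' : sz N' = (sz N + sz N1)%N.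
  apply/eqP; rewrite -(eqn_add2r (sz L1)) -(sz_exact se') (sz_exact se) (sz_exact sec).
  by rewrite addnA.
rewrite -(ltrD2l (wt x N)) -wN' addr0 lt_neqAle le1 andbT; apply/negP => /eqP/e1.
by rewrite sN' -{2}[sz N]addn0 leq_add2l leqn0 => /eqP/rzeroP.
Qed.

End ExceptionalModules.

(** * Simple modules *)

Section SimpleModules.
Context (K : fieldType) (n : nat) (Q : valued_quiver n) (X : modulation K Q).
Implicit Types (M N L I : rep X).

Lemma euler0D a b c : euler0 Q a (fun i => b i + c i)%N = (euler0 Q a b + euler0 Q a c)%N.
Proof. by rewrite /euler0 -big_split /=; apply: eq_bigr => i _; rewrite mulnDr mulnDl. Qed.

Lemma euler1D a b c : euler1 X a (fun i => b i + c i)%N = (euler1 X a b + euler1 X a c)%N.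
Proof. by rewrite /euler1 -big_split /=; apply: eq_bigr => i _; rewrite mulnDr mulnDl. Qed.

Lemma euler_exact a N M L (f : rhom N M) (g : rhom M L) : short_exact f g ->
  euler X a (dimvec M) = euler X a (dimvec N) + euler X a (dimvec L).
Proof.
move=> se; rewrite /euler !dimvecE.
have -> : dv M = (fun i => dv N i + dv L i)%N.
  by apply: funext => i; rewrite /dv (short_exact_dim i se).
by rewrite euler0D euler1D !PoszD opprD addrACA.
Qed.

Lemma dim0_eq M i (u v : rV M i) : dim (rV M i) = 0%N -> u = v.
Proof.
move=> d0; apply: (can_inj v2rK); apply/rowP => -[k k0]; exfalso.
by move: k0; rewrite d0.
Qed.

(** The Euler form of M with M' is that of M with itself, hence positive, so a nonzero h exists; its
    kernel and its image contradict the stability of M and M' unless h is bijective. *)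
Lemma exceptional_iso M M' : exceptional M -> exceptional M' -> dimvec M = dimvec M' ->
  exists h : rhom M M', rinj h /\ rsurj h.
Proof.
move=> [Mdiv Mext] [M'div M'ext] dE.
have szE : sz M = sz M'.
  by apply: eq_bigr => i _; have /rowP/(_ i) := dE; rewrite !mxE.
pose e := homdim M M; have e0 : (0 < e)%N by apply: End_division_homdim.
have eE : euler X (dimvec M) (dimvec M) = e%:Z by apply: euler_hom.
have /Hom_zeroPn[h [i0 [v0 hv0]]] : ~ Hom_zero M M'.
  move=> hz; have := euler_le M M'; rewrite -dE eE.
  by have /homdim_eq0 -> := hz; rewrite lez_nat leqNgt e0.
have [J [p [q [ps qi qp]]]] := rimage h.
have nzJ : ~ rzero J by move=> z; case/negP: hv0; rewrite -qp (z _ (p i0 v0)) linear0.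
exists h; suff qs : rsurj q.
  have pi : rinj p by apply: (rsurj_inj ps); rewrite szE; apply/eqP; rewrite eqn_leq
    (sz_rinj qi) -szE andbT; have [Z [k sek]] := rsurj_ker qs;
    rewrite szE (sz_exact sek) leq_addl.
  split=> i; first by move=> u v; rewrite -!qp => /qi/pi.
  by move=> w; have [v <-] := qs i w; have [u <-] := ps i v; exists u; rewrite qp.
(* [th] makes both modules stable, which forces the image of h to be all of M' *)
pose th N : int := (sz M)%:Z * euler X (dimvec M) (dimvec N) - e%:Z * (sz N)%:Z.
have thD N Z L (f : rhom N Z) (g : rhom Z L) : short_exact f g -> th Z = th N + th L.
  by move=> se; rewrite /th (euler_exact _ se) (sz_exact se) PoszD !mulrDr opprD addrACA.
have th0 Z : dimvec Z = dimvec M -> th Z = 0.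
  move=> dZ; have -> : th Z = th M.
    by rewrite /th dZ; congr (_ - _ * Posz _); apply: eq_bigr => i _;
      have /rowP/(_ i) := dZ; rewrite !mxE.
  by rewrite /th eE mulrC subrr.
have szM : (0 < sz M)%N by rewrite lt0n; apply/eqP => /rzeroP; case: Mdiv.
have ths Z N (f : rhom N Z) : exceptional Z -> dimvec Z = dimvec M -> rinj f ->
    ~ rsurj f -> ~ rzero N -> th N < 0.
  move=> [Zdiv Zext] dZ fi fs nzN; suff le : euler X (dimvec M) (dimvec N) <= 0.
    rewrite /th subr_lt0; apply: (@le_lt_trans _ _ 0).
      by rewrite pmulr_rle0 // ltz_nat.
    by rewrite -PoszM ltz_nat muln_gt0 e0 lt0n; apply/eqP => /rzeroP.
  rewrite -dZ; apply: le_trans (euler_le Z N) _; rewrite lez_nat leqn0; apply/eqP/homdim_eq0.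
  apply: contrapT => /Hom_zeroPn[g [i [v gv]]]; apply: fs => j w.
  have [|g' g'E] := proj2 Zdiv (rcomp f g).
    by exists i, v; apply: contra gv => /eqP f0; apply/eqP/(fi i); rewrite linear0.
  by exists (g j (g' j w)); case: (g'E j w).
have [Z [k sek]] := rsurj_ker ps; have [ki _ kE] := sek.
have thZ : th Z <= 0.
  have [/rzeroP z|nz] := pselect (rzero Z); last first.
    apply/ltW/(ths M _ k) => // ks; apply: nzJ => i w.
    by have [v <-] := ps i w; apply/kE; apply: ks.
  rewrite /th (_ : euler X _ _ = 0) ?mulr0 ?z ?mulr0 ?subrr //.
  have dz i : dv Z i = 0%N by move/eqP: z; rewrite sum_nat_eq0 => /forallP/(_ i)/eqP.
  rewrite /euler !dimvecE (_ : dv Z = fun=> 0%N); last exact: funext.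
  by rewrite /euler0 /euler1 big1 => [|i _]; rewrite ?big1 ?muln0 // => i _; rewrite muln0.
apply: contrapT => nqs; have := ths M' _ q (conj M'div M'ext) (esym dE) qi nqs nzJ.
have := thD _ _ _ _ _ sek; rewrite (th0 M) // => /esym/eqP; rewrite addrC addr_eq0 => /eqP ->.
by rewrite oppr_lt0 ltNge thZ.
Qed.

(** The dimension is the boolean [i == v] read as 0 or 1, which avoids transporting along an
    equality of vertices. *)
Definition simpleV (v i : 'I_n) : vectType (mF X i)^c := 'rV[(mF X i)^c]_(i == v).

Definition Srep (v : 'I_n) : rep X.
Proof.
by refine (@Rep _ _ _ X (simpleV v) (fun i j a u m => 0) _ _ _ _) => * //=;
  rewrite ?addr0 // /ract scaler0.
Defined.

Lemma srep0 v i (u : rV (Srep v) i) : i != v -> u = 0.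
Proof.
by move=> iv; apply/rowP => -[k k0]; exfalso; move: k0; rewrite (negPf iv).
Qed.

Lemma eq_or_neq (i v : 'I_n) : i = v \/ i != v.
Proof. by case: (eqVneq i v); [left | right]. Qed.

Lemma sum_bool (V : nmodType) (b : bool) (F : 'I_b -> V) k : \sum_i F i = F k.
Proof.
rewrite (bigD1 k) //= big1 ?addr0 // => i /negP[]; rewrite -val_eqE.
case: b k i {F} => -[k kb] [i ib] //=.
by move: kb ib; rewrite !ltnS !leqn0 => /eqP-> /eqP->.
Qed.

Definition unit_dim (v : 'I_n) : 'rV[nat]_n := \row_i nat_of_bool (i == v).

Lemma dimvec_Srep v : dimvec (Srep v) = unit_dim v.
Proof. by apply/rowP => i; rewrite !mxE /dim /= mul1n. Qed.

Lemma sz_Srep v : sz (Srep v) = 1%N.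
Proof.
rewrite /sz (bigD1 v) //= big1 => [|i iv]; first by rewrite /dim /= eqxx.
by rewrite /dim /= (negPf iv).
Qed.

Lemma arrNloop i : ~~ arr Q i i.
Proof. by apply/negP => a; have := @arr_acyclic _ Q [:: i]; rewrite /= a => /(_ isT). Qed.

Lemma size1_simple M : sz M = 1%N -> simple_rep M.
Proof.
move=> s1; split=> [/rzeroP|N h hi]; first by rewrite s1.
have := sz_rinj hi; rewrite s1 leq_eqVlt ltnS leqn0 => /orP[/eqP N1|/eqP/rzeroP]; last by left.
by right; apply: rinj_surj; rewrite // N1 s1.
Qed.

Lemma Srep_exceptional v : exceptional (Srep v).
Proof.
split; last first.
  apply/Ext_zeroP => c [cDl _ _ _]; exists (fun i => \0 : {linear rV (Srep v) i -> rV (Srep v) i}).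
  move=> i j a u m; rewrite /cobound /= subr0.
  have [jv|jv] := eq_or_neq j v; last by apply: srep0.
  have iv : i != v by apply/negP => /eqP iv; move: (a); rewrite iv jv; apply/negP/arrNloop.
  rewrite (srep0 u iv); apply: (addrI (c i j a 0 m)); by rewrite -cDl !addr0.
have [nz simp] := size1_simple (sz_Srep v).
split=> // h [i [u hu]].
have [N [f [fi fE]]] := rker h; case: (simp N f fi) => [Nz|fs].
  have hi : rinj h.
    move=> j w w' /eqP; rewrite -subr_eq0 -linearB => /eqP/fE[y].
    by rewrite (Nz _ y) linear0 => /esym/subr0_eq.
  have [h' h'E] := rbij_inv hi (rinj_surj hi erefl).
  by exists h' => j w; case: (h'E j) => a b; split; [apply: a | apply: b].
by case/negP: hu; apply/eqP/fE; apply: fs.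
Qed.

Lemma sink_sub M v : (0 < dim (rV M v))%N ->
  (forall j, arr Q v j -> dim (rV M j) = 0%N) -> exists f : rhom (Srep v) M, rinj f.
Proof.
move=> d0 vsink; pose w i : rV M i := r2v (const_mx 1).
have fL i : linear (fun u : rV (Srep v) i => \sum_(k < (i == v)) u 0 k *: w i).
  move=> a u u'; rewrite scaler_sumr -big_split /=.
  by apply: eq_bigr => k _; rewrite !mxE scalerDl scalerA.
have fphi i j (a : arr Q i j) (u : rV (Srep v) i) m :
    mk_linear (fL j) (phi (Srep v) a u m) = phi M a (mk_linear (fL i) u) m.
  rewrite linear0; have [iv|iv] := eq_or_neq i v; last by rewrite (srep0 u iv) linear0 phi0l.
  by apply: dim0_eq; rewrite vsink // -iv.
exists (RHom fphi) => i u u' /eqP; rewrite -subr_eq0 -linearB /= => /eqP fu.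
apply/subr0_eq; set z := u - u' in fu *; have [iv|iv] := eq_or_neq i v; last exact: srep0.
apply/rowP => k; rewrite [RHS]mxE; move: fu; rewrite (sum_bool _ k) => fu.
apply/eqP/negPn/negP => /mFc_div[y yz].
have := congr1 (fun t => v2r (y *: t)) fu; rewrite scalerA yz scale1r scaler0 r2vK linear0.
have d0' : (0 < dim (rV M i))%N by rewrite iv.
by move/rowP/(_ (Ordinal d0')); rewrite !mxE => /eqP; rewrite oner_eq0.
Qed.

Lemma source_quo M v : (0 < dim (rV M v))%N ->
  (forall i, arr Q i v -> dim (rV M i) = 0%N) -> exists g : rhom M (Srep v), rsurj g.
Proof.
move=> d0 vsource.
have gL i : linear (fun x : rV M i => (\row_(k < (i == v)) \sum_r v2r x 0 r : rV (Srep v) i)).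
  move=> a u u'; apply/rowP => k; rewrite !mxE mulr_sumr -big_split /=.
  by apply: eq_bigr => r _; rewrite linearP !mxE.
have gphi i j (a : arr Q i j) (u : rV M i) m :
    mk_linear (gL j) (phi M a u m) = phi (Srep v) a (mk_linear (gL i) u) m.
  have [jv|jv] := eq_or_neq j v; last by rewrite [LHS]srep0.
  suff -> : u = 0 by rewrite phi0l linear0.
  by apply: dim0_eq; rewrite vsource // -jv.
exists (RHom gphi) => i w; have [iv|iv] := eq_or_neq i v; last first.
  by exists 0; rewrite linear0 (srep0 w iv).
have d0' : (0 < dim (rV M i))%N by rewrite iv.
have [k kE] : exists k : 'I_(i == v), forall z : rV (Srep v) i, z = const_mx (z 0 k).
  have k0 : (0 < (i == v))%N by rewrite iv eqxx.
  exists (Ordinal k0) => z; apply/rowP => k; rewrite mxE; congr (z 0 _).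
  by apply: val_inj => /=; have := ltn_ord k; rewrite {2}iv eqxx ltnS leqn0 => /eqP.
exists (w 0 k *: r2v (delta_mx 0 (Ordinal d0'))); rewrite linearZ /=.
rewrite [RHS]kE; apply/rowP => k'; rewrite !mxE (bigD1 (Ordinal d0')) //= big1.
  by rewrite r2vK !mxE !eqxx addr0 mulr1.
by move=> r r0; rewrite r2vK !mxE (negPf r0).
Qed.

(** Decreases strictly along arrows by acyclicity, so a vertex of least height in a support is a
    sink of that support. *)
Definition height (i : 'I_n) : nat := #|[pred j | connect (arr Q) i j]|.

Lemma height_arr i j : arr Q i j -> (height j < height i)%N.
Proof.
move=> a; apply: proper_card; apply/properP; split.
  apply/fintype.subsetP => k; rewrite !inE; exact: connect_trans (connect1 a).
exists i; rewrite !inE ?connect0 //; apply/negP => /connectP[p pp pE].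
have := @arr_acyclic _ Q (j :: p).
by rewrite /= rcons_path pp -pE a => /(_ isT).
Qed.

End SimpleModules.

(** * Root data *)

Section Pairing.
Context (R : realType) (n : nat) (Q : valued_quiver n).
Implicit Types (x y : 'rV[R]_n) (b : 'rV[nat]_n).

Lemma pairrE x b : pairr Q x b = \sum_i x 0 i * (b 0 i)%:R * (vf Q i)%:R.
Proof. by apply: eq_bigr => i _; rewrite !mxE. Qed.

Lemma pairrD x y b : pairr Q (x + y) b = pairr Q x b + pairr Q y b.
Proof. by rewrite !pairrE -big_split /=; apply: eq_bigr => i _; rewrite mxE !mulrDl. Qed.

Lemma pairrZ (a : R) x b : pairr Q (a *: x) b = a * pairr Q x b.
Proof. by rewrite !pairrE mulr_sumr; apply: eq_bigr => i _; rewrite mxE -!mulrA. Qed.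

Lemma pairrN x b : pairr Q (- x) b = - pairr Q x b.
Proof. by rewrite -scaleN1r pairrZ mulN1r. Qed.

Lemma pairrB x y b : pairr Q (x - y) b = pairr Q x b - pairr Q y b.
Proof. by rewrite pairrD pairrN. Qed.

Lemma pairr0 b : pairr Q (0 : 'rV[R]_n) b = 0.
Proof. by rewrite -(scale0r 0) pairrZ mul0r. Qed.

Lemma pairrDr x b b' : pairr Q x (b + b') = pairr Q x b + pairr Q x b'.
Proof.
by rewrite !pairrE -big_split /=; apply: eq_bigr => i _; rewrite mxE natrD mulrDr mulrDl.
Qed.

Lemma pairrMn x b k : pairr Q x (b *+ k) = k%:R * pairr Q x b.
Proof.
rewrite !pairrE mulr_sumr; apply: eq_bigr => i _.
have -> : (b *+ k) 0 i = (b 0%R i * k)%N.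
  by rewrite mulmxnE; elim: k => [|k IH]; rewrite ?muln0 // mulrS IH mulnS.
by rewrite natrM; ring.
Qed.

End Pairing.

Lemma fin_lower (R : realType) (T : finType) (P : pred T) (g : T -> R) :
  (forall t, P t -> 0 < g t) -> exists2 e, 0 < e & forall t, P t -> e <= g t.
Proof.
move=> gpos; have [/existsP[t0 Pt0]|] := boolP [exists t, P t]; last first.
  by rewrite negb_exists => /forallP nP; exists 1 => // t; rewrite (negPf (nP t)).
case: (@arg_minP _ R T t0 P g Pt0) => t Pt tmin.
by exists (g t); [apply: gpos | move=> t' Pt'; apply: tmin].
Qed.

Section SignPatterns.
Context (R : realType) (n : nat) (Q : valued_quiver n) (m : nat).
Context (b : 'I_m -> 'rV[nat]_n) (sub quo : rel 'I_m).
Implicit Types (x : 'rV[R]_n) (j l : 'I_m).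

Definition sub_neg x l : bool := [forall j, sub j l ==> (pairr Q x (b j) < 0)].
Definition sub_npos x l : bool := [forall j, sub j l ==> (pairr Q x (b j) <= 0)].
Definition quo_pos x l : bool := [forall j, quo j l ==> (0 < pairr Q x (b j))].
Definition quo_nneg x l : bool := [forall j, quo j l ==> (0 <= pairr Q x (b j))].

End SignPatterns.

(* The combinatorial data of an admissible set that the wall-crossing argument
   uses: the indices of sub- and quotient roots, the lateral rank, the Euler
   form [rE], and points [ryl j], [ryr j] representing its two partial maps. *)
Record root_data (R : realType) (n : nat) (Q : valued_quiver n) (m : nat) := RootData {
  rb : 'I_m -> 'rV[nat]_n;
  rsub : rel 'I_m;
  rquo : rel 'I_m;
  rlat : 'I_m -> int;
  rE : 'I_m -> 'I_m -> R;
  ryl : 'I_m -> 'rV[R]_n;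
  ryr : 'I_m -> 'rV[R]_n;
  ryl_pr : forall j l, pairr Q (ryl j) (rb l) = rE j l;
  ryr_pr : forall j l, pairr Q (ryr j) (rb l) = rE l j;
  rb_gt0 : forall j, 0 < pairr Q (const_mx 1 : 'rV[R]_n) (rb j);
  rlat_inj : injective rlat;
  rE_ge0 : forall j l, rlat j < rlat l -> 0 <= rE j l;
  rE_le0 : forall j l, rlat l < rlat j -> rE j l <= 0;
  rE_gt0 : forall j, 0 < rE j j;
  rsub_refl : reflexive rsub;
  rquo_refl : reflexive rquo;
  rsub_trans : transitive rsub;
  rquo_trans : transitive rquo;
  rsub_index : forall j l, rsub j l -> (j <= l)%N;
  rquo_index : forall j l, rquo j l -> (j <= l)%N;
  rsub_hom : forall j l, rsub j l -> 0 < rE j l;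
  rquo_hom : forall j l, rquo j l -> 0 < rE l j;
  rE_sub : forall i j l, rsub j l -> 0 < rE i j -> 0 < rE i l;
  rE_quo : forall i j l, rquo j l -> 0 < rE j i -> 0 < rE l i;
  rINTl : forall j l, rlat j <= rlat l -> exists k : nat, rE j l = k%:R * rE j j;
  rINTr : forall j l, rlat j <= rlat l -> exists k : nat, rE j l = k%:R * rE l l;
  rFTw : forall (x : 'rV[R]_n) l, pairr Q x (rb l) = 0 ->
    sub_npos Q rb rsub x l = quo_nneg Q rb rquo x l;
  rTF : forall (x : 'rV[R]_n) j l, quo_pos Q rb rquo x j -> sub_npos Q rb rsub x l ->
    rE j l <= 0;
  rTF' : forall (x : 'rV[R]_n) j l, quo_nneg Q rb rquo x j -> sub_neg Q rb rsub x l ->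
    rE j l <= 0;
  rHNs : forall (x : 'rV[R]_n) l, sub_npos Q rb rsub x l \/ exists2 j, rsub j l & quo_pos Q rb rquo x j;
  rHNq : forall (x : 'rV[R]_n) l, quo_nneg Q rb rquo x l \/ exists2 j, rquo j l & sub_neg Q rb rsub x j
}.

(** * From exceptional modules to root data *)

Section RootDataOfModules.
Context (R : realType).
Context (K : fieldType) (n : nat) (Q : valued_quiver n) (X : modulation K Q).
Context (m : nat) (beta : 'I_m -> 'rV[nat]_n) (hS : admissible_roots X beta).
Implicit Types (M N L : rep X) (x : 'rV[R]_n) (j l : 'I_m) (b : 'rV[nat]_n).

Lemma exists_Mroot j : exists M : rep X, Mroot (beta j) M.
Proof. by have [_ /(_ j) + _ _] := hS. Qed.

Definition Mod j : rep X := sval (cid (exists_Mroot j)).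

Lemma Mod_root j : Mroot (beta j) (Mod j).
Proof. exact: svalP (cid (exists_Mroot j)). Qed.

Lemma Mroot_iso b M M' : Mroot b M -> Mroot b M' ->
  exists h : rhom M M', rinj h /\ rsurj h.
Proof. by move=> [eM dM] [eM' dM']; apply: exceptional_iso => //; rewrite dM dM'. Qed.

Lemma Mod_ext j : Ext0 (Mod j) (Mod j).
Proof. by apply/Ext_zeroP; case: (Mod_root j) => [[]]. Qed.

Lemma Mod_div j : End_division (Mod j).
Proof. by case: (Mod_root j) => [[]]. Qed.

Lemma subrootP b l : subroot X b (beta l) <->
  exists N (f : rhom N (Mod l)), rinj f /\ Mroot b N.
Proof.
split=> [[N [M [h [rN rM hi]]]]|[N [f [fi rN]]]].
  have [g [gi _]] := Mroot_iso rM (Mod_root l).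
  by exists N, (rcomp g h); split=> //; apply: rinj_comp.
by exists N, (Mod l), f; split=> //; apply: Mod_root.
Qed.

Lemma quotrootP b l : quotroot X b (beta l) <->
  exists L (g : rhom (Mod l) L), rsurj g /\ Mroot b L.
Proof.
split=> [[M [L [h [rM rL hs]]]]|[L [g [gs rL]]]].
  have [g [_ gs]] := Mroot_iso (Mod_root l) rM.
  by exists L, (rcomp h g); split=> //; apply: rsurj_comp.
by exists (Mod l), L, g; split=> //; apply: Mod_root.
Qed.

Definition subr j l : bool := `[< subroot X (beta j) (beta l) >].
Definition quor j l : bool := `[< quotroot X (beta j) (beta l) >].

Lemma subrP j l : reflect (exists f : rhom (Mod j) (Mod l), rinj f) (subr j l).
Proof.
apply: (iffP (asboolP _)) => [/subrootP[N [f [fi rN]]]|[f fi]].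
  have [g [gi _]] := Mroot_iso (Mod_root j) rN.
  by exists (rcomp f g); apply: rinj_comp.
by apply/subrootP; exists (Mod j), f; split=> //; apply: Mod_root.
Qed.

Lemma quorP j l : reflect (exists g : rhom (Mod l) (Mod j), rsurj g) (quor j l).
Proof.
apply: (iffP (asboolP _)) => [/quotrootP[L [g [gs rL]]]|[g gs]].
  have [h [_ hs]] := Mroot_iso rL (Mod_root j).
  by exists (rcomp h g); apply: rsurj_comp.
by apply/quotrootP; exists (Mod j), g; split=> //; apply: Mod_root.
Qed.

Lemma beta_inj : injective beta. Proof. by case: hS. Qed.

(** The vertical ordering turns exceptional submodules of the root modules into indices of the
    family. *)
Lemma exceptional_sub_index N l (f : rhom N (Mod l)) : rinj f -> exceptional N ->
  exists2 j, subr j l & dimvec N = beta j.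
Proof.
move=> fi eN; have sN : subroot X (dimvec N) (beta l) by apply/subrootP; exists N, f.
case: hS => _ _ _ /(_ l (dimvec N)) [|j _ dE]; first by left.
by exists j => //; apply/asboolP; rewrite -dE.
Qed.

Lemma exceptional_quo_index L l (g : rhom (Mod l) L) : rsurj g -> exceptional L ->
  exists2 j, quor j l & dimvec L = beta j.
Proof.
move=> gs eL; have qL : quotroot X (dimvec L) (beta l) by apply/quotrootP; exists L, g.
case: hS => _ _ _ /(_ l (dimvec L)) [|j _ dE]; first by right.
by exists j => //; apply/asboolP; rewrite -dE.
Qed.

Lemma subr_index j l : subr j l -> (j <= l)%N.
Proof.
move/asboolP => s; case: hS => binj _ _ /(_ l (beta j)) [|k kl /binj->] //; by left.
Qed.

Lemma quor_index j l : quor j l -> (j <= l)%N.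
Proof.
move/asboolP => s; case: hS => binj _ _ /(_ l (beta j)) [|k kl /binj->] //; by right.
Qed.

Lemma subr_trans : transitive subr.
Proof.
move=> k j l /subrP[f fi] /subrP[g gi]; apply/subrP.
by exists (rcomp g f); apply: rinj_comp.
Qed.

Lemma quor_trans : transitive quor.
Proof.
move=> k j l /quorP[f fs] /quorP[g gs]; apply/quorP.
by exists (rcomp f g); apply: rsurj_comp.
Qed.

Lemma subr_refl : reflexive subr.
Proof. by move=> l; apply/subrP; exists (rid _). Qed.

Lemma quor_refl : reflexive quor.
Proof. by move=> l; apply/quorP; exists (rid _) => i w; exists w. Qed.

Lemma hom_zeroP j l : hom_zero X (beta j) (beta l) <-> Hom_zero (Mod j) (Mod l).
Proof.
split=> [|hz M N rM rN h i v]; first by apply; apply: Mod_root.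
have [f [_ fs]] := Mroot_iso (Mod_root j) rM; have [g [gi _]] := Mroot_iso rN (Mod_root l).
apply: (gi i); rewrite linear0; have [u <-] := fs i v.
exact: (hz (rcomp g (rcomp h f)) i u).
Qed.

Lemma ext_zeroP j l : ext_zero X (beta j) (beta l) <-> Ext_zero (Mod j) (Mod l).
Proof.
split=> [|ez M N rM rN]; first by apply; apply: Mod_root.
have [f [fi _]] := Mroot_iso rM (Mod_root j); have [g [_ gs]] := Mroot_iso (Mod_root l) rN.
by apply/Ext_zeroP; apply: Ext0_sub fi _; apply: Ext0_quo gs _; apply/Ext_zeroP.
Qed.

Lemma exists_lateral : exists r, lateral_ordering X beta r.
Proof. by case: hS. Qed.

Definition latr : rel 'I_m := sval (cid exists_lateral).
(** Rank in a chosen lateral ordering, as an integer so that duality can negate it. *)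
Definition lat j : int := Posz #|[pred k | latr k j]|.

Lemma latr_ordering : lateral_ordering X beta latr.
Proof. exact: svalP (cid exists_lateral). Qed.

Lemma lat_le j l : (lat j <= lat l) = latr j l.
Proof.
have [[rr ra rt rtot] _ _] := latr_ordering; rewrite lez_nat; apply/idP/idP.
  apply: contraTT => nr; rewrite -ltnNge; apply: proper_card; apply/properP.
  have rlj : latr l j by have := rtot j l; rewrite (negPf nr).
  split; first by apply/fintype.subsetP => k; rewrite !inE => kl; apply: rt kl rlj.
  by exists j; rewrite !inE ?rr.
move=> rjl; apply: subset_leq_card; apply/fintype.subsetP => k; rewrite !inE => kj.
exact: rt kj rjl.
Qed.

Lemma lat_inj : injective lat.
Proof.
have [[_ ra _ _] _ _] := latr_ordering.
by move=> j l e; apply: ra; rewrite -!lat_le e lexx.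
Qed.

Lemma Hom_lat j l : ~ Hom_zero (Mod j) (Mod l) -> lat j <= lat l.
Proof.
by have [_ h _] := latr_ordering; rewrite lat_le => nz; apply: h => /hom_zeroP.
Qed.

Lemma Ext_lat j l : lat j <= lat l -> Ext_zero (Mod j) (Mod l).
Proof.
have [[_ ra _ _] _ h] := latr_ordering; rewrite lat_le => rjl.
apply/ext_zeroP; apply: contrapT => /h[rlj]; apply; apply: ra; exact/andP.
Qed.

Definition Ef j l : R := (euler X (beta j) (beta l))%:~R.

Lemma dimvec_Mod j : dimvec (Mod j) = beta j.
Proof. by case: (Mod_root j). Qed.

Lemma Ef_hom j l : lat j <= lat l -> Ef j l = (homdim (Mod j) (Mod l))%:R.
Proof. by move/Ext_lat/euler_hom; rewrite !dimvec_Mod /Ef => ->. Qed.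

Lemma Ef_le0 j l : lat l < lat j -> Ef j l <= 0.
Proof.
move=> lt; have /homdim_eq0 hz : Hom_zero (Mod j) (Mod l).
  by apply: contrapT => /Hom_lat; rewrite leNgt lt.
by have := euler_le (Mod j) (Mod l); rewrite hz !dimvec_Mod /Ef lerz0.
Qed.

Lemma Ef_gt0 j l : ~ Hom_zero (Mod j) (Mod l) -> 0 < Ef j l.
Proof. by move=> nz; rewrite Ef_hom ?Hom_lat // ltr0n homdim_gt0. Qed.

Lemma Ef_le0_Hom j l : Hom_zero (Mod j) (Mod l) -> Ef j l <= 0.
Proof.
move=> /homdim_eq0 hz; have := euler_le (Mod j) (Mod l).
by rewrite hz !dimvec_Mod /Ef lerz0.
Qed.

Lemma Ef_gt0P j l : 0 < Ef j l <-> ~ Hom_zero (Mod j) (Mod l).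
Proof.
by split=> [E0 /Ef_le0_Hom|]; [rewrite leNgt E0 | apply: Ef_gt0].
Qed.

Lemma rinj_nz N M (f : rhom N M) : rinj f -> ~ rzero N -> ~ Hom_zero N M.
Proof. by move=> fi nz hz; apply: nz => i v; apply: (fi i); rewrite hz linear0. Qed.

Lemma rsurj_nz M L (g : rhom M L) : rsurj g -> ~ rzero L -> ~ Hom_zero M L.
Proof. by move=> gs nz hz; apply: nz => i w; have [v <-] := gs i w; apply: hz. Qed.

Lemma subr_hom j l : subr j l -> 0 < Ef j l.
Proof.
by move=> /subrP[f fi]; apply/Ef_gt0/(rinj_nz fi); case: (Mod_div j).
Qed.

Lemma quor_hom j l : quor j l -> 0 < Ef l j.
Proof.
by move=> /quorP[f fi]; apply/Ef_gt0/(rsurj_nz fi); case: (Mod_div j).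
Qed.

Lemma Ef_sub i j l : subr j l -> 0 < Ef i j -> 0 < Ef i l.
Proof.
move=> /subrP[f fi] /Ef_gt0P nz; apply: Ef_gt0 => hz; apply: nz => h k v.
by apply: (fi k); rewrite linear0; apply: (hz (rcomp f h)).
Qed.

Lemma Ef_quo i j l : quor j l -> 0 < Ef j i -> 0 < Ef l i.
Proof.
move=> /quorP[f fs] /Ef_gt0P nz; apply: Ef_gt0 => hz; apply: nz => h k v.
by have [u <-] := fs k v; apply: (hz (rcomp h f)).
Qed.

(** Divisibility by the dimension of an endomorphism division algebra; it makes the coefficients of
    roots in rank two integral. *)
Lemma Ef_INTl j l : lat j <= lat l -> exists k : nat, Ef j l = k%:R * Ef j j.
Proof.
move=> le; have /dvdnP[k kE] := homdim_dvdr (Mod l) (Mod_div j).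
by exists k; rewrite !Ef_hom // kE natrM.
Qed.

Lemma Ef_INTr j l : lat j <= lat l -> exists k : nat, Ef j l = k%:R * Ef l l.
Proof.
move=> le; have /dvdnP[k kE] := homdim_dvdl (Mod j) (Mod_div l).
by exists k; rewrite !Ef_hom // kE natrM.
Qed.

Lemma wt_Mod x j : wt x (Mod j) = pairr Q x (beta j).
Proof. by rewrite /wt dimvec_Mod. Qed.

Lemma wt_one M : ~ rzero M -> 0 < wt (const_mx 1 : 'rV[R]_n) M.
Proof.
move=> /rzeroP/eqP; rewrite sum_nat_eq0 negb_forall => /existsP[i /= d0].
rewrite wtE (bigD1 i) //=; apply: ltr_pwDl.
  by rewrite mxE mul1r mulr_gt0 // ltr0n ?lt0n // -lt0n vf_gt0.
by apply: sumr_ge0 => k _; rewrite mxE mul1r mulr_ge0.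
Qed.

Let Fs := @sub_neg R n Q m beta subr.
Let Fw := @sub_npos R n Q m beta subr.
Let Ts := @quo_pos R n Q m beta quor.
Let Tw := @quo_nneg R n Q m beta quor.

(** King's semistability can be tested on subroots: if some submodule has positive weight, so has an
    exceptional one, which belongs to the family. *)
Lemma sub_npos_rep x l : Fw x l <-> forall N (f : rhom N (Mod l)), rinj f -> wt x N <= 0.
Proof.
split=> [/forallP Fl N f fi|h]; last first.
  apply/forallP => j; apply/implyP => /subrP[f fi].
  by rewrite -wt_Mod; apply: h fi.
rewrite leNgt; apply/negP => w0.
have [I [g [gi eI gp]]] := pos_sub_exceptional (@Mod_ext l) fi w0.
have [j sj dj] := exceptional_sub_index gi eI.
have := gp _ (rid I) (fun i w => ex_intro _ w erefl) (proj1 (proj1 eI)).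
by rewrite /wt dj ltNge; have /implyP/(_ sj) -> := Fl j.
Qed.

Lemma quo_nneg_rep x l : Tw x l <-> forall L (g : rhom (Mod l) L), rsurj g -> 0 <= wt x L.
Proof.
split=> [/forallP Fl N f fi|h]; last first.
  apply/forallP => j; apply/implyP => /quorP[f fi].
  by rewrite -wt_Mod; apply: h fi.
rewrite leNgt; apply/negP => w0.
have [I [g [gi eI gp]]] := neg_quo_exceptional (@Mod_ext l) fi w0.
have [j sj dj] := exceptional_quo_index gi eI.
have := gp _ (rid I) (fun i u v => id) (proj1 (proj1 eI)).
by rewrite /wt dj ltNge; have /implyP/(_ sj) -> := Fl j.
Qed.

Lemma wt_shift x (e : R) M : wt (x + e *: const_mx 1) M = wt x M + e * wt (const_mx 1 : 'rV[R]_n) M.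
Proof. by rewrite /wt pairrD pairrZ. Qed.

Lemma beta_gt0 j : 0 < pairr Q (const_mx 1 : 'rV[R]_n) (beta j).
Proof. by rewrite -wt_Mod; apply: wt_one; case: (Mod_div j). Qed.

(** Strict inequalities at finitely many subroots survive a small shift of x along (1, ..., 1),
    which strictly raises every nonzero module; this reduces to the weak case. *)
Lemma sub_neg_rep x l : Fs x l ->
  forall N (f : rhom N (Mod l)), rinj f -> ~ rzero N -> wt x N < 0.
Proof.
move=> /forallP Fl N f fi nz.
have [|e e0 eP] := @fin_lower R _ (subr^~ l)
    (fun j => - pairr Q x (beta j) / pairr Q (const_mx 1 : 'rV[R]_n) (beta j)).
  by move=> j sj; rewrite divr_gt0 ?beta_gt0 // oppr_gt0; have /implyP := Fl j; apply.
have : Fw (x + e *: const_mx 1) l.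
  apply/forallP => j; apply/implyP => sj; rewrite pairrD pairrZ -lerBrDl sub0r.
  by have := eP j sj; rewrite ler_pdivlMr ?beta_gt0.
move/sub_npos_rep/(_ N f fi); rewrite wt_shift => le; apply: lt_le_trans le.
by rewrite ltrDl mulr_gt0 // wt_one.
Qed.

Lemma quo_pos_rep x l : Ts x l ->
  forall L (g : rhom (Mod l) L), rsurj g -> ~ rzero L -> 0 < wt x L.
Proof.
move=> /forallP Fl N f fi nz.
have [|e e0 eP] := @fin_lower R _ (quor^~ l)
    (fun j => pairr Q x (beta j) / pairr Q (const_mx 1 : 'rV[R]_n) (beta j)).
  by move=> j sj; rewrite divr_gt0 ?beta_gt0 //; have /implyP := Fl j; apply.
have : Tw (x + (- e) *: const_mx 1) l.
  apply/forallP => j; apply/implyP => sj; rewrite pairrD pairrZ mulNr subr_ge0.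
  by have := eP j sj; rewrite ler_pdivlMr ?beta_gt0.
move/quo_nneg_rep/(_ N f fi); rewrite wt_shift mulNr subr_ge0; apply: lt_le_trans.
by rewrite mulr_gt0 // wt_one.
Qed.

Lemma sub_npos_quo_nneg x l : pairr Q x (beta l) = 0 -> Fw x l = Tw x l.
Proof.
rewrite -wt_Mod => w0; apply/idP/idP.
  move/sub_npos_rep => h; apply/quo_nneg_rep => L g gs.
  have [N [f se]] := rsurj_ker gs; have [fi _ _] := se.
  have := wt_exact x se; rewrite w0 => /esym/eqP; rewrite addrC addr_eq0 => /eqP ->.
  by rewrite oppr_ge0; apply: h fi.
move/quo_nneg_rep => h; apply/sub_npos_rep => N f fi.
have [L [g se]] := rcoker fi; have [_ gs _] := se.
have := wt_exact x se; rewrite w0 => /esym/eqP; rewrite addr_eq0 => /eqP ->.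
by rewrite oppr_le0; apply: h gs.
Qed.

Lemma Hom_zero_factor M N :
  (forall J (p : rhom M J) (q : rhom J N), rsurj p -> rinj q -> ~ rzero J -> False) ->
  Hom_zero M N.
Proof.
move=> h; apply: contrapT => /Hom_zeroPn[f [i [v fv]]].
have [J [p [q [ps qi qp]]]] := rimage f; apply: (h J p q ps qi) => z.
by case/negP: fv; rewrite -qp (z _ (p i v)) linear0.
Qed.

Lemma quo_pos_sub_npos x j l : Ts x j -> Fw x l -> Ef j l <= 0.
Proof.
move=> /quo_pos_rep T /sub_npos_rep F; apply: Ef_le0_Hom; apply: Hom_zero_factor => J p q ps qi nz.
by have := F _ q qi; rewrite leNgt (T _ p).
Qed.

Lemma quo_nneg_sub_neg x j l : Tw x j -> Fs x l -> Ef j l <= 0.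
Proof.
move=> /quo_nneg_rep T /sub_neg_rep F; apply: Ef_le0_Hom; apply: Hom_zero_factor => J p q ps qi nz.
by have := T _ p ps; rewrite leNgt (F _ q).
Qed.

(** When semistability fails, the exceptional submodule produced by [pos_sub_exceptional] has only
    quotients of positive weight. *)
Lemma sub_npos_or x l : Fw x l \/ exists2 j, subr j l & Ts x j.
Proof.
have [Fl|] := boolP (Fw x l); [by left | move=> /forallPn[j]].
rewrite negb_imply -ltNge => /andP[/subrP[f fi]]; rewrite -wt_Mod => w0; right.
have [I [g [gi eI gp]]] := pos_sub_exceptional (@Mod_ext l) fi w0.
have [k sk dk] := exceptional_sub_index gi eI; exists k => //.
have [h [_ hs]] := Mroot_iso (conj eI dk) (Mod_root k).
apply/forallP => i; apply/implyP => /quorP[f' fs'].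
rewrite -wt_Mod; apply: (gp _ (rcomp f' h)); first exact: rsurj_comp.
by case: (Mod_div i).
Qed.

Lemma quo_nneg_or x l : Tw x l \/ exists2 j, quor j l & Fs x j.
Proof.
have [Fl|] := boolP (Tw x l); [by left | move=> /forallPn[j]].
rewrite negb_imply -ltNge => /andP[/quorP[f fi]]; rewrite -wt_Mod => w0; right.
have [I [g [gi eI gp]]] := neg_quo_exceptional (@Mod_ext l) fi w0.
have [k sk dk] := exceptional_quo_index gi eI; exists k => //.
have [h [hi _]] := Mroot_iso (Mod_root k) (conj eI dk).
apply/forallP => i; apply/implyP => /subrP[f' fs'].
rewrite -wt_Mod; apply: (gp _ (rcomp h f')); first exact: rinj_comp.
by case: (Mod_div i).
Qed.

(** Gradients of the Euler form in its second and first argument; the division by [vf] compensates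
    for the weights of the pairing. *)
Definition Eyl j : 'rV[R]_n := \row_i (((beta j 0 i)%:R * (vf Q i)%:R -
  \sum_(e : arrow Q | (sval e).2 == i)
    (beta j 0 (sval e).1)%:R * (arrow_dim X (proj2_sig e))%:R) / (vf Q i)%:R).
Definition Eyr j : 'rV[R]_n := \row_i (((beta j 0 i)%:R * (vf Q i)%:R -
  \sum_(e : arrow Q | (sval e).1 == i)
    (beta j 0 (sval e).2)%:R * (arrow_dim X (proj2_sig e))%:R) / (vf Q i)%:R).

Lemma vf_neq0 i : (vf Q i)%:R != 0 :> R.
Proof. by rewrite pnatr_eq0 -lt0n vf_gt0. Qed.

Lemma EulerE j l : Ef j l = \sum_i (beta j 0 i)%:R * (beta l 0 i)%:R * (vf Q i)%:R
  - \sum_(e : arrow Q) (beta j 0 (sval e).1)%:R * (beta l 0 (sval e).2)%:R *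
    (arrow_dim X (proj2_sig e))%:R.
Proof.
rewrite /Ef /euler rmorphB /= -!pmulrn /euler0 /euler1; congr (_ - _).
  by rewrite (raddf_sum (GRing.natmul 1)) /=; apply: eq_bigr => i _; rewrite !natrM.
by rewrite (raddf_sum (GRing.natmul 1)) /=; apply: eq_bigr => i _; rewrite !natrM.
Qed.

Lemma Eyl_pr j l : pairr Q (Eyl j) (beta l) = Ef j l.
Proof.
rewrite pairrE EulerE (partition_big (fun e : arrow Q => (sval e).2) predT) //= -sumrB.
apply: eq_bigr => i _; rewrite mxE mulrAC divfK ?vf_neq0 // mulrBl; congr (_ - _).
  by rewrite mulrAC.
by rewrite mulr_suml; apply: eq_bigr => e /eqP eE; rewrite -{1}eE mulrAC.
Qed.

Lemma Eyr_pr j l : pairr Q (Eyr j) (beta l) = Ef l j.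
Proof.
rewrite pairrE EulerE (partition_big (fun e : arrow Q => (sval e).1) predT) //= -sumrB.
apply: eq_bigr => i _; rewrite mxE mulrAC divfK ?vf_neq0 // mulrBl; congr (_ - _).
  by rewrite mulrC mulrA.
by rewrite mulr_suml; apply: eq_bigr => e /eqP eE; rewrite -{1}eE mulrC mulrA.
Qed.

Definition root_data_of : root_data R Q m.
Proof.
refine (@RootData R n Q m beta subr quor lat Ef Eyl Eyr Eyl_pr Eyr_pr beta_gt0 lat_inj
  _ Ef_le0 _ subr_refl quor_refl subr_trans quor_trans subr_index quor_index subr_hom
  quor_hom Ef_sub Ef_quo Ef_INTl Ef_INTr sub_npos_quo_nneg quo_pos_sub_npos quo_nneg_sub_neg
  sub_npos_or quo_nneg_or).
- by move=> j l /ltW/Ef_hom ->.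
- by move=> j; apply: subr_hom; apply: subr_refl.
Defined.

End RootDataOfModules.

Section SimpleRoots.
Context (K : fieldType) (n : nat) (Q : valued_quiver n) (X : modulation K Q).

Lemma min_height (P : pred 'I_n) : (exists i, P i) ->
  exists2 i, P i & forall j, P j -> (height Q i <= height Q j)%N.
Proof. by move=> [i Pi]; case: (@arg_minnP _ i P (height Q) Pi) => k Pk kmin; exists k. Qed.

(** A vertex of least height in the support of a simple module carries a one-dimensional simple
    submodule, which must be the whole module. *)
Lemma simple_rootP v b : simple_root X v b <-> b = unit_dim v.
Proof.
split=> [[M [[nz sM] dv0 <-]]|->]; last first.
  exists (Srep X v); split; rewrite ?dimvec_Srep //; first exact/size1_simple/sz_Srep.
  by rewrite /dim /= eqxx.
have [w dw wmin] := min_height (ex_intro (fun i => 0 < dim (rV M i))%N v dv0).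
have [|f fi] := sink_sub dw.
  move=> j a; apply/eqP; rewrite -leqn0 leqNgt; apply/negP => /wmin.
  by rewrite leqNgt height_arr.
case: (sM _ f fi) => [/rzeroP|fs]; first by rewrite sz_Srep.
have dE : dimvec M = unit_dim w.
  rewrite -(dimvec_Srep X); apply/rowP => i; rewrite !mxE; apply/eqP.
  rewrite eqn_leq (rinj_dim i fi) andbT; have [Z [k se]] := rsurj_ker fs.
  by rewrite -(short_exact_dim i se) leq_addl.
suff <- : w = v by [].
apply/eqP/negPn/negP => wv; have /rowP/(_ v) := dE; rewrite !mxE eq_sym (negPf wv) => d0.
by move: dv0; rewrite d0.
Qed.

Context (m : nat) (beta : 'I_m -> 'rV[nat]_n) (hS : admissible_roots X beta).

Lemma dim_Mod j i : dim (rV (Mod hS j) i) = beta j 0 i.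
Proof. by rewrite -(dimvec_Mod hS) mxE. Qed.

Lemma sink_root j v : (0 < beta j 0%R v)%N -> (forall w, arr Q v w -> beta j 0 w = 0%N) ->
  exists2 l, beta l = unit_dim v & subr X beta l j.
Proof.
move=> d0 s0; have [||f fi] := @sink_sub _ _ _ _ (Mod hS j) v; rewrite ?dim_Mod //.
  by move=> w a; rewrite dim_Mod s0.
have [l sl dl] := exceptional_sub_index fi (Srep_exceptional X v).
by exists l => //; rewrite -dl dimvec_Srep.
Qed.

(** The simple module at v is both a quotient and a submodule of the root module; the composite
    endomorphism is nonzero, hence invertible. *)
Lemma support1_root j v : (forall w, w != v -> beta j 0 w = 0%N) -> beta j = unit_dim v.
Proof.
move=> s0; have dvj : (0 < beta j 0%R v)%N.
  rewrite lt0n; apply/eqP => d0; have [nz _] := Mod_div hS j; apply: nz; apply/rzeroP.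
  apply/eqP; rewrite sum_nat_eq0; apply/forallP => i /=; rewrite dim_Mod.
  by have [->|/s0 ->] := eqVneq i v; rewrite ?d0.
have nl w : arr Q v w \/ arr Q w v -> w != v.
  by move=> a; apply/eqP => wv; move: a; rewrite wv (negPf (arrNloop Q v)); case.
have [||f fi] := @sink_sub _ _ _ _ (Mod hS j) v; rewrite ?dim_Mod //.
  by move=> w a; rewrite dim_Mod s0 // nl //; left.
have [||g gs] := @source_quo _ _ _ _ (Mod hS j) v; rewrite ?dim_Mod //.
  by move=> w a; rewrite dim_Mod s0 // nl //; right.
have [_ /(_ (rcomp f g))] := Mod_div hS j; case.
  exists v; pose u : rV (Srep X v) v := const_mx 1; have [x xE] := gs v u.
  exists x => /=; rewrite xE; apply/eqP => fu0.
  have : u = 0 by apply: (fi v); rewrite linear0.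
  have k0 : (0 < (v == v))%N by rewrite eqxx.
  by move=> /rowP/(_ (Ordinal k0)); rewrite !mxE => /eqP; rewrite oner_eq0.
move=> h hE; have fs : rsurj f by move=> i w; exists (g i (h i w)); case: (hE i w).
rewrite -(dimvec_Mod hS) -(dimvec_Srep X); apply/rowP => i; rewrite !mxE; apply/eqP.
rewrite eqn_leq (rinj_dim i fi) andbT; have [Z [k se]] := rsurj_ker fs.
by rewrite -(short_exact_dim i se) leq_addl.
Qed.

End SimpleRoots.

(** * Walls and stable roots *)

(** The device behind all genericity arguments: near p the signs of finitely many linear functionals
    are those at p, with zeros resolved by the direction v. *)
Lemma perturb_fun (R : realType) (n : nat) (K : finType) (f : K -> 'rV[R]_n -> R)
    (p v : 'rV[R]_n) :
    (forall k a x y, f k (a *: x + y) = a * f k x + f k y) ->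
  exists2 e, 0 < e & forall e' k, 0 < e' -> e' <= e ->
    Num.sg (f k (p + e' *: v)) = if f k p == 0 then Num.sg (f k v) else Num.sg (f k p).
Proof.
move=> fL.
have [|e e0 eP] := @fin_lower R _ (fun k => f k p != 0) (fun k => `|f k p| / (`|f k v| + 1)).
  by move=> k pk; rewrite divr_gt0 ?normr_gt0 // ltr_wpDl.
exists e => // e' k e'0 e'e; rewrite addrC fL; case: eqVneq => [->|pk].
  by rewrite addr0 sgrM gtr0_sg ?mul1r.
have := le_trans e'e (eP k pk); rewrite ler_pdivlMr ?ltr_wpDl // => le1.
have : `|e' * f k v| < `|f k p|.
  by rewrite normrM gtr0_norm //; apply: lt_le_trans le1; rewrite ltr_pM2l // ltrDl.
rewrite ltr_norml; have [pk0|pk0|pk0] := ltrgt0P (f k p); last by rewrite pk0 eqxx in pk.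
- by move=> /andP[h _]; rewrite !gtr0_sg //; lra.
- by move=> /andP[_ h]; rewrite !ltr0_sg //; lra.
Qed.

Section RootGeometry.
Context (R : realType) (n : nat) (Q : valued_quiver n) (m : nat) (S : root_data R Q m).
Implicit Types (x y p : 'rV[R]_n) (i j l g A B : 'I_m).

Definition pr x j : R := pairr Q x (rb S j).
(** F and T recall the torsion-free and torsion classes attached to x; the suffixes s and w mark
    strict and weak inequalities. *)
Definition Fs x l : bool := sub_neg Q (rb S) (rsub S) x l.
Definition Fw x l : bool := sub_npos Q (rb S) (rsub S) x l.
Definition Ts x l : bool := quo_pos Q (rb S) (rquo S) x l.
Definition Tw x l : bool := quo_nneg Q (rb S) (rquo S) x l.

Local Notation E := (rE S).
Local Notation lat := (rlat S).
Local Notation sub := (rsub S).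
Local Notation quo := (rquo S).
Let one : 'rV[R]_n := const_mx 1.

Lemma prD x y j : pr (x + y) j = pr x j + pr y j. Proof. exact: pairrD. Qed.
Lemma prZ a x j : pr (a *: x) j = a * pr x j. Proof. exact: pairrZ. Qed.
Lemma prN x j : pr (- x) j = - pr x j. Proof. exact: pairrN. Qed.
Lemma prB x y j : pr (x - y) j = pr x j - pr y j. Proof. exact: pairrB. Qed.
Lemma pr0 j : pr 0 j = 0. Proof. exact: pairr0. Qed.
Lemma pr_yl i j : pr (ryl S i) j = E i j. Proof. exact: ryl_pr. Qed.
Lemma pr_yr i j : pr (ryr S i) j = E j i. Proof. exact: ryr_pr. Qed.
Lemma pr1_gt0 j : 0 < pr one j. Proof. exact: rb_gt0. Qed.

Lemma pr_sum (c : 'I_m -> R) (f : 'I_m -> 'rV[R]_n) (P : pred 'I_m) j :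
  pr (\sum_(v | P v) c v *: f v) j = \sum_(v | P v) c v * pr (f v) j.
Proof.
elim/big_rec2: _ => [|v a y _ <-]; first exact: pr0.
by rewrite prD prZ.
Qed.

Lemma FsP x l : reflect (forall j, sub j l -> pr x j < 0) (Fs x l).
Proof.
by apply: (iffP forallP) => h j; [move=> s; have /implyP := h j; apply | apply/implyP/h].
Qed.

Lemma FwP x l : reflect (forall j, sub j l -> pr x j <= 0) (Fw x l).
Proof.
by apply: (iffP forallP) => h j; [move=> s; have /implyP := h j; apply | apply/implyP/h].
Qed.

Lemma TsP x l : reflect (forall j, quo j l -> 0 < pr x j) (Ts x l).
Proof.
by apply: (iffP forallP) => h j; [move=> s; have /implyP := h j; apply | apply/implyP/h].
Qed.

Lemma TwP x l : reflect (forall j, quo j l -> 0 <= pr x j) (Tw x l).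
Proof.
by apply: (iffP forallP) => h j; [move=> s; have /implyP := h j; apply | apply/implyP/h].
Qed.

Lemma E_lat i j : 0 < E i j -> lat i <= lat j.
Proof. by rewrite leNgt => h; apply/negP => /rE_le0; rewrite leNgt h. Qed.

Lemma lat_eq i j : (lat i == lat j) = (i == j).
Proof. by rewrite (inj_eq (@rlat_inj _ _ _ _ S)). Qed.

Lemma lat_neq_lt i j : i != j -> lat i < lat j \/ lat j < lat i.
Proof. by rewrite -lat_eq neq_lt => /orP. Qed.

Lemma E_lat_lt i j : i != j -> 0 < E i j -> lat i < lat j.
Proof. by move=> ij /E_lat; rewrite lt_neqAle lat_eq ij. Qed.

Lemma E_ge0 i j : lat i <= lat j -> 0 <= E i j.
Proof.
rewrite le_eqVlt lat_eq => /orP[/eqP->|]; last exact: rE_ge0.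
exact/ltW/rE_gt0.
Qed.

Lemma E_anti i j : i != j -> 0 < E i j -> E j i <= 0.
Proof. by move=> ij /(E_lat_lt ij)/rE_le0. Qed.

Lemma fw_sub x j l : Fw x l -> sub j l -> Fw x j.
Proof. by move=> /FwP h s; apply/FwP => i si; apply/h/(rsub_trans si s). Qed.
Lemma tw_quo x j l : Tw x l -> quo j l -> Tw x j.
Proof. by move=> /TwP h s; apply/TwP => i si; apply/h/(rquo_trans si s). Qed.
Lemma ts_quo x j l : Ts x l -> quo j l -> Ts x j.
Proof. by move=> /TsP h s; apply/TsP => i si; apply/h/(rquo_trans si s). Qed.
Lemma fs_lt0 x l : Fs x l -> pr x l < 0. Proof. by move/FsP; apply; apply: rsub_refl. Qed.
Lemma fw_le0 x l : Fw x l -> pr x l <= 0. Proof. by move/FwP; apply; apply: rsub_refl. Qed.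
Lemma ts_gt0 x l : Ts x l -> 0 < pr x l. Proof. by move/TsP; apply; apply: rquo_refl. Qed.
Lemma tw_ge0 x l : Tw x l -> 0 <= pr x l. Proof. by move/TwP; apply; apply: rquo_refl. Qed.
Lemma fs_fw x l : Fs x l -> Fw x l.
Proof. by move/FsP => h; apply/FwP => j /h/ltW. Qed.
Lemma ts_tw x l : Ts x l -> Tw x l.
Proof. by move/TsP => h; apply/TwP => j /h/ltW. Qed.

Lemma TF x i j : Ts x i -> Fw x j -> E i j <= 0. Proof. exact: rTF. Qed.
Lemma TF' x i j : Tw x i -> Fs x j -> E i j <= 0. Proof. exact: rTF'. Qed.
Lemma HNs x l : Fw x l \/ exists2 j, sub j l & Ts x j. Proof. exact: rHNs. Qed.
Lemma HNq x l : Tw x l \/ exists2 j, quo j l & Fs x j. Proof. exact: rHNq. Qed.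
Lemma FTw x l : pr x l = 0 -> Fw x l = Tw x l. Proof. exact: rFTw. Qed.

Lemma perturb p (eta : 'rV[R]_n) : exists2 e, 0 < e & forall e' j, 0 < e' -> e' <= e ->
  Num.sg (pr (p + e' *: eta) j) = if pr p j == 0 then Num.sg (pr eta j) else Num.sg (pr p j).
Proof. by apply: (@perturb_fun R n _ (fun j x => pr x j)) => j a x y; rewrite prD prZ. Qed.

Lemma perturb1 p (eta : 'rV[R]_n) : exists2 e, 0 < e & forall j,
  Num.sg (pr (p + e *: eta) j) = if pr p j == 0 then Num.sg (pr eta j) else Num.sg (pr p j).
Proof. by have [e e0 eP] := perturb p eta; exists e => // j; apply: eP. Qed.

(** The Euler form tells roots apart: if i is laterally before j then E(j, i) <= 0 while E(j, j) >
    0, and symmetrically. *)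
Lemma nonprop i j (c : R) : (forall x, pr x i = c * pr x j) -> i = j.
Proof.
move=> h; apply/eqP/negPn/negP => ij.
have c0 : 0 < c by have := pr1_gt0 i; rewrite h pmulr_lgt0 // pr1_gt0.
have [ltij|ltji] := lat_neq_lt ij.
  by have := rE_le0 ltij; rewrite -pr_yl h pr_yl leNgt mulr_gt0 // rE_gt0.
have := rE_le0 ltji; rewrite -pr_yl leNgt -(pmulr_rgt0 _ c0) -h pr_yl.
by rewrite rE_gt0.
Qed.

Lemma separate i j a b : i != j -> exists eta, pr eta i = a /\ pr eta j = b.
Proof.
have sep u v : u != v -> exists eta, pr eta u = 0 /\ pr eta v = 1.
  move=> uv; have [x xn] : exists x, pr x v != pr one v / pr one u * pr x u.
    apply: contrapT => no; case/eqP: uv; apply/esym/(@nonprop v u (pr one v / pr one u)) => x.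
    by apply/eqP/negPn/negP => xn; apply: no; exists x.
  have u1 := pr1_gt0 u; have u1n : pr one u != 0 by rewrite gt_eqF.
  pose y := x - (pr x u / pr one u) *: one.
  have yu : pr y u = 0 by rewrite /y prB prZ divfK // subrr.
  have yv : pr y v != 0.
    apply: contraNneq xn => /eqP; rewrite /y prB prZ subr_eq0 => /eqP ->.
    by apply/eqP; field.
  by exists ((pr y v)^-1 *: y); rewrite !prZ yu mulr0 mulVf.
move=> ij; have [u [ui uj]] := sep i j ij.
rewrite eq_sym in ij; have [v [vj vi]] := sep j i ij.
by exists (b *: u + a *: v); rewrite !prD !prZ ui uj vi vj !mulr0 !mulr1 add0r addr0.
Qed.

Definition onwall p j : bool := (pr p j == 0) && Fw p j.
Definition stable p j : Prop := onwall p j /\ forall l, sub l j -> l != j -> pr p l < 0.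

Lemma wall_tw p j : onwall p j -> Tw p j.
Proof. by case/andP => /eqP/FTw ->. Qed.

Lemma wall_fw p j : onwall p j -> Fw p j. Proof. by case/andP. Qed.
Lemma wall_eq0 p j : onwall p j -> pr p j = 0. Proof. by case/andP => /eqP. Qed.

Lemma wall_sub p j l : onwall p j -> sub l j -> pr p l = 0 -> onwall p l.
Proof. by move=> /wall_fw w s p0; rewrite /onwall p0 eqxx (fw_sub w). Qed.

Lemma wall_quo p j l : onwall p j -> quo l j -> pr p l = 0 -> onwall p l.
Proof. by move=> /wall_tw w s p0; rewrite /onwall p0 eqxx FTw // (tw_quo w). Qed.

(** If p vanished on l, a displacement inside H(j) lowering l would keep j nonpositive on its
    subroots, by strictness, and yet be negative on a quotient root of j. *)
Lemma stable_quo p j l : stable p j -> quo l j -> l != j -> 0 < pr p l.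
Proof.
move=> [w st] q lj; have := tw_ge0 (tw_quo (wall_tw w) q).
rewrite le_eqVlt => /orP[/eqP/esym p0|//]; rewrite eq_sym in lj.
have [eta [ej el]] := separate 0 (-1) lj.
have [e e0 eP] := perturb1 p eta.
have pj : pr (p + e *: eta) j = 0 by rewrite prD prZ ej mulr0 addr0 wall_eq0.
have : Fw (p + e *: eta) j.
  apply/FwP => i si; have [->|ij] := eqVneq i j; first by rewrite pj.
  by rewrite -sgr_le0 eP; have pi := st i si ij; rewrite lt_eqF // sgr_le0 ltW.
rewrite FTw // => /tw_quo/(_ q)/tw_ge0.
by rewrite prD prZ p0 add0r el mulrN1 oppr_ge0 leNgt e0.
Qed.

(** Bottom of a Jordan-Hoelder filtration: the subroot of least index among those on which p
    vanishes. *)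
Lemma wall_has_stable_sub p j : onwall p j -> exists2 l, sub l j & stable p l.
Proof.
move=> w; have Pj : sub j j && (pr p j == 0) by rewrite rsub_refl wall_eq0 ?eqxx.
case: (@arg_minnP _ j (fun l => sub l j && (pr p l == 0)) val Pj) => l /andP[sl /eqP p0] lmin.
have wl : onwall p l by apply: wall_sub w sl p0.
exists l => //; split=> // i si il; rewrite lt_neqAle (FwP _ _ (wall_fw wl)) // andbT.
apply/negP => pi; case/negP: il; apply/eqP/val_inj/eqP.
by rewrite eqn_leq (rsub_index si) lmin // pi andbT (rsub_trans si).
Qed.

Lemma stable_of_quo p j : onwall p j -> (forall l, quo l j -> l != j -> 0 < pr p l) -> stable p j.
Proof.
move=> w st; split=> // l s lj; have := FwP _ _ (wall_fw w) _ s.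
rewrite le_eqVlt => /orP[/eqP p0|//]; rewrite eq_sym in lj.
have [eta [ej el]] := separate 0 1 lj.
have [e e0 eP] := perturb1 p eta.
have pj : pr (p + e *: eta) j = 0 by rewrite prD prZ ej mulr0 addr0 wall_eq0.
have : Tw (p + e *: eta) j.
  apply/TwP => i si; have [->|ij] := eqVneq i j; first by rewrite pj.
  by rewrite -sgr_ge0 eP; have pi := st i si ij; rewrite gt_eqF // sgr_ge0 ltW.
rewrite -FTw // => /fw_sub/(_ s)/fw_le0.
by rewrite prD prZ p0 add0r el mulr1 leNgt e0.
Qed.

Lemma wall_has_stable_quo p j : onwall p j -> exists2 l, quo l j & stable p l.
Proof.
move=> w; have Pj : quo j j && (pr p j == 0) by rewrite rquo_refl wall_eq0 ?eqxx.
case: (@arg_minnP _ j (fun l => quo l j && (pr p l == 0)) val Pj) => l /andP[sl /eqP p0] lmin.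
have wl : onwall p l by apply: wall_quo w sl p0.
exists l => //; apply: stable_of_quo => // i si il.
rewrite lt_neqAle (TwP _ _ (wall_tw wl)) // andbT eq_sym.
apply/negP => pi; case/negP: il; apply/eqP/val_inj/eqP.
by rewrite eqn_leq (rquo_index si) lmin // pi andbT (rquo_trans si).
Qed.

Lemma stable_ts p (eta : 'rV[R]_n) j e : stable p j ->
  (forall j, Num.sg (pr (p + e *: eta) j) =
     if pr p j == 0 then Num.sg (pr eta j) else Num.sg (pr p j)) ->
  0 < pr eta j -> Ts (p + e *: eta) j.
Proof.
move=> st eP ej; apply/TsP => l q; rewrite -sgr_gt0 eP.
have [->|lj] := eqVneq l j; first by rewrite wall_eq0 ?eqxx ?sgr_gt0 //; case: st.
by have pl := stable_quo st q lj; rewrite gt_eqF // sgr_gt0.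
Qed.

(** Schur's lemma for stable objects: p is displaced so that i becomes strictly torsion while j
    stays torsion-free. *)
Lemma stable_orth p i j : stable p i -> stable p j -> i != j -> E i j <= 0.
Proof.
move=> si sj ij; have [eta [ei ej]] := separate 1 0 ij.
have [e e0 eP] := perturb1 p eta.
apply: (@TF (p + e *: eta)); first by apply: stable_ts eP _; rewrite ?ei ?ltr01.
apply/FwP => l sl; rewrite -sgr_le0 eP; have [->|lj] := eqVneq l j.
  by rewrite wall_eq0 ?eqxx ?ej ?sgr0 //; case: sj.
by have pl := proj2 sj l sl lj; rewrite lt_eqF // sgr_le0 ltW.
Qed.

Definition combo l A B (a b : R) : Prop := forall x, pr x l = a * pr x A + b * pr x B.

(** A destabilizing subroot j of l would have E(j, l) > 0, whereas E(j, A) and E(j, B) are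
    nonpositive because A and B are semistable at p. *)
Lemma wall_conv p A B l a b : onwall p A -> onwall p B -> 0 <= a -> 0 <= b ->
  combo l A B a b -> onwall p l.
Proof.
move=> wA wB a0 b0 cl; rewrite /onwall cl !wall_eq0 // !mulr0 addr0 eqxx /=.
have [//|[j s T]] := HNs p l; have := rsub_hom s.
rewrite -pr_yl cl !pr_yl ltNge; case/negP.
have := TF T (wall_fw wA); have := TF T (wall_fw wB).
by move=> hB hA; rewrite -oppr_ge0 opprD -!mulrN addr_ge0 // mulr_ge0 // oppr_ge0.
Qed.

(* Triangular elimination: going down the lateral order, multiples of [ryl v]
   repair the negative values of [psi] at the roots v of P. *)
Lemma triangular (psi : 'rV[R]_n) (P : {set 'I_m}) : exists c : 'I_m -> R,
  [/\ forall v, 0 <= c v,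
      forall v, v \in P -> 0 <= pr (psi + \sum_(u in P) c u *: ryl S u) v &
      forall v, v \in P -> pr psi v <= 0 -> (forall u, u \in P -> u != v -> E u v <= 0) ->
        pr (psi + \sum_(u in P) c u *: ryl S u) v = 0].
Proof.
elim: {P}#|P| {-2}P (erefl #|P|) => [|k IH] P cP.
  have P0 : P = finset.set0 by apply/eqP; rewrite -cards_eq0 cP.
  by exists (fun=> 0); split=> // v; rewrite P0 finset.in_set0.
have [v0 v0P] : exists v, v \in P by apply/set0Pn; rewrite -card_gt0 cP.
case: (@arg_minP _ int _ v0 (fun v => v \in P) lat v0P) => v vP vmin {v0 v0P}.
have [|c [c0 cge ceq]] := IH (P :\ v); first by have := cardsD1 v P; rewrite vP cP => -[].
set psi' := psi + _ in cge ceq.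
pose cv := Num.max 0 (- pr psi' v / E v v).
pose c' u := if u == v then cv else c u.
have Evv := rE_gt0 S v; have Evn : E v v != 0 by rewrite gt_eqF.
have sE w : pr (psi + \sum_(u in P) c' u *: ryl S u) w = pr psi' w + cv * E v w.
  rewrite (big_setD1 v vP) /= addrCA addrC prD; congr (_ + _).
    rewrite /psi'; congr (pr (_ + _) _); apply: eq_bigr => u; rewrite in_setD1 /c'.
    by case/andP => /negPf ->.
  by rewrite prZ pr_yl /c' eqxx.
have cv0 : 0 <= cv by rewrite le_max lexx.
exists c'; split=> [u|w wP|w wP psiw orth].
- by rewrite /c'; case: ifP.
- rewrite sE; have [->|wv] := eqVneq w v.
    rewrite -lerBlDl sub0r -ler_pdivrMr //.
    by rewrite /cv le_max lexx orbT.
  apply: addr_ge0; first by apply: cge; rewrite in_setD1 wv.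
  by apply: mulr_ge0 => //; apply: E_ge0; apply: vmin.
- rewrite sE; have [wv|wv] := eqVneq w v; last first.
    rewrite ceq ?in_setD1 ?wv //; last first.
      by move=> u; rewrite in_setD1 => /andP[_ uP]; apply: orth.
    suff -> : E v w = 0 by rewrite mulr0 addr0.
    by apply/eqP; rewrite eq_le orth 1?eq_sym //= E_ge0 // vmin.
  have psi'v : pr psi' v <= 0.
    rewrite /psi' prD pr_sum -wv -[leRHS]addr0 lerD // -oppr_ge0 -sumrN.
    apply: sumr_ge0 => u; rewrite in_setD1 pr_yl => /andP[uv uP].
    by rewrite -mulrN mulr_ge0 // oppr_ge0 orth // wv.
  rewrite wv /cv max_r; first by rewrite divfK // subrr.
  by rewrite divr_ge0 ?oppr_ge0 // ltW.
Qed.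

(** A negative point is repaired to vanish on P by [triangular]. A proper subroot l of v stays
    negative: E(u, l) > 0 with u in P would force u = v by orthogonality, and E(v, l) > 0 is
    incompatible with E(l, v) > 0. *)
Lemma orth_point (P : {set 'I_m}) :
  {in P &, forall u v, u != v -> E u v <= 0} -> exists p, forall v, v \in P -> stable p v.
Proof.
move=> orth; have [c [c0 _ ceq]] := triangular (- one) P.
set p := - one + _ in ceq; exists p => v vP.
have pv : pr p v = 0.
  by apply: ceq => // [|u uP uv]; [rewrite prN oppr_le0 ltW ?pr1_gt0 | apply: orth].
have neg l : sub l v -> l != v -> pr p l < 0.
  move=> s lv; rewrite /p prD prN pr_sum -[ltRHS]addr0.
  apply: ltr_leD; first by rewrite oppr_lt0 pr1_gt0.
  rewrite -oppr_ge0 -sumrN; apply: sumr_ge0 => u uP; rewrite -mulrN mulr_ge0 // oppr_ge0 pr_yl.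
  rewrite leNgt; apply/negP => ul; have uv := rE_sub s ul.
  have [uev|nuv] := eqVneq u v; last by have := orth _ _ uP vP nuv; rewrite leNgt uv.
  by have := E_anti lv (rsub_hom s); rewrite -uev leNgt ul.
split=> //; rewrite /onwall pv eqxx; apply/FwP => l s.
by have [->|/(neg l s)/ltW//] := eqVneq l v; rewrite pv.
Qed.

End RootGeometry.

(** * Rank two: hom-orthogonal pairs and the roots between them *)

Section RankTwo.
Context (R : realType) (n : nat) (Q : valued_quiver n) (m : nat) (S : root_data R Q m).
Implicit Types (x y p : 'rV[R]_n) (i j l g A B : 'I_m).

Local Notation pr := (pr S).
Local Notation E := (rE S).
Local Notation lat := (rlat S).
Local Notation sub := (rsub S).
Local Notation quo := (rquo S).
Local Notation wallb := (onwall S).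
Local Notation stable := (stable S).
Local Notation combo := (combo S).

(** Generic point of the subspace [W]: the functionals are treated one at a time, each by a
    displacement too small to annihilate those that are already nonzero. *)
Lemma avoid (K : finType) (W : 'rV[R]_n -> Prop) (f : K -> 'rV[R]_n -> R) :
    (forall k a x y, f k (a *: x + y) = a * f k x + f k y) ->
    W 0 -> (forall a x y, W x -> W y -> W (a *: x + y)) ->
  exists2 x, W x & forall k, f k x = 0 -> forall y, W y -> f k y = 0.
Proof.
move=> fL W0 WL.
suff [x Wx xP] : exists2 x, W x & forall k, k \in enum K -> f k x = 0 -> forall y, W y -> f k y = 0.
  by exists x => // k; apply: xP; rewrite mem_enum.
elim: (enum K) => [|k s [x Wx xP]]; first by exists 0.
have [all0|] := pselect (forall y, W y -> f k y = 0).
  by exists x => // k'; rewrite inE => /orP[/eqP->|/xP].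
move=> /existsNP[y /not_implyP[Wy /eqP fy]].
have [e e0 eP] := perturb_fun x y fL.
have nz k' : f k' x != 0 -> f k' (e *: y + x) != 0.
  by move=> fk; rewrite -sgr_eq0 addrC eP // (negPf fk) sgr_eq0.
have [fx|fx] := eqVneq (f k x) 0; last first.
  exists x => // k'; rewrite inE => /orP[/eqP->|/xP//] fx'.
  by rewrite fx' eqxx in fx.
exists (e *: y + x); first exact: WL.
move=> k'; rewrite inE => /orP[/eqP->|k's f0].
  by rewrite fL fx addr0 => /eqP; rewrite mulf_eq0 (negPf fy) gt_eqF.
by apply: (xP k' k's); apply/eqP/negPn/negP => /nz; rewrite f0 eqxx.
Qed.

(** Hom-orthogonality in terms of the Euler form: when A is laterally first, E(A, B) is the
    dimension of Hom(A, B), and E(B, A) <= 0 is automatic. *)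
Definition pairb A B : bool := (lat A < lat B) && (E A B == 0).
Definition mid A B l : Prop := exists a b : nat, combo l A B a%:R b%:R.

Lemma E_neq0 A : E A A != 0. Proof. by rewrite gt_eqF // rE_gt0. Qed.

Lemma pair_neq A B : pairb A B -> A != B.
Proof. by case/andP => + _; apply: contraTneq => ->; rewrite ltxx. Qed.
Lemma pair_E0 A B : pairb A B -> E A B = 0. Proof. by case/andP => _ /eqP. Qed.
Lemma pair_le0 A B : pairb A B -> E A B <= 0. Proof. by move/pair_E0 ->. Qed.
Lemma pair_anti A B : pairb A B -> E B A <= 0. Proof. by case/andP => /rE_le0. Qed.

Lemma orth_pair A B : A != B -> E A B <= 0 -> E B A <= 0 -> pairb A B \/ pairb B A.
Proof.
move=> AB o1 o2; have [lt|lt] := lat_neq_lt S AB; [left|right].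
  by rewrite /pairb lt eq_le o1 rE_ge0.
by rewrite /pairb lt eq_le o2 rE_ge0.
Qed.

Lemma E_combol A B l a b g : combo l A B a b -> E l g = a * E A g + b * E B g.
Proof. by move=> c; rewrite -!pr_yr c. Qed.
Lemma E_combor A B l a b g : combo l A B a b -> E g l = a * E g A + b * E g B.
Proof. by move=> c; rewrite -!pr_yl c. Qed.

Lemma combo_coefl A B l a b : pairb A B -> combo l A B a b -> E A l = a * E A A.
Proof. by move=> /pair_E0 AB /E_combor ->; rewrite AB mulr0 addr0. Qed.
Lemma combo_coefr A B l a b : pairb A B -> combo l A B a b -> E l B = b * E B B.
Proof. by move=> /pair_E0 AB /E_combol ->; rewrite AB mulr0 add0r. Qed.

Lemma combo_uniq A B l a b a' b' : pairb A B -> combo l A B a b -> combo l A B a' b' ->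
  a = a' /\ b = b'.
Proof.
move=> AB c c'; split.
  apply: (mulIf (E_neq0 A)).
  by rewrite -(combo_coefl AB c) (combo_coefl AB c').
apply: (mulIf (E_neq0 B)).
by rewrite -(combo_coefr AB c) (combo_coefr AB c').
Qed.

Lemma combo_l A B : combo A A B 1 0. Proof. by move=> x; rewrite mul1r mul0r addr0. Qed.
Lemma combo_r A B : combo B A B 0 1. Proof. by move=> x; rewrite mul1r mul0r add0r. Qed.
Lemma mid_l A B : mid A B A. Proof. by exists 1%N, 0%N; apply: combo_l. Qed.
Lemma mid_r A B : mid A B B. Proof. by exists 0%N, 1%N; apply: combo_r. Qed.

Lemma combo_sum_gt0 A B l a b : 0 <= a -> 0 <= b -> combo l A B a b -> 0 < a + b.
Proof.
move=> a0 b0 c; rewrite lt_neqAle addr_ge0 // andbT eq_sym; apply/eqP => ab.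
have [za zb] : a = 0 /\ b = 0 by split; lra.
by have := pr1_gt0 S l; rewrite c za zb !mul0r addr0 ltxx.
Qed.

Lemma combo_same_slope A B l g a b a' b' :
  0 <= a -> 0 <= b -> 0 <= a' -> 0 <= b' ->
  combo l A B a b -> combo g A B a' b' -> a * b' = a' * b -> l = g.
Proof.
move=> a0 b0 a'0 b'0 cl cg e; have s := combo_sum_gt0 a'0 b'0 cg.
have sn : a' + b' != 0 by rewrite gt_eqF.
apply: (@nonprop _ _ _ _ S _ _ ((a + b) / (a' + b'))) => x; apply: (mulfI sn).
rewrite [RHS]mulrA (mulrC (a' + b') (_ / _)) divfK // cl cg; apply/eqP; rewrite -subr_eq0.
have -> : (a' + b') * (a * pr x A + b * pr x B) - (a + b) * (a' * pr x A + b' * pr x B) =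
  (a * b' - a' * b) * (pr x A - pr x B) by ring.
by rewrite e subrr mul0r.
Qed.

(** E(l, g) - E(g, l) equals E(B, A) (b a' - a b'), and E(B, A) <= 0: homomorphisms go from the
    larger slope a/b to the smaller one. *)
Lemma combo_E_order A B l g a b a' b' : pairb A B -> combo l A B a b -> combo g A B a' b' ->
  l != g -> 0 < E l g -> b * a' < a * b'.
Proof.
move=> AB cl cg lg Elg; have Egl := E_anti lg Elg.
have EBA := pair_anti AB; have EAB := pair_E0 AB.
have e1 : E l g = a * (a' * E A A) + b * (a' * E B A + b' * E B B).
  by rewrite (E_combol _ cl) !(E_combor _ cg) EAB mulr0 addr0.
have e2 : E g l = a' * (a * E A A) + b' * (a * E B A + b * E B B).
  by rewrite (E_combol _ cg) !(E_combor _ cl) EAB mulr0 addr0.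
have : 0 < E B A * (b * a' - a * b').
  have -> : E B A * (b * a' - a * b') = E l g - E g l by rewrite e1 e2; ring.
  by rewrite subr_gt0; apply: le_lt_trans Elg.
by rewrite nmulr_rgt0 ?subr_lt0 // lt_neqAle EBA andbT; apply: contraTneq Elg => z;
  rewrite -leNgt; move: Egl; rewrite e1 e2 z !mulr0 !add0r; nra.
Qed.

Definition planar2 p A B : Prop := forall l, wallb p l -> exists a b, combo l A B a b.

Lemma planar_stable p A B : stable p A -> stable p B -> pairb A B -> planar2 p A B ->
  forall C, stable p C -> C = A \/ C = B.
Proof.
move=> sA sB AB pl C sC; apply: contrapT => /not_orP[CA CB].
have [a [b c]] := pl C (proj1 sC); move/eqP: CA => CA; move/eqP: CB => CB.
have := pr1_gt0 S C; rewrite c.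
have := stable_orth sA sC; rewrite eq_sym CA => /(_ isT).
rewrite (combo_coefl AB c) pmulr_lle0 ?rE_gt0 // => a0.
have := stable_orth sC sB CB; rewrite (combo_coefr AB c) pmulr_lle0 ?rE_gt0 // => b0.
have A1 := pr1_gt0 S A; have B1 := pr1_gt0 S B.
by have := mulr_le0_ge0 a0 (ltW A1); have := mulr_le0_ge0 b0 (ltW B1); lra.
Qed.

Lemma nonstable_ends p l : wallb p l -> ~ stable p l -> exists A B,
  [/\ stable p A, stable p B, lat A < lat B, sub A l & quo B l].
Proof.
move=> w ns; have [A sA stA] := wall_has_stable_sub w.
have [B qB stB] := wall_has_stable_quo w.
have Al : A != l by apply: contra_notN ns => /eqP <-.
have lB : l != B by apply: contra_notN ns => /eqP ->.
exists A, B; split=> //.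
exact: lt_trans (E_lat_lt Al (rsub_hom sA)) (E_lat_lt lB (rquo_hom qB)).
Qed.

Lemma planar_mid p A B : stable p A -> stable p B -> pairb A B -> planar2 p A B ->
  forall l, wallb p l -> l != A -> l != B -> sub A l /\ quo B l.
Proof.
move=> sA sB AB pl l w lA lB; have := planar_stable sA sB AB pl => two.
have [|A' [B' [sA' sB' lt s q]]] := nonstable_ends w.
  by move=> /two[] e; [case/eqP: lA | case/eqP: lB].
have ltAB : lat A < lat B by case/andP: AB.
case: (two _ sA') (two _ sB') s q lt => -> [] -> s q lt //; rewrite ?ltxx // in lt.
by have := lt_trans lt ltAB; rewrite ltxx.
Qed.

(** The coefficients of l are E(A, l) / E(A, A) and E(l, B) / E(B, B), natural numbers by [rINTl]
    and [rINTr] because A is a subroot and B a quotient root of l. *)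
Lemma planar_wallP p A B : stable p A -> stable p B -> pairb A B -> planar2 p A B ->
  forall l, wallb p l <-> mid A B l.
Proof.
move=> sA sB AB pl l; split=> [w|[a [b c]]]; last first.
  by apply: wall_conv c; rewrite ?ler0n //; [case: sA | case: sB].
have [->|lA] := eqVneq l A; first exact: mid_l.
have [->|lB] := eqVneq l B; first exact: mid_r.
have [s q] := planar_mid sA sB AB pl w lA lB; have [a [b c]] := pl l w.
have [k kE] := rINTl (E_lat (rsub_hom s)); have [k' kE'] := rINTr (E_lat (rquo_hom q)).
exists k, k'; suff [<- <-] : a = k%:R /\ b = k'%:R by [].
split.
  by apply: (mulIf (E_neq0 A)); rewrite -(combo_coefl AB c).
by apply: (mulIf (E_neq0 B)); rewrite -(combo_coefr AB c).
Qed.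

Definition planar p : Prop := forall i j l, wallb p i -> wallb p j -> wallb p l ->
  i != j -> exists a b, combo l i j a b.

Lemma planar_pair p i j : planar p -> wallb p i -> wallb p j -> i != j ->
  exists A B, [/\ stable p A, stable p B, pairb A B & planar2 p A B].
Proof.
move=> pl wi wj ij.
suff [A [B [sA sB AB]]] : exists A B, [/\ stable p A, stable p B & A != B].
  have pl2 C D : stable p C -> stable p D -> C != D -> planar2 p C D.
    by move=> [wC _] [wD _] CD l wl; apply: pl.
  case: (orth_pair AB (stable_orth sA sB AB)) => [|PAB|PBA].
  - by rewrite (stable_orth sB sA) // eq_sym.
  - by exists A, B; split=> //; apply: pl2.
  - by exists B, A; split=> //; apply: pl2 => //; rewrite eq_sym.
have [si|/(nonstable_ends wi)[A [B [sA sB lt _ _]]]] := pselect (stable p i); last first.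
  by exists A, B; split=> //; apply: contraTneq lt => ->; rewrite ltxx.
have [sj|/(nonstable_ends wj)[A [B [sA sB lt _ _]]]] := pselect (stable p j); last first.
  by exists A, B; split=> //; apply: contraTneq lt => ->; rewrite ltxx.
by exists i, j.
Qed.

(** The point of [orth_point] is displaced generically inside the common zero space of P, so that
    only roots in the span of P still vanish at it. *)
Lemma orth_point_span (P : {set 'I_m}) :
  {in P &, forall u v, u != v -> E u v <= 0} ->
  exists p, (forall v, v \in P -> stable p v) /\
    forall l, pr p l = 0 -> forall y, (forall v, v \in P -> pr y v = 0) -> pr y l = 0.
Proof.
move=> /orth_point[p st].
have [|||eta eP eta0] := @avoid _ (fun y => forall v, v \in P -> pr y v = 0) (fun l y => pr y l).
- by move=> l a x y; rewrite prD prZ.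
- by move=> v _; rewrite pr0.
- by move=> a x y xP yP v vP; rewrite prD prZ xP // yP // mulr0 addr0.
have [e e0 eE] := perturb1 S p eta; exists (p + e *: eta); split=> [v vP|l].
  have [w neg] := st v vP.
  have pv : pr (p + e *: eta) v = 0 by rewrite prD prZ eP // (wall_eq0 w) mulr0 addr0.
  have negs l : sub l v -> l != v -> pr (p + e *: eta) l < 0.
    by move=> s lv; rewrite -sgr_lt0 eE; have pl := neg l s lv; rewrite lt_eqF // sgr_lt0.
  split=> //; rewrite /onwall pv eqxx; apply/FwP => l s.
  by have [->|lv] := eqVneq l v; [rewrite pv | apply/ltW/negs].
move=> /eqP; rewrite -sgr_eq0 eE; case: (eqVneq (pr p l) 0) => [_|pn]; last by rewrite sgr_eq0 (negPf pn).
by rewrite sgr_eq0 => /eqP/eta0.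
Qed.

Lemma pair_span A B l : pairb A B ->
  (forall y, pr y A = 0 -> pr y B = 0 -> pr y l = 0) -> exists a b, combo l A B a b.
Proof.
move=> AB h; have [u [uA uB]] := separate S 1 0 (pair_neq AB).
have [v [vA vB]] := separate S 0 1 (pair_neq AB).
exists (pr u l), (pr v l) => x; apply/eqP; rewrite -subr_eq0.
have := h (x - pr x A *: u - pr x B *: v); rewrite !prB !prZ uA uB vA vB.
rewrite !mulr1 !mulr0 !subr0 !subrr => /(_ erefl erefl) <-.
by rewrite opprD addrA (mulrC (pr u l)) (mulrC (pr v l)).
Qed.

(** At a point where only roots of the plane of A and B vanish, A and B are the only stable roots; l
    lies on its wall there, so its stable subroot and its stable quotient root are A and B. *)
Lemma mid_ends A B l : pairb A B -> mid A B l -> l != A -> l != B -> sub A l /\ quo B l.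
Proof.
move=> AB [a [b c]] lA lB; have [|p [st span]] := @orth_point_span [set A; B].
  by move=> u v /set2P[]-> /set2P[]->; rewrite ?eqxx // => _; [apply: pair_le0|apply: pair_anti].
have sA : stable p A by apply: st; rewrite set21.
have sB : stable p B by apply: st; rewrite set22.
apply: (planar_mid sA sB AB) => // [k /wall_eq0 k0|].
  by apply: pair_span => // y yA yB; apply: span k0 _ _ => v /set2P[]->.
by apply: wall_conv c; rewrite ?ler0n //; [case: sA | case: sB].
Qed.

Lemma mid_lat A B l : pairb A B -> mid A B l -> lat A <= lat l /\ lat l <= lat B.
Proof.
move=> AB ml; have ltAB : lat A < lat B by case/andP: AB.
have [->|lA] := eqVneq l A; first by split=> //; exact: ltW.
have [->|lB] := eqVneq l B; first by split=> //; exact: ltW.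
have [s q] := mid_ends AB ml lA lB.
by split; [apply/E_lat/rsub_hom | apply/E_lat/rquo_hom].
Qed.

End RankTwo.

(** * Presented groups *)

Section PresentedGroups.
Variables (T : choiceType) (rels : seq T -> seq T -> Prop).
Local Notation G := (presented_group rels).
Local Open Scope group_scope.

Definition pos (w : seq T) : seq (T * bool) := [seq (t, true) | t <- w].

Lemma pg_pi_cat u v : pg_pi rels (u ++ v) = pg_pi rels u * pg_pi rels v :> G.
Proof. by apply/esym/pg_piE; apply: WeCat; apply: repr_pg_pi. Qed.

Lemma pg_wordE w : pg_word rels w = pg_pi rels (pos w).
Proof.
elim: w => [|t w IH]; first by rewrite /pg_word big_nil.
by rewrite /pg_word big_cons -/(pg_word rels w) IH -pg_pi_cat.
Qed.

Lemma pg_word_cat u v : pg_word rels (u ++ v) = pg_word rels u * pg_word rels v.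
Proof. by rewrite /pg_word big_cat. Qed.

Lemma pg_word_cons t v : pg_word rels (t :: v) = pg_gen rels t * pg_word rels v.
Proof. by rewrite /pg_word big_cons. Qed.

Lemma pg_word1 t : pg_word rels [:: t] = pg_gen rels t.
Proof. by rewrite /pg_word big_seq1. Qed.

Lemma pg_word_rel u v : rels u v -> pg_word rels u = pg_word rels v.
Proof. by move=> r; rewrite !pg_wordE; apply: pg_piE; apply: WeRel. Qed.

Lemma pg_word_eq u v : pg_word rels u = pg_word rels v -> word_eq rels (pos u) (pos v).
Proof.
rewrite !pg_wordE => e; apply: WeTrans (repr_pg_pi rels (pos v)).
by rewrite -e; apply/WeSym/repr_pg_pi.
Qed.

Section Lift.
Variables (H : groupType) (f : T -> H).
Definition wprod (w : seq T) : H := \big[*%g/1%g]_(t <- w) f t.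
Hypothesis f_rel : forall u v, rels u v -> wprod u = wprod v.

Let ev (s : seq (T * bool)) : H :=
  \big[*%g/1%g]_(x <- s) (if x.2 then f x.1 else (f x.1)^-1).

Lemma ev_word_eq s s' : word_eq rels s s' -> ev s = ev s'.
Proof.
elim=> // [u v w _ -> _ ->|u u' v v' _ eu _ ev'|t b|u v r] //.
- by rewrite /ev !big_cat /= -!/(ev _) eu ev'.
- by rewrite /ev !big_cons big_nil /= mulg1; case: b; rewrite /= ?mulgV ?mulVg.
- by rewrite /ev !big_map; apply: f_rel.
Qed.

Definition pg_lift (x : G) : H := ev (repr x).

Lemma pg_lift_pi s : pg_lift (pg_pi rels s) = ev s.
Proof. by apply/ev_word_eq/repr_pg_pi. Qed.

Lemma pg_liftM x y : pg_lift (x * y) = pg_lift x * pg_lift y.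
Proof.
by rewrite -(pg_reprK x) -(pg_reprK y) -pg_pi_cat !pg_lift_pi /ev big_cat.
Qed.

Lemma pg_lift1 : pg_lift 1 = 1.
Proof. by apply: (mulgI (pg_lift 1)); rewrite -pg_liftM !mulg1. Qed.

Lemma pg_liftV x : pg_lift x^-1 = (pg_lift x)^-1.
Proof. by apply: (mulgI (pg_lift x)); rewrite -pg_liftM !mulgV pg_lift1. Qed.

Lemma pg_lift_word w : pg_lift (pg_word rels w) = wprod w.
Proof. by rewrite pg_wordE pg_lift_pi /ev big_map. Qed.

Lemma pg_lift_gen t : pg_lift (pg_gen rels t) = f t.
Proof. by rewrite -pg_word1 pg_lift_word /wprod big_seq1. Qed.

End Lift.

Lemma wprod_cat (H : groupType) (f : T -> H) u v : wprod f (u ++ v) = wprod f u * wprod f v.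
Proof. by rewrite /wprod big_cat. Qed.

Lemma wprod_cons (H : groupType) (f : T -> H) t v : wprod f (t :: v) = f t * wprod f v.
Proof. by rewrite /wprod big_cons. Qed.

Lemma wprod1 (H : groupType) (f : T -> H) t : wprod f [:: t] = f t.
Proof. by rewrite /wprod big_seq1. Qed.

Lemma wprod_word w : wprod (pg_gen rels) w = pg_word rels w. Proof. by []. Qed.

Lemma pg_hom_ext (H : groupType) (F F' : G -> H) :
  {morph F : x y / x * y} -> {morph F' : x y / x * y} ->
  (forall t, F (pg_gen rels t) = F' (pg_gen rels t)) -> F =1 F'.
Proof.
move=> FM FM' Fg x.
have F1 : F 1 = 1 by apply: (mulgI (F 1)); rewrite -FM !mulg1.
have F1' : F' 1 = 1 by apply: (mulgI (F' 1)); rewrite -FM' !mulg1.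
rewrite -(pg_reprK x); elim: (repr x) => [|[t b] s IH]; first by rewrite F1 F1'.
rewrite -cat1s pg_pi_cat FM FM' IH; congr (_ * _); case: b; first exact: Fg.
have -> : pg_pi rels [:: (t, false)] = (pg_gen rels t)^-1.
  apply: (mulgI (pg_gen rels t)); rewrite mulgV -pg_pi_cat.
  by apply: pg_piE; apply: (WeCancel rels t true).
apply: (mulgI (F (pg_gen rels t))); rewrite -FM mulgV F1.
by rewrite Fg -FM' mulgV F1'.
Qed.

Section Action.
Variables (Y : Type) (a a' : T -> Y -> Y).
Hypotheses (aK : forall t, cancel (a t) (a' t)) (a'K : forall t, cancel (a' t) (a t)).
Hypothesis a_rel : forall u v, rels u v -> forall y, foldr a y u = foldr a y v.

Lemma action_eq u v y : pg_word rels u = pg_word rels v -> foldr a y u = foldr a y v.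
Proof.
move/pg_word_eq; pose act := foldr (fun (x : T * bool) y => if x.2 then a x.1 y else a' x.1 y).
have posE w z : act z (pos w) = foldr a z w by elim: w => //= t w ->.
suff main s s' : word_eq rels s s' -> forall z, act z s = act z s'.
  by move=> e; rewrite -!posE; apply: main.
elim=> // [u1 v1 w1 _ e _ e'|u1 u1' v1 v1' _ e _ e'|t b|u1 v1 r] z.
- by rewrite e e'.
- by rewrite /act !foldr_cat -!/(act _ _) e' e.
- by case: b => /=; rewrite ?aK ?a'K.
- by rewrite -!/(pos _) !posE; apply: a_rel.
Qed.

End Action.

End PresentedGroups.

(** * Lists sorted by a real key *)

Section KeyLists.
Context (R : realType) (I : finType).
Implicit Types (P : pred I) (k : I -> R) (w : seq I).

Definition klist P k w : Prop := (forall i, (i \in w) = P i) /\ sorted (fun i j => k i < k j) w.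

Lemma key_trans k : transitive (fun i j => k i < k j).
Proof. by move=> j i l; apply: lt_trans. Qed.

Lemma klist_uniq P k w w' : klist P k w -> klist P k w' -> w = w'.
Proof.
move=> [wP sw] [wP' sw']; apply: (irr_sorted_eq (key_trans (k := k))) => // i.
by rewrite ?ltxx // wP wP'.
Qed.

Lemma klist_eq P P' k k' w : klist P k w -> P =1 P' ->
  (forall i j, P i -> P j -> (k i < k j) = (k' i < k' j)) -> klist P' k' w.
Proof.
move=> [wP sw] PP kk; split=> [i|]; first by rewrite wP PP.
move: sw; rewrite !(sorted_pairwise (key_trans (k := _))) => pw.
apply: (sub_in_pairwise (P := P)) pw; first by move=> i j Pi Pj; rewrite kk.
by apply/allP => i; rewrite wP.
Qed.

Lemma klist_exists P k : {in P &, injective k} -> exists w, klist P k w.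
Proof.
move=> kinj; exists (sort (fun i j => k i <= k j) [seq i <- enum I | P i]).
have mE i : i \in sort (fun i j => k i <= k j) [seq i <- enum I | P i] = P i.
  by rewrite mem_sort mem_filter mem_enum andbT.
split=> [i|]; first by rewrite mE.
have le_tr : transitive (fun i j => k i <= k j) by move=> j i l; apply: le_trans.
have : sorted (fun i j => k i <= k j) (sort (fun i j => k i <= k j) [seq i <- enum I | P i]).
  by apply: sort_sorted => i j; apply: le_total.
rewrite (sorted_pairwise le_tr) (sorted_pairwise (key_trans (k := k))) => pw.
have : pairwise (fun i j => i != j) (sort (fun i j => k i <= k j) [seq i <- enum I | P i]).
  by rewrite -uniq_pairwise sort_uniq filter_uniq // enum_uniq.
have : all P (sort (fun i j => k i <= k j) [seq i <- enum I | P i]).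
  by apply/allP => i; rewrite mE.
elim: (sort _ _) pw => //= i w IH /andP[li pw] /andP[Pi Pw] /andP[ni nw].
rewrite IH // andbT; apply/allP => j jw; rewrite lt_neqAle (allP li) // andbT.
apply/eqP => /kinj ij; have /allP/(_ j jw)/negP := ni; apply; apply/eqP/ij => //.
exact: (allP Pw).
Qed.

(** For a coarse key [k0] refined by [k], the sorted list is the concatenation of the sorted level
    sets of [k0]; levels may be empty. *)
Lemma klist_split P k (k0 : I -> R) (cs : seq R) (ws : R -> seq I) :
    sorted <%R cs -> (forall i, P i -> k0 i \in cs) ->
    (forall i j, P i -> P j -> k0 i < k0 j -> k i < k j) ->
    (forall c, c \in cs -> klist (fun i => P i && (k0 i == c)) k (ws c)) ->
  klist P k (flatten [seq ws c | c <- cs]).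
Proof.
move=> scs Pcs kk0 wsP.
suff main cs' : {subset cs' <= cs} -> sorted <%R cs' ->
    klist (fun i => P i && (k0 i \in cs')) k (flatten [seq ws c | c <- cs']).
  apply: klist_eq (main cs _ scs) _ _ => // i.
  by case Pi: (P i) => //=; rewrite Pcs.
elim: cs' => [|c cs' IH] sub scs'; first by split=> // i; rewrite in_nil andbF.
have csub : c \in cs by apply: sub; rewrite mem_head.
have [mw sw] := wsP c csub.
have [|//|mf sf] := IH; first by move=> d dcs; apply: sub; rewrite inE dcs orbT.
  exact: path_sorted scs'.
split=> [i|].
  rewrite /= mem_cat mw mf inE; case: (P i) => //=.
move: sw sf; rewrite /= !(sorted_pairwise (key_trans (k := _))) pairwise_cat => -> ->.
rewrite !andbT; apply/allrelP => i j; rewrite mw mf => /andP[Pi /eqP ic] /andP[Pj jc].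
apply: kk0 => //; rewrite ic; move: scs'; rewrite /= (path_sortedE lt_trans) => /andP[/allP h _].
exact: h.
Qed.

End KeyLists.

(** * Wall crossing in the picture group *)

Section SlopeWords.
Context (R : realType) (n : nat) (Q : valued_quiver n) (m : nat) (S : root_data R Q m).
Implicit Types (x y p d v Y : 'rV[R]_n) (i j l g A B : 'I_m).

Local Notation pr := (pr S).
Local Notation E := (rE S).
Local Notation sub := (rsub S).
Local Notation wallb := (onwall S).
Local Notation stable := (stable S).
Local Notation combo := (combo S).
Local Notation pairb := (pairb S).
Local Notation mid := (mid S).

Definition midb A B l : bool := `[< mid A B l >].

(* for l = aA + bB, a strictly increasing function of a/b, also defined at b = 0 *)
Definition slope A B l : R := E A l / (E A l + E l B).

Lemma slope_lt A B l g a b a' b' : pairb A B -> 0 <= a -> 0 <= b -> 0 <= a' -> 0 <= b' ->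
  combo l A B a b -> combo g A B a' b' -> (slope A B l < slope A B g) = (a * b' < a' * b).
Proof.
move=> AB a0 b0 a'0 b'0 cl cg; rewrite /slope.
rewrite (combo_coefl AB cl) (combo_coefr AB cl) (combo_coefl AB cg) (combo_coefr AB cg).
have EA := rE_gt0 S A; have EB := rE_gt0 S B.
have pos u w : 0 <= u -> 0 <= w -> 0 < u + w -> 0 < u * E A A + w * E B B.
  move=> u0 w0 uw; have [u1|u1] := ltP 0 u.
    by apply: ltr_pwDl; [exact: mulr_gt0 | apply: mulr_ge0 => //; exact: ltW].
  by apply: ltr_wpDl; [apply: mulr_ge0 => //; exact: ltW | apply: mulr_gt0 => //; lra].
rewrite ltr_pdivrMr ?pos ?(combo_sum_gt0 _ _ cl) // mulrAC ltr_pdivlMr ?pos ?(combo_sum_gt0 _ _ cg) //.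
rewrite !mulrDr [a' * E A A * (a * E A A)]mulrC ltrD2l.
have -> : a * E A A * (b' * E B B) = (a * b') * (E A A * E B B) by ring.
have -> : a' * E A A * (b * E B B) = (a' * b) * (E A A * E B B) by ring.
by rewrite ltr_pM2r // mulr_gt0.
Qed.

Lemma slope_inj A B : pairb A B -> {in midb A B &, injective (slope A B)}.
Proof.
move=> AB l g /asboolP[a [b cl]] /asboolP[a' [b' cg]] e.
apply: (combo_same_slope (ler0n _ _) (ler0n _ _) (ler0n _ _) (ler0n _ _) cl cg).
apply/eqP; rewrite eq_le !leNgt.
rewrite -(slope_lt AB (ler0n _ _) (ler0n _ _) (ler0n _ _) (ler0n _ _) cl cg).
rewrite -(slope_lt AB (ler0n _ _) (ler0n _ _) (ler0n _ _) (ler0n _ _) cg cl).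
by rewrite e ltxx.
Qed.

(** The right-hand side of the rank two relation; by [swP] the default value does not occur for a
    pair. *)
Definition sw A B : seq 'I_m :=
  if pselect (exists w, klist (midb A B) (slope A B) w) is left h then sval (cid h) else [::].

Lemma swP A B : pairb A B -> klist (midb A B) (slope A B) (sw A B).
Proof.
move=> AB; rewrite /sw; case: pselect => [h|no]; first exact: (svalP (cid h)).
by case: no; apply: klist_exists; apply: slope_inj.
Qed.

(** As the relation reads A B = B [phi A B], this word is the conjugate of A by B, written with
    letters laterally before B. *)
Definition phi A B : seq 'I_m := behead (sw A B).

Lemma mem_sw A B l : pairb A B -> (l \in sw A B) = midb A B l.
Proof. by move=> /swP[-> _]. Qed.

Lemma slope_r A B : pairb A B -> slope A B B = 0.
Proof. by move=> AB; rewrite /slope (pair_E0 AB) mul0r. Qed.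

Lemma slope_gt0 A B l : pairb A B -> mid A B l -> l != B -> 0 < slope A B l.
Proof.
move=> AB [a [b c]] lB; rewrite -(slope_r AB).
rewrite (slope_lt AB _ _ _ _ (combo_r S A B) c) ?ler0n ?ler01 // mul0r mulr1 lt_neqAle ler0n andbT.
apply: contra lB => /eqP a0; have b1 := combo_sum_gt0 (ler0n _ _) (ler0n _ _) c.
by apply/eqP; apply: (@nonprop _ _ _ _ S _ _ b%:R) => x; rewrite c -a0 mul0r add0r.
Qed.

Lemma sw_cons A B : pairb A B -> sw A B = B :: phi A B.
Proof.
move=> AB; have [mw sww] := swP AB; rewrite /phi; case E0: (sw A B) mw sww => [|h w] mw.
  by have := mw B; rewrite in_nil => /esym/asboolP[]; apply: mid_r.
rewrite /= (path_sortedE (key_trans (k := slope A B))) => /andP[/allP hall _].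
suff -> : h = B by [].
have := mw B; rewrite /midb asboolT ?inE; last exact: mid_r.
case/orP => [/eqP //|/hall]; rewrite slope_r // => h0.
have mh : mid A B h by apply/asboolP; have := mw h; rewrite mem_head => /esym.
apply/eqP/negPn/negP => hB; have := slope_gt0 AB mh hB.
by rewrite ltNge ltW.
Qed.

Lemma phiP A B : pairb A B -> klist (fun l => midb A B l && (l != B)) (slope A B) (phi A B).
Proof.
move=> AB; have [mw sww] := swP AB; rewrite sw_cons // in mw sww; split; last exact: path_sorted sww.
move=> l; have := mw l; rewrite inE => <-; have [->|] := eqVneq l B; last by rewrite andbT.
move: sww; rewrite /= (path_sortedE (key_trans (k := slope A B))) => /andP[/allP h _].
by rewrite ?andbF; apply/negP => /h; rewrite ltxx.
Qed.

Lemma mem_phi A B l : pairb A B -> (l \in phi A B) = midb A B l && (l != B).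
Proof. by move=> /phiP[-> _]. Qed.

(** The line [Y + s *: d] meets H(j) at [s = - ctime d Y j]; [tie] compares two meeting parameters
    after clearing denominators, and is therefore linear in Y. *)
Definition ctime d Y j : R := pr Y j / pr d j.
Definition tie d Y i j : R := pr Y i * pr d j - pr Y j * pr d i.

(** Where the line meets H(j), the value of l is [tie d Y l j / pr d j], so the last condition puts
    that point on D(j). Close to p, only subroots whose wall contains p can violate it. *)
Definition vis p d Y j : bool := [&& wallb p j, 0 < pr d j &
  [forall l, (wallb p l && sub l j) ==> (tie d Y l j <= 0)]].

(* w lists the walls through p which the line Y + R d crosses when moved to an
   infinitesimal neighbourhood of p, in the order opposite to d. *)
Definition isW p d Y w : Prop := klist (vis p d Y) (fun j => - ctime d Y j) w.

Lemma tie_linear d i j a x y : tie d (a *: x + y) i j = a * tie d x i j + tie d y i j.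
Proof. by rewrite /tie !prD !prZ; ring. Qed.

Lemma tt_lt d Y i j : 0 < pr d i -> 0 < pr d j ->
  (- ctime d Y i < - ctime d Y j) = (0 < tie d Y i j).
Proof.
move=> di dj; rewrite ltrN2 /ctime ltr_pdivrMr // mulrAC ltr_pdivlMr // /tie subr_gt0.
by [].
Qed.

Lemma visP p d Y j : reflect [/\ wallb p j, 0 < pr d j &
  forall l, wallb p l -> sub l j -> tie d Y l j <= 0] (vis p d Y j).
Proof.
apply: (iffP and3P) => -[w dj h]; split=> //; first by move=> l wl s; have /implyP := forallP h l;
  rewrite wl s; apply.
by apply/forallP => l; apply/implyP => /andP[wl s]; apply: h.
Qed.

(** Subroots that are nonzero at p keep their sign, so among the walls through p the direction alone
    decides. *)
Lemma wall_near p (eta : 'rV[R]_n) e :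
    (forall j, Num.sg (pr (p + e *: eta) j) =
       if pr p j == 0 then Num.sg (pr eta j) else Num.sg (pr p j)) ->
  forall j, wallb (p + e *: eta) j <->
    [/\ wallb p j, pr eta j = 0 & forall l, wallb p l -> sub l j -> pr eta l <= 0].
Proof.
move=> eP j; split=> [w|[w e0 h]]; last first.
  rewrite /onwall -sgr_eq0 eP (wall_eq0 w) eqxx sgr_eq0 e0 eqxx; apply/FwP => l s.
  rewrite -sgr_le0 eP; case: eqVneq => [p0|pl]; first by rewrite sgr_le0 h // (wall_sub w).
  by rewrite sgr_le0; apply: (FwP _ _ _ (wall_fw w)).
have p0 : pr p j = 0.
  apply/eqP/negPn/negP => pj; have := eP j; rewrite (negPf pj) (wall_eq0 w) sgr0 => /esym/eqP.
  by rewrite sgr_eq0 (negPf pj).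
have wp : wallb p j.
  rewrite /onwall p0 eqxx; apply/FwP => l s; rewrite leNgt; apply/negP => pl.
  have := FwP _ _ _ (wall_fw w) l s; rewrite -sgr_le0 eP gt_eqF //.
  by rewrite gtr0_sg // ler10.
split=> // [|l wl s].
  by apply/eqP; rewrite -sgr_eq0; have := eP j; rewrite p0 eqxx (wall_eq0 w) sgr0 => <-.
by have := FwP _ _ _ (wall_fw w) l s; rewrite -sgr_le0 eP (wall_eq0 wl) eqxx sgr_le0.
Qed.

Lemma combo_tie d Y A B l g a b a' b' : combo l A B a b -> combo g A B a' b' ->
  tie d Y l g = (a * b' - a' * b) * tie d Y A B.
Proof. by move=> cl cg; rewrite /tie !cl !cg; ring. Qed.

(** On this side of the codimension two stratum an intermediate wall l is hidden: its subroot A is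
    positive where the line meets H(l). *)
Lemma isW_apart p d v A B : stable p A -> stable p B -> pairb A B -> planar2 S p A B ->
  0 < pr d A -> 0 < pr d B -> 0 < tie d v A B -> isW p d v [:: A; B].
Proof.
move=> sA sB AB pl dA dB DAB; have mP := planar_wallP sA sB AB pl.
have only C l : stable p C -> wallb p l -> sub l C -> l = C.
  move=> [_ neg] wl s; apply/eqP/negPn/negP => lC.
  by have := neg l s lC; rewrite (wall_eq0 wl) ltxx.
split=> [l|]; last by rewrite /= andbT tt_lt.
rewrite !inE; apply/orP/visP => [lAB|[wl dl h]]; last first.
  apply/orP/negPn/negP; rewrite negb_or => /andP[lA lB].
  have [s _] := planar_mid sA sB AB pl wl lA lB; have := h A (proj1 sA) s.
  have [a [b c]] := iffLR (mP l) wl; rewrite (combo_tie _ _ (combo_l S A B) c).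
  rewrite mul1r mulr0 subr0 leNgt mulr_gt0 // lt_neqAle ler0n andbT.
  apply: contra lA => /eqP b0; apply/eqP; apply: (@nonprop _ _ _ _ S _ _ a%:R) => x.
  by rewrite c -b0 mul0r addr0.
have dd C : tie d v C C <= 0 by rewrite /tie mulrC subrr.
by case: lAB => /eqP ->; split=> //; [case: sA| |case: sB|] => // g wg /only ->.
Qed.

(** On the other side every intermediate wall is seen, in slope order: a subroot g of l has the
    larger slope by [combo_E_order], hence is negative where the line meets H(l). Together with
    [isW_apart] this gives the two sides of the picture relation; the filter allows d to be parallel
    to H(B). *)
Lemma isW_meet p d v A B : stable p A -> stable p B -> pairb A B -> planar2 S p A B ->
  0 < pr d A -> 0 <= pr d B -> tie d v A B < 0 -> isW p d v [seq l <- sw A B | 0 < pr d l].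
Proof.
move=> sA sB AB pl dA dB DAB; have mP := planar_wallP sA sB AB pl.
have [mw sww] := swP AB.
split=> [l|].
  rewrite mem_filter mw; apply/andP/visP => [[dl /asboolP ml]|[wl dl h]]; last first.
    by split=> //; apply/asboolP/mP.
  split=> //; first exact/mP.
  move=> g wg s; have [->|gl] := eqVneq g l; first by rewrite /tie mulrC subrr.
  have [a [b cl]] := ml; have [a' [b' cg]] := iffLR (mP g) wg.
  have := combo_E_order AB cg cl gl (rsub_hom s).
  rewrite (combo_tie _ _ cg cl) => lt1; apply: mulr_ge0_le0; last exact: ltW.
  by rewrite subr_ge0 ltW // mulrC.
move: sww; rewrite (sorted_pairwise (key_trans (k := _))) => /(pairwise_filter (fun l => 0 < pr d l)).
move=> pw; rewrite (sorted_pairwise (key_trans (k := _))).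
apply: (sub_in_pairwise (P := fun l => midb A B l && (0 < pr d l))) pw; last first.
  by apply/allP => l; rewrite mem_filter mw andbC.
move=> l g /andP[/asboolP[a [b cl]] dl] /andP[/asboolP[a' [b' cg]] dg].
rewrite (slope_lt AB _ _ _ _ cl cg) ?ler0n // tt_lt // (combo_tie _ _ cl cg) => lt1.
by rewrite nmulr_lgt0 // subr_lt0.
Qed.

(** The word of the displaced line falls into groups, one for each parameter c at which the line of
    Y meets walls; the group at c is the word of v at a point infinitesimally displaced from p in
    the direction [Y + c *: d]. *)
Lemma isW_group p d Y v : (forall j, wallb p j -> 0 <= pr d j) ->
  exists2 e, 0 < e & forall e', 0 < e' -> e' <= e ->
  forall (p1 : R -> 'rV[R]_n) (ws : R -> seq 'I_m) (cs : seq R),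
    (forall c, exists h, p1 c = p + h *: (Y + c *: d) /\ forall j, Num.sg (pr (p1 c) j) =
       if pr p j == 0 then Num.sg (pr (Y + c *: d) j) else Num.sg (pr p j)) ->
    (forall c, c \in cs -> isW (p1 c) d v (ws c)) ->
    sorted <%R cs -> (forall j, vis p d Y j -> - ctime d Y j \in cs) ->
  isW p d (Y + e' *: v) (flatten [seq ws c | c <- cs]).
Proof.
move=> dge; have [e e0 eP] := @perturb_fun R n _ (fun (k : 'I_m * 'I_m) x => tie d x k.1 k.2) Y v
  (fun k a x y => tie_linear d k.1 k.2 a x y).
exists e => // e' e'0 e'e p1 ws cs p1P wsP scs csP.
have DP i j : Num.sg (tie d (Y + e' *: v) i j) =
    if tie d Y i j == 0 then Num.sg (tie d v i j) else Num.sg (tie d Y i j).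
  exact: (eP e' (i, j)).
have vis_coarse j : vis p d (Y + e' *: v) j -> vis p d Y j.
  move=> /visP[w dj h]; apply/visP; split=> // l wl s; rewrite leNgt; apply/negP => D0.
  by have := h l wl s; rewrite -sgr_le0 DP gt_eqF // gtr0_sg // ler10.
have key c j : 0 < pr d j -> (- ctime d Y j == c) = (pr (Y + c *: d) j == 0).
  move=> dj; rewrite prD prZ addr_eq0 /ctime eqr_oppLR -(inj_eq (mulIf (lt0r_neq0 dj))).
  by rewrite (divfK (lt0r_neq0 dj)) mulNr.
apply: (@klist_split _ _ _ _ (fun j => - ctime d Y j)) => // [j /vis_coarse/csP //|i j|c cc].
  move=> /visP[_ di _] /visP[_ dj _]; rewrite !tt_lt // => D0.
  by rewrite -sgr_gt0 DP gt_eqF // sgr_gt0.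
have [h [p1E p1S]] := p1P c.
have nearP := wall_near (fun j => etrans (congr1 (fun z => Num.sg (pr z j)) (esym p1E)) (p1S j)).
have DDc l j : pr (Y + c *: d) j = 0 -> tie d Y l j = pr (Y + c *: d) l * pr d j.
  rewrite !prD !prZ => /eqP; rewrite addr_eq0 /tie => /eqP ->; ring.
apply: (klist_eq (wsP c cc)) => [j|i j].
  apply/visP/andP => [[w1 dj h1]|[/visP[w dj h1]]]; last first.
    rewrite key // => /eqP jc.
    have w1 : wallb (p1 c) j.
      rewrite p1E; apply/nearP; split=> // l wl s; rewrite -(pmulr_lle0 _ dj) -DDc //.
      rewrite leNgt; apply/negP => D0; have := h1 l wl s.
      by rewrite -sgr_le0 DP gt_eqF // gtr0_sg // ler10.
    split=> // l; rewrite p1E => /nearP[wl lc _] s; have := h1 l wl s.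
    by rewrite -sgr_le0 DP DDc // lc mul0r eqxx sgr_le0.
  move: (w1); rewrite p1E => /nearP[w jc hc]; rewrite key // jc eqxx; split=> //.
  apply/visP; split=> // l wl s; rewrite -sgr_le0 DP DDc //.
  case: eqVneq => [/eqP|]; last by rewrite sgr_le0 (pmulr_lle0 _ dj) hc.
  rewrite mulf_eq0 (gt_eqF dj) orbF => /eqP lc; rewrite sgr_le0; apply: h1 => //.
  by rewrite p1E; apply/nearP; split=> // g wg sg; apply: hc => //; apply: rsub_trans s.
move=> /visP[w1 di _] /visP[w1' dj _]; rewrite !tt_lt //.
move: w1 w1'; rewrite p1E => /nearP[_ ic _] /nearP[_ jc _].
by rewrite -[RHS]sgr_gt0 DP (DDc i j jc) ic mul0r eqxx sgr_gt0.
Qed.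

End SlopeWords.

(** Connectedness of [0, 1] for values in a bare type, by a supremum argument. *)
Lemma locally_constant (R : realType) (T : Type) (L : R -> T) :
  (forall s0, 0 <= s0 <= 1 -> exists2 e, 0 < e &
     forall s, 0 <= s <= 1 -> `|s - s0| < e -> L s = L s0) -> L 1 = L 0.
Proof.
move=> loc; pose A : set R := [set s | 0 <= s <= 1 /\ forall s', 0 <= s' <= s -> L s' = L 0]%classic.
have A0 : A 0.
  split=> [|s' /andP[s0 s1]]; first by rewrite lexx ler01.
  by congr L; apply/eqP; rewrite eq_le s1 s0.
have supA : has_sup A by split; [exists 0 | exists 1 => s [/andP[]]].
set c := sup A.
have c0 : 0 <= c by apply: sup_upper_bound.
have c1 : c <= 1 by apply: ge_sup; [exists 0 | move=> s [/andP[]]].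
have [|e e0 eP] := loc c; first by rewrite c0.
have [s1 [/andP[s10 s11] s1P] s1c] := sup_adherent e0 supA.
have s1c' : s1 <= c by apply: sup_upper_bound => //; split=> //; rewrite s10.
have Lc : L c = L 0.
  rewrite -(s1P s1) ?s10 ?lexx //; apply/esym/eP; rewrite ?s10 //.
  by rewrite ler0_norm ?subr_le0 // -/c in s1c *; lra.
pose t := Num.min 1 (c + e / 2).
have At : A t.
  split=> [|s' /andP[s'0]].
    rewrite /t ge_min lexx andbT le_min ler01 /=; lra.
  rewrite /t le_min => /andP[s'1 s'c]; have [le1|lt1] := leP s' s1.
    by apply: s1P; rewrite s'0.
  rewrite -Lc; apply: eP; first by rewrite s'0.
  by rewrite -/c in s1c; rewrite ltr_norml; apply/andP; split; lra.
have tc : t <= c by apply: sup_upper_bound.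
suff t1 : t = 1 by case: At => _; apply; rewrite t1 lexx ler01.
by move: tc; rewrite /t minElt; case: ifP => // _; rewrite gerDl leNgt divr_gt0.
Qed.

(** * Invariance of the word of a line under deformation *)

Section Invariance.
Context (R : realType) (n : nat) (Q : valued_quiver n) (m : nat) (S : root_data R Q m).
Implicit Types (x y v Y Z : 'rV[R]_n) (i j l g A B : 'I_m).

Local Notation pr := (pr S).
Local Notation sub := (rsub S).
Local Notation wallb := (onwall S).
Local Notation combo := (combo S).
Local Notation pairb := (pairb S).
Local Notation DD := (tie S).
Local Notation tt := (ctime S).
Local Notation vis := (vis S).
Local Notation isW := (isW S).

(** Two instances occur: p = 0, d = (1, ..., 1), c0 = 0 for the value of a point, and c0 = -1 near a
    rank three stratum. [C] is a region of lines, none of which lies in a hyperplane parallel to d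
    of a wall through p, or has a visible wall exactly at the threshold [c0]. *)
Variables (p d : 'rV[R]_n) (H : groupType) (f : 'I_m -> H) (C : 'rV[R]_n -> Prop) (c0 : R).
Hypothesis dge : forall j, wallb p j -> 0 <= pr d j.
Hypothesis Cconv : forall Y Z s, C Y -> C Z -> 0 <= s -> s <= 1 -> C (Y + s *: (Z - Y)).
Hypothesis Copen : forall Y v, C Y -> exists2 e, 0 < e &
  forall e', 0 < e' -> e' <= e -> C (Y + e' *: v).
Hypothesis Cnz : forall Y l, C Y -> wallb p l -> pr d l = 0 -> pr Y l != 0.
Hypothesis Cbase : forall Y j, C Y -> vis p d Y j -> tt d Y j != c0.
Hypothesis f_pair : forall A B, pairb A B -> wallb p A -> wallb p B ->
  0 < pr d A -> 0 < pr d B -> wprod f [:: A; B] = wprod f (sw S A B).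

Let J j := wallb p j && (0 < pr d j).

Definition no_ties Y : Prop := forall i j, J i -> J j -> i != j -> DD d Y i j != 0.

Definition wval Y h : Prop :=
  exists2 w, isW p d Y w & h = wprod f [seq j <- w | c0 < tt d Y j].

Lemma wval_fun Y h h' : wval Y h -> wval Y h' -> h = h'.
Proof. by move=> [w iw ->] [w' iw' ->]; rewrite (klist_uniq iw iw'). Qed.

Lemma visJ Y j : vis p d Y j -> J j.
Proof. by move=> /visP[w dj _]; rewrite /J w. Qed.

Lemma tie_self Y j : DD d Y j j = 0. Proof. by rewrite /tie mulrC subrr. Qed.

Lemma isW_exists Y : no_ties Y -> exists w, isW p d Y w.
Proof.
move=> nt; apply: klist_exists => i j /visJ Ji /visJ Jj /eqP; rewrite eqr_opp => /eqP e.
apply/eqP/negPn/negP => ij; case/negP: (nt i j Ji Jj ij); move: Ji Jj e => /andP[_ di] /andP[_ dj].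
move/eqP; rewrite /ctime eqr_div ?lt0r_neq0 // => /eqP e.
by rewrite /tie e subrr.
Qed.

(** At worst codimension two: walls met simultaneously belong to one plane of roots. *)
Definition tame Y : Prop := forall i j l, J i -> J j -> J l -> i != j ->
  DD d Y i j = 0 -> DD d Y i l = 0 -> exists a b, combo l i j a b.

Lemma sort_lt_cs (s : seq R) : sorted <%R (sort <=%R (undup s)).
Proof. by rewrite lt_sorted_uniq_le sort_uniq undup_uniq sort_sorted //; apply: le_total. Qed.

(** At each parameter the line of Y meets either a single wall, seen from both sides, or a plane of
    walls, whose two local words are [[:: A; B]] and [sw S A B]; the relations identify the
    products. *)
Lemma two_sides Y v : C Y -> tame Y ->
    (forall i j, J i -> J j -> i != j -> DD d Y i j = 0 -> DD d v i j != 0) ->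
  exists h, exists2 e, 0 < e & (forall e', 0 < e' -> e' <= e ->
    wval (Y + e' *: v) h /\ wval (Y - e' *: v) h) /\ (no_ties Y -> wval Y h).
Proof.
move=> CY tY vY.
pose cs := sort <=%R (undup [seq - tt d Y j | j <- enum 'I_m]).
have scs : sorted <%R cs by apply: sort_lt_cs.
have csP j : - tt d Y j \in cs.
  by rewrite mem_sort mem_undup; apply/map_f; rewrite mem_enum.
have ex_p1 c : exists p1, exists h, p1 = p + h *: (Y + c *: d) /\ forall j, Num.sg (pr p1 j) =
    if pr p j == 0 then Num.sg (pr (Y + c *: d) j) else Num.sg (pr p j).
  by have [h _ hP] := perturb1 S p (Y + c *: d); exists (p + h *: (Y + c *: d)), h.
pose p1 c := sval (cid (ex_p1 c)).
have p1P c : exists h, p1 c = p + h *: (Y + c *: d) /\ forall j, Num.sg (pr (p1 c) j) =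
    if pr p j == 0 then Num.sg (pr (Y + c *: d) j) else Num.sg (pr p j).
  exact: svalP (cid (ex_p1 c)).
have near c j : wallb (p1 c) j <->
    [/\ wallb p j, pr (Y + c *: d) j = 0 & forall l, wallb p l -> sub l j -> pr (Y + c *: d) l <= 0].
  have [h [p1E p1S]] := p1P c.
  by rewrite p1E; apply: wall_near => i; rewrite -p1E.
have p1J c j : wallb (p1 c) j -> J j.
  move=> /near[w e _]; rewrite /J w lt_neqAle dge // andbT eq_sym; apply/eqP => d0.
  by case/negP: (Cnz CY w d0); move: e; rewrite prD prZ d0 mulr0 addr0 => ->.
have p1t c j : wallb (p1 c) j -> tt d Y j = - c.
  move=> w; have /andP[_ dj] := p1J _ _ w; have [_ e _] := iffLR (near c j) w.
  move: e; rewrite prD prZ => /eqP; rewrite addr_eq0 /ctime => /eqP ->.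
  by rewrite mulNr mulfK // gt_eqF.
have p1vis c j : wallb (p1 c) j -> vis p d Y j.
  move=> w; have /andP[wj dj] := p1J _ _ w; have [_ e h] := iffLR (near c j) w.
  apply/visP; split=> // l wl s; have := h l wl s.
  have tj := p1t c j w; rewrite /tie -subr_le0 subr0 !prD !prZ in e *.
  have -> : pr Y j = - c * pr d j by move/eqP: e; rewrite addr_eq0 mulNr => /eqP.
  have -> : pr Y l * pr d j - - c * pr d j * pr d l = (pr Y l + c * pr d l) * pr d j by ring.
  by rewrite pmulr_lle0.
have p1DD c i j : wallb (p1 c) i -> wallb (p1 c) j -> DD d Y i j = 0.
  move=> /near[_ ic _] /near[_ jc _]; move: ic jc; rewrite !prD !prZ => /eqP + /eqP.
  by rewrite !addr_eq0 /tie => /eqP -> /eqP ->; ring.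
have local c : exists ws ws', [/\ isW (p1 c) d v ws, isW (p1 c) d (- v) ws',
    wprod f ws = wprod f ws' & forall j, j \in ws ++ ws' -> wallb (p1 c) j].
  have inw u ws : isW (p1 c) d u ws -> forall j, j \in ws -> wallb (p1 c) j.
    by move=> [mw _] j; rewrite mw => /visP[].
  (* At most one wall through [p1 c]: the local words on both sides coincide. *)
  have [[i [j [wi wj ij]]]|no2] := pselect (exists i j, [/\ wallb (p1 c) i, wallb (p1 c) j & i != j]); last first.
    have only i j : wallb (p1 c) i -> wallb (p1 c) j -> i = j.
      by move=> wi wj; apply/eqP/negPn/negP => ij; apply: no2; exists i, j.
    have visE u j : vis (p1 c) d u j = wallb (p1 c) j.
      apply/visP/idP => [[]//|w]; split=> //; first by have /andP[] := p1J _ _ w.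
      by move=> l wl _; rewrite (only l j) // tie_self.
    have [ws iw] : exists ws, isW (p1 c) d v ws.
      by apply: klist_exists => i j /visP[wi _ _] /visP[wj _ _] _; apply: only.
    have iw' : isW (p1 c) d (- v) ws.
      apply: (klist_eq iw) => [j|i j]; first by rewrite !visE.
      by rewrite !visE => wi wj; rewrite (only i j) // !ltxx.
    exists ws, ws; split=> // j; rewrite mem_cat orbb; exact: inw iw j.
  have plan : planar S (p1 c).
    move=> a b l wa wb wl ab; apply: (tY a b l (p1J _ _ wa) (p1J _ _ wb) (p1J _ _ wl) ab).
      exact: p1DD wa wb.
    exact: p1DD wa wl.
  have [A [B [sA sB AB pl2]]] := planar_pair plan wi wj ij.
  have [wA _] := sA; have [wB _] := sB.
  have /andP[wpA dA] := p1J _ _ wA; have /andP[wpB dB] := p1J _ _ wB.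
  have DN u : DD d (- u) A B = - DD d u A B by rewrite /tie !prN; ring.
  have meet u : DD d u A B < 0 -> isW (p1 c) d u (sw S A B).
    move=> D0; have := isW_meet sA sB AB pl2 dA (ltW dB) D0.
    rewrite (_ : [seq l <- _ | _] = sw S A B) //; apply/all_filterP/allP => l.
    rewrite mem_sw // => /asboolP/(planar_wallP sA sB AB pl2)/p1J.
    by case/andP.
  have eqf := f_pair AB wpA wpB dA dB.
  have := vY A B (p1J _ _ wA) (p1J _ _ wB) (pair_neq AB) (p1DD _ _ _ wA wB).
  rewrite neq_lt => /orP[D0|D0].
    exists (sw S A B), [:: A; B]; split=> //; first exact: meet.
      by apply: isW_apart => //; rewrite DN oppr_gt0.
    move=> l; rewrite mem_cat => /orP[|]; first exact: inw (meet _ D0) l.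
    by rewrite !inE => /orP[]/eqP->.
  have D0' : DD d (- v) A B < 0 by rewrite DN oppr_lt0.
  exists [:: A; B], (sw S A B); split=> //; first exact: isW_apart.
    exact: meet.
  move=> l; rewrite mem_cat => /orP[|]; last exact: inw (meet _ D0') l.
  by rewrite !inE => /orP[]/eqP->.
pose ws c := sval (cid (local c)); pose ws' c := sval (cid (svalP (cid (local c)))).
have wsP c : [/\ isW (p1 c) d v (ws c), isW (p1 c) d (- v) (ws' c),
    wprod f (ws c) = wprod f (ws' c) & forall j, j \in ws c ++ ws' c -> wallb (p1 c) j].
  exact: svalP (cid (svalP (cid (local c)))).
have [e1 e10 e1P] := isW_group Y v dge; have [e2 e20 e2P] := isW_group Y (- v) dge.
have [e3 e30 e3P] := perturb S (Y - c0 *: d) v; have [e4 e40 e4P] := perturb S (Y - c0 *: d) (- v).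
have [e5 e50 e5P] := @perturb_fun R n _ (fun (k : 'I_m * 'I_m) x => DD d x k.1 k.2) Y v
  (fun k a x y => tie_linear S d k.1 k.2 a x y).
(* The threshold keeps or drops whole groups, since no wall of Y is visible exactly at [c0]. *)
pose trunc (ws : R -> seq 'I_m) := flatten [seq (if c < - c0 then ws c else [::]) | c <- cs].
have thr e' u j : 0 < pr d j -> vis p d Y j ->
    (forall j, Num.sg (pr (Y - c0 *: d + e' *: u) j) = if pr (Y - c0 *: d) j == 0 then
       Num.sg (pr u j) else Num.sg (pr (Y - c0 *: d) j)) ->
    (c0 < tt d (Y + e' *: u) j) = (c0 < tt d Y j).
  move=> dj vj sg.
  have eqv Z : (c0 < tt d Z j) = (0 < pr (Z - c0 *: d) j).
    by rewrite prB prZ subr_gt0 /ctime ltr_pdivlMr.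
  have nz : pr (Y - c0 *: d) j != 0.
    rewrite prB prZ subr_eq0; apply: contra (Cbase CY vj) => /eqP e.
    by rewrite /ctime e mulfK // gt_eqF.
  by rewrite !eqv addrAC -sgr_gt0 sg (negPf nz) sgr_gt0.
have cut e' u (us : R -> seq 'I_m) : (forall c j, j \in us c -> wallb (p1 c) j) ->
    (forall j, Num.sg (pr (Y - c0 *: d + e' *: u) j) = if pr (Y - c0 *: d) j == 0 then
       Num.sg (pr u j) else Num.sg (pr (Y - c0 *: d) j)) ->
    [seq j <- flatten [seq us c | c <- cs] | c0 < tt d (Y + e' *: u) j] = trunc us.
  move=> usP sg; rewrite /trunc filter_flatten -map_comp; congr flatten.
  apply: eq_map => c /=; have jP j : j \in us c -> (c0 < tt d (Y + e' *: u) j) = (c < - c0).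
    move=> /usP w; have /andP[_ dj] := p1J _ _ w; rewrite (thr e' u j dj (p1vis _ _ w) sg).
    by rewrite (p1t _ _ w) ltrNr.
  case: ifPn => cc.
    by apply/all_filterP/allP => j /jP ->.
  by apply/eqP; rewrite -size_eq0 size_filter -leqn0 leqNgt -has_count; apply/hasPn => j /jP ->.
have wsin c j : j \in ws c -> wallb (p1 c) j.
  by have [_ _ _ h] := wsP c => jw; apply: h; rewrite mem_cat jw.
have wsin' c j : j \in ws' c -> wallb (p1 c) j.
  by have [_ _ _ h] := wsP c => jw; apply: h; rewrite mem_cat jw orbT.
have eqtr : wprod f (trunc ws) = wprod f (trunc ws').
  rewrite /trunc; elim: cs {scs csP cut trunc} => //= c cs IH; rewrite !wprod_cat IH.
  by case: ifP => // _; have [_ _ -> _] := wsP c.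
pose e := Num.min e5 (Num.min (Num.min e1 e2) (Num.min e3 e4)).
have e0 : 0 < e by rewrite !lt_min e50 e10 e20 e30 e40.
have plus e' : 0 < e' -> e' <= e -> isW p d (Y + e' *: v) (flatten [seq ws c | c <- cs]) /\
    wval (Y + e' *: v) (wprod f (trunc ws)).
  move=> e'0; rewrite !le_min => /and3P[_ /andP[le1 _] /andP[le3 _]].
  have iw : isW p d (Y + e' *: v) (flatten [seq ws c | c <- cs]).
    by apply: (e1P _ e'0 le1 p1) => // c _; case: (wsP c).
  by split=> //; exists (flatten [seq ws c | c <- cs]); rewrite ?cut // => j; apply: e3P.
exists (wprod f (trunc ws)); exists e => //; split.
  move=> e' e'0 e'e; split; first exact: (plus e' e'0 e'e).2.
  move: e'e; rewrite !le_min => /and3P[_ /andP[_ le2] /andP[_ le4]].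
  rewrite eqtr -scalerN; exists (flatten [seq ws' c | c <- cs]); rewrite ?cut //.
    by apply: (e2P _ e'0 le2 p1) => // c _; case: (wsP c).
  by move=> j; apply: e4P.
move=> nt; have [iw _] := plus e e0 (lexx e).
have e5e : e <= e5 by rewrite ge_min lexx.
have e3e : e <= e3 by rewrite !ge_min lexx !orbT.
have DP i j : Num.sg (DD d (Y + e *: v) i j) =
    if DD d Y i j == 0 then Num.sg (DD d v i j) else Num.sg (DD d Y i j).
  exact: (e5P e (i, j)).
have nz i j : wallb p i -> J j -> i != j -> DD d Y i j != 0.
  move=> wi Jj ij; have [di|di] := ltP 0 (pr d i); first by apply: nt => //; rewrite /J wi.
  have di0 : pr d i = 0 by apply/eqP; rewrite eq_le di dge.
  rewrite /tie di0 mulr0 subr0 mulf_neq0 ?(Cnz CY wi di0) //.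
  by have /andP[_ dj] := Jj; rewrite gt_eqF.
have visE j : vis p d (Y + e *: v) j = vis p d Y j.
  apply/visP/visP => -[w dj h]; split=> // l wl s; have := h l wl s;
    have [->|lj] := eqVneq l j; rewrite ?tie_self //;
    have lz := nz l j wl (introT andP (conj w dj)) lj.
    by rewrite -sgr_le0 DP (negPf lz) sgr_le0.
  by rewrite -[in X in _ -> X]sgr_le0 DP (negPf lz) sgr_le0.
have sg3 j := e3P e j e0 e3e.
exists (flatten [seq ws c | c <- cs]).
  apply: (klist_eq iw) => // i j; rewrite !visE => vi vj.
  have /andP[wi di] := visJ vi; have /andP[wj dj] := visJ vj; rewrite !tt_lt //.
  have [->|ij] := eqVneq i j; first by rewrite !tie_self.
  by rewrite -[LHS]sgr_gt0 DP (negPf (nz i j _ _ _)) ?sgr_gt0 ?/J ?wj.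
rewrite -(cut e v ws) //; congr wprod; apply: eq_in_filter => j.
have [mw _] := iw; rewrite mw visE => vj.
by have /andP[_ dj] := visJ vj; rewrite (thr e v j).
Qed.

Lemma no_ties_dense Y v : no_ties Y ->
  forall s, forall i j, J i -> J j -> i != j -> DD d (Y + s *: v) i j = 0 -> DD d v i j != 0.
Proof.
move=> nt s i j Ji Jj ij; rewrite addrC tie_linear => e; apply/eqP => v0.
by case/negP: (nt i j Ji Jj ij); move: e; rewrite v0 mulr0 add0r => ->.
Qed.

(** [L s] is the common value on both sides of the point of parameter s. Neighbouring parameters
    share points at which both values are computed, so [L] is locally constant. *)
Lemma wval_segment Y Z h : C Y -> C Z -> no_ties Y -> no_ties Z ->
  (forall s, 0 <= s <= 1 -> tame (Y + s *: (Z - Y))) -> wval Y h -> wval Z h.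
Proof.
move=> CY CZ ntY ntZ tm wY; set v := Z - Y.
have ex s : exists h', 0 <= s <= 1 -> exists2 e, 0 < e & (forall e', 0 < e' -> e' <= e ->
    wval (Y + s *: v + e' *: v) h' /\ wval (Y + s *: v - e' *: v) h') /\
    (no_ties (Y + s *: v) -> wval (Y + s *: v) h').
  have [s01|] := boolP (0 <= s <= 1); last by exists h.
  have [|h' [e e0 hP]] := @two_sides (Y + s *: v) v _ (tm s s01) (no_ties_dense ntY (s := s)).
    by case/andP: s01 => s0 s1; apply: Cconv.
  by exists h' => _; exists e.
pose L s := sval (cid (ex s)).
have LP s : 0 <= s <= 1 -> exists2 e, 0 < e & (forall e', 0 < e' -> e' <= e ->
    wval (Y + s *: v + e' *: v) (L s) /\ wval (Y + s *: v - e' *: v) (L s)) /\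
    (no_ties (Y + s *: v) -> wval (Y + s *: v) (L s)).
  exact: svalP (cid (ex s)).
have Y0 : Y + 0 *: v = Y by rewrite scale0r addr0.
have Z1 : Y + 1 *: v = Z by rewrite scale1r /v addrC subrK.
have [|e0 _ [_ /(_ _)]] := LP 0; rewrite ?lexx ?ler01 // Y0 => /(_ ntY) wL0.
have [|e1 _ [_ /(_ _)]] := LP 1; rewrite ?lexx ?ler01 // Z1 => /(_ ntZ) wL1.
rewrite (wval_fun wY wL0) -(_ : L 1 = L 0) //; apply: locally_constant => s0 s01.
have [e e0' [eP _]] := LP s0 s01; exists e => // s s01' se.
have [e' e'0 [e'P _]] := LP s s01'.
have [<-//|ss0] := eqVneq s s0.
pose w := Num.min e' ((e - `|s - s0|) / 2).
have w0 : 0 < w by rewrite lt_min e'0 divr_gt0 // subr_gt0.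
have we' : w <= e' by rewrite ge_min lexx.
have we : `|s - s0| + w <= e.
  have : w <= (e - `|s - s0|) / 2 by rewrite ge_min lexx orbT.
  by move: (`|s - s0|) => z *; lra.
have [wp wm] := e'P w w0 we'.
move: ss0; rewrite neq_lt => /orP[lt|gt].
  have ns : `|s - s0| = s0 - s by rewrite ltr0_norm ?subr_lt0 // opprB.
  have wpos : 0 < s0 - s + w by rewrite addr_gt0 // subr_gt0.
  rewrite ns in we; have [_ h'] := eP _ wpos we; apply: (wval_fun wm).
  suff -> : Y + s *: v - w *: v = Y + s0 *: v - (s0 - s + w) *: v by [].
  by apply/rowP => i; rewrite !mxE; ring.
have ns : `|s - s0| = s - s0 by rewrite gtr0_norm ?subr_gt0.
have wpos : 0 < s - s0 + w by rewrite addr_gt0 // subr_gt0.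
rewrite ns in we; have [h' _] := eP _ wpos we; apply: (wval_fun wp).
suff -> : Y + s *: v + w *: v = Y + s0 *: v + (s - s0 + w) *: v by [].
by apply/rowP => i; rewrite !mxE; ring.
Qed.

(** The path from Y to Y' goes through a generic Z near Y. If (i, j) and (i, l) are tied at one
    point of the segment from an end X to Z, then [F X (i, j, l) Z] vanishes; by genericity this
    functional is identically 0, which puts l in the span of i and j. *)
Theorem wval_invariant Y Y' h : C Y -> C Y' -> no_ties Y -> no_ties Y' ->
  wval Y h -> wval Y' h.
Proof.
move=> CY CY' ntY ntY' wY.
pose F (X : 'rV[R]_n) (k : 'I_m * 'I_m * 'I_m) (Z : 'rV[R]_n) : R :=
  DD d X k.1.1 k.1.2 * DD d Z k.1.1 k.2 - DD d X k.1.1 k.2 * DD d Z k.1.1 k.1.2.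
pose K := ((bool * ('I_m * 'I_m * 'I_m)) + 'I_m * 'I_m)%type.
pose G (k : K) (Z : 'rV[R]_n) : R := match k with
  | inl (b, t) => F (if b then Y else Y') t Z
  | inr (i, j) => DD d Z i j end.
have GL k a x y : G k (a *: x + y) = a * G k x + G k y.
  by case: k => [[b t]|[i j]]; rewrite /G /F !tie_linear //; ring.
have [v _ vP] := @avoid R n _ (fun _ => True) G GL I (fun _ _ _ _ _ => I).
have [e1 e10 e1P] := @perturb_fun R n _ G Y v GL.
have [e2 e20 e2P] := Copen v CY.
pose e := Num.min e1 e2; have e0 : 0 < e by rewrite lt_min e10.
pose Z := Y + e *: v.
have CZ : C Z by apply: e2P => //; rewrite ge_min lexx orbT.
have GZ k : G k Z = 0 -> forall y, G k y = 0.
  move=> GkZ y; apply: vP => //; apply/eqP; rewrite -sgr_eq0.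
  have := e1P e k e0; rewrite ge_min lexx => /(_ isT); rewrite -/Z GkZ sgr0.
  case: eqVneq => [Y0 <-|Yn /esym/eqP]; first by rewrite eqxx.
  by rewrite sgr_eq0 (negPf Yn).
have ntZ : no_ties Z.
  move=> i j /andP[_ di] /andP[_ dj] ij; apply/eqP => e'; case/eqP: ij.
  apply: (@nonprop _ _ _ _ S i j (pr d i / pr d j)) => y.
  have := GZ (inr (i, j)) e' y; rewrite /= /tie => /eqP; rewrite subr_eq0 => /eqP eq1.
  by apply: (mulIf (lt0r_neq0 dj)); rewrite eq1 mulrAC divfK ?gt_eqF // mulrC.
have tameX (b : bool) s : no_ties (if b then Y else Y') -> 0 <= s <= 1 ->
    tame ((if b then Y else Y') + s *: (Z - (if b then Y else Y'))).
  set X := (if b then Y else Y') => ntX s01 i j l Ji Jj Jl ij.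
  have lin a c : DD d (X + s *: (Z - X)) a c = (1 - s) * DD d X a c + s * DD d Z a c.
    have -> : X + s *: (Z - X) = s *: Z + (1 - s) *: X + 0.
      by rewrite scalerBr scalerBl scale1r addr0; rewrite addrCA addrA addrC addrA.
    by rewrite addr0 tie_linear /tie !prZ; ring.
  rewrite !lin => e' e''.
  have FZ : F X (i, j, l) Z = 0.
    rewrite /F /=; move: e' e''; move: (DD d X i j) (DD d X i l) (DD d Z i j) (DD d Z i l) => a b' c g e' e''.
    have -> : a * g - b' * c = (g - b') * ((1 - s) * a + s * c) + (a - c) * ((1 - s) * b' + s * g) by ring.
    by rewrite e' e''; ring.
  have Fy y : F X (i, j, l) y = 0 by apply: (GZ (inl (b, (i, j, l)))).
  have Dij := ntX i j Ji Jj ij; have /andP[_ di] := Ji.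
  pose k := DD d X i l / DD d X i j.
  have Dil y : DD d y i l = k * DD d y i j.
    have := Fy y; rewrite /F /= => /eqP; rewrite subr_eq0 => /eqP eq1.
    by apply: (mulfI Dij); rewrite eq1 /k mulrA mulrCA divff // mulr1.
  exists ((pr d l - k * pr d j) / pr d i), k => y.
  have := Dil y; rewrite /tie => eq1; apply: (mulIf (lt0r_neq0 di)).
  rewrite mulrDl mulrAC divfK ?gt_eqF //.
  have : pr y l * pr d i = pr y i * pr d l - k * (pr y i * pr d j - pr y j * pr d i).
    by rewrite -eq1; ring.
  by move=> ->; ring.
have wZ := wval_segment CY CZ ntY ntZ (fun s => tameX true s ntY) wY.
apply: (wval_segment CZ CY' ntZ ntY' _ wZ) => s /andP[s0 s1].
rewrite (_ : _ + _ = Y' + (1 - s) *: (Z - Y')).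
  by apply: (tameX false) => //; apply/andP; split; lra.
by apply/rowP => i; rewrite !mxE; ring.
Qed.

End Invariance.

(** * Rank three configurations *)

Lemma conv_gt (R : realType) (s a b c : R) : 0 <= s -> s <= 1 -> c < a -> c < b ->
  c < (1 - s) * a + s * b.
Proof.
rewrite le_eqVlt => /orP[/eqP<- _ ca _|s0 s1 ca cb]; first by lra.
have p1 : 0 < s * (b - c) by rewrite mulr_gt0 ?subr_gt0.
have p2 : 0 <= (1 - s) * (a - c) by rewrite mulr_ge0 // subr_ge0 // ltW.
lra.
Qed.

Section RankThree.
Context (R : realType) (n : nat) (Q : valued_quiver n) (m : nat) (S : root_data R Q m).
Implicit Types (x y v Y Z : 'rV[R]_n) (i j l g A B : 'I_m).

Local Notation pr := (pr S).
Local Notation E := (rE S).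
Local Notation lat := (rlat S).
Local Notation sub := (rsub S).
Local Notation wallb := (onwall S).
Local Notation stable := (stable S).
Local Notation combo := (combo S).
Local Notation pairb := (pairb S).
Local Notation sw := (sw S).
Local Notation phi := (phi S).
Local Notation DD := (tie S).
Local Notation tt := (ctime S).
Local Notation isW := (isW S).

Lemma stable_near p (eta : 'rV[R]_n) e A : stable p A ->
  (forall j, Num.sg (pr (p + e *: eta) j) =
     if pr p j == 0 then Num.sg (pr eta j) else Num.sg (pr p j)) ->
  pr eta A = 0 -> stable (p + e *: eta) A.
Proof.
move=> [w neg] eP eA.
have pA : pr (p + e *: eta) A = 0 by rewrite prD prZ eA mulr0 addr0 wall_eq0.
have negs l : sub l A -> l != A -> pr (p + e *: eta) l < 0.
  by move=> s lv; rewrite -sgr_lt0 eP; have pl := neg l s lv; rewrite lt_eqF // sgr_lt0.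
split=> //; rewrite /onwall pA eqxx; apply/FwP => l s.
by have [->|lv] := eqVneq l A; [rewrite pA | apply/ltW/negs].
Qed.

Lemma pair_mid A1 A2 t g : pairb A1 A2 -> pairb A1 t -> pairb A2 t -> mid S A1 A2 g ->
  pairb g t.
Proof.
move=> P12 P1 P2 mg; have [_ le2] := mid_lat P12 mg; have [a [b c]] := mg.
apply/andP; split; first by apply: le_lt_trans le2 _; case/andP: P2.
by rewrite (E_combol _ c) (pair_E0 P1) (pair_E0 P2) !mulr0 addr0.
Qed.

Lemma filter_phi (d : 'rV[R]_n) A B : pairb A B -> 0 < pr d A -> pr d B = 0 ->
  [seq l <- sw A B | 0 < pr d l] = phi A B.
Proof.
move=> AB dA dB; rewrite sw_cons //= dB ltxx; apply/all_filterP/allP => l.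
rewrite mem_phi // => /andP[/asboolP[a [b c]] lB].
rewrite c dB mulr0 addr0 mulr_gt0 // lt_neqAle ler0n andbT.
apply: contra lB => /eqP a0; apply/eqP; apply: (@nonprop _ _ _ _ S _ _ b%:R) => x.
by rewrite c -a0 mul0r add0r.
Qed.

Lemma eps_ge0 (a b : R) : (forall e, 0 < e -> 0 <= a + e * b) -> 0 <= a.
Proof.
move=> h; rewrite leNgt; apply/negP => a0; have [b0|b0] := leP b 0.
  by have := h 1 ltr01; rewrite mul1r; lra.
have e0 : 0 < - a / (2 * b) by rewrite divr_gt0 ?oppr_gt0 // mulr_gt0.
have := h _ e0; have -> : - a / (2 * b) * b = - a / 2.
  by rewrite invfM mulrA mulfVK // gt_eqF.
lra.
Qed.

Variables (A1 A2 t : 'I_m).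
Hypotheses (P12 : pairb A1 A2) (P1 : pairb A1 t) (P2 : pairb A2 t).

Let e1 := E A1 A1.
Let e2 := E A2 A2.
Let e3 := E t t.
Variables u1 u2 u3 : 'rV[R]_n.
Local Notation c1 := (pr u1).
Local Notation c2 := (pr u2).
Local Notation c3 := (pr u3).
Hypotheses (c1A1 : c1 A1 = 1) (c1A2 : c1 A2 = 0) (c1t : c1 t = 0).
Hypotheses (c2A1 : c2 A1 = 0) (c2A2 : c2 A2 = 1) (c2t : c2 t = 0).
Hypotheses (c3A1 : c3 A1 = 0) (c3A2 : c3 A2 = 0) (c3t : c3 t = 1).

Let E12 : E A1 A2 = 0. Proof. exact: pair_E0 P12. Qed.
Let E13 : E A1 t = 0. Proof. exact: pair_E0 P1. Qed.
Let E23 : E A2 t = 0. Proof. exact: pair_E0 P2. Qed.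

Variable p : 'rV[R]_n.
Hypotheses (s1 : stable p A1) (s2 : stable p A2) (s3 : stable p t).
Hypothesis span : forall l, pr p l = 0 ->
  forall y, pr y A1 = 0 -> pr y A2 = 0 -> pr y t = 0 -> pr y l = 0.

Let coords l : wallb p l -> forall x, pr x l = c1 l * pr x A1 + c2 l * pr x A2 + c3 l * pr x t.
Proof.
move=> /wall_eq0 pl x; apply/eqP; rewrite -subr_eq0.
have := span pl (y := x - pr x A1 *: u1 - pr x A2 *: u2 - pr x t *: u3).
rewrite !prB !prZ
  c1A1 c2A1 c3A1 c1A2 c2A2 c3A2 c1t c2t c3t.
rewrite !mulr0 !mulr1 !subr0 !subrr => /(_ erefl erefl erefl) <-.
by apply/eqP; ring.
Qed.

Let E1l l : wallb p l -> E A1 l = c1 l * e1.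
Proof. by move=> w; rewrite -pr_yl (coords w) !pr_yl E12 E13 !mulr0 !addr0. Qed.
Let E2l l : wallb p l -> E A2 l = c1 l * E A2 A1 + c2 l * e2.
Proof. by move=> w; rewrite -pr_yl (coords w) !pr_yl E23 mulr0 addr0. Qed.
Let El3 l : wallb p l -> E l t = c3 l * e3.
Proof. by move=> w; rewrite -pr_yr (coords w) !pr_yr E13 E23 !mulr0 !add0r. Qed.
Let E3l l : wallb p l -> E t l = c1 l * E t A1 + c2 l * E t A2 + c3 l * e3.
Proof. by move=> w; rewrite -pr_yl (coords w) !pr_yl. Qed.

Let e1p : 0 < e1. Proof. exact: rE_gt0. Qed.
Let e2p : 0 < e2. Proof. exact: rE_gt0. Qed.
Let e3p : 0 < e3. Proof. exact: rE_gt0. Qed.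

(** A further stable root would have nonpositive coordinates, by orthogonality to the three given
    ones. *)
Let only3 l : stable p l -> [\/ l = A1, l = A2 | l = t].
Proof.
move=> sl; have [w _] := sl; have [->|l1] := eqVneq l A1; first by constructor 1.
have [->|l2] := eqVneq l A2; first by constructor 2.
have [->|l3] := eqVneq l t; first by constructor 3.
exfalso; have o1 : E A1 l <= 0 by apply: stable_orth s1 sl _; rewrite eq_sym.
have o2 : E A2 l <= 0 by apply: stable_orth s2 sl _; rewrite eq_sym.
have o3 : E l t <= 0 by apply: stable_orth sl s3 l3.
move: o1; rewrite E1l // pmulr_lle0 // => n1.
move: o3; rewrite El3 // pmulr_lle0 // => n3.
have n2 : c2 l <= 0.
  rewrite -(pmulr_lle0 _ e2p); move: o2; rewrite E2l // => o2.
  have := mulr_le0 n1 (pair_anti P12); lra.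
have := pr1_gt0 S l; rewrite (coords w).
have := mulr_le0_ge0 n1 (ltW (pr1_gt0 S A1)); have := mulr_le0_ge0 n2 (ltW (pr1_gt0 S A2)).
have := mulr_le0_ge0 n3 (ltW (pr1_gt0 S t)); lra.
Qed.

(** Otherwise the wall root l would have a torsion-free quotient root near p; a stable subroot of
    the latter is one of the three, on which the displacement is positive. *)
Let pos3 (eta : 'rV[R]_n) l : 0 < pr eta A1 -> 0 < pr eta A2 -> 0 < pr eta t ->
  wallb p l -> 0 <= pr eta l.
Proof.
move=> h1 h2 h3 w; have [e e0 eP] := perturb1 S p eta.
suff /tw_ge0 : Tw S (p + e *: eta) l by rewrite -sgr_ge0 eP (wall_eq0 w) eqxx sgr_ge0.
have [//|[i q F]] := HNq S (p + e *: eta) l.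
have pi : pr p i = 0.
  apply/eqP; rewrite eq_le (tw_ge0 (tw_quo (wall_tw w) q)) andbT leNgt; apply/negP => pi.
  by have := fs_lt0 F; rewrite -sgr_lt0 eP gt_eqF // gtr0_sg // ltr10.
have wi := wall_quo w q pi; have [j s sj] := wall_has_stable_sub wi.
have : pr (p + e *: eta) j < 0 by apply: (FsP _ _ _ F).
rewrite -sgr_lt0 eP (wall_eq0 (proj1 sj)) eqxx.
by case: (only3 sj) => ->; rewrite gtr0_sg // ltr10.
Qed.

Let c1ge l : wallb p l -> 0 <= c1 l.
Proof.
move=> w; apply: (@eps_ge0 _ (c2 l + c3 l)) => e e0.
have := @pos3 (u1 + e *: (u2 + u3)) l; rewrite !(prD, prZ).
by rewrite c1A1 c2A1 c3A1 c1A2 c2A2 c3A2 c1t c2t c3t; apply=> //; lra.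
Qed.
Let c2ge l : wallb p l -> 0 <= c2 l.
Proof.
move=> w; apply: (@eps_ge0 _ (c1 l + c3 l)) => e e0.
have := @pos3 (u2 + e *: (u1 + u3)) l; rewrite !(prD, prZ).
by rewrite c1A1 c2A1 c3A1 c1A2 c2A2 c3A2 c1t c2t c3t; apply=> //; lra.
Qed.
Let c3ge l : wallb p l -> 0 <= c3 l.
Proof.
move=> w; apply: (@eps_ge0 _ (c1 l + c2 l)) => e e0.
have := @pos3 (u3 + e *: (u1 + u2)) l; rewrite !(prD, prZ).
by rewrite c1A1 c2A1 c3A1 c1A2 c2A2 c3A2 c1t c2t c3t; apply=> //; lra.
Qed.

(** This direction is parallel to H(t) and positive on every other wall through p, so t is never
    crossed and only relations among laterally earlier roots intervene. *)
Let d := u1 + u2.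
Let dE l : pr d l = c1 l + c2 l. Proof. exact: prD. Qed.
Let dge l : wallb p l -> 0 <= pr d l.
Proof. by move=> w; rewrite dE addr_ge0 ?c1ge ?c2ge. Qed.
Let dt : pr d t = 0. Proof. by rewrite dE c1t c2t addr0. Qed.

Let d0_t l : wallb p l -> pr d l = 0 -> l = t.
Proof.
move=> w; rewrite dE => dl0; have := c1ge w; have := c2ge w => h2 h1.
have z1 : c1 l = 0 by lra.
have z2 : c2 l = 0 by lra.
by apply: (@nonprop _ _ _ _ S l t (c3 l)) => x; rewrite (coords w) z1 z2 !mul0r !add0r.
Qed.

Let dpos l : wallb p l -> l != t -> 0 < pr d l.
Proof.
move=> w lt; rewrite lt_neqAle dge // andbT eq_sym.
by apply: contra lt => /eqP/(d0_t w) ->.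
Qed.

Let flat_mid l : wallb p l -> c3 l = 0 -> mid S A1 A2 l.
Proof.
move=> w z3; have [e e0 eP] := perturb1 S p u3.
have sA1 : stable (p + e *: u3) A1 := stable_near s1 eP c3A1.
have sA2 : stable (p + e *: u3) A2 := stable_near s2 eP c3A2.
have cl : combo l A1 A2 (c1 l) (c2 l).
  by move=> x; rewrite (coords w) z3 mul0r addr0.
apply/(planar_wallP sA1 sA2 P12); last first.
  exact: wall_conv (proj1 sA1) (proj1 sA2) (c1ge w) (c2ge w) cl.
move=> k /(wall_near eP)[wk k3 _]; exists (c1 k), (c2 k) => x.
by rewrite (coords wk) k3 mul0r addr0.
Qed.

Let lat_t l : wallb p l -> l != t -> lat l < lat t.
Proof.
move=> w lt; have := c3ge w; rewrite le_eqVlt => /orP[/eqP/esym z3|p3].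
  have [_ le] := mid_lat P12 (flat_mid w z3).
  by apply: le_lt_trans le _; case/andP: P2.
by apply: (E_lat_lt lt); rewrite El3 // mulr_gt0.
Qed.

Variables (H : groupType) (f : 'I_m -> H).
Hypothesis f_pair : forall A B, pairb A B -> lat B < lat t ->
  wprod f [:: A; B] = wprod f (sw A B).

Let D3 i j : DD d u3 i j = c3 i * pr d j - c3 j * pr d i. Proof. by []. Qed.

Let no_ties3 Y e : (Y = u1 \/ Y = u2) -> 0 < e ->
  (forall i j, Num.sg (DD d (Y + e *: u3) i j) =
     if DD d Y i j == 0 then Num.sg (DD d u3 i j) else Num.sg (DD d Y i j)) ->
  no_ties S p d (Y + e *: u3).
Proof.
move=> Y12 e0 eP i j /andP[wi di] /andP[wj dj] ij.
rewrite -sgr_eq0 eP; case: (eqVneq (DD d Y i j) 0) => [Y0|]; last by rewrite sgr_eq0.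
rewrite sgr_eq0 D3; apply: contra ij => /eqP D0; apply/eqP.
have r12 : c1 i * pr d j = c1 j * pr d i /\ c2 i * pr d j = c2 j * pr d i.
  move: Y0; rewrite /tie; case: Y12 => -> /eqP;
  rewrite subr_eq0 !dE => /eqP e12; split; lra.
have r3 : c3 i * pr d j = c3 j * pr d i by lra.
apply: (@nonprop _ _ _ _ S i j (pr d i / pr d j)) => x; apply: (mulIf (lt0r_neq0 dj)).
rewrite mulrAC divfK ?gt_eqF // (coords wi x) (coords wj x) !mulrDl.
have [r1 r2] := r12.
rewrite [c1 i * _ * _]mulrAC [c2 i * _ * _]mulrAC [c3 i * _ * _]mulrAC r1 r2 r3; ring.
Qed.

Let near_fam (Y : 'rV[R]_n) : exists p1 : R -> 'rV[R]_n, forall c, exists h, p1 c = p + h *: (Y + c *: d) /\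
    forall j, Num.sg (pr (p1 c) j) =
       if pr p j == 0 then Num.sg (pr (Y + c *: d) j) else Num.sg (pr p j).
Proof.
have ex c : exists q, exists h, q = p + h *: (Y + c *: d) /\ forall j, Num.sg (pr q j) =
    if pr p j == 0 then Num.sg (pr (Y + c *: d) j) else Num.sg (pr p j).
  by have [h _ hP] := perturb1 S p (Y + c *: d); exists (p + h *: (Y + c *: d)), h.
by exists (fun c => sval (cid (ex c))) => c; apply: svalP (cid (ex c)).
Qed.

(** In the plane of g and t the direction u3 lies on the side where all intermediate walls are seen;
    dropping t, whose wall is parallel to d, leaves [phi g t]. *)
Let local_phi (eta : 'rV[R]_n) h g : pairb g t -> 0 < pr d g -> c3 g = 0 ->
  (forall j, Num.sg (pr (p + h *: eta) j) =
     if pr p j == 0 then Num.sg (pr eta j) else Num.sg (pr p j)) ->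
  stable (p + h *: eta) g -> pr eta t = 0 ->
  (forall l, wallb p l -> pr eta l = 0 -> exists a, c1 l = a * c1 g /\ c2 l = a * c2 g) ->
  wallb p g ->
  isW (p + h *: eta) d u3 (phi g t).
Proof.
move=> gt dg z3 hP sg et par wg; have dg' := dg; rewrite -(filter_phi gt dg dt).
apply: isW_meet gt _ dg _ _ => //; first exact: stable_near s3 hP et.
- move=> l /(wall_near hP)[wl el _]; have [a [r1 r2]] := par l wl el; exists a, (c3 l) => x.
  by rewrite (coords wl) (coords wg) z3 r1 r2; ring.
- by rewrite dt.
- by rewrite D3 c3t z3 dt mulr0 mul1r sub0r oppr_lt0.
Qed.

(** The first condition keeps the lines on one side of H(t); the second puts every [ctime] above the
    threshold -1, so that whole words are counted. *)
Let C Y : Prop := 0 < pr Y t /\ forall j, wallb p j -> 0 < pr d j -> - pr d j < pr Y j.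

Let C_in Y e : (Y = u1 \/ Y = u2) -> 0 < e -> C (Y + e *: u3).
Proof.
move=> Y12 e0; split.
  rewrite prD prZ c3t mulr1; case: Y12 => ->; rewrite ?c1t ?c2t;
  by rewrite add0r.
move=> j w dj; rewrite prD prZ.
have := mulr_ge0 (ltW e0) (c3ge w); have := c1ge w; have := c2ge w.
by case: Y12 => ->; lra.
Qed.

(** Both words are read along lines on the same side of H(t): the line of u1 passes near the planes
    of (A1, t) and (A2, t), that of u2 near the planes of (g, t) for all g between A1 and A2. *)
Lemma rank3_local : wprod f (phi A1 t ++ phi A2 t) =
  wprod f (flatten [seq phi g t | g <- sw A1 A2]).
Proof.
have DL := fun (k : 'I_m * 'I_m) a x y => tie_linear S d k.1 k.2 a x y.
have [ea ea0 eaP] := @perturb_fun R n _ (fun (k : 'I_m * 'I_m) x => DD d x k.1 k.2) u1 u3 DL.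
have [eb eb0 ebP] := @perturb_fun R n _ (fun (k : 'I_m * 'I_m) x => DD d x k.1 k.2) u2 u3 DL.
have [ga ga0 gaP] := isW_group u1 u3 dge; have [gb gb0 gbP] := isW_group u2 u3 dge.
pose e := Num.min (Num.min ea eb) (Num.min ga gb).
have e0 : 0 < e by rewrite !lt_min ea0 eb0 ga0 gb0.
have eea : e <= ea by rewrite !ge_min lexx.
have eeb : e <= eb by rewrite !ge_min lexx !orbT.
have ega : e <= ga by rewrite !ge_min lexx !orbT.
have egb : e <= gb by rewrite !ge_min lexx !orbT.
have wa : wval S p d f (-1) (u1 + e *: u3) (wprod f (phi A1 t ++ phi A2 t)).
  have [p1 p1P] := near_fam u1.
  pose ws (c : R) := if c == -1 then phi A1 t else phi A2 t.
  exists (phi A1 t ++ phi A2 t); last first.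
    rewrite (_ : [seq _ <- _ | _] = phi A1 t ++ phi A2 t) //; apply/all_filterP/allP => j.
    rewrite mem_cat !mem_phi // => /orP[]/andP[/asboolP mj jt].
      have wj : wallb p j by have [a [b c]] := mj; apply: wall_conv c; rewrite ?ler0n //; [case: s1|case: s3].
      have dj := dpos wj jt; have [_ /(_ j wj dj)] := C_in (or_introl erefl) e0.
      by rewrite /ctime ltr_pdivlMr // mulN1r.
    have wj : wallb p j by have [a [b c]] := mj; apply: wall_conv c; rewrite ?ler0n //; [case: s2|case: s3].
    have dj := dpos wj jt; have [_ /(_ j wj dj)] := C_in (or_introl erefl) e0.
    by rewrite /ctime ltr_pdivlMr // mulN1r.
  have -> : phi A1 t ++ phi A2 t = flatten [seq ws c | c <- [:: -1; 0]].
    by rewrite /= /ws eqxx eq_sym oppr_eq0 oner_eq0 cats0.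
  apply: (gaP e e0 ega p1) => //= [c||j /visP[w dj h]].
  - rewrite !inE => /orP[]/eqP->; rewrite /ws ?eqxx ?[0 == _]eq_sym ?oppr_eq0 ?oner_eq0.
      have [h [-> hP]] := p1P (-1).
      have eta1 l : pr (u1 + -1 *: d) l = - c2 l by rewrite prD prZ dE; ring.
      apply: local_phi => //; rewrite ?eta1 ?c2t ?oppr0 //; last by case: s1.
      - by rewrite dE c1A1 c2A1 addr0.
      - by apply: stable_near s1 hP _; rewrite eta1 c2A1 oppr0.
      - move=> l wl; rewrite eta1 => /eqP; rewrite oppr_eq0 => /eqP z2; exists (c1 l).
        by rewrite c1A1 c2A1 mulr1 mulr0.
    have [h [-> hP]] := p1P 0.
    have eta1 l : pr (u1 + 0 *: d) l = c1 l by rewrite prD prZ mul0r addr0.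
    apply: local_phi => //; rewrite ?eta1 //; last by case: s2.
    - by rewrite dE c1A2 c2A2 add0r.
    - by apply: stable_near s2 hP _; rewrite eta1.
    - by move=> l wl; rewrite eta1 => z1; exists (c2 l); rewrite c1A2 c2A2 mulr1 mulr0.
  - by rewrite andbT oppr_lt0.
  have [z1|/eqP n1] := eqVneq (c1 j) 0.
    by rewrite /ctime z1 mul0r oppr0 !inE eqxx orbT.
  have [z2|/eqP n2] := eqVneq (c2 j) 0.
    rewrite /ctime dE z2 addr0 divff ?inE ?eqxx //; exact/eqP.
  (* With both coordinates positive, j would be semistable at a nearby point where A1 is torsion,
     although E(A1, j) > 0. *)
  exfalso; have p1j : 0 < c1 j by rewrite lt_neqAle c1ge // andbT eq_sym; apply/eqP.
  have p2j : 0 < c2 j by rewrite lt_neqAle c2ge // andbT eq_sym; apply/eqP.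
  pose k := - (c1 j / pr d j).
  have [q _ qP] := perturb1 S p (u1 + k *: d).
  have etaE l : pr (u1 + k *: d) l = c1 l + k * pr d l by rewrite prD prZ.
  have kj : k * pr d j = - c1 j by rewrite /k mulNr divfK // gt_eqF.
  have wq : wallb (p + q *: (u1 + k *: d)) j.
    apply/(wall_near qP); split=> //; first by rewrite etaE kj subrr.
    move=> l wl s; have := h l wl s; rewrite /tie etaE => le0.
    rewrite -(pmulr_lle0 _ dj) mulrDl mulrAC kj; lra.
  have T1 : Ts S (p + q *: (u1 + k *: d)) A1.
    apply: stable_ts s1 qP _; rewrite etaE c1A1 dE c1A1 c2A1 addr0 mulr1 /k subr_gt0.
    by rewrite ltr_pdivrMr // mul1r dE ltrDl.
  by have := TF T1 (wall_fw wq); rewrite E1l // leNgt mulr_gt0.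
have wb : wval S p d f (-1) (u2 + e *: u3) (wprod f (flatten [seq phi g t | g <- sw A1 A2])).
  have [p1 p1P] := near_fam u2.
  have midw g : g \in sw A1 A2 -> [/\ mid S A1 A2 g, wallb p g, pairb g t, c3 g = 0 & 0 < pr d g].
    rewrite mem_sw // => /asboolP mg; have [a [b c]] := mg.
    have wg : wallb p g by apply: wall_conv c; rewrite ?ler0n //; [case: s1|case: s2].
    have gt := pair_mid P12 P1 P2 mg; split=> //; first by rewrite c c3A1 c3A2 !mulr0 addr0.
    exact: dpos (pair_neq gt).
  pose key g := - tt d u2 g.
  have keyE g h : 0 < pr d g -> 0 < pr d h -> (key g < key h) = (c1 g * c2 h < c1 h * c2 g).
    move=> dg dh; rewrite /key tt_lt // /tie !dE.
    by rewrite [X in 0 < X](_ : _ = c1 h * c2 g - c1 g * c2 h) ?subr_gt0 //; ring.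
  pose ws c := if pselect (exists g, g \in sw A1 A2 /\ key g = c) is left h
    then phi (sval (cid h)) t else [::].
  have key_lt g h : g \in sw A1 A2 -> h \in sw A1 A2 ->
      (slope S A1 A2 g < slope S A1 A2 h) = (key g < key h).
    move=> /midw[[a [b cg]] _ _ _ dg] /midw[[a' [b' ch]] _ _ _ dh].
    rewrite keyE // (slope_lt P12 _ _ _ _ cg ch) ?ler0n //.
    by rewrite !cg !ch c1A1 c1A2 c2A1 c2A2 !mulr0 !mulr1 !addr0 !add0r.
  have key_inj g h : g \in sw A1 A2 -> h \in sw A1 A2 -> key g = key h -> g = h.
    move=> gs hs e'; apply: (slope_inj P12); rewrite -?topredE /= -?(mem_sw _ P12) //.
    by apply/eqP; rewrite eq_le !leNgt !key_lt // e' ltxx.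
  have wsE g : g \in sw A1 A2 -> ws (key g) = phi g t.
    move=> gs; rewrite /ws; case: pselect => [h|[]]; last by exists g.
    by have [h1 h2] := svalP (cid h); rewrite (key_inj _ _ h1 gs h2).
  exists (flatten [seq phi g t | g <- sw A1 A2]); last first.
    rewrite (_ : [seq _ <- _ | _] = flatten [seq phi g t | g <- sw A1 A2]) //.
    apply/all_filterP/allP => j /flatten_mapP[g /midw[_ wg gt _ _]].
    rewrite mem_phi // => /andP[/asboolP[a [b c]] jt].
    have wj : wallb p j by apply: wall_conv c; rewrite ?ler0n //; case: s3.
    have dj := dpos wj jt; have [_ /(_ j wj dj)] := C_in (or_intror erefl) e0.
    by rewrite /ctime ltr_pdivlMr // mulN1r.
  have -> : flatten [seq phi g t | g <- sw A1 A2] =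
      flatten [seq ws c | c <- [seq key g | g <- sw A1 A2]].
    by rewrite -map_comp; congr flatten; apply/eq_in_map => g /wsE /= ->.
  apply: (gbP e e0 egb p1) => //= [c /mapP[g gs ->]||j /visP[w dj h]].
  - rewrite wsE //; have [mg wg gt z3 dg] := midw g gs; have [h [-> hP]] := p1P (key g).
    have etaE l : pr (u2 + key g *: d) l = c2 l + key g * pr d l by rewrite prD prZ.
    have kg : key g * pr d g = - c2 g by rewrite /key /ctime mulNr divfK // gt_eqF.
    have kt : pr (u2 + key g *: d) t = 0 by rewrite etaE c2t dt mulr0 addr0.
    have par l : pr (u2 + key g *: d) l = 0 -> c1 l = pr d l / pr d g * c1 g /\ c2 l = pr d l / pr d g * c2 g.
      rewrite etaE => z; have cg : c2 g = - (key g * pr d g) by rewrite kg opprK.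
      have cl : c2 l = - (key g * pr d l) by apply/eqP; rewrite -addr_eq0 z.
      have eq2 : c2 l = pr d l / pr d g * c2 g.
        rewrite cg cl mulrN; congr (- _); rewrite mulrCA divfK ?gt_eqF //.
      split=> //; apply: (addIr (c2 l)); rewrite {2}eq2 -mulrDr -!dE divfK // gt_eqF //.
    apply: local_phi => // [|l wl el]; last by exists (pr d l / pr d g); apply: par.
    have [a [b cg]] := mg.
    have [q q0 qP] := perturb1 S p u3.
    have sA1 : stable (p + q *: u3) A1 := stable_near s1 qP c3A1.
    have sA2 : stable (p + q *: u3) A2 := stable_near s2 qP c3A2.
    have wq : wallb (p + q *: u3) g.
      by apply: wall_conv cg; rewrite ?ler0n //; [case: sA1|case: sA2].
    have neg l : sub l g -> l != g -> wallb p l -> pr (u2 + key g *: d) l < 0.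
      move=> s lg wl.
      have l3 : c3 l = 0.
        apply/eqP; rewrite eq_le c3ge // andbT.
        by have := FwP _ _ _ (wall_fw wq) l s; rewrite -sgr_le0 qP (wall_eq0 wl) eqxx sgr_le0.
      have cl : combo l A1 A2 (c1 l) (c2 l) by move=> x; rewrite (coords wl) l3 mul0r addr0.
      have cg' : combo g A1 A2 (c1 g) (c2 g) by move=> x; rewrite (coords wg) z3 mul0r addr0.
      have := combo_E_order P12 cl cg' lg (rsub_hom s) => lt1.
      rewrite -(pmulr_llt0 _ dg) etaE mulrDl mulrAC kg !dE; lra.
    have eg : pr (u2 + key g *: d) g = 0 by rewrite etaE kg subrr.
    have pg0 : pr (p + h *: (u2 + key g *: d)) g = 0 by rewrite prD prZ eg mulr0 addr0 wall_eq0.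
    have negs l : sub l g -> l != g -> pr (p + h *: (u2 + key g *: d)) l < 0.
      move=> s lg; rewrite -sgr_lt0 hP; case: eqVneq => [pl|pl].
        by rewrite sgr_lt0 neg // (wall_sub wg).
      by rewrite sgr_lt0 lt_neqAle pl (FwP _ _ _ (wall_fw wg)).
    split=> //; rewrite /onwall pg0 eqxx; apply/FwP => l s.
    by have [->|lg] := eqVneq l g; [rewrite pg0 | apply/ltW/negs].
  - rewrite sorted_map; have [_] := swP P12; rewrite !(sorted_pairwise _); last 2 first.
    + by move=> ? ? ?; apply: lt_trans.
    + by move=> ? ? ?; apply: lt_trans.
    apply: (sub_in_pairwise (P := [in sw A1 A2])); last exact/allP.
    by move=> g h gs hs; rewrite /relpre /= key_lt.
  have jt : j != t by apply: contraTneq dj => ->; rewrite dt ltxx.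
  have [q _ qP] := perturb1 S p (u2 + key j *: d).
  have etaE l : pr (u2 + key j *: d) l = c2 l + key j * pr d l by rewrite prD prZ.
  have kj : key j * pr d j = - c2 j by rewrite /key /ctime mulNr divfK // gt_eqF.
  have wq : wallb (p + q *: (u2 + key j *: d)) j.
    apply/(wall_near qP); split=> //; first by rewrite etaE kj subrr.
    move=> l wl s; have := h l wl s; rewrite /tie etaE => le0.
    rewrite -(pmulr_lle0 _ dj) mulrDl mulrAC kj; lra.
  have s3q : stable (p + q *: (u2 + key j *: d)) t.
    by apply: stable_near s3 qP _; rewrite etaE c2t dt mulr0 addr0.
  (* This stable subroot lies between A1 and A2, and the line meets its wall at the same parameter
     as that of j. *)
  have [A' sA' stA'] := wall_has_stable_sub wq.
  have [wA' eA' _] := iffLR (wall_near qP A') (proj1 stA').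
  have A't : A' != t.
    apply/eqP => A't; have := rsub_hom sA'; rewrite A't => Etj.
    have tj : t != j by rewrite eq_sym.
    have := E_anti tj Etj; rewrite El3 // pmulr_lle0 // => n3; move: Etj.
    have z3 : c3 j = 0 by apply/eqP; rewrite eq_le n3 c3ge.
    rewrite E3l // z3 mul0r addr0 ltNge; case/negP.
    by have := mulr_ge0_le0 (c1ge w) (pair_anti P1); have := mulr_ge0_le0 (c2ge w) (pair_anti P2); lra.
  have z3 : c3 A' = 0.
    apply/eqP; rewrite eq_le c3ge // andbT -(pmulr_lle0 _ e3p) -El3 //.
    exact: stable_orth stA' s3q A't.
  apply/mapP; exists A'; first by rewrite mem_sw //; apply/asboolP/flat_mid.
  have dA' := dpos wA' A't.
  apply: (mulIf (lt0r_neq0 dA')); move: eA'; rewrite etaE => /eqP; rewrite addrC addr_eq0 => /eqP ->.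
  by rewrite /key /ctime mulNr divfK // gt_eqF.
have nta : no_ties S p d (u1 + e *: u3).
  by apply: no_ties3 => // [|i j]; [left | exact: (eaP e (i, j))].
have ntb : no_ties S p d (u2 + e *: u3).
  by apply: no_ties3 => // [|i j]; [right | exact: (ebP e (i, j))].
have CL Y Z s : C Y -> C Z -> 0 <= s -> s <= 1 -> C (Y + s *: (Z - Y)).
  move=> [Y1 Y2] [Z1 Z2] s0 s1'; have cE j : pr (Y + s *: (Z - Y)) j = (1 - s) * pr Y j + s * pr Z j.
    by rewrite prD prZ prB; ring.
  by split=> [|j w dj]; rewrite cE; apply: conv_gt => //; [apply: Y2 | apply: Z2].
have CO Y v : C Y -> exists2 e, 0 < e & forall e', 0 < e' -> e' <= e -> C (Y + e' *: v).
  move=> [Y1 Y2]; have [ex ex0 exP] := perturb S Y v; have [ey ey0 eyP] := perturb S (Y + d) v.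
  exists (Num.min ex ey); rewrite ?lt_min ?ex0 // => e' e'0; rewrite le_min => /andP[lex ley].
  split=> [|j w dj]; first by rewrite -sgr_gt0 exP // gt_eqF // sgr_gt0.
  have Yd : 0 < pr (Y + d) j by rewrite prD; have := Y2 j w dj; lra.
  have : 0 < pr (Y + d + e' *: v) j by rewrite -sgr_gt0 eyP // gt_eqF // sgr_gt0.
  by rewrite -[- _ < _]subr_gt0 opprK (prD S (Y + d)) (prD S Y d) (prD S Y (e' *: v)) addrAC.
apply: (wval_fun (p := p) (d := d) _ wb).
apply: (wval_invariant dge CL CO _ _ _ (C_in (or_introl erefl) e0) (C_in (or_intror erefl) e0) nta ntb wa).
- by move=> Y l [Y1 _] wl /(d0_t wl) ->; rewrite gt_eqF.
- move=> Y j [_ Y2] /visP[w dj _]; apply/eqP => e'; have := Y2 j w dj.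
  by move: e'; rewrite /ctime => /(congr1 ( *%R^~ (pr d j))); rewrite divfK ?gt_eqF // mulN1r => ->; rewrite ltxx.
- move=> A B AB wA wB dA dB; apply: f_pair => //; apply: lat_t => //.
  by apply: contraTneq dB => ->; rewrite dt ltxx.
Qed.

End RankThree.

(** Conjugation by t, sending g to [phi S g t], respects the relation of A1 and A2, and this follows
    from relations laterally before t alone. The points u1, u2, u3 form a dual basis of A1, A2, t,
    found from [ryl] by elimination. *)
Lemma rank3 (R : realType) (n : nat) (Q : valued_quiver n) (m : nat) (S : root_data R Q m)
    (A1 A2 t : 'I_m) (H : groupType) (f : 'I_m -> H) :
  pairb S A1 A2 -> pairb S A1 t -> pairb S A2 t ->
  (forall A B, pairb S A B -> rlat S B < rlat S t -> wprod f [:: A; B] = wprod f (sw S A B)) ->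
  wprod f (phi S A1 t ++ phi S A2 t) = wprod f (flatten [seq phi S g t | g <- sw S A1 A2]).
Proof.
move=> P12 P1 P2 fP; have [|p [st span]] := @orth_point_span _ _ _ _ S [set A1; A2; t].
  move=> u v; rewrite !inE -!orbA => /or3P[]/eqP-> /or3P[]/eqP->; rewrite ?eqxx // => _;
  by [apply: pair_le0 | apply: pair_anti].
have n1 := E_neq0 S A1; have n2 := E_neq0 S A2; have n3 := E_neq0 S t.
have z12 := pair_E0 P12; have z13 := pair_E0 P1; have z23 := pair_E0 P2.
pose u1 := (rE S A1 A1)^-1 *: ryl S A1.
have [a1 a2 a3] : [/\ pr S u1 A1 = 1, pr S u1 A2 = 0 & pr S u1 t = 0].
  by rewrite !prZ !pr_yl z12 z13 !mulr0 mulVf.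
pose u2 := (rE S A2 A2)^-1 *: (ryl S A2 - rE S A2 A1 *: u1).
have prU2 l : pr S u2 l = (rE S A2 A2)^-1 * (rE S A2 l - rE S A2 A1 * pr S u1 l).
  by rewrite prZ prB prZ pr_yl.
have b1 : pr S u2 A1 = 0 by rewrite prU2 a1 mulr1 subrr mulr0.
have b2 : pr S u2 A2 = 1 by rewrite prU2 a2 mulr0 subr0 mulVf.
have b3 : pr S u2 t = 0 by rewrite prU2 a3 z23 !mulr0 subrr mulr0.
pose u3 := (rE S t t)^-1 *: (ryl S t - rE S t A1 *: u1 - rE S t A2 *: u2).
have prU3 l : pr S u3 l = (rE S t t)^-1 * (rE S t l - rE S t A1 * pr S u1 l - rE S t A2 * pr S u2 l).
  by rewrite prZ !prB (prZ S _ u1) (prZ S _ u2) pr_yl.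
have d1 : pr S u3 A1 = 0 by rewrite prU3 a1 b1 mulr1 mulr0 subr0 subrr mulr0.
have d2 : pr S u3 A2 = 0 by rewrite prU3 a2 b2 mulr1 mulr0 subr0 subrr mulr0.
have d3 : pr S u3 t = 1 by rewrite prU3 a3 b3 !mulr0 !subr0 mulVf.
apply: (@rank3_local _ _ _ _ S _ _ _ P12 P1 P2 _ _ _ a1 a2 a3 b1 b2 b3 d1 d2 d3 p) => //;
  try by apply: st; rewrite !inE eqxx ?orbT.
by move=> l pl y y1 y2 y3; apply: (span l pl) => v; rewrite !inE -!orbA => /or3P[]/eqP->.
Qed.

(** * Words in the picture group *)

Section LetterProducts.
Variables (T : choiceType) (H : groupType) (f : T -> H).
Local Open Scope group_scope.

Lemma wprod_all1 w : (forall l, l \in w -> f l = 1) -> wprod f w = 1.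
Proof. by move=> h; rewrite /wprod big_seq big1. Qed.

Lemma wprod_only A w : uniq w -> A \in w -> (forall l, l \in w -> l != A -> f l = 1) ->
  wprod f w = f A.
Proof.
elim: w => // x w IH /= /andP[xw uw]; rewrite inE wprod_cons.
have [-> _ h|xA /= Aw h] := eqVneq A x.
  rewrite wprod_all1 ?mulg1 // => l lw; apply: h; rewrite ?inE ?lw ?orbT //.
  by apply: contraNneq xw => <-.
rewrite h ?mem_head 1?eq_sym // mul1g; apply: IH => // l lw; apply: h.
by rewrite inE lw orbT.
Qed.

Lemma wprod_flatten (U : choiceType) (g : U -> seq T) w :
  wprod f (flatten [seq g x | x <- w]) = wprod (fun x => wprod f (g x)) w.
Proof. by elim: w => [|x w IH] /=; rewrite /wprod ?big_nil // big_cat big_cons; congr (_ * _). Qed.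

Lemma wprod2 x y : wprod f [:: x; y] = f x * f y.
Proof. by rewrite wprod_cons wprod1. Qed.
End LetterProducts.

Section PresentedMore.
Variables (T : choiceType) (rels rels' : seq T -> seq T -> Prop).

Lemma pg_word_sub u v :
    (forall u v, rels u v -> pg_word rels' u = pg_word rels' v) ->
  pg_word rels u = pg_word rels v -> pg_word rels' u = pg_word rels' v.
Proof.
by move=> h /(congr1 (pg_lift (pg_gen rels'))); rewrite !pg_lift_word.
Qed.

Lemma pg_word_count t u v :
    (forall u v, rels u v -> count_mem t u = count_mem t v) ->
  pg_word rels u = pg_word rels v -> count_mem t u = count_mem t v.
Proof.
move=> h e; pose a x (z : int) := z + (x == t)%:Z; pose a' x (z : int) := z - (x == t)%:Z.
have aE w z : foldr a z w = z + (count_mem t w)%:Z.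
  elim: w => [|x w IH] /=; first by rewrite addr0.
  by rewrite IH /a PoszD -addrA; congr (_ + _); rewrite addrC.
have := @action_eq _ rels _ a a' (fun x => addrK _) (fun x => subrK _) _ u v 0 e.
rewrite !aE !add0r => e'; apply/eqP; rewrite -eqz_nat e' // => u' v' /h r z.
by rewrite !aE r.
Qed.
End PresentedMore.

(** * The tower of groups along the lateral order *)

Section Tower.
Context (R : realType) (n : nat) (Q : valued_quiver n) (m : nat) (S : root_data R Q m).
Implicit Types (i j l g A B : 'I_m).

Local Notation E := (rE S).
Local Notation lat := (rlat S).
Local Notation sub := (rsub S).
Local Notation combo := (combo S).
Local Notation pairb := (pairb S).
Local Notation sw := (sw S).
Local Notation phi := (phi S).

Definition prel (u v : seq 'I_m) : Prop :=
  exists A B, [/\ pairb A B, u = [:: A; B] & v = sw A B].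

(* The relations whose roots have lateral rank at most k; if o is Some w, the
   letter w is moreover made central. *)
Definition lrel (o : option 'I_m) (k : int) (u v : seq 'I_m) : Prop :=
  (exists A B, [/\ pairb A B, lat B <= k, u = [:: A; B] & v = sw A B]) \/
  (exists w g, [/\ o = Some w, u = [:: w; g] & v = [:: g; w]]).

Lemma combo_l0 l A B a : combo l A B a 0 -> l = A.
Proof. by move=> c; apply: (@nonprop _ _ _ _ S _ _ a) => x; rewrite c mul0r addr0. Qed.

Lemma combo_r0 l A B b : combo l A B 0 b -> l = B.
Proof. by move=> c; apply: (@nonprop _ _ _ _ S _ _ b) => x; rewrite c mul0r add0r. Qed.

(** A root strictly between A and B has A as subroot and B as quotient root, so it is vertically
    later than both. Hence a vertically last letter commutes with the letters orthogonal to it. *)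
Lemma phi_last A B : pairb A B -> (forall j, (j <= A)%N) \/ (forall j, (j <= B)%N) ->
  phi A B = [:: A].
Proof.
move=> AB last; apply: klist_uniq (phiP AB) _; split=> // i; rewrite inE.
have [->|iA] := eqVneq i A.
  rewrite (pair_neq AB) andbT; symmetry; apply/asboolP/mid_l.
symmetry; apply/negP => /andP[/asboolP mi iB]; have [sA qB] := mid_ends AB mi iA iB.
case: last => last; first by case/eqP: iA; apply/val_inj/anti_leq; rewrite last (rsub_index sA).
by case/eqP: iB; apply/val_inj/anti_leq; rewrite last (rquo_index qB).
Qed.

Lemma sw_last A B : pairb A B -> (forall j, (j <= A)%N) \/ (forall j, (j <= B)%N) ->
  sw A B = [:: B; A].
Proof. by move=> AB last; rewrite sw_cons // phi_last. Qed.

Lemma sw_uniq A B : pairb A B -> uniq (sw A B).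
Proof.
move=> AB; have [_ sw] := swP AB.
by apply: sorted_uniq sw => [|l]; [apply: key_trans | rewrite ltxx].
Qed.

Lemma mid_lt A B l (k : int) : pairb A B -> lat B < k -> l \in sw A B -> lat l < k.
Proof.
move=> AB Bk; rewrite mem_sw // => /asboolP /(mid_lat AB)[_ le].
exact: le_lt_trans le Bk.
Qed.

Lemma phi_lt A B l : pairb A B -> l \in phi A B -> lat l < lat B.
Proof.
move=> AB; rewrite mem_phi // => /andP[/asboolP/(mid_lat AB)[_ le] lB].
by rewrite lt_neqAle le lat_eq lB.
Qed.

Section Step.
Variables (o : option 'I_m) (t : 'I_m).
Hypotheses (o_last : forall w, o = Some w -> forall j, (j <= w)%N) (ot : o != Some t).

Local Notation rels := (lrel o (lat t - 1)).
Local Notation G := (presented_group rels).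
Local Notation gen := (pg_gen rels).
Local Notation word := (pg_word rels).

(** In G only the relations before t hold, and t is made to act on G as the stable letter of an HNN
    extension. [rl] kills all letters but the earlier ones orthogonal to t (and possibly the central
    letter); [fl] kills the same letters and conjugates the survivors by t. *)
Let keep g := (E g t == 0) && ((lat g < lat t) || (o == Some g)).
Let rl g : G := if keep g then gen g else 1%g.
Let fl g : G := if keep g then (if o == Some g then gen g else word (phi g t)) else 1%g.

Let ltB B : (lat B <= lat t - 1) = (lat B < lat t). Proof. by lia. Qed.

Let keep_pair g : keep g -> lat g < lat t -> pairb g t.
Proof. by case/andP=> e _ lt; apply/andP. Qed.

Let pair_keep g : pairb g t -> keep g.
Proof. by move=> p; rewrite /keep (pair_E0 p) eqxx; case/andP: p => ->. Qed.

Let word_central w : o = Some w -> forall y : G, (gen w * y = y * gen w)%g.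
Proof.
move=> ow y; have gc g : (gen w * gen g = gen g * gen w)%g.
  rewrite -!(pg_word1 rels) -!pg_word_cat; apply: pg_word_rel; right; by exists w, g.
suff e : (gen w * y * (gen w)^-1 = y)%g by rewrite -[in RHS]e mulgVK.
apply: (pg_hom_ext (F := fun y => (gen w * y * (gen w)^-1)%g) (F' := id)) => //= [a b|g].
- by rewrite !mulgA mulgVK.
- by rewrite gc mulgK.
Qed.

Let fl_o g : o == Some g -> fl g = if keep g then gen g else 1%g.
Proof. by move=> og; rewrite /fl og. Qed.

Let fl_lt g : keep g -> lat g < lat t -> fl g = word (phi g t).
Proof.
move=> k lt; rewrite /fl k; case: eqP => // og.
rewrite phi_last ?pg_word1 //; first exact: keep_pair.
by left; apply: o_last.
Qed.

(** E(l, t) is a nonnegative combination of E(A, t) >= 0 and E(B, t) >= 0, so a root strictly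
    between A and B survives only if both A and B do; killing letters is therefore compatible with
    the relation. *)
Let kill_rel (H : groupType) (h : 'I_m -> H) A B : (forall g, ~~ keep g -> h g = 1%g) ->
  pairb A B -> lat B < lat t ->
  (keep A -> keep B -> wprod h [:: A; B] = wprod h (sw A B)) ->
  wprod h [:: A; B] = wprod h (sw A B).
Proof.
move=> nk AB Bt; have At : lat A < lat t by apply: lt_trans Bt; case/andP: AB.
have kE g : lat g < lat t -> keep g = (E g t == 0) by move=> lt; rewrite /keep lt andbT.
have A0 := E_ge0 (S := S) (ltW At); have B0 := E_ge0 (S := S) (ltW Bt).
have midk l : l \in sw A B -> keep l -> (keep A \/ l = B) /\ (keep B \/ l = A).
  move=> ls; rewrite !kE // ?(mid_lt AB Bt ls) //.
  move: ls; rewrite mem_sw // => /asboolP[a [b c]]; rewrite (E_combol _ c) => e.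
  have ha : 0 <= a%:R * E A t by rewrite mulr_ge0.
  have hb : 0 <= b%:R * E B t by rewrite mulr_ge0.
  move: e; rewrite paddr_eq0 // !mulf_eq0 => /andP[/orP[/eqP a0|->] /orP[/eqP b0|->]];
    split; try (by left); right.
  - by apply: (@combo_r0 l A B b%:R); rewrite -a0.
  - by apply: (@combo_l0 l A B a%:R); rewrite -b0.
  - by apply: (@combo_r0 l A B b%:R); rewrite -a0.
  - by apply: (@combo_l0 l A B a%:R); rewrite -b0.
have Ain : A \in sw A B by rewrite mem_sw //; apply/asboolP/mid_l.
have Bin : B \in sw A B by rewrite mem_sw //; apply/asboolP/mid_r.
have us := sw_uniq AB; have nAB := pair_neq AB.
case kA: (keep A); case kB: (keep B) => hk; first exact: hk.
- rewrite [RHS](@wprod_only _ _ _ A) // => [|l ls lA]; last first.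
    by apply: nk; apply/negP => /(midk l ls)[_ []]; [rewrite kB | move/eqP; apply/negP].
  by rewrite wprod2 (nk B) ?kB // mulg1.
- rewrite [RHS](@wprod_only _ _ _ B) // => [|l ls lB]; last first.
    by apply: nk; apply/negP => /(midk l ls)[h' _]; case: h'; [rewrite kA | move/eqP; apply/negP].
  by rewrite wprod2 (nk A) ?kA // mul1g.
rewrite wprod2 !nk ?kA ?kB // mulg1 wprod_all1 // => l ls; apply: nk.
apply/negP => /(midk l ls)[]; rewrite kA kB => -[//|->] [//|e].
by move: nAB; rewrite e eqxx.
Qed.

Let rl_rel u v : rels u v -> wprod rl u = wprod rl v.
Proof.
case=> [[A [B [AB]]]|[w [g [ow -> ->]]]].
  rewrite ltB => Bt -> ->; apply: kill_rel => // [g /negbTE kg|kA kB]; first by rewrite /rl kg.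
  have At : lat A < lat t by apply: lt_trans Bt; case/andP: AB.
  have all_keep l : l \in sw A B -> rl l = gen l.
    move=> ls; rewrite /rl; case: ifP => //; rewrite /keep (mid_lt AB Bt ls) andbT.
    move: ls; rewrite mem_sw // => /asboolP[a [b c]]; rewrite (E_combol _ c).
    by case/andP: kA kB => /eqP -> _ /andP[/eqP -> _]; rewrite !mulr0 addr0 eqxx.
  rewrite [RHS](eq_big_seq gen) //; transitivity (word [:: A; B]).
    by rewrite wprod2 /rl kA kB pg_word_cons pg_word1.
  by apply: pg_word_rel; left; exists A, B; rewrite ltB.
rewrite !wprod2 /rl; case: (keep w); last by rewrite mulg1 mul1g.
exact: word_central.
Qed.

(** For surviving A and B this is exactly the rank three identity. *)
Let fl_rel u v : rels u v -> wprod fl u = wprod fl v.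
Proof.
case=> [[A [B [AB]]]|[w [g [ow -> ->]]]].
  rewrite ltB => Bt -> ->; apply: kill_rel => // [g /negbTE kg|kA kB]; first by rewrite /fl kg.
  have At : lat A < lat t by apply: lt_trans Bt; case/andP: AB.
  have PA := keep_pair kA At; have PB := keep_pair kB Bt.
  have gE l : l \in sw A B -> fl l = word (phi l t).
    move=> ls; have lt := mid_lt AB Bt ls; apply: fl_lt => //.
    apply: pair_keep; apply: (pair_mid AB PA PB); move: ls; by rewrite mem_sw // => /asboolP.
  rewrite [RHS](eq_big_seq (fun l => word (phi l t))) //.
  rewrite wprod2 (fl_lt kA At) (fl_lt kB Bt) -!wprod_word -wprod_cat.
  rewrite -[RHS](wprod_flatten gen); apply: (rank3 AB PA PB) => A' B' AB' Bt'.
  by apply: pg_word_rel; left; exists A', B'; rewrite ltB.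
rewrite !wprod2 (@fl_o w) ?ow //; case: (keep w); last by rewrite mulg1 mul1g.
exact: word_central.
Qed.

Let r := @pg_lift _ rels _ rl.
Let f := @pg_lift _ rels _ fl.
Let rM x y : r (x * y)%g = (r x * r y)%g. Proof. exact: pg_liftM rl_rel _ _. Qed.
Let fM x y : f (x * y)%g = (f x * f y)%g. Proof. exact: pg_liftM fl_rel _ _. Qed.
Let r1 : r 1%g = 1%g. Proof. exact: pg_lift1 rl_rel. Qed.
Let f1 : f 1%g = 1%g. Proof. exact: pg_lift1 fl_rel. Qed.
Let rV x : r x^-1%g = (r x)^-1%g. Proof. exact: pg_liftV rl_rel _. Qed.

Let r_word w : r (word w) = wprod rl w. Proof. exact: pg_lift_word rl_rel _. Qed.
Let r_gen g : r (gen g) = rl g. Proof. exact: pg_lift_gen rl_rel _. Qed.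
Let f_gen g : f (gen g) = fl g. Proof. exact: pg_lift_gen fl_rel _. Qed.

Let r_rl g : r (rl g) = rl g.
Proof. by rewrite /rl; case: ifP => kg; rewrite ?r1 // r_gen /rl kg. Qed.

Let rr y : r (r y) = r y.
Proof.
apply: (pg_hom_ext (F := fun y => r (r y)) (F' := r)) => [a b|a b|g].
- by rewrite !rM.
- by rewrite rM.
- by rewrite r_gen r_rl.
Qed.

Let fr y : f (r y) = f y.
Proof.
apply: (pg_hom_ext (F := fun y => f (r y)) (F' := f)) => [a b|a b|g].
- by rewrite rM fM.
- by rewrite fM.
- rewrite r_gen /rl; case: ifP => // kg.
  by rewrite f1 f_gen /fl kg.
Qed.

Let r_phi g : pairb g t -> r (word (phi g t)) = gen g.
Proof.
move=> gt; rewrite r_word (@wprod_only _ _ _ g).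
- by rewrite /rl pair_keep.
- by have := sw_uniq gt; rewrite sw_cons // => /andP[].
- by rewrite mem_phi // (pair_neq gt) andbT; apply/asboolP/mid_l.
move=> l lp lg; rewrite /rl; case: ifP => // /andP[+ _].
move: lp; rewrite mem_phi // => /andP[/asboolP[a [b c]] lt].
rewrite (E_combol _ c) (pair_E0 gt) mulr0 add0r mulf_eq0 (negbTE (E_neq0 _ _)) orbF => /eqP b0.
by case/eqP: lg; apply: (@combo_l0 _ _ t a%:R); rewrite -b0.
Qed.

Let rf y : r (f y) = r y.
Proof.
apply: (pg_hom_ext (F := fun y => r (f y)) (F' := r)) => [a b|a b|g].
- by rewrite fM rM.
- by rewrite rM.
rewrite f_gen r_gen /fl; case: ifP => kg; last by rewrite r1 /rl kg.
have [og|og] := eqVneq o (Some g); first exact: r_gen.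
rewrite r_phi // ?/rl ?kg //; apply: keep_pair => //.
by case/andP: kg => _; rewrite (negbTE og) orbF.
Qed.

(** Since f r = f and r f = r, the remainder [(f y)^-1 * y] depends only on the coset of y modulo
    left multiplication by the image of f: coset representatives come for free. The stable letter
    replaces the factor f(y) by r(y), and [T'] does the reverse. *)
Let T y : G := (r y * (f y)^-1 * y)%g.
Let T' y : G := (f y * (r y)^-1 * y)%g.

Let TK : cancel T T'.
Proof.
move=> y; have e : r (T y) = r y.
  by rewrite /T !rM rV rr rf mulgV mul1g.
have e' : f (T y) = f y by rewrite -fr e fr.
by rewrite /T' e e' /T !mulgA mulgVK mulgV mul1g.
Qed.

Let T'K : cancel T' T.
Proof.
move=> y; have e : r (T' y) = r y.
  by rewrite /T' !rM rV rr rf mulgV mul1g.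
have e' : f (T' y) = f y by rewrite -fr e fr.
by rewrite /T e e' /T' !mulgA mulgVK mulgV mul1g.
Qed.

Let a x y : G := if x == t then T y else (gen x * y)%g.
Let a' x y : G := if x == t then T' y else ((gen x)^-1 * y)%g.

Let foldr_a w y : t \notin w -> foldr a y w = (word w * y)%g.
Proof.
elim: w => [|x w IH]; first by rewrite /pg_word big_nil mul1g.
rewrite inE negb_or eq_sym => /andP[xt tw].
by rewrite /= IH // /a (negbTE xt) pg_word_cons mulgA.
Qed.

Let T_phi g y : pairb g t -> T (word (phi g t) * y)%g = (gen g * T y)%g.
Proof.
move=> gt; have e : f (word (phi g t)) = word (phi g t).
  rewrite -fr r_phi // f_gen fl_lt // ?pair_keep //; by case/andP: gt.
by rewrite /T rM r_phi // fM e invgM !mulgA mulgVK.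
Qed.

(** Letters other than t act on G by left multiplication, and t by [T]; [T_phi] is the relation A t
    = t [phi A t]. Acting on 1, a word without t returns its own value in G. *)
Lemma tower_step u v : t \notin u -> t \notin v ->
  pg_word (lrel o (lat t)) u = pg_word (lrel o (lat t)) v -> word u = word v.
Proof.
move=> tu tv e.
have := @action_eq _ (lrel o (lat t)) _ a a' _ _ _ u v 1%g e.
rewrite !foldr_a // !mulg1; apply.
- by move=> x y; rewrite /a /a'; case: (x == t); [apply: TK | apply: mulKg].
- by move=> x y; rewrite /a /a'; case: (x == t); [apply: T'K | apply: mulVKg].
move=> u' v' r' y; case: (r') => [[A [B [AB]]]|[w [g [ow eu ev]]]].
  rewrite le_eqVlt => /orP[|Bt].
    rewrite lat_eq => /eqP Bt; rewrite {B}Bt in AB * => -> ->.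
    have tA : A != t by apply: pair_neq AB.
    rewrite sw_cons //= /a eqxx (negbTE tA) -/a foldr_a ?T_phi //.
    by rewrite mem_phi // eqxx andbF.
  move=> eu ev; have tA : A != t.
    by apply: contraTneq Bt => <-; rewrite -leNgt; case/andP: AB => /ltW.
  have tB : B != t by apply: contraTneq Bt => ->; rewrite ltxx.
  rewrite !foldr_a.
  + by congr (_ * _)%g; apply: pg_word_rel; left; exists A, B; rewrite ltB.
  + by rewrite ev; apply: contraTN Bt => /(mid_lt AB) h; apply/negP => /h; rewrite ltxx.
  + by rewrite eu !inE negb_or ![t == _]eq_sym tA tB.
have wt : w != t by apply: contraNneq ot => <-; rewrite ow.
rewrite eu ev /= /a (negbTE wt); case: eqP => [_|_]; last first.
  by rewrite !mulgA (word_central ow).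
have c := word_central ow.
rewrite /T rM fM r_gen f_gen (@fl_o w) ?ow // /rl.
case: (keep w); last by rewrite !mul1g mulgA [RHS]mulgA c.
rewrite invgM !mulgA; congr (_ * _)%g; rewrite -!mulgA; congr (_ * _)%g.
by rewrite mulVg mulg1.
Qed.

(** For a vertically last t the orthogonal letters commute with t. In the action on pairs of an
    element of G and an integer, t counts visits to fixed points of [r]: [rcons s t] counts 1, since
    1 is fixed, while [t :: s] counts 1 only if the value of s is fixed. *)
Lemma tower_fixed s : o = None -> (forall j, (j <= t)%N) -> (forall x, x \in s -> lat x < lat t) ->
  pg_word (lrel o (lat t)) (t :: s) = pg_word (lrel o (lat t)) (rcons s t) ->
  word [seq x <- s | E x t == 0] = word s.
Proof.
move=> oN tlast slt e.
have -> : word [seq x <- s | E x t == 0] = r (word s).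
  rewrite r_word; elim: s slt {e} => [|x s IH] slt; first by rewrite /pg_word /wprod !big_nil.
  have kx : keep x = (E x t == 0) by rewrite /keep slt ?mem_head ?andbT.
  rewrite wprod_cons -IH => [|y ys]; last by apply: slt; rewrite inE ys orbT.
  by rewrite /rl kx /=; case: ifP => _; rewrite ?mul1g ?pg_word_cons.
pose b x (y : G * int) := if x == t then (y.1, y.2 + `[< r y.1 = y.1 >]%:Z) else ((gen x * y.1)%g, y.2).
pose b' x (y : G * int) := if x == t then (y.1, y.2 - `[< r y.1 = y.1 >]%:Z) else (((gen x)^-1 * y.1)%g, y.2).
have foldr_b w y : t \notin w -> foldr b y w = ((word w * y.1)%g, y.2).
  elim: w => [|x w IH]; first by rewrite /pg_word big_nil mul1g; case: y.
  rewrite inE negb_or eq_sym => /andP[xt tw].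
  by rewrite /= IH // /b (negbTE xt) pg_word_cons mulgA.
have ts : t \notin s by apply/negP => /slt; rewrite ltxx.
have e1 : foldr b (1%g, 0) (t :: s) = (word s, (`[< r (word s) = word s >] : nat)%:Z).
  by rewrite /= foldr_b // /b eqxx /= mulg1 add0r.
have e2 : foldr b (1%g, 0) (rcons s t) = (word s, 1%Z).
  by rewrite -cats1 foldr_cat foldr_b //= /b eqxx /= mulg1 r1 asboolT.
have := @action_eq _ (lrel o (lat t)) _ b b' _ _ _ (t :: s) (rcons s t) (1%g, 0) e.
rewrite e1 e2 => h.
suff [] : (word s, (`[< r (word s) = word s >] : nat)%:Z) = (word s, 1%Z).
  by case: asboolP.
apply: h.
- move=> x [y z]; rewrite /b /b'; case: (x == t) => /=; first by rewrite addrK.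
  by rewrite mulKg.
- move=> x [y z]; rewrite /b /b'; case: (x == t) => /=; first by rewrite subrK.
  by rewrite mulVKg.
move=> u v r' [y z]; case: (r') => [[A [B [AB]]]|[w [g [ow _ _]]]]; last by exfalso; move: ow; rewrite oN.
rewrite le_eqVlt => /orP[|Bt].
  rewrite lat_eq => /eqP Bt; rewrite {B}Bt in AB * => -> ->.
  have tA : A != t by apply: pair_neq AB.
  rewrite sw_last //; last by right.
  rewrite /= /b eqxx (negbTE tA) /= rM r_gen /rl pair_keep //.
  congr (_, _ + _); congr (nat_of_bool _)%:Z.
  by apply/asboolP/asboolP => [->|/mulgI].
move=> eu ev; have tA : A != t.
  by apply: contraTneq Bt => <-; rewrite -leNgt; case/andP: AB => /ltW.
have tB : B != t by apply: contraTneq Bt => ->; rewrite ltxx.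
rewrite !foldr_b //=.
+ by congr (_ * _, _)%g; apply: pg_word_rel; left; exists A, B; rewrite ltB.
+ by rewrite ev; apply: contraTN Bt => /(mid_lt AB) h'; apply/negP => /h'; rewrite ltxx.
+ by rewrite eu !inE negb_or ![t == _]eq_sym tA tB.
Qed.

End Step.

Lemma lat_bound : exists N : nat, forall i, - N%:Z < lat i /\ lat i <= N%:Z.
Proof.
exists (\sum_i `|lat i|%N).+1 => i; rewrite (bigD1 i) //=; lia.
Qed.

(** One lateral rank at a time, by [tower_step]; at the rank of the central letter, its relations
    are commutations and follow from centrality. *)
Lemma lrel_down (o : option 'I_m) k (N : nat) (u v : seq 'I_m) : (forall w, o = Some w -> forall j, (j <= w)%N) ->
  (forall x, x \in u -> lat x <= k \/ o = Some x) ->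
  (forall x, x \in v -> lat x <= k \/ o = Some x) ->
  pg_word (lrel o (k + N%:Z)) u = pg_word (lrel o (k + N%:Z)) v ->
  pg_word (lrel o k) u = pg_word (lrel o k) v.
Proof.
move=> olast ku kv; elim: N => [|N IH]; first by rewrite addr0.
have kN : k + N.+1%:Z - 1 = k + N%:Z by lia.
move=> e; apply: IH; have [t /eqP tk|nt] := pickP [pred t | lat t == k + N.+1%:Z]; last first.
  apply: pg_word_sub e => u' v' [[A [B [AB lB -> ->]]]|[w [g [ow -> ->]]]]; apply: pg_word_rel.
    left; exists A, B; split=> //; have /= := nt B; lia.
  by right; exists w, g.
rewrite -tk in e kN; have [ot|ot] := eqVneq o (Some t); last first.
  rewrite -kN; apply: tower_step e => //.
    by apply/negP => /ku[|/eqP]; [lia | apply/negP].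
  by apply/negP => /kv[|/eqP]; [lia | apply/negP].
apply: pg_word_sub e => u' v' [[A [B [AB lB -> ->]]]|[w [g [ow -> ->]]]].
  have [Bt|Bt] := eqVneq B t.
    rewrite Bt in AB *; rewrite (sw_last AB); last by right; apply: olast.
    by apply/esym/pg_word_rel; right; exists t, A.
  apply: pg_word_rel; left; exists A, B; split=> //; rewrite -kN.
  by have := lB; rewrite le_eqVlt lat_eq (negbTE Bt) /=; lia.
by apply: pg_word_rel; right; exists w, g.
Qed.

Lemma prel_lrel (o : option 'I_m) k (u v : seq 'I_m) : (forall w, o = Some w -> forall j, (j <= w)%N) ->
  (forall x, x \in u -> lat x <= k \/ o = Some x) ->
  (forall x, x \in v -> lat x <= k \/ o = Some x) ->
  pg_word prel u = pg_word prel v -> pg_word (lrel o k) u = pg_word (lrel o k) v.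
Proof.
move=> olast ku kv e; have [N NP] := lat_bound.
apply: (@lrel_down o k (N + `|k|)) => //; apply: pg_word_sub e => u' v' [A [B [AB -> ->]]].
by apply: pg_word_rel; left; exists A, B; split=> //; have [_] := NP B; lia.
Qed.

Lemma lrel_prel k u v : pg_word (lrel None k) u = pg_word (lrel None k) v ->
  pg_word prel u = pg_word prel v.
Proof.
apply: pg_word_sub => u' v' [[A [B [AB lB -> ->]]]|[w [g []//]]].
by apply: pg_word_rel; exists A, B.
Qed.

(** In the quotient where w is central, all copies of w move to the front and the common deletion
    cancels. Descending below every lateral rank leaves only the centrality relations, which
    preserve the number of copies. *)
Lemma count_last (w : 'I_m) u v : (forall j, (j <= w)%N) ->
  [seq x <- u | x != w] = [seq x <- v | x != w] ->
  pg_word prel u = pg_word prel v -> count_mem w u = count_mem w v.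
Proof.
move=> wlast uv e; have [N NP] := lat_bound.
have olast x : Some w = Some x -> forall j, (j <= x)%N by case=> <-.
have comm K g a : pg_word (lrel (Some w) K) (g :: nseq a w) =
    pg_word (lrel (Some w) K) (rcons (nseq a w) g).
  elim: a => //= a IH; rewrite [RHS]pg_word_cons -IH -pg_word_cons.
  rewrite -[[:: g, w & _]]/([:: g; w] ++ nseq a w) -[[:: w, g & _]]/([:: w; g] ++ nseq a w).
  rewrite !pg_word_cat; congr (_ * _)%g; apply/esym/pg_word_rel; right; by exists w, g.
have split K s : pg_word (lrel (Some w) K) s =
    pg_word (lrel (Some w) K) (nseq (count_mem w s) w ++ [seq x <- s | x != w]).
  elim: s => //= x s IH; rewrite pg_word_cons IH -pg_word_cons; case: eqVneq => [->//|xw] /=.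
  rewrite add0n -cat_cons pg_word_cat comm -pg_word_cat -cats1 -catA //.
have : pg_word (lrel (Some w) N%:Z) (nseq (count_mem w u) w) =
    pg_word (lrel (Some w) N%:Z) (nseq (count_mem w v) w).
  apply: (mulIg (pg_word _ [seq x <- u | x != w])); rewrite -!pg_word_cat -split uv -split.
  by apply: prel_lrel e => // x _; left; have [] := NP x.
rewrite (_ : N%:Z = - N%:Z + (N + N)%:Z) => [/lrel_down e'|]; last by lia.
have : pg_word (lrel (Some w) (- N%:Z)) (nseq (count_mem w u) w) =
    pg_word (lrel (Some w) (- N%:Z)) (nseq (count_mem w v) w).
  by apply: e' => // x /nseqP[-> _]; right.
move/(@pg_word_count _ _ w); rewrite !count_nseq /= eqxx !mul1n; apply.
move=> u' v' [[A [B [_ lB _ _]]]|[x [g [_ -> ->]]]] /=; last by rewrite addnCA.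
by have [] := NP B; lia.
Qed.

(** In a relation of rank at most that of t, the letter t occurs once on each side or not at all. *)
Lemma count_top t u v : (forall x, x \in u -> lat x <= lat t) ->
  (forall x, x \in v -> lat x <= lat t) ->
  pg_word prel u = pg_word prel v -> count_mem t u = count_mem t v.
Proof.
move=> ut vt /(@prel_lrel None (lat t)) e.
have : pg_word (lrel None (lat t)) u = pg_word (lrel None (lat t)) v.
  by apply: e => // x h; left; auto.
apply: pg_word_count => u' v' [[A [B [AB lB -> ->]]]|[w [g []//]]].
have nA : A != t.
  by apply: contraTneq lB => <-; rewrite -ltNge; case/andP: AB.
rewrite [RHS]count_uniq_mem ?sw_uniq //= (negbTE nA) add0n addn0.
congr (nat_of_bool _); move: lB; rewrite le_eqVlt => /orP[|Bt].
  by rewrite lat_eq => /eqP Bt; rewrite -Bt eqxx mem_sw //; apply/esym/asboolP/mid_r.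
rewrite (_ : B == t = false); last by apply: contraTF Bt => /eqP ->; rewrite ltxx.
by apply/esym; apply: contraTF Bt => ts; apply/negP => /(mid_lt AB)/(_ ts); rewrite ltxx.
Qed.

(** No homomorphism from an earlier letter to a later one; words of green sequences have this
    property by [gpath_forth]. *)
Definition forth (s : seq 'I_m) := pairwise (fun x y => E x y <= 0) s.

Section Peel.
Variables (t : 'I_m) (s0 s1 : seq 'I_m).
Hypotheses (fo : forth (s0 ++ t :: s1)) (top : forall x, x \in s0 ++ t :: s1 -> lat x <= lat t).

(** What remains after t has been moved to the front by g t = t [phi g t]; all letters left precede
    t laterally. *)
Definition peel := flatten [seq phi g t | g <- s0] ++ s1.

Let fo0 x y : x \in s0 -> y \in t :: s1 -> E x y <= 0.
Proof.
by move: fo; rewrite /forth pairwise_cat => /and3P[/allrelP h _ _]; apply: h.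
Qed.

Let fo1 y : y \in s1 -> E t y <= 0.
Proof.
by move: fo; rewrite /forth pairwise_cat => /and3P[_ _ /= /andP[/allP h _]]; apply: h.
Qed.

Lemma peel_pair g : g \in s0 -> pairb g t.
Proof.
move=> g0; have Eg := fo0 g0 (mem_head t s1).
have lt : lat g < lat t.
  rewrite lt_neqAle top ?mem_cat ?g0 // andbT lat_eq.
  by apply: contraTneq Eg => ->; rewrite -ltNge rE_gt0.
by rewrite /pairb lt /= eq_le Eg E_ge0 // ltW.
Qed.

Lemma peel_word : pg_word prel (s0 ++ t :: s1) = pg_word prel (t :: peel).
Proof.
rewrite /peel; have: {subset s0 <= [pred g | pairb g t]} by move=> g /peel_pair.
elim: (s0) => //= g s IH sub; rewrite pg_word_cons IH => [|x xs]; last first.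
  by apply: sub; rewrite inE xs orbT.
have gt : pairb g t by apply: sub; rewrite mem_head.
rewrite -pg_word_cons -[g :: _]/([:: g; t] ++ _) pg_word_cat.
have -> : pg_word prel [:: g; t] = pg_word prel (sw g t).
  by apply: pg_word_rel; exists g, t.
by rewrite -pg_word_cat sw_cons //= catA.
Qed.

Lemma peel_lt x : x \in peel -> lat x < lat t.
Proof.
rewrite mem_cat => /orP[/flatten_mapP[g g0 xg]|x1].
  exact: phi_lt (peel_pair g0) xg.
rewrite lt_neqAle top ?mem_cat ?inE ?x1 ?orbT // andbT lat_eq.
by apply: contraTneq (fo1 x1) => ->; rewrite -ltNge rE_gt0.
Qed.

(** Letters of [phi g t] are nonnegative combinations of g and t, which settles pairs from different
    blocks; inside one block, the slope order runs against homomorphisms by [combo_E_order]. *)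
Lemma peel_forth : forth peel.
Proof.
have key x y g : g \in s0 -> x \in phi g t -> E g y <= 0 -> E t y <= 0 -> E x y <= 0.
  move=> g0; rewrite mem_phi ?peel_pair // => /andP[/asboolP[a [b c]] _] h1 h2.
  by rewrite (E_combol _ c) -[0]addr0; apply: lerD; rewrite mulr_ge0_le0.
rewrite /peel /forth pairwise_cat; apply/and3P; split.
- apply/allrelP => x y /flatten_mapP[g g0 xg] y1; apply: key xg _ _ => //; last exact: fo1.
  by apply: fo0; rewrite // inE y1 orbT.
- have: pairwise (fun x y => E x y <= 0) s0.
    by move: fo; rewrite /forth pairwise_cat => /and3P[].
  have: {subset s0 <= s0} by [].
  elim: {1 3 4}(s0) => //= g s IH sub /andP[/allP gs ps].
  have g0 : g \in s0 by apply: sub; rewrite mem_head.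
  have gt := peel_pair g0.
  rewrite pairwise_cat IH // => [|x xs]; last by apply: sub; rewrite inE xs orbT.
  rewrite andbT; apply/andP; split.
    apply/allrelP => x y xg /flatten_mapP[h hs yh].
    have h0 : h \in s0 by apply: sub; rewrite inE hs orbT.
    apply: key xg _ _ => //; last by apply: rE_le0; apply: phi_lt (peel_pair h0) yh.
    move: yh; rewrite mem_phi ?peel_pair // => /andP[/asboolP[a [b c]] _].
    by rewrite (E_combor _ c) (pair_E0 gt) mulr0 addr0 mulr_ge0_le0 // gs.
  have [_] := phiP gt; rewrite (sorted_pairwise (key_trans (k := _))).
  apply: (sub_in_pairwise (P := [in phi g t])); last exact/allP.
  move=> x y; rewrite !mem_phi // => /andP[/asboolP[a [b c]] _] /andP[/asboolP[a' [b' c']] _].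
  rewrite (slope_lt gt _ _ _ _ c c') // => lt1; rewrite leNgt; apply/negP => E1.
  have xy : x != y by apply: contraTneq lt1 => e; rewrite -leNgt; move: c'; rewrite -e => /(combo_uniq gt c)[-> ->].
  by have := combo_E_order gt c c' xy E1; rewrite mulrC => lt2; have := lt_trans lt1 lt2; rewrite ltxx.
by move: fo; rewrite /forth pairwise_cat => /and3P[_ _ /andP[]].
Qed.

Lemma mem_peel x : x \in s0 ++ t :: s1 -> x = t \/ x \in peel.
Proof.
rewrite mem_cat inE => /or3P[x0|/eqP|x1]; [right|by left|right]; last by rewrite mem_cat x1 orbT.
rewrite mem_cat; apply/orP; left; apply/flatten_mapP; exists x => //.
have xt := peel_pair x0.
by rewrite mem_phi // (pair_neq xt) andbT; apply/asboolP/mid_l.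
Qed.

End Peel.

Lemma exists_top (s : seq 'I_m) : s != [::] -> exists s0 t s1,
  s = s0 ++ t :: s1 /\ forall x, x \in s -> lat x <= lat t.
Proof.
move=> s0; suff [t ts h] : exists2 t, t \in s & forall x, x \in s -> lat x <= lat t.
  by case/splitPr: ts h => p q h; exists p, t, q.
elim: s s0 => // a s IH _; have [->|/IH[t ts h]] := eqVneq s [::].
  by exists a; rewrite ?mem_head // => x; rewrite inE => /eqP ->.
have [le|lt] := leP (lat a) (lat t).
  exists t; rewrite ?inE ?ts ?orbT // => x; rewrite inE => /orP[/eqP->|/h] //.
exists a; rewrite ?mem_head // => x; rewrite inE => /orP[/eqP->|/h] // le.
exact: le_trans le (ltW lt).
Qed.

Lemma forth_filter (P : pred 'I_m) s : forth s -> forth [seq x <- s | P x].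
Proof. exact: pairwise_filter. Qed.

Lemma filter_peel w t s0 s1 : (forall g, g \in s0 -> pairb g t) -> E t w = 0 ->
  [seq x <- peel t s0 s1 | E x w == 0] =
  peel t [seq x <- s0 | E x w == 0] [seq x <- s1 | E x w == 0].
Proof.
move=> h tw; rewrite /peel filter_cat; congr (_ ++ _).
elim: s0 h => //= g s IH h; have gt : pairb g t by apply: h; rewrite mem_head.
rewrite filter_cat IH => [|x xs]; last by apply: h; rewrite inE xs orbT.
have lE l : l \in phi g t -> (E l w == 0) = (E g w == 0).
  rewrite mem_phi // => /andP[/asboolP[a [b c]] lt].
  rewrite (E_combol _ c) tw mulr0 addr0 mulf_eq0; case: eqVneq => //= a0.
  by case/eqP: lt; apply: (@combo_r0 _ g t b%:R); rewrite -a0.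
rewrite (eq_in_filter lE); case: (E g w == 0); first by rewrite filter_predT.
by rewrite filter_pred0.
Qed.

(** Induction on the laterally last letter t: by [count_top] it survives the filter, so E(t, w) = 0;
    then t is peeled off and cancelled from both words, the filter commuting with [peel]. *)
Lemma filter_fixed w s : forth s -> (forall x, x \in s -> lat x < lat w) ->
  pg_word prel [seq x <- s | E x w == 0] = pg_word prel s ->
  forall x, x \in s -> E x w = 0.
Proof.
have [N NP] := lat_bound.
suff main M : forall s, (forall x, x \in s -> lat x <= - N%:Z + M%:Z) -> forth s ->
    (forall x, x \in s -> lat x < lat w) ->
    pg_word prel [seq x <- s | E x w == 0] = pg_word prel s ->
    forall x, x \in s -> E x w = 0.
  by apply: (main (N + N)%N) => x _; have [_] := NP x; lia.
elim: M => [|M IH] {}s sM fo sw e.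
  by move=> x /sM; have [] := NP x; lia.
have [->//|/exists_top[s0 [t [s1 [es top]]]]] := eqVneq s [::].
have ts : t \in s by rewrite es mem_cat mem_head orbT.
have kt : t \in [seq x <- s | E x w == 0].
  rewrite -has_pred1 has_count (count_top (t := t) _ top e) -?has_count ?has_pred1 //.
  by move=> x; rewrite mem_filter => /andP[_ /top].
move: kt; rewrite mem_filter => /andP[/eqP kt _].
rewrite es in fo top e.
have fe : [seq x <- s0 ++ t :: s1 | E x w == 0] =
    [seq x <- s0 | E x w == 0] ++ t :: [seq x <- s1 | E x w == 0].
  by rewrite filter_cat /= kt eqxx.
have f' : forth ([seq x <- s0 | E x w == 0] ++ t :: [seq x <- s1 | E x w == 0]).
  by rewrite -fe; apply: forth_filter.
have top' x : x \in [seq x <- s0 | E x w == 0] ++ t :: [seq x <- s1 | E x w == 0] ->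
    lat x <= lat t.
  by rewrite -fe mem_filter => /andP[_ /top].
move: e; rewrite fe (peel_word f' top') (peel_word fo top) !pg_word_cons => /mulgI.
rewrite -filter_peel //; last by move=> g; apply: (peel_pair fo top).
move=> e x; rewrite es => /(mem_peel fo top)[->//|]; apply: IH e _.
- by move=> y /(peel_lt fo top) yt; have := sM _ ts; lia.
- exact: (peel_forth fo top).
- by move=> y /(peel_lt fo top) yt; apply: lt_trans yt (sw _ ts).
Qed.

(* Induction on the laterally last letter t of s: while t is after w, it is
   removed from both words by [peel]; when all letters precede w, the tower step
   of w forces s to equal its subword of letters orthogonal to w. *)
Lemma commute_orth (w : 'I_m) s : (forall j, (j <= w)%N) -> forth s -> w \notin s ->
  (forall x, x \in s -> E w x <= 0) ->
  pg_word prel (w :: s) = pg_word prel (rcons s w) ->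
  forall x, x \in s -> E x w <= 0.
Proof.
move=> wlast; have [N NP] := lat_bound.
suff main M : forall s, (forall x, x \in s -> lat x <= - N%:Z + M%:Z) -> forth s ->
    w \notin s -> (forall x, x \in s -> E w x <= 0) ->
    pg_word prel (w :: s) = pg_word prel (rcons s w) ->
    forall x, x \in s -> E x w <= 0.
  by apply: (main (N + N)%N) => x _; have [_] := NP x; lia.
elim: M => [|M IH] {}s sM fo ws wx e.
  by move=> x /sM; have [] := NP x; lia.
have [->//|/exists_top[s0 [t [s1 [es top]]]]] := eqVneq s [::].
have ts : t \in s by rewrite es mem_cat mem_head orbT.
have wt : w != t by apply: contraNneq ws => ->.
have [lt|lt] := lat_neq_lt S wt; last first.
  have sw x : x \in s -> lat x < lat w by move=> /top h; apply: le_lt_trans h lt.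
  have ek : pg_word (lrel None (lat w)) (w :: s) = pg_word (lrel None (lat w)) (rcons s w).
    apply: prel_lrel e => // x; rewrite ?mem_rcons inE => /orP[/eqP->|/sw/ltW]; by left.
  have fx : pg_word prel [seq x <- s | E x w == 0] = pg_word prel s.
    by apply: (lrel_prel (k := lat w - 1)); apply: tower_fixed.
  by move=> x xs; rewrite (filter_fixed fo sw fx).
have pwt : pairb w t by rewrite /pairb lt eq_le wx ?E_ge0 // ltW.
rewrite es in fo top e ws wx.
have sp x : x \in peel t s0 s1 -> x != w /\ E w x <= 0.
  rewrite mem_cat => /orP[/flatten_mapP[g g0]|x1]; last first.
    have xs : x \in s0 ++ t :: s1 by rewrite mem_cat inE x1 !orbT.
    by split; [apply: contraNneq ws => <- | apply: wx].
  have gs : g \in s0 ++ t :: s1 by rewrite mem_cat g0.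
  have gt := peel_pair fo top g0.
  rewrite mem_phi // => /andP[/asboolP[a [b c]] xt].
  have wE : E w x <= 0.
    by rewrite (E_combor _ c) (pair_E0 pwt) mulr0 addr0 mulr_ge0_le0 // wx.
  by split=> //; apply: contraTneq wE => ->; rewrite -ltNge rE_gt0.
have e' : pg_word prel (w :: peel t s0 s1) = pg_word prel (rcons (peel t s0 s1) w).
  apply: (mulgI (pg_gen prel t)); rewrite -!pg_word_cons -rcons_cons -cats1 [RHS]pg_word_cat.
  rewrite -(peel_word fo top) -pg_word_cat cats1 -e [RHS]pg_word_cons (peel_word fo top).
  rewrite -pg_word_cons -[[:: w, t & _]]/([:: w; t] ++ _) -[[:: t, w & _]]/([:: t; w] ++ _) !pg_word_cat.
  congr (_ * _)%g; rewrite -(sw_last pwt); last by left.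
  by apply/esym/pg_word_rel; exists w, t.
move=> x; rewrite es => /(mem_peel fo top)[->|]; first exact: rE_le0.
apply: IH e' _ => [y /(peel_lt fo top) yt|||y /sp[]//].
- by have := sM _ ts; lia.
- exact: (peel_forth fo top).
- by apply/negP => /sp[]; rewrite eqxx.
Qed.

End Tower.

(** * Duality and truncation *)

Section DualRootData.
Context (R : realType) (n : nat) (Q : valued_quiver n).

Section Opposite.
Variables (m : nat) (b : 'I_m -> 'rV[nat]_n) (r : rel 'I_m).
Implicit Types (x : 'rV[R]_n).

Lemma quo_pos_opp x l : quo_pos Q b r (- x) l = sub_neg Q b r x l.
Proof. by apply: eq_forallb => j; rewrite pairrN oppr_gt0. Qed.

Lemma quo_nneg_opp x l : quo_nneg Q b r (- x) l = sub_npos Q b r x l.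
Proof. by apply: eq_forallb => j; rewrite pairrN oppr_ge0. Qed.

Lemma sub_neg_opp x l : sub_neg Q b r (- x) l = quo_pos Q b r x l.
Proof. by apply: eq_forallb => j; rewrite pairrN oppr_lt0. Qed.

Lemma sub_npos_opp x l : sub_npos Q b r (- x) l = quo_nneg Q b r x l.
Proof. by apply: eq_forallb => j; rewrite pairrN oppr_le0. Qed.
End Opposite.

Variables (m : nat) (S : root_data R Q m).
Local Notation lat := (rlat S).

(* The root data of the opposite modulation: sub- and quotient roots, and the
   sides of the walls, are exchanged. *)
Definition dual : root_data R Q m.
Proof.
refine (@RootData R n Q m (rb S) (rquo S) (rsub S) (fun j => - lat j)
  (fun i j => rE S j i) (ryr S) (ryl S) (ryr_pr S) (ryl_pr S) (rb_gt0 S)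
  _ _ _ (rE_gt0 S) (@rquo_refl _ _ _ _ S) (@rsub_refl _ _ _ _ S)
  (@rquo_trans _ _ _ _ S) (@rsub_trans _ _ _ _ S) (@rquo_index _ _ _ _ S)
  (@rsub_index _ _ _ _ S) (@rquo_hom _ _ _ _ S) (@rsub_hom _ _ _ _ S)
  (@rE_quo _ _ _ _ S) (@rE_sub _ _ _ _ S) _ _ _ _ _ _ _).
- by move=> i j /oppr_inj/rlat_inj.
- by move=> j l; rewrite ltrN2 => /rE_ge0.
- by move=> j l; rewrite ltrN2 => /rE_le0.
- by move=> j l; rewrite lerN2 => /(rINTr (r := S)).
- by move=> j l; rewrite lerN2 => /(rINTl (r := S)).
- move=> x l x0; rewrite -[sub_npos _ _ _ _ _]quo_nneg_opp -[quo_nneg _ _ (rsub S) _ _]sub_npos_opp.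
  by apply/esym/rFTw; rewrite pairrN x0 oppr0.
- move=> x j l; rewrite -[quo_pos _ _ _ _ _]sub_neg_opp -[sub_npos _ _ _ _ _]quo_nneg_opp => h h'.
  exact: rTF' h' h.
- move=> x j l; rewrite -[quo_nneg _ _ _ _ _]sub_npos_opp -[sub_neg _ _ _ _ _]quo_pos_opp => h h'.
  exact: rTF h' h.
- move=> x l; rewrite -[sub_npos _ _ _ _ _]quo_nneg_opp.
  have [|[j q h]] := rHNq S (- x) l; [by left | right; exists j => //].
  by rewrite -sub_neg_opp.
- move=> x l; rewrite -[quo_nneg _ _ _ _ _]sub_npos_opp.
  have [|[j q h]] := rHNs S (- x) l; [by left | right; exists j => //].
  by rewrite -quo_pos_opp.
Defined.

Lemma onwall_dual x j : onwall dual x j = onwall S (- x) j.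
Proof.
rewrite /onwall prN oppr_eq0; apply: andb_id2l => /eqP x0.
rewrite [RHS](FTw (S := S)); first exact/esym/quo_nneg_opp.
by rewrite prN -[pr S x j]/(pr dual x j) x0 oppr0.
Qed.

Lemma Ts_dual x j : Ts dual x j = Fs S (- x) j.
Proof. by rewrite /Ts /Fs sub_neg_opp. Qed.

Lemma pairb_dual A B : pairb dual A B = pairb S B A.
Proof. by rewrite /pairb ltrN2. Qed.

Lemma mid_dual A B l : mid dual A B l <-> mid S B A l.
Proof.
by split=> -[a [b c]]; exists b, a => x; rewrite addrC; apply: c.
Qed.

Lemma sw_dual A B : pairb S B A -> sw dual A B = rev (sw S B A).
Proof.
move=> BA; have AB : pairb dual A B by rewrite pairb_dual.
apply: klist_uniq (swP AB) _; split=> [l|].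
  by rewrite mem_rev mem_sw //; apply/asboolP/asboolP => /mid_dual.
rewrite rev_sorted; have [_] := swP BA.
rewrite !(sorted_pairwise _); last 2 first.
- by move=> ? ? ? h1 h2; apply: lt_trans h2 h1.
- exact: key_trans.
apply: (sub_in_pairwise (P := [in sw S B A])); last exact/allP.
move=> l g; rewrite !mem_sw // => /asboolP[a [b c]] /asboolP[a' [b' c']].
rewrite (slope_lt BA _ _ _ _ c c') // => h.
rewrite (@slope_lt _ _ _ _ dual A B _ _ b'%:R a'%:R b%:R a%:R) //.
- by rewrite mulrC [b%:R * _]mulrC.
- by move=> x; rewrite addrC; apply: c'.
- by move=> x; rewrite addrC; apply: c.
Qed.

(** Inverting generators reverses products, and the slope word of the dual pair is the reversed
    one. *)
Lemma prel_dual u v : pg_word (prel S) u = pg_word (prel S) v ->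
  pg_word (prel dual) (rev u) = pg_word (prel dual) (rev v).
Proof.
pose f x := ((pg_gen (prel dual) x)^-1)%g.
have fE w : wprod f w = ((pg_word (prel dual) (rev w))^-1)%g.
  elim: w => [|x w IH]; first by rewrite /wprod /pg_word !big_nil invg1.
  by rewrite wprod_cons IH rev_cons -cats1 pg_word_cat invgM pg_word1.
move=> /(congr1 (pg_lift f)); rewrite !pg_lift_word ?fE => [/invg_inj //||];
  move=> {}u {}v [A [B [AB -> ->]]]; rewrite !fE; congr (_^-1)%g.
all: rewrite -sw_dual //; apply: pg_word_rel; exists B, A.
all: by rewrite pairb_dual.
Qed.

Lemma rev_forth s : forth S s -> forth dual (rev s).
Proof.
rewrite /forth; elim: s => //= x s IH /andP[/allP xs ps].
rewrite rev_cons -cats1 pairwise_cat IH //= !andbT; apply/allrelP => y z.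
by rewrite mem_rev inE => ys /eqP ->; apply: xs.
Qed.
End DualRootData.

Lemma commute_orth' (R : realType) (n : nat) (Q : valued_quiver n) (m : nat)
    (S : root_data R Q m) (w : 'I_m) s :
  (forall j : 'I_m, (j <= w)%N) -> forth S s -> w \notin s ->
  (forall x, x \in s -> rE S x w <= 0) ->
  pg_word (prel S) (w :: s) = pg_word (prel S) (rcons s w) ->
  forall x, x \in s -> rE S w x <= 0.
Proof.
move=> wlast fo ws xw /prel_dual; rewrite rev_cons rev_rcons => e x xs.
apply: (@commute_orth _ _ _ _ (dual S) w (rev s)) => //.
- exact: rev_forth.
- by rewrite mem_rev.
- by move=> y; rewrite mem_rev; apply: xw.
- by rewrite mem_rev.
Qed.

Section Truncation.
Context (R : realType) (n : nat) (Q : valued_quiver n) (m : nat) (S : root_data R Q m.+1).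

Definition wid : 'I_m -> 'I_m.+1 := widen_ord (leqnSn m).

Lemma wid_inj : injective wid.
Proof. by move=> i j /(congr1 val) /= e; apply: val_inj. Qed.

Lemma wid_max j : wid j != ord_max.
Proof. by apply/eqP => /(congr1 val) /= e; have := ltn_ord j; rewrite e ltnn. Qed.

Lemma widP (j : 'I_m.+1) : j != ord_max -> exists i, j = wid i.
Proof.
move=> jm; have lt : (j < m)%N.
  by have := leq_ord j; rewrite leq_eqVlt => /orP[/eqP e|//]; case/eqP: jm; apply: val_inj.
by exists (Ordinal lt); apply: val_inj.
Qed.

Lemma wid_le (j : 'I_m.+1) (l : 'I_m) : (j <= l)%N -> exists i, j = wid i.
Proof.
move=> jl; apply: widP; apply: contraTneq jl => ->.
by rewrite -ltnNge; apply: ltn_ord.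
Qed.

Let b j := rb S (wid j).
Let sub i j := rsub S (wid i) (wid j).
Let quo i j := rquo S (wid i) (wid j).

Let forall_wid (r : rel 'I_m.+1) (P : pred 'I_m.+1) l :
  (forall i j, r i j -> (i <= j)%N) ->
  [forall j, r (wid j) (wid l) ==> P (wid j)] = [forall j, r j (wid l) ==> P j].
Proof.
move=> ri; apply/forallP/forallP => h j; last exact: h.
by apply/implyP => rj; have [i ej] := wid_le (ri _ _ rj); move: rj; rewrite ej; apply/implyP/h.
Qed.

Lemma sub_neg_wid (x : 'rV[R]_n) l : sub_neg Q b sub x l = sub_neg Q (rb S) (rsub S) x (wid l).
Proof. by rewrite -[RHS](forall_wid (fun j => pairr Q x (rb S j) < 0) l (@rsub_index _ _ _ _ S)). Qed.
Lemma sub_npos_wid (x : 'rV[R]_n) l : sub_npos Q b sub x l = sub_npos Q (rb S) (rsub S) x (wid l).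
Proof. by rewrite -[RHS](forall_wid (fun j => pairr Q x (rb S j) <= 0) l (@rsub_index _ _ _ _ S)). Qed.
Lemma quo_pos_wid (x : 'rV[R]_n) l : quo_pos Q b quo x l = quo_pos Q (rb S) (rquo S) x (wid l).
Proof. by rewrite -[RHS](forall_wid (fun j => 0 < pairr Q x (rb S j)) l (@rquo_index _ _ _ _ S)). Qed.
Lemma quo_nneg_wid (x : 'rV[R]_n) l : quo_nneg Q b quo x l = quo_nneg Q (rb S) (rquo S) x (wid l).
Proof. by rewrite -[RHS](forall_wid (fun j => 0 <= pairr Q x (rb S j)) l (@rquo_index _ _ _ _ S)). Qed.

(** Sub- and quotient roots have smaller indices, so the conditions on the remaining roots never
    refer to the deleted one. *)
Definition trunc : root_data R Q m.
Proof.
refine (@RootData R n Q m b sub quo (fun j => rlat S (wid j))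
  (fun i j => rE S (wid i) (wid j)) (fun j => ryl S (wid j)) (fun j => ryr S (wid j))
  _ _ _ _ _ _ _ _ _ _ _ _ _ _ _ _ _ _ _ _ _ _ _ _).
- by move=> j l; apply: ryl_pr.
- by move=> j l; apply: ryr_pr.
- by move=> j; apply: rb_gt0.
- by move=> i j /rlat_inj/wid_inj.
- by move=> j l; apply: rE_ge0.
- by move=> j l; apply: rE_le0.
- by move=> j; apply: rE_gt0.
- by move=> j; apply: rsub_refl.
- by move=> j; apply: rquo_refl.
- by move=> i j k; apply: rsub_trans.
- by move=> i j k; apply: rquo_trans.
- by move=> i j; apply: rsub_index.
- by move=> i j; apply: rquo_index.
- by move=> i j; apply: rsub_hom.
- by move=> i j; apply: rquo_hom.
- by move=> i j l; apply: rE_sub.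
- by move=> i j l; apply: rE_quo.
- by move=> i j; apply: rINTl.
- by move=> i j; apply: rINTr.
- by move=> x l x0; rewrite sub_npos_wid quo_nneg_wid; apply: rFTw.
- by move=> x j l; rewrite sub_npos_wid quo_pos_wid; apply: rTF.
- by move=> x j l; rewrite sub_neg_wid quo_nneg_wid; apply: rTF'.
- move=> x l; rewrite sub_npos_wid; have [|[j s h]] := rHNs S x (wid l); [by left | right].
  by have [i ej] := wid_le (rsub_index s); rewrite ej in s h; exists i; rewrite ?quo_pos_wid.
- move=> x l; rewrite quo_nneg_wid; have [|[j s h]] := rHNq S x (wid l); [by left | right].
  by have [i ej] := wid_le (rquo_index s); rewrite ej in s h; exists i; rewrite ?sub_neg_wid.
Defined.

Lemma onwall_trunc x j : onwall trunc x j = onwall S x (wid j).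
Proof. by rewrite /onwall /Fw sub_npos_wid. Qed.

End Truncation.

(** * Compartments and green sequences *)

Section Compartments.
Context (R : realType) (n : nat) (Q : valued_quiver n) (m : nat).
Implicit Types (S : root_data R Q m) (e : nat -> option bool) (x y z v w : 'rV[R]_n) (i j l X : 'I_m).

Definition sgn_ok (s : option bool) (a : R) : bool :=
  match s with Some true => 0 < a | Some false => a < 0 | None => true end.

(** Signs are functions on all natural numbers, so that one [e] serves every prefix length k as well
    as the truncation of S. *)
Definition reg S e (k : nat) x : Prop :=
  forall j : 'I_m, (j < k)%N -> sgn_ok (e j) (pr S x j).

Definition cut S e (i : 'I_m) : Prop := exists x, onwall S x i /\ reg S e i x.

Definition adm S e (k : nat) : Prop :=
  forall i : 'I_m, (i < k)%N -> (e i = None <-> ~ cut S e i).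

(* The side of the wall X of e1 and e2 seen at z, up to level k. *)
Definition facet S e1 e2 X (k : nat) z : Prop := pr S z X = 0 /\
  forall j : 'I_m, (j < k)%N -> j != X ->
    sgn_ok (e1 j) (pr S z j) /\ sgn_ok (e2 j) (pr S z j).

Definition generic S X z : Prop := forall j, j != X -> pr S z j != 0.

Definition nege e : nat -> option bool := fun j : nat => omap negb (e j).

Lemma sgn_okN s a : sgn_ok (omap negb s) (- a) = sgn_ok s a.
Proof. by case: s => [[]|] //=; rewrite ?oppr_lt0 ?oppr_gt0. Qed.

Lemma sgn_ok_conv s (a b t : R) : 0 <= t -> t <= 1 -> sgn_ok s a -> sgn_ok s b ->
  sgn_ok s (a + t * (b - a)).
Proof.
have -> : a + t * (b - a) = (1 - t) * a + t * b by ring.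
case: s => [[]|] //= t0 t1 ha hb; first exact: conv_gt.
by rewrite -oppr_gt0 opprD -!mulrN; apply: conv_gt; rewrite // oppr_gt0.
Qed.

(* y is an infinitesimal displacement of x in the direction v *)
Definition displaced S x v y : Prop := forall j, Num.sg (pr S y j) =
  if pr S x j == 0 then Num.sg (pr S v j) else Num.sg (pr S x j).

Lemma displace S x v : exists y, displaced S x v y.
Proof. by have [e _ eP] := perturb1 S x v; exists (x + e *: v). Qed.

Lemma displaced_gt S x v y j : displaced S x v y -> 0 < pr S x j -> 0 < pr S y j.
Proof. by move=> d h; rewrite -sgr_gt0 d gt_eqF // sgr_gt0. Qed.

Lemma displaced_lt S x v y j : displaced S x v y -> pr S x j < 0 -> pr S y j < 0.
Proof. by move=> d h; rewrite -sgr_lt0 d lt_eqF // sgr_lt0. Qed.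

Lemma displaced_gt0 S x v y j : displaced S x v y -> 0 <= pr S x j -> 0 < pr S v j -> 0 < pr S y j.
Proof.
move=> d h hv; rewrite -sgr_gt0 d; case: eqVneq => [_|x0]; rewrite sgr_gt0 //.
by rewrite lt_neqAle eq_sym x0.
Qed.

Lemma displaced_lt0 S x v y j : displaced S x v y -> pr S x j <= 0 -> pr S v j < 0 -> pr S y j < 0.
Proof.
move=> d h hv; rewrite -sgr_lt0 d; case: eqVneq => [_|x0]; rewrite sgr_lt0 //.
by rewrite lt_neqAle x0.
Qed.

Lemma displaced_eq0 S x v y j : displaced S x v y -> pr S x j = 0 -> pr S v j = 0 -> pr S y j = 0.
Proof. by move=> d h hv; apply/eqP; rewrite -sgr_eq0 d h eqxx hv sgr0. Qed.

Lemma displaced_ge S x v y j : displaced S x v y -> 0 < pr S y j -> 0 <= pr S x j.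
Proof.
move=> d; rewrite leNgt => h; apply/negP => x0.
by have := displaced_lt d x0; rewrite ltNge (ltW h).
Qed.

Lemma displaced_le S x v y j : displaced S x v y -> pr S y j < 0 -> pr S x j <= 0.
Proof.
move=> d; rewrite leNgt => h; apply/negP => x0.
by have := displaced_gt d x0; rewrite ltNge (ltW h).
Qed.

Lemma displaced_ok S x v y j s : displaced S x v y -> sgn_ok s (pr S x j) ->
  sgn_ok s (pr S y j).
Proof. by move=> d; case: s => [[]|] //=; [apply: displaced_gt | apply: displaced_lt]. Qed.

Lemma reg_displaced S e k x v y : displaced S x v y -> reg S e k x -> reg S e k y.
Proof. by move=> d r j jk; apply: displaced_ok d (r j jk). Qed.

Lemma reg_conv S e k x y (t : R) : 0 <= t -> t <= 1 -> reg S e k x -> reg S e k y ->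
  reg S e k (x + t *: (y - x)).
Proof. by move=> t0 t1 rx ry j jk; rewrite prD prZ prB; apply: sgn_ok_conv; auto. Qed.

Lemma reg_le S e k k' x : (k' <= k)%N -> reg S e k x -> reg S e k' x.
Proof. by move=> le r j jk; apply: r; apply: leq_trans jk le. Qed.

Lemma adm_le S e k k' : (k' <= k)%N -> adm S e k -> adm S e k'.
Proof. by move=> le r j jk; apply: r; apply: leq_trans jk le. Qed.

Lemma facet_le S e1 e2 X k k' z : (k' <= k)%N -> facet S e1 e2 X k z -> facet S e1 e2 X k' z.
Proof. by move=> le [z0 r]; split=> // j jk; apply: r; apply: leq_trans jk le. Qed.

Lemma adm_cut S e k i : adm S e k -> (i < k)%N -> e i <> None -> cut S e i.
Proof. by move=> a ik ei; apply: contrapT => /(a i ik). Qed.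

Lemma reg_dual S e k x : reg (dual S) (nege e) k (- x) <-> reg S e k x.
Proof.
by split=> h j jk; have := h j jk; rewrite (prN (dual S)) /nege sgn_okN.
Qed.

Lemma cut_dual S e i : cut (dual S) (nege e) i <-> cut S e i.
Proof.
split=> -[x [w r]]; exists (- x).
  by rewrite -onwall_dual; split=> //; apply/reg_dual; rewrite opprK.
by rewrite onwall_dual opprK; split=> //; apply/reg_dual.
Qed.

Lemma adm_dual S e k : adm S e k -> adm (dual S) (nege e) k.
Proof.
move=> a i ik; rewrite cut_dual -(a i ik) /nege.
by case: (e i).
Qed.

Lemma facet_dual S e1 e2 X k z : facet (dual S) (nege e2) (nege e1) X k (- z) <->
  facet S e1 e2 X k z.
Proof.
rewrite /facet (prN (dual S)) /nege; split=> -[z0 h]; split.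
- by apply/eqP; rewrite -oppr_eq0; apply/eqP.
- by move=> j jk jX; have [] := h j jk jX; rewrite (prN (dual S)) !sgn_okN.
- by apply/eqP; rewrite oppr_eq0; apply/eqP.
- by move=> j jk jX; rewrite (prN (dual S)) !sgn_okN; have [] := h j jk jX.
Qed.

Lemma generic_dual S X z : generic S X z -> generic (dual S) X (- z).
Proof. by move=> h j jX; rewrite (prN (dual S)) oppr_eq0; apply: h. Qed.

Lemma zero_between (a b : R) : 0 < a -> b <= 0 ->
  exists t, [/\ 0 < t, t <= 1, a + t * (b - a) = 0 & b < 0 -> t < 1].
Proof.
move=> a0 b0; have ab : 0 < a - b by lra.
exists (a / (a - b)); rewrite divr_gt0 // ler_pdivrMr // ltr_pdivrMr //; split=> //; try lra.
by rewrite -[b - a]opprB mulrN divfK ?subrr // gt_eqF.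
Qed.

Section Cuts.
Variables (S : root_data R Q m).

(** Positivity on the proper quotient roots of i is constant on the region. An uncut j cannot become
    nonpositive: at its zero on the segment from x to x' its own proper quotient roots are still
    positive by induction, so this zero would lie on D(j). *)
Lemma core_T e i x x' j : adm S e i -> reg S e i x -> Ts S x i -> reg S e i x' ->
  rquo S j i -> j != i -> 0 < pr S x' j.
Proof.
suff main k : forall i j, (i < k)%N -> adm S e i -> reg S e i x -> Ts S x i -> reg S e i x' ->
    rquo S j i -> j != i -> 0 < pr S x' j by apply: (main i.+1).
elim: k => // k IH {}i {}j ik a rx tx rx' qj ji.
have lt : (j < i)%N by rewrite ltn_neqAle (rquo_index qj) andbT.
have tj := ts_quo tx qj; have := rx j lt; have := rx' j lt.
case ej: (e j) => [[]|] //=; first by move=> _; rewrite ltNge (ltW (ts_gt0 tj)).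
move=> _ _; rewrite ltNge; apply/negP => x'j.
have jle := ltnW lt; have rxj := reg_le jle rx; have rx'j := reg_le jle rx'.
have [t [t0 t1 tz _]] := zero_between (ts_gt0 tj) x'j.
apply: (proj1 (a j lt) ej); exists (x + t *: (x' - x)); split; last exact: reg_conv (ltW t0) t1 _ _.
have pj : pr S (x + t *: (x' - x)) j = 0 by rewrite prD prZ prB tz.
rewrite /onwall pj eqxx (FTw pj); apply/TwP => l ql.
have [->|lj] := eqVneq l j; first by rewrite pj.
rewrite prD prZ prB; apply: ltW; apply: (@sgn_ok_conv (Some true) _ _ _ (ltW t0) t1) => /=.
  exact: (TsP _ _ _ tj).
by apply: (IH j) => //; [apply: leq_trans lt _; rewrite -ltnS | apply: adm_le a].
Qed.

(** By [core_T] the proper quotient roots of i stay positive on the segment from x to x', so the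
    zero of i on it lies on D(i). *)
Lemma cut_T e i x x' : adm S e i -> reg S e i x -> Ts S x i -> reg S e i x' ->
  pr S x' i <= 0 -> cut S e i.
Proof.
move=> a rx tx rx' x'i; have [t [t0 t1 tz _]] := zero_between (ts_gt0 tx) x'i.
exists (x + t *: (x' - x)); split; last exact: reg_conv (ltW t0) t1 _ _.
have pj : pr S (x + t *: (x' - x)) i = 0 by rewrite prD prZ prB tz.
rewrite /onwall pj eqxx (FTw pj); apply/TwP => l ql.
have [->|li] := eqVneq l i; first by rewrite pj.
rewrite prD prZ prB; apply: ltW; apply: (@sgn_ok_conv (Some true) _ _ _ (ltW t0) t1) => /=.
  exact: (TsP _ _ _ tx).
exact: core_T a rx tx rx' ql li.
Qed.

Lemma cut_Ts_point e i : cut S e i -> exists x, reg S e i x /\ Ts S x i.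
Proof.
move=> [x [w r]]; have [y d] := displace S x (const_mx 1); exists y; split.
  exact: reg_displaced d r.
apply/TsP => j q; apply: displaced_gt0 d _ (pr1_gt0 S j).
exact: (TwP _ _ _ (wall_tw w) _ q).
Qed.

Lemma cut_quo e i x j : adm S e i -> cut S e i -> reg S e i x -> rquo S j i -> j != i ->
  0 < pr S x j.
Proof. by move=> a /cut_Ts_point[y [ry ty]] rx; apply: core_T a ry ty rx. Qed.

End Cuts.

Lemma core_F S e i x x' j : adm S e i -> reg S e i x -> Fs S x i -> reg S e i x' ->
  rsub S j i -> j != i -> pr S x' j < 0.
Proof.
move=> a rx fx rx' s ji; rewrite -oppr_gt0 -prN.
apply: (@core_T (dual S) (nege e) i (- x) (- x') j) => //; try exact/reg_dual.
  exact: adm_dual.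
by rewrite Ts_dual opprK.
Qed.

Lemma cut_Fs_point S e i : cut S e i -> exists x, reg S e i x /\ Fs S x i.
Proof.
move=> /cut_dual/cut_Ts_point[x [r t]]; exists (- x); split; last by rewrite -Ts_dual.
by apply/reg_dual; rewrite opprK.
Qed.

Lemma cut_sub S e i x j : adm S e i -> cut S e i -> reg S e i x -> rsub S j i -> j != i ->
  pr S x j < 0.
Proof. by move=> a /cut_Fs_point[y [ry ty]] rx; apply: core_F a ry ty rx. Qed.

Lemma cut_Fs S e i x : adm S e i -> cut S e i -> reg S e i x -> pr S x i < 0 -> Fs S x i.
Proof.
move=> a c r x0; apply/FsP => j q; have [->//|ji] := eqVneq j i; exact: cut_sub a c r q ji.
Qed.

(** Proper subroots of i are negative throughout a region cut by D(i), so D(i) fills the whole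
    section of the region by H(i). *)
Lemma cut_stable S e i x : adm S e i -> cut S e i -> reg S e i x -> pr S x i = 0 -> stable S x i.
Proof.
move=> a c r x0; have neg l : rsub S l i -> l != i -> pr S x l < 0 by apply: cut_sub a c r.
split=> //; rewrite /onwall x0 eqxx; apply/FwP => l s.
by have [->|li] := eqVneq l i; [rewrite x0 | apply/ltW/neg].
Qed.

Lemma facet_displaced S e1 e2 X k z v y : displaced S z v y -> pr S v X = 0 ->
  facet S e1 e2 X k z -> facet S e1 e2 X k y.
Proof.
move=> d vX [zX h]; split=> [|j jk jX]; first exact: displaced_eq0 d zX vX.
by have [h1 h2] := h j jk jX; split; apply: displaced_ok d _.
Qed.

Lemma generic_direction S X : exists2 v, pr S v X = 0 & forall j, j != X -> pr S v j != 0.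
Proof.
have [|||v vX vn] := @avoid R n 'I_m (fun x => pr S x X = 0) (fun j x => pr S x j).
- by move=> j a b c; rewrite prD prZ.
- exact: pr0.
- by move=> a b c h1 h2; rewrite prD prZ h1 h2 mulr0 addr0.
exists v => // j jX; apply/eqP => vj; have [y [yj yX]] := separate S 1 0 jX.
by have := vn j vj y yX; rewrite yj => /eqP; rewrite oner_eq0.
Qed.

Lemma facet_generic S e1 e2 X k z : facet S e1 e2 X k z -> exists z',
  [/\ facet S e1 e2 X k z', generic S X z' &
      forall j, (0 < pr S z j -> 0 < pr S z' j) /\ (pr S z j < 0 -> pr S z' j < 0)].
Proof.
move=> f; have [v vX vn] := generic_direction S X.
have [z' d] := displace S z v; exists z'; split.
- exact: facet_displaced d vX f.
- move=> j jX; rewrite -sgr_eq0 d.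
  by case: (eqVneq (pr S z j) 0) => [_|z0]; rewrite sgr_eq0 // vn.
- by move=> j; split; [apply: displaced_gt d | apply: displaced_lt d].
Qed.

Lemma facet_conv S e1 e2 X k z z' (t : R) : 0 <= t -> t <= 1 ->
  facet S e1 e2 X k z -> facet S e1 e2 X k z' -> facet S e1 e2 X k (z + t *: (z' - z)).
Proof.
move=> t0 t1 [zX h] [zX' h']; split=> [|j jk jX].
  by rewrite prD prZ prB zX zX' subr0 mulr0 addr0.
have [h1 h2] := h j jk jX; have [h1' h2'] := h' j jk jX.
by rewrite prD prZ prB; split; apply: sgn_ok_conv.
Qed.

Section Crossing.
Variables (S : root_data R Q m) (e1 e2 : nat -> option bool) (X : 'I_m).
Hypotheses (e1X : e1 X = Some false) (e2X : e2 X = Some true).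

Lemma facet_reg1 k z w y : facet S e1 e2 X k z -> displaced S z w y -> pr S w X < 0 ->
  reg S e1 k y.
Proof.
move=> [zX h] d wX j jk; have [->|jX] := eqVneq j X.
  by rewrite e1X /=; apply: displaced_lt0 d _ wX; rewrite zX.
by have [h1 _] := h j jk jX; apply: displaced_ok d h1.
Qed.

Lemma facet_reg2 k z w y : facet S e1 e2 X k z -> displaced S z w y -> 0 < pr S w X ->
  reg S e2 k y.
Proof.
move=> [zX h] d wX j jk; have [->|jX] := eqVneq j X.
  by rewrite e2X /=; apply: displaced_gt0 d _ wX; rewrite zX.
by have [_ h2] := h j jk jX; apply: displaced_ok d h2.
Qed.

Lemma facet_sides k z : facet S e1 e2 X k z -> exists y1 y2 w,
  [/\ reg S e1 k y1, reg S e2 k y2, displaced S z (- w) y1, displaced S z w y2 & 0 < pr S w X].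
Proof.
move=> f; have [y1 d1] := displace S z (- const_mx 1); have [y2 d2] := displace S z (const_mx 1).
exists y1, y2, (const_mx 1); split=> //; last exact: pr1_gt0.
- by apply: facet_reg1 f d1 _; rewrite prN oppr_lt0 pr1_gt0.
- by apply: facet_reg2 f d2 _; rewrite pr1_gt0.
Qed.

(* A letter cut on one side only keeps its sign along the facet: otherwise its
   wall would cross the facet and be seen from both sides. *)
Lemma facet_sign i z0 z1 : adm S e1 i.+1 -> adm S e2 i -> cut S e2 i -> i != X ->
  (X < i)%N -> e1 i = None -> generic S X z0 ->
  facet S e1 e2 X i z0 -> facet S e1 e2 X i z1 -> pr S z0 i * pr S z1 i < 0 -> False.
Proof.
move=> a1 a2 c2 iX Xi e1i g0 f0 f1 opp.
have [t [t0 t1 tz]] : exists t, [/\ 0 <= t, t < 1 & pr S z0 i + t * (pr S z1 i - pr S z0 i) = 0].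
  have [z0i|z0i] := ltP 0 (pr S z0 i).
    have z1i : pr S z1 i < 0 by rewrite -(pmulr_rlt0 _ z0i).
    have [t [/ltW t0 _ tz /(_ z1i) t1]] := zero_between z0i (ltW z1i); by exists t.
  have z0n : 0 < - pr S z0 i.
    by rewrite oppr_gt0 lt_neqAle z0i andbT; apply: contraTneq opp => ->; rewrite mul0r ltxx.
  have z1i : - pr S z1 i < 0 by rewrite -(pmulr_rlt0 _ z0n) mulrNN.
  have [t [/ltW t0 _ tz /(_ z1i) t1]] := zero_between z0n (ltW z1i); exists t; split=> //.
  by apply: oppr_inj; rewrite oppr0 -tz; ring.
set y := z0 + t *: (z1 - z0).
have fy : facet S e1 e2 X i y by apply: facet_conv (ltW t1) f0 f1.
have yi : pr S y i = 0 by rewrite prD prZ prB.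
have [_ [y2 [w [_ r2 _ d2 wX]]]] := facet_sides f0.
have nsX : ~~ rsub S X i.
  apply/negP => s; have := cut_sub a2 c2 r2 s; rewrite eq_sym iX => /(_ isT).
  by have /= := r2 X Xi; rewrite e2X /= => h; rewrite ltNge (ltW h).
have le0 z l : facet S e1 e2 X i z -> rsub S l i -> l != i -> pr S z l <= 0.
  move=> /facet_sides[_ [y2' [w' [_ r2' _ d2' _]]]] s li.
  exact: displaced_le d2' (cut_sub a2 c2 r2' s li).
have neg l : rsub S l i -> l != i -> pr S y l < 0.
  move=> s li; have lX : l != X by apply: contraNneq nsX => <-.
  have n0 : pr S z0 l < 0 by rewrite lt_neqAle g0 //= (le0 z0).
  have n1 : pr S z1 l <= 0 by apply: le0.
  rewrite prD prZ prB; have -> : pr S z0 l + t * (pr S z1 l - pr S z0 l) =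
    (1 - t) * pr S z0 l + t * pr S z1 l by ring.
  have : (1 - t) * pr S z0 l < 0 by rewrite pmulr_rlt0 ?subr_gt0.
  have := mulr_ge0_le0 t0 n1; lra.
have sy : stable S y i.
  split=> //; rewrite /onwall yi eqxx; apply/FwP => l s.
  by have [->|li] := eqVneq l i; [rewrite yi | apply/ltW/neg].
have nqX : ~~ rquo S X i.
  apply/negP => q; have := stable_quo sy q; rewrite eq_sym iX => /(_ isT).
  by case: fy => ->; rewrite ltxx.
(* A displacement inside H(i) towards the negative side of X carries y into the region of [e1],
   which D(i) would then cut. *)
have [v [vX vi]] := separate S (-1) 0 (i := X) (j := i) ltac:(by rewrite eq_sym).
have [y' d'] := displace S y v.
apply: (proj1 (a1 i (ltnSn i)) e1i); exists y'; split; last first.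
  by apply: facet_reg1 fy d' _; rewrite vX oppr_lt0.
have y'i := displaced_eq0 d' yi vi.
rewrite /onwall y'i eqxx; apply/FwP => l s.
by have [->|li] := eqVneq l i; [rewrite y'i | apply/ltW/(displaced_lt d')/neg].
Qed.
End Crossing.

Section Facets.
Variables (S : root_data R Q m) (e1 e2 : nat -> option bool) (X : 'I_m).
Hypotheses (e1X : e1 X = Some false) (e2X : e2 X = Some true).

Lemma facet_sign' i z0 z1 : adm S e2 i.+1 -> adm S e1 i -> cut S e1 i -> i != X ->
  (X < i)%N -> e2 i = None -> generic S X z0 ->
  facet S e1 e2 X i z0 -> facet S e1 e2 X i z1 -> pr S z0 i * pr S z1 i < 0 -> False.
Proof.
move=> a2 a1 c1 iX Xi e2i g0 f0 f1 opp.
apply: (@facet_sign (dual S) (nege e2) (nege e1) X _ _ i (- z0) (- z1)) => //.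
- by rewrite /nege e2X.
- by rewrite /nege e1X.
- exact: adm_dual.
- exact: adm_dual.
- exact/cut_dual.
- by rewrite /nege e2i.
- exact: generic_dual.
- exact/facet_dual.
- exact/facet_dual.
- by rewrite !(prN (dual S)) mulrNN.
Qed.

Hypothesis agree : forall j : nat, (j < X)%N -> e1 j = e2 j.

(** A letter on which e1 and e2 disagree is cut on one side only, and its sign is constant along the
    facet by [facet_sign] and its dual; the common signs therefore suffice. *)
Lemma facet_common k z0 z1 : adm S e1 k -> adm S e2 k -> facet S e1 e2 X k z0 -> generic S X z0 ->
  pr S z1 X = 0 ->
  (forall j : 'I_m, (j < k)%N -> j != X -> e1 j = e2 j -> sgn_ok (e1 j) (pr S z1 j)) ->
  facet S e1 e2 X k z1.
Proof.
move=> a1 a2 f0 g0 z1X h; suff main q : (q <= k)%N -> facet S e1 e2 X q z1 by exact: main.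
elim: q => [|i IH] ik; first by split.
have fi := IH (ltnW ik); split=> // j; rewrite ltnS leq_eqVlt => /orP[/eqP ji|ji] jX; last first.
  by case: fi => _; apply.
have jk : (j < k)%N by rewrite ji.
have [e12|e12] := eqVneq (e1 j) (e2 j); first by rewrite -e12; have := h j jk jX e12.
have Xj : (X < j)%N.
  rewrite ltnNge leq_eqVlt; apply/negP => /orP[/eqP/val_inj/eqP|/agree/eqP]; exact/negP.
have fj0 := facet_le (ltnW jk) f0; rewrite -ji in fi.
have opp0 (no : forall z, facet S e1 e2 X j z -> pr S z0 j * pr S z j < 0 -> False) :
    0 < pr S z0 j * pr S z1 j.
  rewrite lt_neqAle eq_sym mulf_neq0 ?g0 //=; last first.
    (* If j vanished at z1, a displacement along H(X) would give it the sign opposite to that at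
       z0. *)
    apply/eqP => z1j; have [v [vj vX]] := separate S (- pr S z0 j) 0 jX.
    have [z d] := displace S z1 v; apply: (no z); first exact: facet_displaced d vX fi.
    rewrite -sgr_lt0 sgrM d z1j eqxx vj sgrN mulrN oppr_lt0 -sgrM sgr_gt0 -expr2.
    by rewrite exprn_even_gt0 ?g0.
  by rewrite leNgt; apply/negP => /(no z1 fi).
have sg1 s : sgn_ok s (pr S z0 j) -> 0 < pr S z0 j * pr S z1 j -> sgn_ok s (pr S z1 j).
  case: s => [[]|] //= z0j; first by rewrite pmulr_rgt0.
  by rewrite nmulr_rgt0.
have [_ /(_ j jk jX)[s1 s2]] := f0.
case e1j: (e1 j) => [b1|]; case e2j: (e2 j) => [b2|]; last by [].
- by exfalso; move: e12 s1 s2; rewrite e1j e2j; case: (b1); case: (b2) => //= _ /ltW h1; rewrite ltNge h1.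
- split=> //; rewrite -e1j; apply: sg1 s1 _; apply: opp0 => z fz.
  apply: (facet_sign' (i := j) _ _ _ jX Xj e2j g0 fj0 fz).
  + exact: adm_le a2.
  + exact: adm_le (ltnW jk) a1.
  + by apply: (adm_cut a1 jk); rewrite e1j.
- split=> //; rewrite -e2j; apply: sg1 s2 _; apply: opp0 => z fz.
  apply: (facet_sign e1X e2X (i := j) _ _ _ jX Xj e1j g0 fj0 fz).
  + exact: adm_le a1.
  + exact: adm_le (ltnW jk) a2.
  + by apply: (adm_cut a2 jk); rewrite e2j.
Qed.

(* Moving along [psi], the gradient of E(om, -) corrected by the positive
   letters before om, the facet reaches the side where om is positive. *)
Lemma facet_om_pos (om : 'I_m) z0 : adm S e1 om -> adm S e2 om -> (X < om)%N ->
  facet S e1 e2 X om z0 -> generic S X z0 -> rE S om X <= 0 ->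
  cut S e1 om \/ cut S e2 om -> exists z, facet S e1 e2 X om z /\ 0 < pr S z om.
Proof.
move=> a1 a2 Xom f0 g0 EX c12.
have [y1 [y2 [w [r1 r2 d1 d2 wX]]]] := facet_sides e1X e2X f0.
have Xle := ltnW Xom.
have regX : reg S e1 X z0.
  move=> j jX; have jne : j != X by apply: contraTneq jX => ->; rewrite ltnn.
  by case: f0 => _ /(_ j (ltn_trans jX Xom) jne)[].
have wallX : stable S z0 X.
  apply: cut_stable (adm_le Xle a1) _ regX _; last by case: f0.
  by apply: (adm_cut a1 Xom); rewrite e1X.
have Tpos (v : 'I_m) : (v < om)%N -> v != X -> e1 v = Some true -> Ts S z0 v.
  move=> vo vX e1v; have cv : cut S e1 v by apply: (adm_cut a1 vo); rewrite e1v.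
  apply/TsP => l q; have [->|lv] := eqVneq l v.
    by case: f0 => _ /(_ v vo vX)[]; rewrite e1v.
  have y1l := cut_quo (adm_le (ltnW vo) a1) cv (reg_le (ltnW vo) r1) q lv.
  have lX : l != X.
    by apply: contraTneq y1l => ->; have := r1 X Xom; rewrite e1X /= -leNgt => /ltW.
  by rewrite lt_neqAle eq_sym g0 //= (displaced_ge d1).
have Fneg (v : 'I_m) : (v < om)%N -> v != X -> e2 v = Some false -> Fs S z0 v.
  move=> vo vX e2v; have cv : cut S e2 v by apply: (adm_cut a2 vo); rewrite e2v.
  apply/FsP => l q; have [->|lv] := eqVneq l v.
    by case: f0 => _ /(_ v vo vX)[_]; rewrite e2v.
  have y2l := cut_sub (adm_le (ltnW vo) a2) cv (reg_le (ltnW vo) r2) q lv.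
  have lX : l != X.
    by apply: contraTneq y2l => ->; have := r2 X Xom; rewrite e2X /= -leNgt => /ltW.
  by rewrite lt_neqAle g0 //= (displaced_le d2).
(* E(om, v) can be negative only for v laterally before om, so only these positive letters need
   repair; X is added to keep [psi] parallel to H(X). *)
pose Pp := [set v : 'I_m | [&& (v < om)%N, v != X, e1 v == Some true, e2 v == Some true & rlat S v < rlat S om]].
pose P := Pp :|: [set v | (v == X) && (rlat S X < rlat S om)].
have [c [c0 cP cX]] := triangular S (ryl S om) P.
set psi := _ + _ in cP cX.
have psiE (v : 'I_m) : pr S psi v = rE S om v + \sum_(u in P) c u * rE S u v.
  by rewrite /psi prD pr_yl pr_sum; congr (_ + _); apply: eq_bigr => u _; rewrite pr_yl.
have inP u : u \in P -> rlat S u < rlat S om /\ (u = X \/ u != X /\ Ts S z0 u).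
  rewrite !inE => /orP[/and5P[uo uX /eqP e1u _ ul]|/andP[/eqP -> ul]]; split=> //; last by left.
  by right; split=> //; apply: Tpos.
have Tw0 u : u \in P -> Tw S z0 u.
  by move=> /inP[_ [->|[_ /ts_tw]]] //; apply: wall_tw; case: wallX.
have psiX : pr S psi X = 0.
  have le_uX u : u \in P -> u != X -> rE S u X <= 0.
    move=> /inP[_ [->|[_ t]]]; first by rewrite eqxx.
    by move=> _; apply: TF t (wall_fw (proj1 wallX)).
  have [lt|ge] := ltP (rlat S X) (rlat S om).
    by apply: cX => //; rewrite ?inE ?lt ?eqxx ?orbT // pr_yl.
  rewrite psiE big1 => [|u uP]; last first.
    have [ul _] := inP u uP; have uX : u != X by apply: contraTneq ul => ->; rewrite -leNgt.
    apply/eqP; rewrite mulf_eq0; apply/orP; right.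
    by rewrite eq_le le_uX //= E_ge0 //; apply: le_trans (ltW ul) ge.
  by rewrite addr0; apply/eqP; rewrite eq_le EX E_ge0.
have psiN (v : 'I_m) : (v < om)%N -> v != X -> e1 v = Some false -> e2 v = Some false -> pr S psi v <= 0.
  move=> vo vX e1v e2v; rewrite psiE.
  have h : \sum_(u in P) c u * rE S u v <= 0.
    apply: sumr_le0 => u uP; rewrite mulr_ge0_le0 //.
    exact: TF' (Tw0 u uP) (Fneg v vo vX e2v).
  suff : rE S om v <= 0 by lra.
  case: c12 => /cut_Ts_point[x [rx tx]]; apply: TF tx _; apply: fs_fw.
    apply: (cut_Fs (adm_le (ltnW vo) a1) _ (reg_le (ltnW vo) rx)).
      by apply: (adm_cut a1 vo); rewrite e1v.
    by have := rx v vo; rewrite e1v.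
  apply: (cut_Fs (adm_le (ltnW vo) a2) _ (reg_le (ltnW vo) rx)).
    by apply: (adm_cut a2 vo); rewrite e2v.
  by have := rx v vo; rewrite e2v.
have psiP (v : 'I_m) : (v < om)%N -> v != X -> e1 v = Some true -> e2 v = Some true -> 0 <= pr S psi v.
  move=> vo vX e1v e2v; have [lt|ge] := ltP (rlat S v) (rlat S om).
    by apply: cP; rewrite !inE vo vX e1v e2v lt.
  rewrite psiE addr_ge0 ?E_ge0 // sumr_ge0 // => u /inP[ul _].
  by rewrite mulr_ge0 // E_ge0 //; apply: le_trans (ltW ul) ge.
have psio : 0 < pr S psi om.
  rewrite psiE ltr_wpDr ?rE_gt0 // sumr_ge0 // => u /inP[ul _].
  by rewrite mulr_ge0 // E_ge0 // ltW.
(* This length brings the value at om to at least 1. *)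
pose t := (1 + `|pr S z0 om|) / pr S psi om.
have t0 : 0 <= t by rewrite divr_ge0 ?ltW // ltr_wpDr.
exists (z0 + t *: psi); split; last first.
  rewrite prD prZ /t divfK ?gt_eqF //.
  have := ler_normr (- pr S z0 om) (- pr S z0 om); rewrite lexx normrN => /esym; lra.
have [z0X f0s] := f0; apply: facet_common a1 a2 f0 g0 _ _.
  by rewrite prD prZ psiX mulr0 addr0.
move=> j jo jX e12; have [s1 _] := f0s j jo jX.
move: s1; rewrite prD prZ; case e1j: (e1 j) e12 => [[]|] //= /esym e2j zj.
  by rewrite ltr_wpDr // mulr_ge0 // psiP.
have := mulr_ge0_le0 t0 (psiN j jo jX e1j e2j); lra.
Qed.
End Facets.

Lemma facet_om_neg S e1 e2 X (om : 'I_m) z0 : e1 X = Some false -> e2 X = Some true ->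
  (forall j : nat, (j < X)%N -> e1 j = e2 j) -> adm S e1 om -> adm S e2 om -> (X < om)%N ->
  facet S e1 e2 X om z0 -> generic S X z0 -> rE S X om <= 0 ->
  cut S e1 om \/ cut S e2 om -> exists z, facet S e1 e2 X om z /\ pr S z om < 0.
Proof.
move=> e1X e2X agree a1 a2 Xo f0 g0 EX c12.
have [||||||||||z [f z0']] := @facet_om_pos (dual S) (nege e2) (nege e1) X _ _ _ om (- z0).
- by rewrite /nege e2X.
- by rewrite /nege e1X.
- by move=> j jX; rewrite /nege agree.
- exact: adm_dual.
- exact: adm_dual.
- by [].
- exact/facet_dual.
- exact: generic_dual.
- by [].
- by case: c12 => c; [right | left]; apply/cut_dual.
exists (- z); rewrite prN oppr_lt0; split=> //; apply/facet_dual; by rewrite opprK.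
Qed.

End Compartments.

(** * Green steps and what persists along them *)

Section Steps.
Context (R : realType) (n : nat) (Q : valued_quiver n) (m : nat).
Implicit Types (S : root_data R Q m) (e : nat -> option bool) (x y z w : 'rV[R]_n) (i j l X : 'I_m).

(** Adjacency along a wall is reduced to the existence of one common facet point; [green_stepP]
    compares this with the topological condition. *)
Definition gstep S e1 e2 X (k : nat) : Prop :=
  [/\ (X < k)%N, e1 X = Some false, e2 X = Some true,
      (forall j : nat, (j < X)%N -> e1 j = e2 j) & exists z, facet S e1 e2 X k z].

Lemma gstep_le S e1 e2 X k k' : (X < k')%N -> (k' <= k)%N -> gstep S e1 e2 X k -> gstep S e1 e2 X k'.
Proof.
by move=> Xk le [_ h1 h2 h3 [z f]]; split=> //; exists z; apply: facet_le f.
Qed.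

Lemma gstep_dual S e1 e2 X k : gstep S e1 e2 X k -> gstep (dual S) (nege e2) (nege e1) X k.
Proof.
move=> [Xk h1 h2 h3 [z f]]; split=> //.
- by rewrite /nege h2.
- by rewrite /nege h1.
- by move=> j jX; rewrite /nege h3.
- by exists (- z); apply/facet_dual.
Qed.

Lemma reg_ext S e e' k x : (forall j : 'I_m, (j < k)%N -> e j = e' j) -> reg S e k x -> reg S e' k x.
Proof. by move=> h r j jk; rewrite -h //; apply: r. Qed.

Lemma cut_ext S e e' i : (forall j : 'I_m, (j < i)%N -> e j = e' j) -> cut S e i -> cut S e' i.
Proof. by move=> h [x [w r]]; exists x; split=> //; apply: reg_ext h r. Qed.

(** Induction on the level: by [facet_common] a facet point of the second step is also one of the
    first, and its sign at j then forces the two successors to agree at j. *)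
Lemma gstep_uniq S e1 e2 e2' X k : adm S e1 k -> adm S e2 k -> adm S e2' k ->
  gstep S e1 e2 X k -> gstep S e1 e2' X k -> forall j : 'I_m, (j < k)%N -> e2 j = e2' j.
Proof.
move=> a1 a2 a2' [Xk e1X e2X ag [z f]] [_ _ e2X' ag' [z' f']].
suff main (i : nat) : forall j : 'I_m, (j < i)%N -> (j < k)%N -> e2 j = e2' j by move=> j; apply: (main j.+1).
elim: i => // i IH j; rewrite ltnS leq_eqVlt => /orP[/eqP ji|/IH//] jk.
have [jX|Xj|/val_inj ->] := ltngtP j X; [by rewrite -ag // ag' | | by rewrite e2X e2X'].
have jX : j != X by apply: contraTneq Xj => ->; rewrite ltnn.
have eq_lt l : (l < j)%N -> e2 l = e2' l.
  by move=> lj; apply: IH; [rewrite -ji | apply: ltn_trans jk].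
have cE : cut S e2 j <-> cut S e2' j.
  by split; apply: cut_ext => l lj; rewrite eq_lt.
have nE : e2 j = None <-> e2' j = None by rewrite (a2 j jk) (a2' j jk) cE.
have [z0 [f0 g0 _]] := facet_generic (facet_le jk f).
have [z'X h'] := facet_le jk f'.
have fz' : facet S e1 e2 X j.+1 z'.
  apply: (facet_common e1X e2X ag (adm_le jk a1) (adm_le jk a2) f0 g0 z'X) => l lj lX _.
  by have [] := h' l lj lX.
have [_ s2'] := h' j (ltnSn j) jX; have [_ s2] := proj2 fz' j (ltnSn j) jX.
case e2j: (e2 j) nE s2 => [b|] nE; last by move=> _; symmetry; apply/nE.
case e2j': (e2' j) nE s2' => [b'|] nE s2'; last by case: nE => _ /(_ erefl).
by move: s2'; case: (b); case: (b') => //= h1; rewrite ltNge (ltW h1).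
Qed.

(** At x the root i is torsion and the negative letter X is torsion-free. *)
Lemma Tsome_E S e k i X x : adm S e k -> (X < k)%N -> (i <= k)%N -> e X = Some false -> reg S e k x ->
  Ts S x i -> rE S i X <= 0.
Proof.
move=> a Xk ik eX r t; apply: TF t _; apply: fs_fw.
apply: (cut_Fs (adm_le (ltnW Xk) a) _ (reg_le (ltnW Xk) r)).
  by apply: (adm_cut a Xk); rewrite eX.
by have := r X Xk; rewrite eX.
Qed.

Lemma Fsome_E S e k i X x : adm S e k -> (X < k)%N -> (i <= k)%N -> e X = Some true -> reg S e k x ->
  Fs S x i -> rE S X i <= 0.
Proof.
move=> a Xk ik eX r t; apply: (@Tsome_E (dual S) (nege e) k i X (- x)) => //.
- exact: adm_dual.
- by rewrite /nege eX.
- exact/reg_dual.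
- by rewrite Ts_dual opprK.
Qed.

Section Step.
Variables (S : root_data R Q m) (e1 e2 : nat -> option bool) (X om : 'I_m).
Hypotheses (a1 : adm S e1 om) (a2 : adm S e2 om) (st : gstep S e1 e2 X om).

Let Xo : (X < om)%N. Proof. by case: st. Qed.
Let oX : om != X. Proof. by apply: contraTneq Xo => ->; rewrite ltnn. Qed.

Lemma step_pos : rE S om X <= 0 -> cut S e1 om \/ cut S e2 om ->
  exists z, [/\ facet S e1 e2 X om z, generic S X z & 0 < pr S z om].
Proof.
case: st => _ e1X e2X ag [z f] EX c.
have [z0 [f0 g0 _]] := facet_generic f.
have [z1 [f1 p1]] := facet_om_pos e1X e2X ag a1 a2 Xo f0 g0 EX c.
have [z2 [f2 g2 h]] := facet_generic f1.
by exists z2; split=> //; have [+ _] := h om; apply.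
Qed.

Lemma step_neg : rE S X om <= 0 -> cut S e1 om \/ cut S e2 om ->
  exists z, [/\ facet S e1 e2 X om z, generic S X z & pr S z om < 0].
Proof.
case: st => _ e1X e2X ag [z f] EX c.
have [z0 [f0 g0 _]] := facet_generic f.
have [z1 [f1 p1]] := facet_om_neg e1X e2X ag a1 a2 Xo f0 g0 EX c.
have [z2 [f2 g2 h]] := facet_generic f1.
by exists z2; split=> //; have [_] := h om; apply.
Qed.

(** If D(om) cuts the region of e1, [step_pos] gives a facet point where om is positive; if not, om
    is positive on the whole region by [cut_T]. Such a point is pushed across X, and its proper
    quotient roots stay positive: X is none of them because E(om, X) <= 0. *)
Lemma Tsome_next : (exists x, reg S e1 om x /\ Ts S x om) -> exists x, reg S e2 om x /\ Ts S x om.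
Proof.
move=> [x [rx tx]]; have [_ e1X e2X ag [z1 f1]] := st.
have EX := Tsome_E a1 Xo (leqnn _) e1X rx tx.
have [z [f g zo]] : exists z, [/\ facet S e1 e2 X om z, generic S X z & 0 < pr S z om].
  have [c|c] := pselect (cut S e1 om); first by apply: step_pos EX (or_introl c).
  have [z [f g _]] := facet_generic f1; exists z; split=> //.
  have [y1 [y2 [w [r1 _ d1 _ _]]]] := facet_sides e1X e2X f.
  rewrite lt_neqAle eq_sym g //=; apply: (displaced_ge d1).
  by rewrite ltNge; apply/negP => /(cut_T a1 rx tx r1)/c.
have [y1 [y2 [w [r1 r2 d1 d2 wX]]]] := facet_sides e1X e2X f.
exists y2; split=> //; apply/TsP => l q; apply: (displaced_gt d2).
have [->//|lo] := eqVneq l om.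
have lX : l != X.
  by apply: contraTneq EX => e; rewrite -e -ltNge; apply: (rquo_hom q).
by rewrite lt_neqAle eq_sym g //=; apply: (displaced_ge d1); apply: core_T a1 rx tx r1 q lo.
Qed.

(** Orthogonality in both directions provides facet points on either side of H(om). Between them om
    vanishes and is negative on its proper subroots; displacements inside H(om) then reach both
    sides of X on D(om). *)
Lemma step_orth_cut : rE S om X <= 0 -> rE S X om <= 0 -> cut S e1 om \/ cut S e2 om ->
  cut S e1 om /\ cut S e2 om.
Proof.
move=> E1 E2 c; have [_ e1X e2X ag _] := st.
have [z1 [f1 g1 p1]] := step_pos E1 c; have [z2 [f2 g2 /[dup] p2 /ltW p2']] := step_neg E2 c.
have [t [/ltW t0 _ tz /(_ p2) t1]] := zero_between p1 p2'.
have f := facet_conv t0 (ltW t1) f1 f2; set y := z1 + _ in f.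
have yo : pr S y om = 0 by rewrite prD prZ prB.
have le0 z l : facet S e1 e2 X om z -> rsub S l om -> l != om -> pr S z l <= 0.
  move=> /(facet_sides e1X e2X)[y1 [y2 [w [r1 r2 d1 d2 _]]]] s lo.
  case: c => c; first exact: displaced_le d1 (cut_sub a1 c r1 s lo).
  exact: displaced_le d2 (cut_sub a2 c r2 s lo).
have neg l : rsub S l om -> l != om -> pr S y l < 0.
  move=> s lo; have lX : l != X.
    by apply: contraTneq E2 => e; rewrite -e -ltNge; apply: (rsub_hom s).
  have n1 : pr S z1 l < 0 by rewrite lt_neqAle g1 //= (le0 z1).
  have n2 : pr S z2 l < 0 by rewrite lt_neqAle g2 //= (le0 z2).
  by rewrite prD prZ prB; apply: (@sgn_ok_conv _ (Some false) _ _ _ t0 (ltW t1)).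
have wall v y' : displaced S y v y' -> pr S v om = 0 -> onwall S y' om.
  move=> d vo; have y'o := displaced_eq0 d yo vo.
  rewrite /onwall y'o eqxx; apply/FwP => l s.
  by have [->|lo] := eqVneq l om; [rewrite y'o | apply/ltW/(displaced_lt d)/neg].
have Xom : X != om by rewrite eq_sym.
have [v [vX vo]] := separate S (-1) 0 Xom; have [y1 d1] := displace S y v.
have [w [wX wo]] := separate S 1 0 Xom; have [y2 d2] := displace S y w.
split; [exists y1 | exists y2]; split; try by apply: wall; eassumption.
- by apply: facet_reg1 e1X _ _ _ _ f d1 _; rewrite vX oppr_lt0.
- by apply: facet_reg2 e2X _ _ _ _ f d2 _; rewrite wX.
Qed.
End Step.

Lemma Fsome_prev S e1 e2 X (om : 'I_m) : adm S e1 om -> adm S e2 om -> gstep S e1 e2 X om ->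
  (exists x, reg S e2 om x /\ Fs S x om) -> exists x, reg S e1 om x /\ Fs S x om.
Proof.
move=> a1 a2 st [x [rx fx]].
have [||||y [ry ty]] := @Tsome_next (dual S) (nege e2) (nege e1) X om.
- exact: adm_dual.
- exact: adm_dual.
- exact: gstep_dual.
- by exists (- x); split; [apply/reg_dual | rewrite Ts_dual opprK].
by exists (- y); split; [apply/reg_dual; rewrite opprK | rewrite -Ts_dual].
Qed.

Section Passed.
Variables (S : root_data R Q m) (k : nat).

(** A letter crossed by a green path stays torsion from then on; this invariant yields
    [gpath_forth]. *)
Definition passed e X : Prop := e X <> Some false /\ exists x, reg S e X x /\ Ts S x X.

Lemma passed_Ts e X x : adm S e k -> (X < k)%N -> passed e X -> reg S e k x -> Ts S x X.
Proof.
move=> a Xk [eX [y [ry ty]]] rx; have aX := adm_le (ltnW Xk) a; have rX := reg_le (ltnW Xk) rx.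
have xX : 0 < pr S x X.
  have := rx X Xk; case eX': (e X) eX => [[]|] //= _ _.
  by rewrite ltNge; apply/negP => /(cut_T aX ry ty rX); apply: (proj1 (a X Xk)).
apply/TsP => l q; have [->//|lX] := eqVneq l X; exact: core_T aX ry ty rX q lX.
Qed.

Lemma passed_E e X (Y : 'I_m) x : adm S e k -> (X < k)%N -> (Y < k)%N -> passed e X -> reg S e k x ->
  e Y = Some false -> rE S X Y <= 0.
Proof.
move=> a Xk Yk p r eY; exact: Tsome_E a Yk (ltnW Xk) eY r (passed_Ts a Xk p r).
Qed.

Lemma step_reg e1 e2 X : gstep S e1 e2 X k -> exists x, reg S e2 k x.
Proof. by move=> [_ h1 h2 _ [z /(facet_sides h1 h2)[_ [y [_ [_ r _ _ _]]]]]]; exists y. Qed.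

Lemma step_passed e1 e2 X : adm S e1 k -> gstep S e1 e2 X k -> passed e2 X.
Proof.
move=> a1 [Xk h1 h2 ag [z f]]; split; first by rewrite h2.
have [y1 [y2 [w [r1 r2 d1 d2 wX]]]] := facet_sides h1 h2 f.
have rX : reg S e1 X z.
  move=> j jX; have jne : j != X by apply: contraTneq jX => ->; rewrite ltnn.
  by case: f => _ /(_ j (ltn_trans jX Xk) jne)[].
have sX : stable S z X.
  apply: cut_stable (adm_le (ltnW Xk) a1) _ rX (proj1 f).
  by apply: (adm_cut a1 Xk); rewrite h1.
exists y2; split; first exact: reg_le (ltnW Xk) r2.
apply/TsP => l q; have [->|lX] := eqVneq l X.
  by have := r2 X Xk; rewrite h2.
exact/(displaced_gt d2)/(stable_quo sX).
Qed.

Lemma passed_step e1 e2 X Y : adm S e1 k -> adm S e2 k -> (X < k)%N -> gstep S e1 e2 Y k ->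
  passed e1 X -> passed e2 X.
Proof.
move=> a1 a2 Xk st p; have [Yk h1 h2 ag [z f]] := st.
have [y1 [y2 [w [r1 r2 d1 d2 wX]]]] := facet_sides h1 h2 f.
have [eX [x [rx tx]]] := p.
have [XY|YX|e] := ltngtP X Y; last by case: eX; rewrite (val_inj e).
  split; first by rewrite -ag.
  by exists x; split=> //; apply: reg_ext rx => j jX; rewrite ag // (ltn_trans jX).
split; last first.
  apply: (Tsome_next (adm_le (ltnW Xk) a1) (adm_le (ltnW Xk) a2)); last by exists x.
  exact: gstep_le YX (ltnW Xk) st.
move=> e2X; have XneY : X != Y by apply: contraTneq YX => ->; rewrite ltnn.
have := passed_Ts a1 Xk p r1 => /ts_gt0/(displaced_ge d1).
by have [_] := proj2 f X Xk XneY; rewrite e2X /= leNgt => ->.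
Qed.
End Passed.

Fixpoint gpath S (k : nat) e (p : seq ('I_m * (nat -> option bool))) : Prop :=
  if p is (X, e') :: p' then [/\ gstep S e e' X k, adm S e' k & gpath S k e' p'] else True.

Definition letters (p : seq ('I_m * (nat -> option bool))) := [seq a.1 | a <- p].
Definition endpt e (p : seq ('I_m * (nat -> option bool))) := last e [seq a.2 | a <- p].

Lemma gpath_passed S k e p X x : adm S e k -> reg S e k x -> (X < k)%N -> passed S e X ->
  gpath S k e p -> forall Y, Y \in letters p -> rE S X Y <= 0.
Proof.
elim: p e x => //= -[Y e'] p IH e x a r Xk pX [st a' gp] Z; rewrite inE => /orP[/eqP ->|].
  by have [Yk eY _ _ _] := st; exact: (passed_E a Xk Yk pX r eY).
have [x' r'] := step_reg st.
exact: IH a' r' Xk (passed_step a a' Xk st pX) gp _.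
Qed.

Lemma gpath_forth S k e p : adm S e k -> gpath S k e p -> forth S (letters p).
Proof.
rewrite /forth; elim: p e => //= -[Y e'] p IH e a [st a' gp]; apply/andP; split; last exact: IH gp.
have [x' r'] := step_reg st; have [Yk _ _ _ _] := st.
apply/allP => Z; exact: gpath_passed a' r' Yk (step_passed a st) gp Z.
Qed.

Lemma gpath_cat S k e p q : gpath S k e (p ++ q) <-> gpath S k e p /\ gpath S k (endpt e p) q.
Proof.
elim: p e => [|[X e'] p IH] e /=; first by split=> [|[]].
split=> [[h1 h2 /IH[h3 h4]]|[[h1 h2 h3] h4]]; first by split.
by split=> //; apply/IH.
Qed.

Lemma gpath_adm S k e p : adm S e k -> gpath S k e p -> adm S (endpt e p) k.
Proof. by elim: p e => //= -[X e'] p IH e _ [_ a gp]; apply: IH. Qed.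

End Steps.

(** * The group element attached to a point *)

Section Values.
Context (R : realType) (n : nat) (Q : valued_quiver n) (m : nat) (S : root_data R Q m).
Implicit Types (x y z v Y : 'rV[R]_n) (i j l X : 'I_m) (w : seq 'I_m).

Local Notation pr := (pr S).
Local Notation one := (const_mx 1 : 'rV[R]_n).
Local Notation tie1 := (tie S one).

Lemma onwall0 j : onwall S 0 j.
Proof. by rewrite /onwall pr0 eqxx; apply/FwP => l _; rewrite pr0. Qed.

Definition nt Y : Prop := no_ties S 0 one Y.

Lemma ntP Y : nt Y <-> forall i j, i != j -> tie1 Y i j != 0.
Proof.
by split=> h i j; [move=> ij; apply: h => //; rewrite onwall0 pr1_gt0 | move=> _ _; apply: h].
Qed.

(* The product of the walls met, from far away, on the half line from Y in the
   direction -one. *)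
Definition wv Y (h : presented_group (prel S)) : Prop :=
  wval S 0 one (pg_gen (prel S)) 0 Y h.

Lemma vis0P Y j : reflect (forall l, rsub S l j -> tie1 Y l j <= 0) (vis S 0 one Y j).
Proof.
apply: (iffP (visP _ _ _ _ _)) => [[_ _ h] l|h]; first exact: h (onwall0 l).
by split; rewrite ?onwall0 ?pr1_gt0 // => l _; apply: h.
Qed.

Lemma vis_onwall Y j : vis S 0 one Y j -> pr Y j = 0 -> onwall S Y j.
Proof.
move=> /vis0P h Yj; rewrite /onwall Yj eqxx; apply/FwP => l s.
by have := h l s; rewrite /tie Yj mul0r subr0 pmulr_lle0 // pr1_gt0.
Qed.

Lemma onwall_vis Y j : onwall S Y j -> vis S 0 one Y j.
Proof.
move=> w; apply/vis0P => l s; rewrite /tie (wall_eq0 w) mul0r subr0.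
by rewrite pmulr_lle0 ?pr1_gt0 //; apply: (FwP _ _ _ (wall_fw w)).
Qed.

(** Ties do not change under shifts along (1, ..., 1), and such a shift brings any point into [W];
    hence a generic displacement inside [W] already breaks all ties. *)
Lemma nt_exists x (W : 'rV[R]_n -> Prop) : W 0 -> (forall a x y, W x -> W y -> W (a *: x + y)) ->
    (forall y, exists s, W (y + s *: one)) ->
  exists v y, [/\ W v, displaced S x v y, nt y &
    forall j, pr y j = 0 -> pr x j = 0 /\ forall y, W y -> pr y j = 0].
Proof.
move=> W0 Wl W1; pose f (k : 'I_m * 'I_m + 'I_m) y :=
  match k with inl (i, j) => tie1 y i j | inr j => pr y j end.
have fl k a y z : f k (a *: y + z) = a * f k y + f k z.
  by case: k => [[i j]|j]; [apply: tie_linear | rewrite /f prD prZ].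
have [v Wv vP] := avoid fl W0 Wl; have [e e0 eP] := perturb_fun x v fl.
have sP k := eP e k e0 (lexx e); exists v, (x + e *: v); split=> //.
- by move=> j; apply: (sP (inr j)).
- apply/ntP => i j ij; rewrite -sgr_eq0 (sP (inl (i, j))).
  case: (eqVneq (f (inl (i, j)) x) 0) => [_|xn]; rewrite sgr_eq0 //.
  apply/eqP => /(vP (inl (i, j))) h; case/eqP: ij.
  apply: (@nonprop _ _ _ _ S i j (pr one i / pr one j)) => y.
  have [s Ws] := W1 y; have := h _ Ws; rewrite /f /tie !prD !prZ => h'.
  have n0 : pr one j != 0 by rewrite gt_eqF // pr1_gt0.
  by apply: (mulIf n0); rewrite mulrAC divfK // ; apply/eqP; rewrite -subr_eq0; apply/eqP; rewrite -h'; ring.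
move=> j /eqP; rewrite -sgr_eq0 (sP (inr j)) /=.
case: (eqVneq (pr x j) 0) => [xj|xn]; rewrite sgr_eq0; last by rewrite (negbTE xn).
by move=> /eqP/(vP (inr j)).
Qed.

Lemma nt_near x : exists v y, displaced S x v y /\ nt y.
Proof. by have [|||v [y [_ h1 h2 _]]] := @nt_exists x (fun=> True) => //; [exists 0 | exists v, y]. Qed.

Lemma nt_facet x X : pr x X = 0 -> exists v y, [/\ displaced S x v y, nt y, pr v X = 0 & generic S X y].
Proof.
move=> xX; have [||y|v [y [h0 h1 h2 h3]]] := @nt_exists x (fun y => pr y X = 0); first exact: pr0.
- by move=> a y z y0 z0; rewrite prD prZ y0 z0 mulr0 addr0.
- exists (- (pr y X / pr one X)); rewrite prD prZ mulNr divfK ?subrr //.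
  by rewrite gt_eqF // pr1_gt0.
exists v, y; split=> // j jX; apply/eqP => /h3[_ h].
by have [z [zj zX]] := separate S 1 0 jX; have := h z zX; rewrite zj; apply/eqP/oner_neq0.
Qed.

(** Convex open sets that meet no wall, in the form required by [wval_invariant] with threshold
    0. *)
Definition zone (C : 'rV[R]_n -> Prop) : Prop :=
  [/\ forall Y Z s, C Y -> C Z -> 0 <= s -> s <= 1 -> C (Y + s *: (Z - Y)),
      forall Y v, C Y -> exists2 e, 0 < e & forall e', 0 < e' -> e' <= e -> C (Y + e' *: v) &
      forall Y j, C Y -> ~~ onwall S Y j].

Lemma zone_value C Y Y' h : zone C -> C Y -> C Y' -> nt Y -> nt Y' -> wv Y h -> wv Y' h.
Proof.
move=> [Cc Co Cw] CY CY' ntY ntY'; apply: (wval_invariant _ Cc Co _ _ _ CY CY' ntY ntY').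
- by move=> j _; apply/ltW/pr1_gt0.
- by move=> Z l _ _ /eqP; rewrite gt_eqF // pr1_gt0.
- move=> Z j CZ vj; apply: contra (Cw Z j CZ) => /eqP; rewrite /ctime => e.
  apply: vis_onwall vj _; apply/eqP; move/eqP: e; rewrite mulf_eq0 invr_eq0.
  by rewrite [pr one j == 0]gt_eqF ?pr1_gt0 // orbF.
by move=> A B AB _ _ _ _; apply: pg_word_rel; exists A, B.
Qed.

Lemma reg_zone e : adm S e m -> zone (reg S e m).
Proof.
move=> a; split=> [Y Z s rY rZ s0 s1|Y v rY|Y j rY].
- exact: reg_conv.
- have [ep ep0 epP] := perturb S Y v; exists ep => // e' e'0 le.
  by apply: reg_displaced rY => j; apply: epP.
apply/negP => w; have c : cut S e j by exists Y; split=> // l lj; apply: rY; apply: ltn_trans lj _.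
have := rY j (ltn_ord j); rewrite (wall_eq0 w).
case ej: (e j) => [[]|] /=; rewrite ?ltxx // => _.
by move: (proj1 (a j (ltn_ord j)) ej).
Qed.

Definition positive Y : Prop := forall j, 0 < pr Y j.

Lemma positive_zone : zone positive.
Proof.
split=> [Y Z s rY rZ s0 s1 j|Y v rY|Y j rY].
- by rewrite prD prZ prB; apply: (@sgn_ok_conv _ (Some true)) => //; [apply: rY | apply: rZ].
- have [ep ep0 epP] := perturb S Y v; exists ep => // e' e'0 le j.
  by rewrite -sgr_gt0 epP // gt_eqF // sgr_gt0.
by rewrite /onwall gt_eqF.
Qed.

Lemma ctime_gt0 Y j : (0 < ctime S one Y j) = (0 < pr Y j).
Proof. by rewrite /ctime pmulr_lgt0 // invr_gt0 pr1_gt0. Qed.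

Lemma wv_negative Y : nt Y -> (forall j, pr Y j < 0) -> wv Y 1%g.
Proof.
move=> /isW_exists[w wP] Yn; exists w => //; rewrite (_ : [seq _ <- _ | _] = [::]).
  by rewrite /wprod big_nil.
by rewrite -(filter_pred0 w); apply: eq_filter => j; rewrite ctime_gt0 ltNge ltW.
Qed.

Lemma wv_positive Y w : positive Y -> isW S 0 one Y w -> wv Y (pg_word (prel S) w).
Proof.
move=> Yp wP; exists w => //; rewrite (_ : [seq _ <- _ | _] = w) //.
by apply/all_filterP/allP => j _; rewrite ctime_gt0.
Qed.

Lemma tie_shift Y s i j : tie1 (Y + s *: one) i j = tie1 Y i j.
Proof. by rewrite /tie !prD !prZ; ring. Qed.

Lemma nt_shift Y s : nt Y -> nt (Y + s *: one).
Proof. by rewrite !ntP => h i j ij; rewrite tie_shift h. Qed.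

Lemma isW_shift Y s w : isW S 0 one Y w -> isW S 0 one (Y + s *: one) w.
Proof.
move=> wP; apply: klist_eq wP _ _ => [j|i j _ _].
  by apply/vis0P/vis0P => h l sl; have := h l sl; rewrite tie_shift.
by rewrite !tt_lt ?pr1_gt0 // tie_shift.
Qed.

(** The points before and after z lie on one line in the direction (1, ..., 1), so their words agree
    except that the second one ends with the walls through z; there is at most one, so no order
    among them matters. *)
Lemma cross_value z (L : seq 'I_m) : nt z -> (size L <= 1)%N -> (forall j, onwall S z j = (j \in L)) ->
  exists y1 y2 h, [/\ displaced S z (- one) y1, displaced S z one y2, nt y1 /\ nt y2,
    wv y1 h & wv y2 (h * pg_word (prel S) L)%g].
Proof.
move=> ntz L1 wL; have [w wP] := isW_exists ntz.
have [e0 e00 d0] := perturb S z (- one); have [e1 e10 d1] := perturb S z one.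
exists (z + e0 *: - one), (z + e1 *: one).
exists (pg_word (prel S) [seq j <- w | 0 < pr z j]).
have D0 : displaced S z (- one) (z + e0 *: - one) by move=> j; apply: d0.
have D1 : displaced S z one (z + e1 *: one) by move=> j; apply: d1.
have e0N : z + e0 *: - one = z + (- e0) *: one by rewrite scalerN scaleNr.
split=> //; first by split; rewrite ?e0N; apply: nt_shift.
  exists w; first by rewrite e0N; apply: isW_shift.
  congr (wprod _ _); apply: eq_filter => j; rewrite ctime_gt0 -[RHS]sgr_gt0 -sgr_gt0 D0.
  case: (eqVneq (pr z j) 0) => // ->; rewrite sgr0 ltxx sgr_gt0 prN.
  by apply/esym/negbTE; rewrite -leNgt oppr_le0 ltW // pr1_gt0.
exists w; first exact: isW_shift.
rewrite -pg_word_cat -wprod_word; congr (wprod _ _).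
have Lz j : j \in L -> pr z j = 0 by rewrite -wL => /wall_eq0.
have [wm ws] := wP; have tr := key_trans (k := fun j => - ctime S one z j).
apply: (klist_uniq (P := fun j => vis S 0 one z j && (0 <= pr z j)) (k := fun j => - ctime S one z j)).
  split=> [j|].
    rewrite mem_cat mem_filter wm -wL andbC le_eqVlt [0 == _]eq_sym andb_orr orbC; congr (_ || _).
    apply/idP/andP => [w'|[v' /eqP zj]]; last exact: vis_onwall v' zj.
    by rewrite onwall_vis // (wall_eq0 w').
  rewrite (sorted_pairwise tr) pairwise_cat; apply/and3P; split.
  - apply/allrelP => i j; rewrite mem_filter => /andP[zi _] jL.
    by rewrite ltrN2 /ctime (Lz j jL) mul0r -/(ctime S one z i) ctime_gt0.
  - by rewrite pairwise_filter // -(sorted_pairwise tr).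
  - by case: L L1 {wL Lz} => [|a []].
split=> [j|]; last by apply: sorted_filter.
rewrite mem_filter wm andbC; congr (_ && _); rewrite ctime_gt0 -sgr_gt0 D1.
case: (eqVneq (pr z j) 0) => [->|z0]; first by rewrite lexx sgr_gt0 pr1_gt0.
by rewrite sgr_gt0 lt_neqAle eq_sym z0.
Qed.

Lemma gpath_value e p Y h : adm S e m -> gpath S m e p -> reg S e m Y -> nt Y -> wv Y h ->
  forall Y', reg S (endpt e p) m Y' -> nt Y' -> wv Y' (h * pg_word (prel S) (letters p))%g.
Proof.
elim: p e Y h => [|[X e'] p IH] e Y h a /=.
  move=> _ rY ntY wY Y' rY' ntY'; rewrite /pg_word big_nil mulg1.
  exact: zone_value (reg_zone a) rY rY' ntY ntY' wY.
move=> [st a' gp] rY ntY wY Y' rY' ntY'.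
have [Xm eX e'X ag [z0 f0]] := st.
have [v [z [dz ntz vX gz]]] := nt_facet (proj1 f0); have f := facet_displaced dz vX f0.
have rX : reg S e X z.
  move=> j jX; have jne : j != X by apply: contraTneq jX => ->; rewrite ltnn.
  by case: f => _ /(_ j (ltn_ord j) jne)[].
have wX : onwall S z X.
  have [] // := cut_stable (adm_le (ltnW Xm) a) _ rX (proj1 f).
  by apply: (adm_cut a Xm); rewrite eX.
have [||y1 [y2 [h' [d1 d2 [nt1 nt2] w1 w2]]]] := cross_value (L := [:: X]) ntz; first by [].
  move=> j; rewrite inE; have [->//|jX] := eqVneq j X.
  by rewrite /onwall (negbTE (gz j jX)).
have r1 : reg S e m y1.
  by apply: facet_reg1 eX _ _ _ _ f d1 _; rewrite prN oppr_lt0 pr1_gt0.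
have r2 : reg S e' m y2.
  by apply: facet_reg2 e'X _ _ _ _ f d2 _; apply: pr1_gt0.
have hh : h = h' by apply: wval_fun (zone_value (reg_zone a) rY r1 ntY nt1 wY) w1.
rewrite pg_word_cons mulgA; apply: IH gp r2 nt2 _ Y' rY' ntY' => //.
by rewrite hh -pg_word1.
Qed.

(** Characterizes the Coxeter element by its value at positive points, without simple roots, which
    lets it pass to the truncation. *)
Definition cval (c : presented_group (prel S)) : Prop := forall Y, positive Y -> nt Y -> wv Y c.

Lemma positive_nt : exists Y, positive Y /\ nt Y.
Proof.
have [v [y [d nty]]] := nt_near one; exists y; split=> // j.
by apply: displaced_gt d _; apply: pr1_gt0.
Qed.

Lemma cval_word Y w : positive Y -> nt Y -> isW S 0 one Y w -> cval (pg_word (prel S) w).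
Proof.
move=> pY ntY wP Y' pY' ntY'.
exact: zone_value positive_zone pY pY' ntY ntY' (wv_positive pY wP).
Qed.

Lemma cval_fun c c' : cval c -> cval c' -> c = c'.
Proof. by have [Y [pY ntY]] := positive_nt => h h'; apply: wval_fun (h Y pY ntY) (h' Y pY ntY). Qed.

Definition complete e p : Prop := [/\ adm S e m, gpath S m e p, reg S e m (- one) & reg S (endpt e p) m one].

Lemma complete_value e p : complete e p -> cval (pg_word (prel S) (letters p)).
Proof.
move=> [a gp r0 r1] Y' pY' ntY'.
have [v [Y [d ntY]]] := nt_near (- one).
have wY : wv Y 1%g.
  by apply: wv_negative ntY _ => j; apply: displaced_lt d _; rewrite prN oppr_lt0 pr1_gt0.
have [v2 [Y2 [d2 ntY2]]] := nt_near one.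
have := gpath_value a gp (reg_displaced d r0) ntY wY (reg_displaced d2 r1) ntY2.
rewrite mul1g; apply: zone_value positive_zone _ pY' ntY2 ntY' => j.
by apply: displaced_gt d2 _; apply: pr1_gt0.
Qed.

End Values.

(** * Deletion of the vertically last letter *)

Section Deletion.
Context (R : realType) (n : nat) (Q : valued_quiver n) (m : nat) (S : root_data R Q m.+1).

Local Notation S' := (trunc S).
Local Notation wid := (@wid m).

Definition del (w : seq 'I_m.+1) : seq 'I_m := pmap (fun j : 'I_m.+1 => insub (j : nat)) w.

Lemma insub_wid (i : 'I_m) : insub (wid i : nat) = Some i.
Proof. by rewrite (insubT (fun k => (k < m)%N) (ltn_ord i)); congr Some; apply: val_inj. Qed.

Lemma insub_max : insub (ord_max (n' := m) : nat) = None :> option 'I_m.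
Proof. by apply: insubF; rewrite /= ltnn. Qed.

Lemma del_wid w : [seq wid j | j <- del w] = [seq j <- w | j != ord_max].
Proof.
elim: w => //= j w IH; have [->|/widP[i ->]] := eqVneq j ord_max.
  by rewrite insub_max.
by rewrite insub_wid /= IH.
Qed.

Lemma mem_del w i : (i \in del w) = (wid i \in w).
Proof. by rewrite -(mem_map (@wid_inj m)) del_wid mem_filter wid_max. Qed.

Lemma pairb_trunc a b : pairb S' a b = pairb S (wid a) (wid b). Proof. by []. Qed.

Lemma sorted_del (r : rel 'I_m.+1) w : transitive r -> sorted r w ->
  sorted (fun i j => r (wid i) (wid j)) (del w).
Proof.
move=> tr sw; have : sorted r [seq wid j | j <- del w] by rewrite del_wid sorted_filter.
by rewrite sorted_map.
Qed.

Lemma sw_trunc a b : pairb S' a b -> sw S' a b = del (sw S (wid a) (wid b)).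
Proof.
move=> ab; have AB : pairb S (wid a) (wid b) by rewrite -pairb_trunc.
apply: klist_uniq (swP ab) _; split=> [l|].
  by rewrite mem_del mem_sw.
by have [_] := swP AB; apply: sorted_del; apply: key_trans.
Qed.

(** Relations involving the last root are commutations by [sw_last], so killing this letter is a
    homomorphism. *)
Lemma del_word u v : pg_word (prel S) u = pg_word (prel S) v ->
  pg_word (prel S') (del u) = pg_word (prel S') (del v).
Proof.
pose f (j : 'I_m.+1) : presented_group (prel S') :=
  if insub (j : nat) is Some i then pg_gen (prel S') i else 1%g.
have fE w : wprod f w = pg_word (prel S') (del w).
  elim: w => [|j w IH]; first by rewrite /wprod /pg_word !big_nil.
  rewrite wprod_cons IH /f /=; case: (insub _) => [i|] /=; last by rewrite mul1g.
  by rewrite pg_word_cons.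
have wmax (j : 'I_m.+1) : (j <= (ord_max : 'I_m.+1))%N by apply: leq_ord.
move=> /(congr1 (pg_lift f)); rewrite !pg_lift_word ?fE //; move=> {}u {}v [A [B [AB -> ->]]].
all: rewrite !fE; have [eA|/widP[a eA]] := eqVneq A ord_max.
1,3: rewrite (sw_last AB); last by left=> j; rewrite eA; apply: wmax.
1,2: by rewrite /= eA insub_max /=; case: (insub _).
all: have [eB|/widP[b eB]] := eqVneq B ord_max.
1,3: rewrite (sw_last AB); last by right=> j; rewrite eB; apply: wmax.
1,2: by rewrite /= eB insub_max /=; case: (insub _).
all: rewrite eA eB in AB *; rewrite -sw_trunc //= !insub_wid /=.
all: by apply: pg_word_rel; exists a, b.
Qed.

Lemma onwall_vis_trunc Y j : vis S' 0 (const_mx 1) Y j = vis S 0 (const_mx 1) Y (wid j).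
Proof.
apply/vis0P/vis0P => h l s; last exact: h (wid l) s.
by have [i ei] := wid_le (rsub_index s); rewrite ei in s *; apply: h i s.
Qed.

(** One generic positive line computes both elements, since the visibility of an earlier root only
    involves earlier roots. *)
Lemma cval_del : exists w, cval (pg_word (prel S) w) /\ cval (pg_word (prel S') (del w)).
Proof.
have [Y [pY ntY]] := positive_nt S; have [w wP] := isW_exists ntY.
exists w; split; first exact: cval_word pY ntY wP.
apply: (@cval_word _ _ _ _ S' Y); first by move=> j; apply: (pY (wid j)).
  by apply/ntP => i j ij; apply: (proj1 (ntP S Y) ntY); rewrite (inj_eq (@wid_inj m)).
have [wm ws] := wP; split=> [j|]; first by rewrite mem_del wm onwall_vis_trunc.
exact: (@sorted_del (fun i j => - ctime S (const_mx 1) Y i < - ctime S (const_mx 1) Y j) w (key_trans (k := _)) ws).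
Qed.
End Deletion.

(** * Lifting green sequences *)

Lemma cat_eq_cat (T : Type) (a b c d : seq T) : a ++ b = c ++ d ->
  (exists q, c = a ++ q /\ b = q ++ d) \/ (exists q, a = c ++ q /\ d = q ++ b).
Proof.
elim: a c => [|x a IH] [|y c] /=; first by left; exists [::].
- by move=> ->; left; exists (y :: c).
- by move=> <-; right; exists (x :: a).
by case=> -> /IH[[q [-> ->]]|[q [-> ->]]]; [left | right]; exists q.
Qed.

Section Lifting.
Context (R : realType) (n : nat) (Q : valued_quiver n) (m : nat) (S : root_data R Q m.+1).
Implicit Types (e : nat -> option bool) (p q : seq ('I_m.+1 * (nat -> option bool))).

Local Notation om := (@ord_max m).
Local Notation one := (const_mx 1 : 'rV[R]_n).
Local Notation word := (pg_word (prel S)).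

Let om_last (j : 'I_m.+1) : (j <= om)%N. Proof. exact: leq_ord. Qed.

Definition ext e (s : option bool) (j : nat) : option bool := if j == m then s else e j.

(** The sign 0 is imposed by admissibility when D(om) misses the region; otherwise b is a free
    choice. *)
Definition side (b : bool) e : option bool := if pselect (cut S e om) then Some b else None.

Lemma extE e s (j : nat) : (j < m)%N -> ext e s j = e j.
Proof. by move=> jm; rewrite /ext ltn_eqF. Qed.

Lemma ext_om e s : ext e s om = s. Proof. by rewrite /ext eqxx. Qed.

Lemma cut_extE e s (i : 'I_m.+1) : cut S (ext e s) i <-> cut S e i.
Proof.
split; apply: cut_ext => j ji; rewrite extE //; apply: leq_trans ji _; exact: leq_ord.
Qed.

Lemma adm_ext e s : adm S e m -> (s = None <-> ~ cut S e om) -> adm S (ext e s) m.+1.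
Proof.
move=> a hs i; rewrite ltnS leq_eqVlt cut_extE => /orP[/eqP im|im].
  have -> : i = om by apply: val_inj.
  by rewrite ext_om.
by rewrite extE //; apply: a.
Qed.

Lemma adm_side b e : adm S e m -> adm S (ext e (side b e)) m.+1.
Proof. by move=> a; apply: adm_ext => //; rewrite /side; case: pselect. Qed.

Lemma reg_side e s x : reg S e m x -> sgn_ok s (pr S x om) -> reg S (ext e s) m.+1 x.
Proof.
move=> r so i; rewrite ltnS leq_eqVlt => /orP[/eqP im|im].
  have -> : i = om by apply: val_inj.
  by rewrite ext_om.
by rewrite extE //; apply: r.
Qed.

(** Once om is cut on one of the two sides, the facet needs a point on the chosen side of H(om);
    [step_pos] and [step_neg] provide it under the condition on E. *)
Lemma gstep_side b e1 e2 X : adm S e1 m -> adm S e2 m -> gstep S e1 e2 X m ->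
  (if b then rE S om X else rE S X om) <= 0 ->
  gstep S (ext e1 (side b e1)) (ext e2 (side b e2)) X m.+1.
Proof.
move=> a1 a2 st EX; have [Xm e1X e2X ag [z0 f0]] := st.
have [z [fz zo]] : exists z, facet S e1 e2 X m z /\
    (cut S e1 om \/ cut S e2 om -> sgn_ok (Some b) (pr S z om)).
  have [c|c] := pselect (cut S e1 om \/ cut S e2 om); last by exists z0; split=> // /c.
  case: b EX => EX.
    by have [z [f _ p]] := step_pos (om := om) a1 a2 st EX c; exists z.
  by have [z [f _ p]] := step_neg (om := om) a1 a2 st EX c; exists z.
split; first exact: ltnW.
- by rewrite extE.
- by rewrite extE.
- by move=> j jX; rewrite !extE ?(ltn_trans jX) // ag.
have [zX h] := fz; exists z; split=> // j; rewrite ltnS leq_eqVlt => /orP[/eqP jm|jm] jX.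
  have -> : j = om by apply: val_inj.
  rewrite !ext_om /side; split; case: pselect => // c; apply: zo; by [left | right].
by rewrite !extE //; apply: h.
Qed.

Definition lift (b : bool) p := [seq (a.1, ext a.2 (side b a.2)) | a <- p].

Lemma letters_lift b p : letters (lift b p) = letters p.
Proof. by rewrite /letters /lift -map_comp. Qed.

Lemma endpt_lift b e p : endpt (ext e (side b e)) (lift b p) = ext (endpt e p) (side b (endpt e p)).
Proof. by rewrite /endpt /lift; elim: p e => //= a p IH e; apply: IH. Qed.

Lemma gpath_lift b e p : adm S e m -> gpath S m e p ->
  (forall X, X \in letters p -> (if b then rE S om X else rE S X om) <= 0) ->
  gpath S m.+1 (ext e (side b e)) (lift b p).
Proof.
elim: p e => //= -[X e'] p IH e a [st a' gp] h; split.
- by apply: gstep_side => //; apply: h; rewrite inE eqxx.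
- exact: adm_side.
- by apply: IH => // Y Yp; apply: h; rewrite inE Yp orbT.
Qed.

(** The torsion property of om persists along the path by [Tsome_next], and a letter about to be
    crossed is still negative; [pre_E] is the same argument backwards in time. *)
Lemma post_E e p : adm S e m -> gpath S m e p -> (exists x, reg S e m x /\ Ts S x om) ->
  forall X, X \in letters p -> rE S om X <= 0.
Proof.
elim: p e => //= -[Y e'] p IH e a [st a' gp] T X; rewrite inE => /orP[/eqP->|].
  have [x [r t]] := T; have [Ym eY _ _ _] := st.
  by have := @Tsome_E _ _ _ _ S e om om Y x a Ym (leqnn _) eY r t.
by apply: IH gp _ X => //; apply: (Tsome_next (om := om) a a' st T).
Qed.

Lemma pre_E e p : adm S e m -> gpath S m e p -> (exists x, reg S (endpt e p) m x /\ Fs S x om) ->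
  (forall X, X \in letters p -> rE S X om <= 0) /\ exists x, reg S e m x /\ Fs S x om.
Proof.
elim: p e => [|[Y e'] p IH] e a /=; first by move=> _ h; split.
move=> [st a' gp] F; have [h F'] := IH e' a' gp F; split; last first.
  exact: (Fsome_prev (om := om) a a' st F').
move=> X; rewrite inE => /orP[/eqP->|]; last exact: h.
have [x [r t]] := F'; have [Ym _ eY _ _] := st.
by have := @Fsome_E _ _ _ _ S e' om om Y x a' Ym (leqnn _) eY r t.
Qed.

Lemma exit_cut e q : cut S e om -> ~ cut S (endpt e q) om -> exists q1 X e' q2,
  [/\ q = q1 ++ (X, e') :: q2, cut S (endpt e q1) om & ~ cut S e' om].
Proof.
elim: q e => [|[X e'] q IH] e c nc //=.
have [c'|c'] := pselect (cut S e' om); last by exists [::], X, e', q.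
have [q1 [Y [e1 [q2 [-> h1 h2]]]]] := IH e' c' nc.
by exists ((X, e') :: q1), Y, e1, q2.
Qed.

Lemma entry_cut e q : ~ cut S e om -> cut S (endpt e q) om -> exists q1 X e' q2,
  [/\ q = q1 ++ (X, e') :: q2, ~ cut S (endpt e q1) om & cut S e' om].
Proof.
elim: q e => [|[X e'] q IH] e nc c //=.
have [c'|c'] := pselect (cut S e' om); first by exists [::], X, e', q.
have [q1 [Y [e1 [q2 [-> h1 h2]]]]] := IH e' c' c.
by exists ((X, e') :: q1), Y, e1, q2.
Qed.

Lemma endpt_cat e p q : endpt e (p ++ q) = endpt (endpt e p) q.
Proof. by rewrite /endpt map_cat last_cat. Qed.

Lemma letters_cat p q : letters (p ++ q) = letters p ++ letters q.
Proof. exact: map_cat. Qed.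

Lemma letters_rcons p a : letters (rcons p a) = rcons (letters p) a.1.
Proof. exact: map_rcons. Qed.

Lemma om_letters e p : gpath S m e p -> om \notin letters p.
Proof.
elim: p e => //= -[X e'] p IH e [[Xm _ _ _ _] _ gp]; rewrite inE negb_or (IH e') // andbT.
by apply: contraTneq Xm => /= <-; rewrite /= ltnn.
Qed.

Variables (e0 : nat -> option bool) (p0 : seq ('I_m.+1 * (nat -> option bool))).
Hypotheses (a0 : adm S e0 m) (g0 : gpath S m e0 p0) (r0 : reg S e0 m (- one))
  (r1 : reg S (endpt e0 p0) m one).

(** The path runs on the negative side of D(om) along p and on the positive side along q; [pre_E]
    and [post_E] supply the conditions on E that lift each half. *)
Lemma insert_complete p q : p0 = p ++ q -> cut S (endpt e0 p) om ->
  exists e p', complete S e p' /\ letters p' = letters p ++ om :: letters q.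
Proof.
move=> ep c; move: g0 r1; rewrite ep gpath_cat endpt_cat => -[gp gq] r1'.
have ap := gpath_adm a0 gp; set e := endpt e0 p in c gq r1' ap *.
have sideE b : side b e = Some b by rewrite /side; case: pselect.
have hT := cut_Ts_point c; have hF := cut_Fs_point c.
exists (ext e0 (side false e0)), (lift false p ++ (om, ext e (Some true)) :: lift true q).
split; last by rewrite letters_cat /= !letters_lift.
split.
- exact: adm_side.
- rewrite gpath_cat; split.
    by apply: gpath_lift => //; have [] := pre_E a0 gp hF.
  rewrite endpt_lift -/e sideE /=; split.
  + split; rewrite ?ext_om //; first by move=> j jm; rewrite !extE.
    have [z [w r]] := c; exists z; split; first exact: wall_eq0 w.
    move=> j; rewrite ltnS leq_eqVlt => /orP[/eqP jm|jm] jo; first by case/eqP: jo; apply: val_inj.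
    by rewrite !extE //; split; apply: r.
  + by apply: adm_ext => //; split.
  + by rewrite -sideE; apply: gpath_lift => //; apply: post_E hT.
- apply: reg_side => //; rewrite /side; case: pselect => //= _.
  by rewrite prN oppr_lt0 pr1_gt0.
rewrite endpt_cat /endpt /= -/(endpt _ _) -sideE -/(endpt _ (lift true q)) endpt_lift.
apply: reg_side => //; rewrite /side; case: pselect => //= _; exact: pr1_gt0.
Qed.

Lemma none_complete : (forall p q, p0 = p ++ q -> ~ cut S (endpt e0 p) om) ->
  exists e p', complete S e p' /\ letters p' = letters p0.
Proof.
move=> nc; exists (ext e0 (side false e0)), (lift false p0); rewrite letters_lift; split=> //; split.
- exact: adm_side.
- have nc1 : ~ cut S e0 om by apply: (nc [::] p0).
  have nc2 p q X e' : p0 = p ++ (X, e') :: q -> ~ cut S e' om.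
    move=> e; have := nc (rcons p (X, e')) q; rewrite cat_rcons => /(_ e).
    by rewrite -cats1 endpt_cat.
  move: nc1 nc2 a0 g0; elim: (p0) (e0) => //= -[X e'] p IH e nc1 nc2 a [st a' gp].
  have nc' : ~ cut S e' om by apply: (nc2 [::] p X e').
  split; [|exact: adm_side|]; last first.
    by apply: IH => // p' q Y e1 ep; apply: (nc2 ((X, e') :: p') q Y e1); rewrite ep.
  have [Xm eX e'X ag [z [zX h]]] := st; split.
  + exact: ltnW.
  + by rewrite extE.
  + by rewrite extE.
  + by move=> j jX; rewrite !extE ?(ltn_trans jX) // ag.
  exists z; split=> // j; rewrite ltnS leq_eqVlt => /orP[/eqP jm|jm] jX.
    have -> : j = om by apply: val_inj.
    by rewrite !ext_om /side; split; case: pselect.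
  by rewrite !extE //; apply: h.
- apply: reg_side => //; rewrite /side; case: pselect => //= _.
  by rewrite prN oppr_lt0 pr1_gt0.
rewrite endpt_lift; apply: reg_side => //; rewrite /side; case: pselect => //= c.
by case: (nc p0 [::]); rewrite ?cats0.
Qed.

Lemma word_mid_eq a b c d : word (a ++ b ++ d) = word (a ++ c ++ d) -> word b = word c.
Proof. by rewrite !pg_word_cat => /mulgI/mulIg. Qed.

(** If no region of p0 is cut, [count_last] shows that w has no letter om; otherwise w has exactly
    one, as does the word obtained by inserting om at a cut region. If om sat in w at an uncut
    region, comparing with an insertion next to a step that leaves or enters the cut regions would
    give a commutation; [commute_orth] makes its letters orthogonal to om, and [step_orth_cut]
    contradicts the change of cut status. *)
Lemma lift_word w : cval (word w) -> [seq j <- w | j != om] = letters p0 ->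
  exists e p, complete S e p /\ letters p = w.
Proof.
move=> cw ew; have valE e p : complete S e p -> word (letters p) = word w.
  by move=> /complete_value/cval_fun; apply.
have count0 u : om \notin u -> count_mem om u = 0%N by move/count_memPn.
have lp0 := om_letters g0.
have [[pa [pb [eab c]]]|nc] := pselect (exists p q, p0 = p ++ q /\ cut S (endpt e0 p) om); last first.
  have [p q ep c|e [p [cp lp]]] := none_complete; first by apply: nc; exists p, q.
  exists e, p; split=> //; rewrite lp -ew; apply/all_filterP/allP => j jw.
  have := count_last om_last _ (valE e p cp); rewrite lp -ew filter_id => /(_ erefl).
  rewrite ew count0 // => /esym/eqP; rewrite eqn0Ngt -has_count has_pred1 => nw.
  by apply: contraNneq nw => <-.
have [e1 [p1 [cp1 lp1]]] := insert_complete eab c.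
have fp1 : [seq j <- letters p1 | j != om] = letters p0.
  rewrite lp1 eab letters_cat filter_cat /= eqxx /=; move: lp0; rewrite eab letters_cat mem_cat negb_or.
  by move=> /andP[la lb]; congr (_ ++ _); apply/all_filterP/allP => j jl; apply: contraTneq jl => ->.
have cnt : count_mem om w = 1%N.
  have := count_last om_last _ (valE _ _ cp1); rewrite fp1 ew => /(_ erefl) <-.
  rewrite lp1 count_cat /= eqxx; move: lp0; rewrite eab letters_cat mem_cat negb_or => /andP[la lb].
  by rewrite !count0.
have ow : om \in w by rewrite -has_pred1 has_count cnt.
case/splitPr: ow cnt ew cw valE => t0 t1; rewrite count_cat /= eqxx => /eqP.
rewrite add1n addnS eqSS addn_eq0 => /andP[/eqP c0 /eqP c1] ew cw valE.
have t0o : om \notin t0 by apply/count_memPn.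
have t1o : om \notin t1 by apply/count_memPn.
have {}ew : t0 ++ t1 = letters p0.
  rewrite -ew filter_cat /= eqxx /=; congr (_ ++ _); apply/esym/all_filterP/allP => j jl;
  by apply: contraTneq jl => ->.
pose ta := take (size t0) p0; pose tb := drop (size t0) p0.
have etb : p0 = ta ++ tb by rewrite cat_take_drop.
have lta : letters ta = t0 by rewrite /letters map_take -/(letters p0) -ew take_size_cat.
have ltb : letters tb = t1 by rewrite /letters map_drop -/(letters p0) -ew drop_size_cat.
suff ct : cut S (endpt e0 ta) om.
  by have [e [p [cp lp]]] := insert_complete etb ct; exists e, p; split=> //; rewrite lp lta ltb.
(* First case: om sits in w later than the known cut region, and some step in between leaves the cut
   regions. *)
apply: contrapT => nct; have := etb; rewrite {1}eab => /cat_eq_cat[[q [eq1 eq2]]|[q [eq1 eq2]]].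
  move: nct; rewrite eq1 endpt_cat => /(exit_cut c)[q1 [X [e' [q2 [eq3 c' nc']]]]].
  have eab' : p0 = (pa ++ q1) ++ ((X, e') :: q2 ++ tb) by rewrite etb eq1 eq3 -!catA.
  have c'' : cut S (endpt e0 (pa ++ q1)) om by rewrite endpt_cat.
  have [e2 [p2 [cp2 lp2]]] := insert_complete eab' c''.
  have := valE _ _ cp2; rewrite lp2 -lta -ltb eq1 eq3.
  rewrite -[om :: letters _]/(letters ((om, e') :: (X, e') :: q2 ++ tb)).
  have -> : letters (pa ++ q1) ++ letters ((om, e') :: (X, e') :: q2 ++ tb) =
    letters (pa ++ q1) ++ (om :: X :: letters q2) ++ letters tb.
    by rewrite -[(om, e') :: _]/([:: (om, e'), (X, e') & q2] ++ tb) (letters_cat _ tb).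
  have -> : letters (pa ++ q1 ++ (X, e') :: q2) ++ om :: letters tb =
    letters (pa ++ q1) ++ rcons (X :: letters q2) om ++ letters tb.
    by rewrite catA letters_cat -!catA cat_rcons.
  move=> /word_mid_eq com; move: (g0); rewrite eab' gpath_cat => -[gpq].
  rewrite -cat_cons gpath_cat => -[gX _]; have apq := gpath_adm a0 gpq.
  have EX Y : Y \in X :: letters q2 -> rE S om Y <= 0.
    exact: post_E apq gX (cut_Ts_point c'') Y.
  have fo : forth S (X :: letters q2) by exact: gpath_forth apq gX.
  have nX : om \notin X :: letters q2 by exact: om_letters gX.
  have EX' := commute_orth om_last fo nX EX com.
  have [st ae' _] := gX; apply: nc'.
  by have [] := step_orth_cut (om := om) apq ae' st (EX _ (mem_head _ _)) (EX' _ (mem_head _ _)) (or_introl c'').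
(* Second case, reversed in time: om sits in w earlier than the known cut region, and some step in
   between enters the cut regions. *)
move: (c); rewrite eq1 endpt_cat => /(entry_cut nct)[q1 [X [e' [q2 [eq3 nc' c']]]]].
have eab' : p0 = (ta ++ rcons q1 (X, e')) ++ (q2 ++ pb) by rewrite eab eq1 eq3 -!catA cat_rcons.
have c'' : cut S (endpt e0 (ta ++ rcons q1 (X, e'))) om.
  by rewrite -cats1 !endpt_cat.
have [e2 [p2 [cp2 lp2]]] := insert_complete eab' c''.
have := valE _ _ cp2; rewrite lp2 -lta -ltb eq2 eq3.
have -> : letters (ta ++ rcons q1 (X, e')) ++ om :: letters (q2 ++ pb) =
  letters ta ++ rcons (rcons (letters q1) X) om ++ letters (q2 ++ pb).
  by rewrite letters_cat letters_rcons -catA [rcons (rcons _ _) _ ++ _]cat_rcons.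
have -> : letters ta ++ om :: letters ((q1 ++ (X, e') :: q2) ++ pb) =
  letters ta ++ (om :: rcons (letters q1) X) ++ letters (q2 ++ pb).
  by rewrite -catA cat_cons -[q1 ++ _ :: _]cat_rcons letters_cat letters_rcons cat_cons.
move=> /word_mid_eq com; move: (g0); rewrite eab' gpath_cat => -[].
rewrite gpath_cat => -[gta gq] _; have ata := gpath_adm a0 gta.
have lq := letters_rcons q1 (X, e').
have [EX _] : (forall Y, Y \in letters (rcons q1 (X, e')) -> rE S Y om <= 0) /\
    exists x, reg S (endpt e0 ta) m x /\ Fs S x om.
  by apply: pre_E ata gq _; rewrite -endpt_cat; exact: (cut_Fs_point c'').
have fo := gpath_forth ata gq; have nX := om_letters gq.
rewrite lq in EX fo nX.
have EX' := commute_orth' om_last fo nX EX (esym com).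
have Xin : X \in rcons (letters q1) X by rewrite mem_rcons mem_head.
move: gq; rewrite -cats1 gpath_cat => -[gq1 /= [st ae' _]].
have aq1 := gpath_adm ata gq1.
by have [/nc'] := step_orth_cut (om := om) aq1 ae' st (EX' X Xin) (EX X Xin) (or_intror c').
Qed.
End Lifting.

Section Truncated.
Context (R : realType) (n : nat) (Q : valued_quiver n) (m : nat) (S : root_data R Q m.+1).
Local Notation S' := (trunc S).
Local Notation wid := (@wid m).

Lemma reg_trunc e k x : (k <= m)%N -> reg S' e k x <-> reg S e k x.
Proof.
move=> km; split=> h j jk; last exact: (h (wid j)).
have [|i ei] := @widP m j; last by rewrite ei in jk *; apply: h.
by apply: contraTneq jk => ->; rewrite -leqNgt.
Qed.

Lemma cut_trunc e (i : 'I_m) : cut S' e i <-> cut S e (wid i).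
Proof.
have im := ltnW (ltn_ord i).
by split=> -[x [w r]]; exists x; move: w r; rewrite onwall_trunc => w /(reg_trunc _ _ im).
Qed.

Lemma adm_trunc e k : (k <= m)%N -> adm S' e k -> adm S e k.
Proof.
move=> km a j jk; have [|i ei] := @widP m j; last by rewrite ei in jk *; rewrite -cut_trunc; apply: a.
by apply: contraTneq jk => ->; rewrite -leqNgt.
Qed.

Lemma gpath_trunc e p : gpath S' m e p -> gpath S m e [seq (wid a.1, a.2) | a <- p].
Proof.
elim: p e => //= -[X e'] p IH e [[Xm eX e'X ag [z [zX h]]] a' gp]; split; last exact: IH.
- split=> //; exists z; split=> // j jm jX; have [|i ei] := @widP m j.
    by apply: contraTneq jm => ->; rewrite -leqNgt.
  by rewrite ei in jm jX *; apply: h => //; apply: contraNneq jX => ->.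
- exact: adm_trunc.
Qed.
End Truncated.

Theorem green_surjective (R : realType) (n : nat) (Q : valued_quiver n) (m : nat)
  (S : root_data R Q m) w : cval (pg_word (prel S) w) ->
  exists e p, complete S e p /\ letters p = w.
Proof.
elim: m S w => [|m IH] S w cw.
  have -> : w = [::] by case: w cw => // -[].
  by exists (fun=> None), [::]; split=> //; split=> // -[].
have [w0 [c0 c0']] := cval_del S; have e0 := cval_fun cw c0.
have cw' : cval (pg_word (prel (trunc S)) (del w)) by rewrite (del_word e0).
have [e [p [[a g r0 r1] lp]]] := IH (trunc S) (del w) cw'.
pose p' := [seq (wid a.1, a.2) | a <- p].
have ep' : endpt e p' = endpt e p by rewrite /endpt /p' -map_comp.
apply: (@lift_word _ _ _ _ S e p') cw _.
- exact: adm_trunc.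
- exact: gpath_trunc.
- exact/(reg_trunc S).
- by rewrite ep'; apply/(reg_trunc S).
- by rewrite -del_wid -lp /letters /p' -!map_comp.
Qed.

(** * Back to the original definitions *)

Section PictureRelations.
Context (R : realType) (K : fieldType) (n : nat) (Q : valued_quiver n) (X : modulation K Q).
Context (m : nat) (beta : 'I_m -> 'rV[nat]_n) (hS : admissible_roots X beta).

Local Notation S := (root_data_of R hS).

Lemma pairr_delta i b : pairr Q (delta_mx 0 i : 'rV[R]_n) b = (b 0%R i)%:R * (vf Q i)%:R.
Proof.
rewrite pairrE (bigD1 i) //= big1 => [|k ki]; rewrite !mxE eqxx ?eqxx ?(negbTE ki) /=.
  by rewrite mul1r addr0.
by rewrite mul0r mul0r.
Qed.

Lemma pairr_inj b b' : (forall x : 'rV[R]_n, pairr Q x b = pairr Q x b') -> b = b'.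
Proof.
move=> h; apply/rowP => i; have := h (delta_mx 0 i); rewrite !pairr_delta => /mulIf.
by move=> e; apply/eqP; rewrite -(eqr_nat R) e // pnatr_eq0 -lt0n vf_gt0.
Qed.

Lemma mid_rootP A B l : mid S A B l <-> exists a b : nat, beta l = beta A *+ a + beta B *+ b.
Proof.
split=> -[a [b c]]; exists a, b; last by move=> x; rewrite /pr /= c pairrDr !pairrMn.
by apply: pairr_inj => x; rewrite pairrDr !pairrMn; apply: c.
Qed.

Lemma hom_zero_le0 j l : hom_zero X (beta j) (beta l) <-> rE S j l <= 0.
Proof.
rewrite (hom_zeroP hS) leNgt; split=> [h|/negP h]; first by apply/negP => /(Ef_gt0P R hS); apply.
by apply: contrapT => /(Ef_gt0P R hS).
Qed.

Lemma slope_word_sw A B : pairb S A B -> slope_word beta A B (sw S A B).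
Proof.
move=> AB; split; first exact: sw_uniq.
  by move=> l; rewrite mem_sw // -mid_rootP; split=> /asboolP.
move=> l l' a b a' b' ls ls' lt el el'.
have [_ ss] := swP AB; have := sorted_ltn_index (key_trans (k := _)) ss _ _ ls ls' lt.
have c : combo S l A B a%:R b%:R by move=> x; rewrite /pr /= el pairrDr !pairrMn.
have c' : combo S l' A B a'%:R b'%:R by move=> x; rewrite /pr /= el' pairrDr !pairrMn.
by rewrite (slope_lt AB _ _ _ _ c c') // -!natrM ltr_nat.
Qed.

Lemma slope_word_uniq A B w : pairb S A B -> slope_word beta A B w -> w = sw S A B.
Proof.
move=> AB [uw mw ow]; apply: klist_uniq (swP AB); split=> [l|].
  apply/idP/idP => [/mw/mid_rootP h|/asboolP/mid_rootP/mw //]; exact/asboolP.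
rewrite (sorted_pairwise (key_trans (k := _))); apply/(pairwiseP A) => i j iw jw ij.
have [si sj] := (mem_nth A iw, mem_nth A jw).
have [a [b el]] := iffLR (mw _) si; have [a' [b' el']] := iffLR (mw _) sj.
have c : combo S (nth A w i) A B a%:R b%:R by move=> x; rewrite /pr /= el pairrDr !pairrMn.
have c' : combo S (nth A w j) A B a'%:R b'%:R by move=> x; rewrite /pr /= el' pairrDr !pairrMn.
rewrite (slope_lt AB _ _ _ _ c c') // -!natrM ltr_nat.
by apply: ow el el'; rewrite ?index_uniq.
Qed.

(** Otherwise E(A, l) and E(l, A) would both equal a E(A, A) > 0, against the lateral order. *)
Lemma orth_mid A B l : pairb S A B -> rE S B A = 0 -> mid S A B l -> l = A \/ l = B.
Proof.
move=> AB BA [a [b c]]; have E0 := pair_E0 AB.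
have EA : rE S A l = a%:R * rE S A A by rewrite (E_combor _ c) E0 mulr0 addr0.
have EB : rE S l A = a%:R * rE S A A by rewrite (E_combol _ c) BA mulr0 addr0.
have EA' : rE S B l = b%:R * rE S B B by rewrite (E_combor _ c) BA mulr0 add0r.
have EB' : rE S l B = b%:R * rE S B B by rewrite (E_combol _ c) E0 mulr0 add0r.
have [a0|a0] := eqVneq a 0%N; first by right; apply: (@combo_r0 _ _ _ _ S l A B b%:R); rewrite -[0]/(0%:R) -a0.
left; apply/eqP/negPn/negP => lA.
have p : 0 < rE S A l by rewrite EA mulr_gt0 ?rE_gt0 // ltr0n lt0n.
have := E_anti (S := S) (i := A) (j := l); rewrite eq_sym lA => /(_ isT p).
by rewrite EB -EA leNgt p.
Qed.

Lemma sw_orth A B : pairb S A B -> rE S B A = 0 -> sw S A B = [:: B; A].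
Proof.
move=> AB BA; apply/esym/(klist_uniq _ (swP AB)); split=> [l|].
  rewrite !inE; apply/orP/asboolP => [[]/eqP->|/(orth_mid AB BA)[]->]; rewrite ?eqxx; auto.
    exact: mid_r.
  exact: mid_l.
by rewrite /= andbT slope_r // slope_gt0 ?(pair_neq AB) //; apply: mid_l.
Qed.

Lemma picture_of_prel u v : prel S u v -> picture_rel X beta u v.
Proof.
move=> [A [B [AB -> ->]]]; exists A, B; split=> //; last exact: slope_word_sw.
  split; first by move/(beta_inj hS)/eqP; rewrite (negbTE (pair_neq AB)).
    exact/hom_zero_le0/pair_le0.
  exact/hom_zero_le0/pair_anti.
by apply/(ext_zeroP hS)/Ext_lat; case/andP: AB => /ltW.
Qed.

(** A picture relation may list its pair against the lateral order. Then both Euler numbers vanish,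
    no root lies strictly between, and the relation is a commutation. *)
Lemma prel_of_picture u v : picture_rel X beta u v ->
  pg_word (prel S) u = pg_word (prel S) v.
Proof.
move=> [i [j [-> [ij hij hji] eij sv]]].
have nij : i != j by apply: contra_notN ij => /eqP ->.
have Eij : rE S i j = 0.
  have /euler_hom := iffLR (ext_zeroP hS _ _) eij; have /homdim_eq0 -> := iffLR (hom_zeroP hS _ _) hij.
  rewrite !dimvec_Mod => e.
  by rewrite /= /Ef e.
have [lt|lt] := lat_neq_lt S nij.
  have ij' : pairb S i j by rewrite /pairb lt Eij eqxx.
  by rewrite (slope_word_uniq ij' sv); apply: pg_word_rel; exists i, j.
have ji' : pairb S j i.
  apply/andP; split=> //; apply/eqP/le_anti/andP; split; first exact/hom_zero_le0.
  exact/E_ge0/ltW.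
have -> : v = [:: j; i].
  have [uv mv ov] := sv.
  have iv : i \in v by apply/mv; exists 1%N, 0%N; rewrite mulr1n mulr0n addr0.
  have jv : j \in v by apply/mv; exists 0%N, 1%N; rewrite mulr1n mulr0n add0r.
  have vij l : l \in v -> l = j \/ l = i.
    move/mv => [a [b e]]; apply: (orth_mid ji' Eij); apply/mid_rootP; exists b, a.
    by rewrite e addrC.
  have lt_ji : (index j v < index i v)%N.
    rewrite ltnNge; apply/negP => le; have lt' : (index i v < index j v)%N.
      rewrite ltn_neqAle le andbT; apply: contra nij => /eqP e.
      by apply/eqP; rewrite -(nth_index i iv) e nth_index.
    have := ov i j 1%N 0%N 0%N 1%N iv jv lt'.
    by rewrite !mulr1n !mulr0n addr0 add0r => /(_ erefl erefl).
  have v2 : size v = 2%N.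
    rewrite (perm_size (s2 := [:: j; i])) //; apply: uniq_perm => //=.
      by rewrite inE eq_sym nij.
    move=> l; rewrite !inE; apply/idP/orP => [/vij[]->|[]/eqP-> //]; rewrite eqxx; auto.
  case: v v2 uv vij lt_ji {sv mv ov iv jv} => [|x [|y []]] //= _; rewrite inE andbT => xy vij.
  have [ex|ex] := vij x (mem_head _ _); last by rewrite ex /= eqxx ltn0.
  have [|ey|-> _] := vij y; first by rewrite !inE eqxx orbT.
    by move: xy; rewrite ex ey eqxx.
  by rewrite ex.
rewrite -(sw_orth ji' Eij); apply/esym; rewrite (sw_orth ji' Eij).
have -> : pg_word (prel S) [:: j; i] = pg_word (prel S) (sw S j i).
  by apply: pg_word_rel; exists j, i.
by rewrite sw_orth.
Qed.

End PictureRelations.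

Import numFieldNormedType.Exports.

(** * Open half spaces and closures of regions *)

Section Topology.
Context (R : realType) (n : nat) (Q : valued_quiver n).
Implicit Types (x y z : 'rV[R]_n).

Local Open Scope classical_set_scope.

Lemma open_pairr_gt0 (I : finType) (P : pred I) (c : I -> R) (b : I -> 'rV[nat]_n) :
  open [set x : 'rV[R]_n | forall i, P i -> 0 < c i * pairr Q x (b i)].
Proof.
rewrite openE => x /= h.
(* [C i - 1] is a Lipschitz constant of the i-th functional for the maximum norm; the extra 1 makes
   the final inequality strict. *)
pose C i : R := 1 + \sum_k `|c i| * ((b i 0%R k)%:R * (vf Q k)%:R).
have C0 i : 0 < C i by rewrite ltr_wpDr // sumr_ge0 // => k _; rewrite !mulr_ge0.
have [e e0 eP] := @fin_lower R I P (fun i => c i * pairr Q x (b i) / C i)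
  (fun i Pi => divr_gt0 (h i Pi) (C0 i)).
apply/nbhs_ballP; exists e => //= y [_ xy] i Pi.
have -> : c i * pairr Q y (b i) = c i * pairr Q x (b i) - c i * pairr Q (x - y) (b i).
  by rewrite pairrB; ring.
have le1 : c i * pairr Q (x - y) (b i) <= e * (C i - 1).
  rewrite /C addrAC subrr add0r; apply: le_trans (ler_norm _) _.
  rewrite normrM pairrE mulr_sumr; apply: (@le_trans _ _ (`|c i| * \sum_k `|(x - y) 0 k * (b i 0%R k)%:R * (vf Q k)%:R|)).
    by rewrite ler_wpM2l // ler_norm_sum.
  rewrite mulr_sumr; apply: ler_sum => k _; rewrite mulrCA ler_wpM2l // -mulrA normrM.
  rewrite [`|_ * _%:R|]ger0_norm ?mulr_ge0 // ler_wpM2r ?mulr_ge0 //.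
  by have := xy 0 k; rewrite /ball /= !mxE => /ltW.
have := eP i Pi; rewrite ler_pdivlMr // => le2.
by move: le1 le2 e0; rewrite mulrBr mulr1; lra.
Qed.

Lemma open_pairr_gt0' b : open [set x : 'rV[R]_n | 0 < pairr Q x b].
Proof.
rewrite (_ : [set x | _] = [set x | forall i : unit, true -> 0 < (1 : R) * pairr Q x b]).
  exact: open_pairr_gt0.
by apply/seteqP; split=> x /=; rewrite mul1r; [move=> ? [] | move=> /(_ tt isT)].
Qed.

Lemma open_pairr_lt0 b : open [set x : 'rV[R]_n | pairr Q x b < 0].
Proof.
rewrite (_ : [set x | _] = [set x | forall i : unit, true -> 0 < (-1 : R) * pairr Q x b]).
  exact: open_pairr_gt0.
by apply/seteqP; split=> x /=; rewrite mulN1r oppr_gt0; [move=> ? [] | move=> /(_ tt isT)].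
Qed.

Lemma open_line (W : set 'rV[R]_n) z (v : 'rV[R]_n) : open W -> W z -> exists2 e, 0 < e &
  forall e', 0 < e' -> e' <= e -> W (z + e' *: v).
Proof.
move=> oW Wz; have : nbhs z W by apply: open_nbhs_nbhs.
move=> /nbhs_ballP[r /= r0 rW]; pose M : R := 1 + \sum_j `|v 0 j|.
have M0 : 0 < M by rewrite ltr_wpDr // sumr_ge0.
exists (r / (2 * M)); first by rewrite divr_gt0 // mulr_gt0.
move=> e' e'0; rewrite ler_pdivlMr ?mulr_gt0 // => le; apply: rW; split=> // i j.
rewrite ord1 /ball /= !mxE opprD addrA subrr sub0r normrN normrM gtr0_norm //.
have vM : `|v 0 j| <= M.
  by rewrite /M (bigD1 j) //= addrCA lerDl addr_ge0 // sumr_ge0.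
have := ler_wpM2l (ltW e'0) vM; lra.
Qed.

Lemma closure_line (U : set 'rV[R]_n) z (v : 'rV[R]_n) :
  (exists2 e, 0 < e & forall e', 0 < e' -> e' <= e -> U (z + e' *: v)) -> closure U z.
Proof.
move=> [e e0 eU] B nB; have [W [oW Wz WB]] : exists W, [/\ open W, W z & W `<=` B].
  by move: nB; rewrite nbhsE => -[W [oW Wz] WB]; exists W.
have [d d0 dW] := open_line v oW Wz; pose t := Num.min e d.
have t0 : 0 < t by rewrite lt_min e0.
exists (z + t *: v); split; [apply: eU | apply/WB/dW] => //; by rewrite ge_min lexx ?orbT.
Qed.

Lemma closure_ge0 (U : set 'rV[R]_n) z b : (forall x, U x -> 0 < pairr Q x b) -> closure U z ->
  0 <= pairr Q z b.
Proof.
move=> h cl; rewrite leNgt; apply/negP => z0.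
have [y [Uy]] := cl _ (open_nbhs_nbhs (conj (@open_pairr_lt0 b) z0)).
by move=> /= y0; have := h y Uy; rewrite ltNge (ltW y0).
Qed.

Lemma closure_le0 (U : set 'rV[R]_n) z b : (forall x, U x -> pairr Q x b < 0) -> closure U z ->
  pairr Q z b <= 0.
Proof.
move=> h cl; rewrite leNgt; apply/negP => z0.
have [y [Uy]] := cl _ (open_nbhs_nbhs (conj (@open_pairr_gt0' b) z0)).
by move=> /= y0; have := h y Uy; rewrite ltNge (ltW y0).
Qed.
End Topology.

Section GreenTranslation.
Context (R : realType) (K : fieldType) (n : nat) (Q : valued_quiver n) (X : modulation K Q).
Context (m : nat) (beta : 'I_m -> 'rV[nat]_n) (hS : admissible_roots X beta).
Implicit Types (x z : 'rV[R]_n) (e f : signs m).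

Local Open Scope classical_set_scope.
Local Notation S := (root_data_of R hS).

Definition of_signs e (j : nat) : option bool := if insub j is Some i then e i else None.

Lemma of_signsE e (i : 'I_m) : of_signs e i = e i.
Proof. by rewrite /of_signs valK. Qed.

Lemma UprefixP e k x : Uprefix Q beta e k x <-> reg S (of_signs e) k x.
Proof.
split=> h j jk; have := h j jk; rewrite of_signsE /pr /=; case: (e j) => [[]|] //=.
- by case=> + _; apply.
- by case=> _; apply.
Qed.

Lemma wallP x j : wall X (beta j) x <-> onwall S x j.
Proof.
split=> [[x0 h]|w].
  rewrite /onwall /pr /= x0 eqxx; apply/FwP => l /asboolP s; exact: h s.
split; first exact: wall_eq0 w.
move=> b s; have [_ _ _ v] := hS; have [l _ eb] := v j b (or_introl s).
by rewrite eb; apply: (FwP _ _ _ (wall_fw w)); apply/asboolP; rewrite -eb.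
Qed.

Lemma admissibleP e : admissible_signs R X beta e <-> adm S (of_signs e) m.
Proof.
have cE (k : 'I_m) : wall X (beta k) `&` Uprefix Q beta e k = set0 :> set 'rV[R]_n <-> ~ cut S (of_signs e) k.
  split=> [h [x [/wallP w /UprefixP r]]|h]; first by rewrite -[False]/(set0 x) -h.
  by apply/seteqP; split=> x // [/wallP w /UprefixP r]; apply: h; exists x.
by split=> h k; [move=> _; rewrite of_signsE -cE | rewrite cE -of_signsE; apply: h].
Qed.

(** From topology to signs: a point of the common boundary is displaced along H(k) to a generic one,
    where the weak inequalities valid on closures become strict. Conversely, the neighbourhood W of
    a generic facet point fixes all signs but that of k, so W meets H(k) inside the facet. *)
Lemma green_stepP e f k : adm S (of_signs e) m -> adm S (of_signs f) m ->
  green_step R X beta e f k <-> gstep S (of_signs e) (of_signs f) k m.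
Proof.
move=> ae af; split=> [[[_ [W [oW [z0 [Wz0 z0k]] _ Wcl]]] ek fk ag]|[km]].
  split; rewrite ?of_signsE //.
    move=> j jk; have jm : (j < m)%N by apply: ltn_trans jk _.
    by rewrite /of_signs (insubT (fun i => (i < m)%N) jm) ag.
  have [v vk vn] := generic_direction S k.
  have [e1 e10 e1P] := perturb S z0 v; have [e2 e20 e2W] := open_line v oW Wz0.
  have [z [tW d]] : exists z : 'rV[R]_n, W z /\ displaced S z0 v z.
    have t0 : 0 < Num.min e1 e2 by rewrite lt_min e10.
    exists (z0 + Num.min e1 e2 *: v); split; first by apply: e2W; rewrite // ge_min lexx orbT.
    by move=> j; apply: e1P; rewrite // ge_min lexx.
  have zk : pr S z k = 0 by apply: displaced_eq0 d _ vk.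
  have gz j : j != k -> pr S z j != 0.
    move=> jk; rewrite -sgr_eq0 d; case: (eqVneq (pr S z0 j) 0) => [_|zn]; rewrite sgr_eq0 //.
    exact: vn.
  have [c1 c2] := Wcl z (conj tW zk).
  have key (g : signs m) j : j != k -> closure (Ureg Q beta g : set 'rV[R]_n) z -> sgn_ok (g j) (pr S z j).
    move=> jk cl; case gj: (g j) => [[]|] //=.
      rewrite lt_neqAle eq_sym gz //=; apply: closure_ge0 cl => x.
      by move=> /(_ j (ltn_ord j))[/(_ gj)].
    rewrite lt_neqAle gz //=; apply: closure_le0 cl => x.
    by move=> /(_ j (ltn_ord j))[_ /(_ gj)].
  by exists z; split=> // j _ jk; rewrite !of_signsE; split; apply: key.
rewrite !of_signsE => ek fk ag [z0 fz0].
have {}ag (j : 'I_m) : (j < k)%N -> e j = f j by move=> jk; rewrite -!of_signsE ag.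
have [z [fz gz _]] := facet_generic fz0; split=> //; split.
  by left; split=> x /(_ k (ltn_ord k))[h1 h2] /=; [apply: h2 | apply: h1].
pose W := [set x : 'rV[R]_n | forall j, (fun j => j != k) j -> 0 < pr S z j * pairr Q x (beta j)].
have sgW x j : W x -> j != k -> Num.sg (pr S x j) = Num.sg (pr S z j).
  move=> Wx jk; have : 0 < pr S z j * pr S x j by apply: Wx.
  case: (ltgtP (pr S z j) 0) => [z_lt|z_gt|/eqP]; last by rewrite (negbTE (gz j jk)).
    by rewrite nmulr_rgt0 // => /ltr0_sg ->; rewrite ltr0_sg.
  by rewrite pmulr_rgt0 // => /gtr0_sg ->; rewrite gtr0_sg.
have [zk h] := fz; have Wfacet x : W x -> pr S x k = 0 -> facet S (of_signs e) (of_signs f) k m x.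
  move=> Wx xk; split=> // j jm jk; have [s1 s2] := h j jm jk.
  have ok s : sgn_ok s (pr S z j) -> sgn_ok s (pr S x j).
    case: s => [[]|] //= zj; first by rewrite -sgr_gt0 sgW // sgr_gt0.
    by rewrite -sgr_lt0 sgW // sgr_lt0.
  by split; apply: ok.
have side g w x : facet S (of_signs e) (of_signs f) k m x ->
    (forall y, displaced S x w y -> reg S (of_signs g) m y) -> closure (Ureg Q beta g : set 'rV[R]_n) x.
  move=> fx hr; have [ep ep0 epP] := perturb S x w; apply: (@closure_line R n _ x w).
  by exists ep => // e' e'0 le; apply/UprefixP/hr => j; apply: epP.
exists W; split.
- exact: open_pairr_gt0.
- exists z; split=> //= j jk; rewrite -[pairr _ _ _]/(pr S z j) -expr2.
  by rewrite exprn_even_gt0 //= gz.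
- move=> x [Wx xk]; apply/wallP; have fx := Wfacet x Wx xk.
  have rk : reg S (of_signs e) k x.
    move=> j jk; have jne : j != k by apply: contraTneq jk => ->; rewrite ltnn.
    by case: fx => _ /(_ j (ltn_ord j) jne)[].
  have [] // := cut_stable (adm_le (ltnW km) ae) _ rk xk.
  by apply: (adm_cut ae km); rewrite of_signsE ek.
- move=> x [Wx xk]; have fx := Wfacet x Wx xk; split.
    apply: (@side e (- const_mx 1) x fx) => y d.
    by apply: facet_reg1 _ _ _ _ _ fx d _; rewrite ?of_signsE // prN oppr_lt0 pr1_gt0.
  apply: (@side f (const_mx 1) x fx) => y d.
  by apply: facet_reg2 _ _ _ _ _ fx d _; rewrite ?of_signsE // pr1_gt0.
Qed.

End GreenTranslation.

(** * The Coxeter word is the value at positive points *)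

Section CoxeterValue.
Context (R : realType) (K : fieldType) (n : nat) (Q : valued_quiver n) (X : modulation K Q).
Context (m : nat) (beta : 'I_m -> 'rV[nat]_n) (hS : admissible_roots X beta).
Implicit Types (x z Y : 'rV[R]_n).

Local Notation S := (root_data_of R hS).

Lemma supp_nonempty j : exists v, (0 < beta j 0%R v)%N.
Proof.
apply: contrapT => h; have := rb_gt0 S j; rewrite pairrE big1 ?ltxx // => i _.
have [->|b0] := eqVneq (beta j 0%R i) 0%N; first by rewrite mulr0 mul0r.
by case: h; exists i; rewrite lt0n.
Qed.

Lemma pr_unit x l v : beta l = unit_dim v -> pr S x l = x 0 v * (vf Q v)%:R.
Proof.
move=> e; rewrite /pr /= e pairrE (bigD1 v) //= big1 => [|i iv]; rewrite !mxE ?eqxx ?mulr1 ?addr0 //.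
by rewrite (negbTE iv) mulr0 mul0r.
Qed.

Lemma pr_unit_gt0 x l v : beta l = unit_dim v -> (0 < pr S x l) = (0 < x 0 v).
Proof. by move=> /pr_unit ->; rewrite pmulr_lgt0 // ltr0n vf_gt0. Qed.

Lemma pr_unit_lt0 x l v : beta l = unit_dim v -> (pr S x l < 0) = (x 0 v < 0).
Proof. by move=> /pr_unit ->; rewrite pmulr_llt0 // ltr0n vf_gt0. Qed.

Lemma pr_lt0 x j v : (forall v, (0 < beta j 0%R v)%N -> x 0 v <= 0) ->
  (0 < beta j 0%R v)%N -> x 0 v < 0 -> pr S x j < 0.
Proof.
move=> h bv xv; rewrite /pr /= pairrE (bigD1 v) //=.
have p : x 0 v * (beta j 0%R v)%:R * (vf Q v)%:R < 0.
  by rewrite !pmulr_llt0 ?ltr0n ?vf_gt0.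
suff : \sum_(i | i != v) x 0 i * (beta j 0%R i)%:R * (vf Q i)%:R <= 0 by lra.
apply: sumr_le0 => i _; have [->|b0] := eqVneq (beta j 0%R i) 0%N; first by rewrite mulr0 mul0r.
by rewrite mulr_le0_ge0 // mulr_le0_ge0 // h // lt0n.
Qed.

Lemma pr_neg x j : (forall i, x 0 i < 0) -> pr S x j < 0.
Proof.
by move=> h; have [v bv] := supp_nonempty j; apply: (pr_lt0 (v := v)) => // i _; apply: ltW.
Qed.

Lemma pr_pos x j : (forall i, 0 < x 0 i) -> 0 < pr S x j.
Proof. by move=> h; rewrite -oppr_lt0 -prN; apply: pr_neg => i; rewrite mxE oppr_lt0. Qed.

(* The point -e_v makes beta_j unstable, and destabilizes it through a quotient
   all of whose simple subroots are beta_l = e_v. *)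
Lemma supp_simple j v : (0 < beta j 0%R v)%N -> exists l, beta l = unit_dim v.
Proof.
move=> bv; pose x : 'rV[R]_n := - delta_mx 0 v.
have xE i : pr S x i = - ((beta i 0%R v)%:R * (vf Q v)%:R) by rewrite prN /pr /= pairr_delta.
have [/tw_ge0|[l _ Fl]] := HNq S x j.
  by rewrite xE oppr_ge0 leNgt mulr_gt0 // ltr0n // vf_gt0.
have [u bu umin] := min_height Q (supp_nonempty l).
have [|l' e' s'] := sink_root hS bu.
  move=> w a; apply/eqP; rewrite -leqn0 leqNgt; apply/negP => /umin.
  by rewrite leqNgt height_arr.
have : pr S x l' < 0 by apply: (FsP _ _ _ Fl); apply: s'.
rewrite xE e' mxE oppr_lt0; case: (eqVneq v u) => [vu _|_]; first by exists l'; rewrite e' vu.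
by rewrite mul0r ltxx.
Qed.

Lemma sub_root_le i j v : rsub S i j -> (beta i 0%R v <= beta j 0%R v)%N.
Proof. by move=> /(subrP hS)[f fi]; rewrite -!(dim_Mod hS); apply: rinj_dim. Qed.

Variable w : seq 'I_m.
Hypothesis cw : coxeter_word X beta w.

Let mem_w l : l \in w <-> exists v, beta l = unit_dim v.
Proof. by have [_ h _] := cw; rewrite h; split=> -[v /simple_rootP]; exists v. Qed.

(* Only the simple roots of the initial segment u of w are positive on x. *)
Let Z (u : seq 'I_m) x : Prop :=
  forall l, l \in w -> if l \in u then 0 < pr S x l else pr S x l < 0.

Let initial (u : seq 'I_m) : Prop := exists u', w = u ++ u'.

Let index_initial u l l' : initial u -> l' \in u -> l \in w -> (index l w < index l' w)%N -> l \in u.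
Proof.
move=> [u' e] l'u lw; rewrite e in lw *; rewrite !index_cat l'u; case: ifP => // _ h.
by move: h; rewrite ltnNge (leq_trans _ (leq_addr _ _)) // ltnW // index_mem.
Qed.

(** Otherwise take a vertex of least height in the support of j whose simple root is in u. As u is
    closed under passing to targets of arrows, it is a sink of the whole support, so its simple
    root, positive at x, is a subroot of j. *)
Let wall_support u x j : initial u ->
  (forall l, l \in u -> 0 < pr S x l) -> onwall S x j ->
  forall v l, (0 < beta j 0%R v)%N -> beta l = unit_dim v -> l \notin u.
Proof.
move=> iu xu wj v l bv el; apply/negP => lu.
pose P v := (0 < beta j 0%R v)%N && [exists l, (l \in u) && (beta l == unit_dim v)].
have [v0 /andP[bv0 /existsP[l0 /andP[lu0 /eqP el0]]] vmin] : exists2 i, P i & forall k, P k ->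
    (height Q i <= height Q k)%N.
  by apply: min_height; exists v; rewrite /P bv; apply/existsP; exists l; rewrite lu el eqxx.
have [|l' el' sl'] := sink_root hS bv0.
  move=> k a; apply/eqP; rewrite -leqn0 leqNgt; apply/negP => bk.
  have [lk elk] := supp_simple bk.
  have lkw : lk \in w by apply/mem_w; exists k.
  have l0w : l0 \in w by apply/mem_w; exists v0.
  have lku : lk \in u.
    apply: (index_initial iu lu0 lkw); have [_ _ ord] := cw.
    by apply: (ord _ _ k v0 lkw l0w _ _ a); apply/simple_rootP.
  have := vmin k; rewrite /P bk => /(_ _); rewrite leqNgt height_arr // => /(_ _)/negP; apply=> //.
  by apply/existsP; exists lk; rewrite lku elk eqxx.
have := FwP _ _ _ (wall_fw wj) l' sl'.
have <- : l0 = l' by apply: (beta_inj hS); rewrite el0 el'.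
by rewrite leNgt xu.
Qed.

Let Z_zone u : initial u -> zone S (Z u).
Proof.
move=> iu; have uw l : l \in u -> l \in w by case: iu => u' -> lu; rewrite mem_cat lu.
split=> [Y Y' s zY zY' s0 s1 l lw|Y v zY|Y j zY].
- have := zY l lw; have := zY' l lw; case: (l \in u) => h h'.
    by rewrite prD prZ prB; apply: (@sgn_ok_conv _ (Some true)).
  by rewrite prD prZ prB; apply: (@sgn_ok_conv _ (Some false)).
- have [ep ep0 epP] := perturb S Y v; exists ep => // e' e'0 le l lw.
  have d : displaced S Y v (Y + e' *: v) by move=> j; apply: epP.
  by have := zY l lw; case: (l \in u); [apply: displaced_gt d | apply: displaced_lt d].
apply/negP => wj; have h v l : (0 < beta j 0%R v)%N -> beta l = unit_dim v -> l \notin u.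
  apply: wall_support iu _ wj v l => l' lu.
  by have := zY l' (uw l' lu); rewrite lu.
have neg v : (0 < beta j 0%R v)%N -> Y 0 v < 0.
  move=> bv; have [l el] := supp_simple bv; rewrite -(pr_unit_lt0 _ el).
  have lw : l \in w by apply/mem_w; exists v.
  by have := zY l lw; rewrite (negbTE (h v l bv el)).
have [v bv] := supp_nonempty j.
have := @pr_lt0 Y j v (fun v bv => ltW (neg v bv)) bv (neg v bv).
by rewrite (wall_eq0 wj) ltxx.
Qed.

Let Z_step u l u' : w = u ++ l :: u' -> exists y1 y2 h,
  [/\ Z u y1, Z (rcons u l) y2, nt S y1 /\ nt S y2, wv y1 h & wv y2 (h * pg_gen (prel S) l)%g].
Proof.
move=> ew; have iu : initial u by exists (l :: u').
have lw : l \in w by rewrite ew mem_cat mem_head orbT.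
have lu : l \notin u.
  have [uw _ _] := cw; move: uw; rewrite ew cat_uniq => /and3P[_ /hasPn/(_ l (mem_head _ _))].
  by [].
have [vl el] := iffLR (mem_w l) lw.
(* Value 1 on the simple roots of u, 0 on l, -1 on the others; a generic displacement inside H(l)
   leaves D(l) as the only wall through the point. *)
pose x : 'rV[R]_n := \row_i (if [exists k, (k \in u) && (beta k == unit_dim i)] then 1
  else if i == vl then 0 else -1).
have xl : pr S x l = 0.
  rewrite (pr_unit _ el) mxE eqxx; case: existsP => [[k /andP[ku /eqP ek]]|_]; last by rewrite mul0r.
  by case/negP: lu; rewrite (_ : l = k) //; apply: (beta_inj hS); rewrite el ek.
have xk k : k \in w -> k != l -> if k \in u then 0 < pr S x k else pr S x k < 0.
  move=> kw kl; have [v ek] := iffLR (mem_w k) kw; case: ifP => ku.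
    rewrite (pr_unit_gt0 _ ek) mxE; case: existsP => // -[]; by exists k; rewrite ku ek eqxx.
  rewrite (pr_unit_lt0 _ ek) mxE; case: existsP => [[k' /andP[ku' /eqP ek']]|_].
    by rewrite (_ : k = k') ?ku' // in ku; apply: (beta_inj hS); rewrite ek ek'.
  case: eqVneq => [evl|_]; last by rewrite ltrN10.
  by case/eqP: kl; apply: (beta_inj hS); rewrite ek el evl.
have [v [z [d ntz vl0 gz]]] := nt_facet xl.
have zl : pr S z l = 0 by apply: displaced_eq0 d xl vl0.
have zk k : k \in w -> k != l -> if k \in u then 0 < pr S z k else pr S z k < 0.
  by move=> kw kl; have := xk k kw kl; case: (k \in u); [apply: displaced_gt d | apply: displaced_lt d].
have wz j : onwall S z j = (j \in [:: l]).
  rewrite inE; apply/idP/eqP => [wj|->].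
    by apply/eqP/negPn/negP => /gz/eqP; rewrite (wall_eq0 wj).
  rewrite /onwall zl eqxx; have [//|[i s t]] := HNs S z l; exfalso.
  have : i = l.
    apply: (beta_inj hS); rewrite el; apply: (support1_root hS) => k kv.
    apply/eqP; rewrite -leqn0; have := sub_root_le k s; rewrite el mxE (negbTE kv).
    by [].
  by move=> e; have := ts_gt0 t; rewrite e zl ltxx.
have [||y1 [y2 [h [d1 d2 nt12 w1 w2]]]] := cross_value (L := [:: l]) ntz; try by [].
exists y1, y2, h; split=> //; last by rewrite -pg_word1.
  move=> k kw; have [->|kl] := eqVneq k l.
    by rewrite (negbTE lu); apply: displaced_lt0 d1 _ _; rewrite ?zl // prN oppr_lt0 pr1_gt0.
  by have := zk k kw kl; case: (k \in u); [apply: displaced_gt d1 | apply: displaced_lt d1].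
move=> k kw; rewrite mem_rcons inE; have [->|kl] /= := eqVneq k l.
  by apply: displaced_gt0 d2 _ _; rewrite ?zl // pr1_gt0.
by have := zk k kw kl; case: (k \in u); [apply: displaced_gt d2 | apply: displaced_lt d2].
Qed.

(** Induction on initial segments of w: [Z u] is a zone by [wall_support], and passing from u to
    [rcons u l] crosses the wall of the simple root l alone. All positive points belong to [Z w]. *)
Lemma coxeter_value : cval (pg_word (prel S) w).
Proof.
have main u : initial u -> forall Y, Z u Y -> nt S Y -> wv Y (pg_word (prel S) u).
  elim/last_ind: u => [_|u l IH [u' ew]] Y zY ntY.
    rewrite /pg_word big_nil; apply: wv_negative ntY _ => j.
    have neg v : (0 < beta j 0%R v)%N -> Y 0 v < 0.
      move=> bv; have [l el] := supp_simple bv; rewrite -(pr_unit_lt0 _ el).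
      by apply: (zY l); apply/mem_w; exists v.
    have [v bv] := supp_nonempty j.
    by apply: (@pr_lt0 Y j v) => // [k bk|]; [apply/ltW/neg | apply: neg].
  rewrite cat_rcons in ew; have iu : initial u by exists (l :: u').
  have iul : initial (rcons u l) by exists u'; rewrite cat_rcons.
  have [y1 [y2 [h [z1 z2 [nt1 nt2] w1 w2]]]] := Z_step ew.
  have eh := wval_fun w1 (IH iu y1 z1 nt1).
  rewrite -cats1 pg_word_cat pg_word1 -eh.
  exact: zone_value (Z_zone iul) z2 zY nt2 ntY w2.
move=> Y pY ntY; apply: main ntY; first by exists [::]; rewrite cats0.
by move=> l lw; rewrite lw; apply: pY.
Qed.
End CoxeterValue.

(** * Green sequences, sign paths and words *)

Section Bijection.
Context (R : realType) (K : fieldType) (n : nat) (Q : valued_quiver n) (X : modulation K Q).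
Context (m : nat) (beta : 'I_m -> 'rV[nat]_n) (hS : admissible_roots X beta).
Implicit Types (x z : 'rV[R]_n).

Local Open Scope classical_set_scope.
Local Notation S := (root_data_of R hS).
Local Notation one := (const_mx 1 : 'rV[R]_n).

(** Level by level: whether a region is cut depends on the earlier signs, and a nonzero sign is then
    read off at x. *)
Lemma adm_uniq (e e' : nat -> option bool) x : adm S e m -> adm S e' m -> reg S e m x -> reg S e' m x ->
  forall j : 'I_m, e j = e' j.
Proof.
move=> a a' r r'; suff main (k : nat) : forall j : 'I_m, (j < k)%N -> e j = e' j.
  by move=> j; apply: (main j.+1).
elim: k => // k IH j jk; have eq_lt (l : 'I_m) : (l < j)%N -> e l = e' l.
  by move=> lj; apply: IH; apply: leq_trans lj _.
have cE : cut S e j <-> cut S e' j by split; apply: cut_ext => l /eq_lt.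
have nE : e j = None <-> e' j = None by rewrite (a j (ltn_ord j)) (a' j (ltn_ord j)) cE.
have := r j (ltn_ord j); have := r' j (ltn_ord j).
case ej: (e j) nE => [b|] nE; last by move=> _ _; symmetry; apply/nE.
case ej': (e' j) nE => [b'|] nE; last by case: nE => _ /(_ erefl).
by case: (b); case: (b') => //= h1 h2; have := lt_trans h1 h2; rewrite ltxx.
Qed.

Definition to_signs (e : nat -> option bool) : signs m := [ffun i : 'I_m => e i].

Lemma to_signsK (e : nat -> option bool) (j : nat) : (j < m)%N -> of_signs (to_signs e) j = e j.
Proof. by move=> jm; rewrite -[j]/(nat_of_ord (Ordinal jm)) of_signsE ffunE. Qed.

Lemma adm_congr (e e' : nat -> option bool) : (forall j : nat, (j < m)%N -> e j = e' j) ->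
  adm S e m -> adm S e' m.
Proof.
move=> h a j jm; rewrite -h // a //; split; apply: contra_not; apply: cut_ext => l _; by rewrite h.
Qed.

Lemma gstep_congr (e f e' f' : nat -> option bool) k : (forall j : nat, (j < m)%N -> e j = e' j) ->
  (forall j : nat, (j < m)%N -> f j = f' j) -> gstep S e f k m -> gstep S e' f' k m.
Proof.
move=> h h' [km ek fk ag [z [zk hz]]]; split; rewrite -?h -?h' //.
- move=> j jk; have jm : (j < m)%N by apply: ltn_trans jk _.
  by rewrite -h // -h' // ag.
- by exists z; split=> // j jm; rewrite -h // -h' //; apply: hz.
Qed.

Lemma gpath_of_green (e : signs m) es ks : (forall f, f \in e :: es -> admissible_signs R X beta f) ->
  green_path R X beta e es ks ->
  gpath S m (of_signs e) (zip ks (map (@of_signs m) es)) /\ size ks = size es.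
Proof.
elim: es e ks => [|f es IH] e [|k ks] //= hadm [st gp].
have ae : adm S (of_signs e) m by apply/admissibleP/hadm/mem_head.
have af : adm S (of_signs f) m by apply/admissibleP/hadm; rewrite !inE eqxx orbT.
have [|g' ->] := IH f ks _ gp; first by move=> g gf; apply: hadm; rewrite inE gf orbT.
by split=> //; split=> //; apply/green_stepP.
Qed.

Lemma green_of_gpath (e : nat -> option bool) p : adm S e m -> gpath S m e p ->
  green_path R X beta (to_signs e) [seq to_signs a.2 | a <- p] (letters p) /\
  forall f, f \in to_signs e :: [seq to_signs a.2 | a <- p] -> admissible_signs R X beta f.
Proof.
have toK (g : nat -> option bool) (j : nat) : (j < m)%N -> g j = of_signs (to_signs g) j by move=> jm; rewrite to_signsK.
have aK g : adm S g m -> admissible_signs R X beta (to_signs g).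
  by move=> ag; apply/admissibleP; apply: adm_congr ag; apply: toK.
elim: p e => [|[k f] p IH] e a /=.
  by move=> _; split=> // g; rewrite inE => /eqP ->; apply: aK.
move=> [st af gp]; have [gp' h] := IH f af gp; split; last first.
  by move=> g; rewrite inE => /orP[/eqP->|/h //]; apply: aK.
split=> //; apply/green_stepP; try exact/admissibleP/aK.
by apply: gstep_congr st; apply: toK.
Qed.

Lemma green_complete Us ks : green_crossing (R := R) X beta Us ks -> exists e p, @complete R n Q m S e p /\ letters p = ks.
Proof.
move=> [e [es [_ hadm gp h0 h1]]]; have [g sz] := gpath_of_green hadm gp.
exists (of_signs e), (zip ks (map (@of_signs m) es)); split; last first.
  by rewrite /letters -[map _ _]/(unzip1 _) unzip1_zip // size_map sz.
split=> //; first exact/admissibleP/hadm/mem_head.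
- by apply/UprefixP/h0 => i; rewrite !mxE oppr_lt0.
rewrite /endpt -[map _ _]/(unzip2 _) unzip2_zip ?size_map ?sz // last_map.
by apply/UprefixP/h1 => i; rewrite mxE.
Qed.

Lemma complete_green (e : nat -> option bool) p : @complete R n Q m S e p ->
  exists Us, green_crossing (R := R) X beta Us (letters p).
Proof.
move=> [a gp r0 r1]; have [g hadm] := green_of_gpath a gp.
exists [seq Ureg Q beta f | f <- to_signs e :: [seq to_signs q.2 | q <- p]].
exists (to_signs e), [seq to_signs q.2 | q <- p]; split=> //.
  move=> x xn j jm; rewrite ffunE; have := r0 j jm; rewrite prN -/(pr S x j).
  split=> [ej|_]; last exact: (pr_neg hS).
  by move: (r0 j jm); rewrite ej /= prN oppr_gt0 ltNge ltW // pr1_gt0.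
move=> x xp j jm; rewrite (map_comp to_signs snd) last_map -/(endpt e p) ffunE.
split=> [_|ej]; first exact: (pr_pos hS).
by move: (r1 j jm); rewrite ej /= ltNge ltW // pr1_gt0.
Qed.

Lemma green_path_inj (e : signs m) es es' ks : (forall f, f \in e :: es ++ es' -> admissible_signs R X beta f) ->
  green_path R X beta e es ks -> green_path R X beta e es' ks -> es = es'.
Proof.
elim: es e es' ks => [|f es IH] e [|f' es'] [|k ks] //= hadm [st gp] [st' gp'].
have a g : g \in e :: f :: es ++ f' :: es' -> adm S (of_signs g) m by move/hadm/admissibleP.
have ae : adm S (of_signs e) m by apply: a; apply: mem_head.
have af : adm S (of_signs f) m by apply: a; rewrite !inE eqxx orbT.
have af' : adm S (of_signs f') m by apply: a; rewrite !inE mem_cat mem_head !orbT.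
have ff' : f = f'.
  apply/ffunP => j; rewrite -!of_signsE.
  by apply: (gstep_uniq ae af af') (ltn_ord j); apply/green_stepP; eassumption.
rewrite -ff' in gp' *; congr (_ :: _); apply: IH gp gp' => g gin.
apply: hadm; move: gin; rewrite !inE !mem_cat !inE => /or3P[->|->|->]; by rewrite ?orbT.
Qed.

(** A compartment determines its sign vector by [adm_uniq], and the letter of a step is the least
    index at which the two sign vectors differ. *)
Lemma green_letters (e e' : signs m) es es' ks ks' x :
  (forall f, f \in e :: es -> admissible_signs R X beta f) ->
  (forall f, f \in e' :: es' -> admissible_signs R X beta f) ->
  green_path R X beta e es ks -> green_path R X beta e' es' ks' -> Ureg Q beta e x ->
  [seq Ureg Q beta f : set 'rV[R]_n | f <- e :: es] = [seq Ureg Q beta f | f <- e' :: es'] ->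
  [/\ e = e', es = es' & ks = ks'].
Proof.
elim: es e e' es' ks ks' x => [|f es IH] e e' es' ks ks' x hadm hadm' gp gp' xe [ee' ess].
all: have ae : adm S (of_signs e) m by apply/admissibleP/hadm/mem_head.
all: have ae' : adm S (of_signs e') m by apply/admissibleP/hadm'/mem_head.
all: have {}ee' : e = e'.
1,3: apply/ffunP => j; rewrite -!of_signsE; apply: (adm_uniq ae ae' (x := x)); apply/UprefixP => //.
1,2: by rewrite -[Uprefix _ _ _ _ _]/(Ureg Q beta e' x) -ee'.
  by case: es' ess gp' hadm' => // _ gp' _; case: ks ks' gp gp' => [|//] [].
case: es' ess gp' hadm' => // f' es' [ff' ess] gp' hadm'.
case: ks gp => // k ks [st gp]; case: ks' gp' => // k' ks' [st' gp'].
have af : adm S (of_signs f) m by apply/admissibleP/hadm; rewrite !inE eqxx orbT.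
have [y /UprefixP yf] := step_reg (iffLR (green_stepP k ae af) st).
have [|||e1 e2 e3] := IH f f' es' ks ks' y _ _ gp gp' yf.
- by move=> g gin; apply: hadm; rewrite inE gin orbT.
- by move=> g gin; apply: hadm'; rewrite inE gin orbT.
- by rewrite /= ff' ess.
rewrite ee' e1 e2 e3; split=> //; congr (_ :: _).
have [_ ek fk ag] := st; have [_ ek' fk' ag'] := st'.
case: (ltngtP k k') => [lt|lt|/val_inj //].
  by have := ag' k lt; rewrite -ee' -e1 ek fk.
by have := ag k' lt; rewrite ee' e1 ek' fk'.
Qed.

Lemma crossing_uniq Us ks ks' : green_crossing (R := R) X beta Us ks -> green_crossing X beta Us ks' ->
  ks = ks'.
Proof.
move=> [e [es [eU ha gp h0 _]]] [e' [es' [eU' ha' gp' _ _]]].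
have [||_ _ //] := green_letters ha ha' gp gp' (x := - one); last by rewrite -eU -eU'.
by apply: h0 => i; rewrite !mxE oppr_lt0.
Qed.

Lemma crossing_inj Us Us' ks : green_crossing (R := R) X beta Us ks -> green_crossing X beta Us' ks ->
  Us = Us'.
Proof.
move=> [e [es [-> ha gp h0 _]]] [e' [es' [-> ha' gp' h0' _]]].
have neg i : (- one) 0 i < 0 by rewrite !mxE oppr_lt0.
have ee' : e = e'.
  apply/ffunP => j; rewrite -!of_signsE; apply: (@adm_uniq _ _ (- one)).
  - exact/admissibleP/ha/mem_head.
  - exact/admissibleP/ha'/mem_head.
  - exact/UprefixP/h0.
  - exact/UprefixP/h0'.
rewrite -ee' in ha' gp' *; congr (map _ (_ :: _)); apply: green_path_inj gp gp' => g.
rewrite inE mem_cat => /or3P[/eqP->|gin|gin]; first exact/ha/mem_head.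
  by apply: ha; rewrite inE gin orbT.
by apply: ha'; rewrite inE gin orbT.
Qed.

Lemma picture_word_eq u v : word_val X beta u = word_val X beta v <->
  pg_word (prel S) u = pg_word (prel S) v.
Proof.
split; apply: pg_word_sub => u' v' r; first exact: prel_of_picture r.
exact/pg_word_rel/(picture_of_prel r).
Qed.

End Bijection.

Theorem theoremA (R : realType) (K : fieldType) (n : nat)
  (Q : valued_quiver n) (X : modulation K Q)
  (m : nat) (beta : 'I_m -> 'rV[nat]_n) (hS : admissible_roots X beta)
  (c : picture_group X beta) (hc : coxeter_element c) :
  exists Phi : seq (set 'rV[R]_n) -> seq 'I_m,
    (forall Us ks, green_crossing X beta Us ks -> Phi Us = ks) /\
    set_bij (maximal_green_sequences R X beta) (positive_expressions c) Phi.
Proof.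
have [w cw wc] := hc; have cv := coxeter_value (R := R) (hS := hS) cw.
(* The empty word is a default off the maximal green sequences; on them the chosen word is the only
   one, by [crossing_uniq]. *)
pose Phi Us : seq 'I_m := if pselect (exists ks, green_crossing (R := R) X beta Us ks) is left h
  then sval (cid h) else [::].
have PhiE Us ks : green_crossing X beta Us ks -> Phi Us = ks.
  move=> g; rewrite /Phi; case: pselect => [h|[]]; last by exists ks.
  exact: crossing_uniq hS _ _ _ (svalP (cid h)) g.
exists Phi; split=> //; split.
- move=> Us [ks g]; rewrite /positive_expressions /= (PhiE _ _ g) -wc.
  apply/(picture_word_eq R hS); have [e [p [cp <-]]] := green_complete hS g.
  exact: cval_fun (complete_value cp) cv.
- move=> Us Us' /set_mem[ks g] /set_mem[ks' g']; rewrite (PhiE _ _ g) (PhiE _ _ g') => e.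
  by rewrite -e in g'; apply: (crossing_inj hS) g g'.
move=> u; rewrite /positive_expressions /= -wc => /(picture_word_eq R hS) e.
have [|e0 [p [cp lp]]] := @green_surjective _ _ _ _ (root_data_of R hS) u; first by rewrite e.
have [Us g] := complete_green cp; rewrite lp in g.
by exists Us; [exists u | apply: PhiE].
Qed.
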